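(* For $d\in\mathbb{N}$ let $\Omega\subset\mathbb{R}^d$ be a bounded domain. Let $X,Y\in\{B,F\}$ and $0<p_0,p_1,q_0,q_1\leq\infty$ (with $p_0<\infty$ if $X=F$ and $p_1<\infty$ if $Y=F$, respectively), as well as $r_0,r_1,s_0,s_1\in\mathbb{R}$ such that $$ r_0-r_1-\left(\frac{1}{p_0}-\frac{1}{p_1}\right)_+>s_1-s_0>0. $$ Then the embedding $\mathrm{Id}\colon H^{r_0,s_0}_{p_0,q_0}X(\Omega)\to H^{r_1,s_1}_{p_1,q_1}Y(\Omega)$ is compact, and for some $M_0,c,c'>0$ there exist sequences of algorithms $(\mathcal{B}_M)_{M\in\mathbb{N}}$ and $(\mathcal{A}_M)_{M\in\mathbb{N}}$ (maps from $H^{r_0,s_0}_{p_0,q_0}X(\Omega)$ to the linear span of $\Psi$) such that: (i) for all $M\ge M_0$ and $m:=m(M):=\big\lceil c\,2^{M/[(r_0-r_1)-(s_1-s_0)-(1/p_0-1/p_1)_+]}\big\rceil$ there holds $$ \sigma_m(\mathrm{Id};\Psi)\sim\sup_{\|f\,|\,H^{r_0,s_0}_{p_0,q_0}X(\Omega)\|\le1}\big\|f-\mathcal{B}_M(f)\,\big|\,H^{r_1,s_1}_{p_1,q_1}Y(\Omega)\big\|\sim m^{-[(r_0-r_1)-(s_1-s_0)]}. $$ For each input, $\mathcal{B}_M$ produces a linear combination of at most $m$ adaptively chosen (i.e. possibly depending on the input) elements from the hyperbolic wavelet dictionary $\Psi:=\{\psi^\lambda\vert_\Omega : \lambda\in\nabla\}$.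 (ii) for all $M\ge M_0$ and $m:=m(M):=\big\lceil c'\,2^{M/[(r_0-r_1)-(s_1-s_0)-(1/p_0-1/p_1)_+]}\big\rceil$ we have $$ \zeta_m(\mathrm{Id};\Psi)\sim d_m(\mathrm{Id};\Psi)\sim\sup_{\|f\,|\,H^{r_0,s_0}_{p_0,q_0}X(\Omega)\|\le1}\big\|f-\mathcal{A}_M(f)\,\big|\,H^{r_1,s_1}_{p_1,q_1}Y(\Omega)\big\|\sim m^{-[(r_0-r_1)-(s_1-s_0)-(1/p_0-1/p_1)_+]}. $$ For each input, $\mathcal{A}_M$ uses a linear combination of the same (i.e. independent of the input) at most $m$ elements from $\Psi$.
   Context: Notation: $x_+=\max\{x,0\}$, $1/\infty=0$. $\sim$ denotes two-sided estimates up to positive constants independent of $M$ (and $m$). $|D|$ denotes the cardinality of a set $D$; $|\boldsymbol{j}|_1=\sum_i j_i$, $|\boldsymbol{j}|_\infty=\max_i j_i$ for $\boldsymbol{j}\in\mathbb{N}_0^d$. Wavelets: Let $\phi$ (scaling function) and $\psi$ (wavelet) be univariate functions which, for some $K\in\mathbb{N}_0$ chosen sufficiently large (depending on the parameters of the function spaces), satisfy: $\phi,\psi\in C^K(\mathbb{R})$ with compact support; $\|\phi\|_{L_2(\mathbb{R})}=\|\psi\|_{L_2(\mathbb{R})}=1$; $\int_{\mathbb{R}}\psi(x)x^b\,dx=0$ for $b=0,\dots,K-1$. Put $\psi_{j,k}:=2^{-1/2}\psi(2^{j-1}\cdot-k)$ for $j\in\mathbb{N}$, $k\in\mathbb{Z}$,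 and $\psi_{0,k}:=\phi(\cdot-k)$; it is assumed that every $f\in L_2(\mathbb{R})$ has the expansion $f=\sum_{j\in\mathbb{N}_0}\sum_{k\in\mathbb{Z}}2^j\langle f,\psi_{j,k}\rangle_{L_2}\psi_{j,k}$. Hyperbolic wavelets: $\psi^{\boldsymbol{j},\boldsymbol{k}}(\boldsymbol{x}):=\prod_{i=1}^d\psi_{j_i,k_i}(x_i)$ for $\boldsymbol{j}\in\mathbb{N}_0^d$, $\boldsymbol{k}\in\mathbb{Z}^d$. Let $\chi^{\boldsymbol{j},\boldsymbol{k}}$ be the characteristic function of $\prod_{i=1}^d[2^{-j_i}k_i,2^{-j_i}(k_i+1)]$. Let $\mathfrak{D}_{\boldsymbol{j}}:=\{\boldsymbol{k}\in\mathbb{Z}^d : \mathrm{supp}(\psi^{\boldsymbol{j},\boldsymbol{k}})\cap\Omega\ne\emptyset\}$ and $\nabla:=\{\lambda=(\boldsymbol{j},\boldsymbol{k}) : \boldsymbol{j}\in\mathbb{N}_0^d,\ \boldsymbol{k}\in\mathfrak{D}_{\boldsymbol{j}}\}$. Hybrid function spaces: For $X\in\{B,F\}$, $0<p,q\le\infty$ ($p<\infty$ if $X=F$), $r,s\in\mathbb{R}$, $H^{r,s}_{p,q}X(\mathbb{R}^d)$ is the set of all $f\in\mathcal{S}'(\mathbb{R}^d)$ with $f=\sum_{(\boldsymbol{j},\boldsymbol{k})\in\mathbb{N}_0^d\times\mathbb{Z}^d}a_{\boldsymbol{j},\boldsymbol{k}}\psi^{\boldsymbol{j},\boldsymbol{k}}$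 (convergence in $\mathcal{S}'(\mathbb{R}^d)$) with (unique) complex coefficients $\boldsymbol{a}=(a_{\boldsymbol{j},\boldsymbol{k}})$ such that $\|f\,|\,H^{r,s}_{p,q}X(\mathbb{R}^d)\|:=\|\boldsymbol{a}\,|\,h^{r,s}_{p,q}x\|<\infty$, where $$\|\boldsymbol{a}\,|\,h^{r,s}_{p,q}b\|=\Big[\sum_{\boldsymbol{j}\in\mathbb{N}_0^d}2^{q((r-1/p)|\boldsymbol{j}|_1+s|\boldsymbol{j}|_\infty)}\Big(\sum_{\boldsymbol{k}\in\mathbb{Z}^d}|a_{\boldsymbol{j},\boldsymbol{k}}|^p\Big)^{q/p}\Big]^{1/q},$$ $$\|\boldsymbol{a}\,|\,h^{r,s}_{p,q}f\|=\Big\|\Big(\sum_{\boldsymbol{j}\in\mathbb{N}_0^d}2^{q(r|\boldsymbol{j}|_1+s|\boldsymbol{j}|_\infty)}\Big|\sum_{\boldsymbol{k}\in\mathbb{Z}^d}a_{\boldsymbol{j},\boldsymbol{k}}\chi^{\boldsymbol{j},\boldsymbol{k}}(\cdot)\Big|^q\Big)^{1/q}\Big\|_{L_p(\mathbb{R}^d)}$$ (usual modification if $\max\{p,q\}=\infty$; $x=b$ if $X=B$, $x=f$ if $X=F$). $H^{r,s}_{p,q}X(\Omega)$ consists of all restrictions $f=g\vert_\Omega\in\mathcal{D}'(\Omega)$ of $g\in H^{r,s}_{p,q}X(\mathbb{R}^d)$, with quasi-norm $\inf\{\|g\,|\,H^{r,s}_{p,q}X(\mathbb{R}^d)\| : g\vert_\Omega=f\}$.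 Widths: For quasi-Banach spaces $A,B$, a bounded linear operator $I\colon A\to B$, and a dictionary $D=\{b^\lambda : \lambda\in\Lambda\}\subset B$, define for $m\in\mathbb{N}_0$ $$\sigma_m(I;D):=\sup_{\|a\|_A\le1}\ \inf_{\Lambda_m\subset\Lambda,\,|\Lambda_m|\le m}\ \inf_{c_\lambda\in\mathbb{C},\,\lambda\in\Lambda_m}\Big\|Ia-\sum_{\lambda\in\Lambda_m}c_\lambda b^\lambda\Big\|_B,$$ $$d_m(I;D):=\inf_{\Lambda_m\subset\Lambda,\,|\Lambda_m|\le m}\ \sup_{\|a\|_A\le1}\ \inf_{c_\lambda\in\mathbb{C},\,\lambda\in\Lambda_m}\Big\|Ia-\sum_{\lambda\in\Lambda_m}c_\lambda b^\lambda\Big\|_B,$$ $$\zeta_m(I;D):=\inf_{\Lambda_m\subset\Lambda,\,|\Lambda_m|\le m}\ \inf_{c_\lambda\colon A\to\mathbb{C},\,\lambda\in\Lambda_m}\ \sup_{\|a\|_A\le1}\Big\|Ia-\sum_{\lambda\in\Lambda_m}c_\lambda(a)b^\lambda\Big\|_B,$$ where in $\zeta_m$ the functionals $c_\lambda$ need neither be linear nor continuous. *)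

(* Defs.v *)
From HB Require Import structures.
From mathcomp Require Import all_boot all_order all_algebra finmap complex.
From mathcomp Require Import all_classical all_reals all_analysis summability.

Set Implicit Arguments.
Unset Strict Implicit.
Unset Printing Implicit Defensive.

Import Order.TTheory GRing.Theory Num.Theory.
Import numFieldNormedType.Exports.
Import ComplexField.Normc.

Local Open Scope classical_set_scope.
Local Open Scope ring_scope.

(* The library has no Lebesgue measure on R^d: it is built by recursion on d,
   as the image of lebesgue_measure \x (measure on R^n) under
   (x, t) |-> x :: t; the measure on R^0 is the unit mass. *)
Section lebesgue_step.
Context {R : realType} (n : nat).
Local Notation T := (measurableTypeR R).
Variable mu : {sigma_finite_measure set (n.-tuple T) -> \bar R}.

Definition tcons (p : T * n.-tuple T) : n.+1.-tuple T :=
  [the n.+1.-tuple T of p.1 :: p.2].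

Lemma measurable_tcons : measurable_fun [set: T * n.-tuple T] tcons.
Proof. exact: measurable_cons. Qed.

Lemma measurable_preimage_tcons (A : set (n.+1.-tuple T)) :
  measurable A -> measurable (tcons @^-1` A).
Proof. by move=> mA; rewrite -[X in measurable X]setTI; exact: measurable_tcons. Qed.

Definition leb_succ (A : set (n.+1.-tuple T)) : \bar R :=
  (@lebesgue_measure R \x mu)%E (tcons @^-1` A).

Let leb_succ0 : leb_succ set0 = 0%E.
Proof. by rewrite /leb_succ preimage_set0 measure0. Qed.

Let leb_succ_ge0 A : (0 <= leb_succ A)%E.
Proof. exact: measure_ge0. Qed.

Let leb_succ_sigma_additive : semi_sigma_additive leb_succ.
Proof.
move=> F mF tF mUF; rewrite /leb_succ preimage_bigcup.
apply: measure_semi_sigma_additive.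
- by move=> k; exact: measurable_preimage_tcons.
- apply/trivIsetP => /= i j _ _ ij; rewrite -preimage_setI.
  by move/trivIsetP : tF => /(_ _ _ _ _ ij) ->//; rewrite preimage_set0.
- by rewrite -preimage_bigcup; exact: measurable_preimage_tcons.
Qed.

HB.instance Definition _ := isMeasure.Build _ _ _ leb_succ
  leb_succ0 leb_succ_ge0 leb_succ_sigma_additive.

Let leb_succ_sigma_finite : sigma_finite setT leb_succ.
Proof.
have /sigma_finiteP[F [TF ndF Foo]] := sigma_finiteT (@lebesgue_measure R).
have /sigma_finiteP[G [TG ndG Goo]] := sigma_finiteT mu.
pose tl (t : n.+1.-tuple T) : n.-tuple T := [tuple of behead t].
exists (fun k => [set t : n.+1.-tuple T | F k (thead t)] `&`
                 [set t | G k (tl t)]).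
  apply/esym/seteqP; split => // t _.
  have [i _ Fit] : (\bigcup_k F k) (thead t) by rewrite -TF.
  have [j _ Gjt] : (\bigcup_k G k) (tl t) by rewrite -TG.
  exists (maxn i j) => //; split.
  - by have /subsetPset := ndF _ _ (leq_maxl i j); exact.
  - by have /subsetPset := ndG _ _ (leq_maxr i j); exact.
move=> k; have [mF Fk] := Foo k; have [mG Gk] := Goo k; split.
  apply: measurableI.
  - by rewrite -[X in measurable X]setTI; exact: measurable_tnth.
  - by rewrite -[X in measurable X]setTI; exact: measurable_behead.
rewrite /leb_succ (_ : _ @^-1` _ = F k `*` G k).
  by rewrite product_measure1E// lte_mul_pinfty// ge0_fin_numE.
apply/seteqP; split => -[x t] /= [Fx Gt]; split => //.
- by rewrite (_ : t = tl (tcons (x, t)))//; exact/val_inj.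
- by rewrite (_ : tl _ = t)//; exact/val_inj.
Qed.

HB.instance Definition _ := Measure_isSigmaFinite.Build _ _ _ leb_succ
  leb_succ_sigma_finite.

End lebesgue_step.

Fixpoint lebesgue_measure_d (R : realType) (d : nat) :
    {sigma_finite_measure set (d.-tuple (measurableTypeR R)) -> \bar R} :=
  if d is d'.+1 then leb_succ (lebesgue_measure_d R d')
  else \d_([tuple] : 0.-tuple (measurableTypeR R)).

Definition vec (R : realType) (d : nat) (t : d.-tuple (measurableTypeR R)) :
  'rV[R]_d := \row_i tnth t i.

Local Open Scope complex_scope.

Definition cintegral disp (T : measurableType disp) (R : realType)
    (mu : {measure set T -> \bar R}) (f : T -> R[i]) : R[i] :=
  Complex (Rintegral mu setT (fun x => complex.Re (f x)))
          (Rintegral mu setT (fun x => complex.Im (f x))).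

Definition cnormL2 (R : realType) (f : R -> R[i]) : \bar R :=
  Lnorm (@lebesgue_measure R) 2%:E (fun x => (normc (f x))%:E).

Definition inL2 (R : realType) (f : R -> R[i]) : Prop :=
  [/\ measurable_fun setT (fun x : measurableTypeR R => complex.Re (f x)),
      measurable_fun setT (fun x : measurableTypeR R => complex.Im (f x)) &
      (cnormL2 f < +oo)%E].

Definition innerL2 (R : realType) (f g : R -> R[i]) : R[i] :=
  cintegral (@lebesgue_measure R) (fun x => f x * conjc (g x)).

Definition supp (R : realType) (T : topologicalType) (f : T -> R[i]) : set T :=
  closure [set x | f x != 0].

Definition realCK (R : realType) (K : nat) (f : R -> R) : Prop :=
  (forall n, (n < K)%N -> forall x, derivable (derive1n n f) x 1) /\
  (forall n, (n <= K)%N -> continuous (derive1n n f)).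

Definition CK (R : realType) (K : nat) (f : R -> R[i]) : Prop :=
  realCK K (fun x => complex.Re (f x)) /\ realCK K (fun x => complex.Im (f x)).

Definition wavelet1 (R : realType) (phi psi : R -> R[i]) (j : nat) (k : int)
    (x : R) : R[i] :=
  if j is j'.+1 then ((Num.sqrt 2)^-1)%:C * psi (2 ^+ j' * x - k%:~R)
  else phi (x - k%:~R).

(* wavelet_expansion: the sum over (j, k) is taken in L_2(R) along the finite
   subsets of nat * int. *)
Record wavelet_system (R : realType) (K : nat) (phi psi : R -> R[i]) : Prop := {
  scaling_CK : CK K phi;
  wavelet_CK : CK K psi;
  scaling_supp : compact (supp phi);
  wavelet_supp : compact (supp psi);
  scaling_norm : cnormL2 phi = 1%E;
  wavelet_norm : cnormL2 psi = 1%E;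
  wavelet_moments : forall b : nat, (b < K)%N ->
    cintegral (@lebesgue_measure R) (fun x => psi x * (x ^+ b)%:C) = 0;
  wavelet_expansion : forall f : R -> R[i], inL2 f ->
    (fun A : {fset nat * int} => cnormL2 (fun x => f x -
       \sum_(l <- A) 2 ^+ l.1 * innerL2 f (wavelet1 phi psi l.1 l.2)
                     * wavelet1 phi psi l.1 l.2 x)) @ totally --> 0%E }.

Definition level (d : nat) := {ffun 'I_d -> nat}.
Definition shift (d : nat) := {ffun 'I_d -> int}.
Definition windex (d : nat) : choiceType := (level d * shift d)%type.

Definition norm1 d (j : level d) : nat := (\sum_i j i)%N.
Definition normoo d (j : level d) : nat := (\max_i j i)%N.

Definition wavelet (R : realType) (d : nat) (phi psi : R -> R[i])
    (l : windex d) (x : 'rV[R]_d) : R[i] :=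
  \prod_i wavelet1 phi psi (l.1 i) (l.2 i) (x ord0 i).

Definition cube (R : realType) (d : nat) (l : windex d) : set 'rV[R]_d :=
  [set x | forall i, (2 ^- l.1 i * (l.2 i)%:~R <= x ord0 i
                        <= 2 ^- l.1 i * (l.2 i + 1)%:~R)%R].

Definition nabla (R : realType) (d : nat) (phi psi : R -> R[i])
    (Omega : set 'rV[R]_d) : set (windex d) :=
  [set l | supp (wavelet phi psi l) `&` Omega !=set0].

Definition ell (R : realType) (T : choiceType) (p : \bar R) (f : T -> \bar R) :
  \bar R :=
  if p is r%:E then ((\esum_(i in setT) (f i `^ r)) `^ r^-1)%E
  else ereal_sup (range f).

Inductive scale := scaleB | scaleF.

(* 1/p, with 1/+oo = 0. *)
Definition recip (R : realType) (p : \bar R) : R := fine (p^-1)%E.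

(* The sum over k in scaleF has at each point finitely many nonzero terms
   (at most 2 ^ d). *)
Definition seqnorm (R : realType) (d : nat) (X : scale) (p q : \bar R) (r s : R)
    (a : windex d -> R[i]) : \bar R :=
  match X with
  | scaleB => ell q (fun j : level d =>
      ((2 `^ ((r - recip p) * (norm1 j)%:R + s * (normoo j)%:R))%R)%:E
      * ell p (fun k : shift d => (normc (a (j, k)))%:E))%E
  | scaleF => Lnorm (lebesgue_measure_d R d) p (fun t => ell q (fun j : level d =>
      (2 `^ (r * (norm1 j)%:R + s * (normoo j)%:R) *
       normc (\sum_(k \in [set: shift d])
                 a (j, k) * (\1_(cube (j, k)) (vec t))%:C))%:E))
  end.

(* Iterated partial derivative along the list of directions s. *)
Fixpoint pderiv (R : realType) (d : nat) (s : seq 'I_d) (f : 'rV[R]_d -> R) :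
    'rV[R]_d -> R :=
  if s is i :: s' then fun x => 'D_(delta_mx 0 i) (pderiv s' f) x else f.

Definition real_smooth (R : realType) (d : nat) (f : 'rV[R]_d -> R) : Prop :=
  forall s : seq 'I_d, continuous (pderiv s f) /\
    forall i x, derivable (pderiv s f) x (delta_mx 0 i).

Definition smooth (R : realType) (d : nat) (f : 'rV[R]_d -> R[i]) : Prop :=
  real_smooth (fun x => complex.Re (f x)) /\
  real_smooth (fun x => complex.Im (f x)).

Definition cpderiv (R : realType) (d : nat) (s : seq 'I_d)
    (f : 'rV[R]_d -> R[i]) (x : 'rV[R]_d) : R[i] :=
  Complex (pderiv s (fun y => complex.Re (f y)) x)
          (pderiv s (fun y => complex.Im (f y)) x).

Definition seminorm (R : realType) (d N : nat) (f : 'rV[R]_d -> R[i]) : \bar R :=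
  ereal_sup [set ((1 + `|x|) ^+ N * normc (cpderiv s f x))%:E |
             s in [set s : seq 'I_d | (size s <= N)%N] & x in setT].

Definition schwartz (R : realType) (d : nat) (f : 'rV[R]_d -> R[i]) : Prop :=
  smooth f /\ forall N, (seminorm N f < +oo)%E.

Definition test_function (R : realType) (d : nat) (Omega : set 'rV[R]_d)
    (f : 'rV[R]_d -> R[i]) : Prop :=
  [/\ smooth f, compact (supp f) & supp f `<=` Omega].

(* A distribution is represented by a functional on all functions R^d -> C that
   vanishes outside its space of test functions, so that equality of functionals
   is equality of distributions: S'(R^d) is [set g | tempered g], and D'(Omega)
   receives [restriction Omega g]. *)
Notation functional R d := (('rV[R]_d -> R[i]) -> R[i]).

Definition tempered (R : realType) (d : nat) (g : functional R d) : Prop :=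
  [/\ forall f, ~ schwartz f -> g f = 0,
      forall (c : R[i]) f h, schwartz f -> schwartz h ->
        g (fun x => c * f x + h x) = c * g f + g h &
      exists (C : R) (N : nat), forall f, schwartz f ->
        ((normc (g f))%:E <= C%:E * seminorm N f)%E].

Definition regular (R : realType) (d : nat) (F : 'rV[R]_d -> R[i]) :
    functional R d := fun f =>
  if `[< schwartz f >] then
    cintegral (lebesgue_measure_d R d) (fun t => F (vec t) * f (vec t))
  else 0.

Definition restriction (R : realType) (d : nat) (Omega : set 'rV[R]_d)
    (g : functional R d) : functional R d := fun f =>
  if `[< test_function Omega f >] then g f else 0.

Definition dictionary (R : realType) (d : nat) (phi psi : R -> R[i])
    (Omega : set 'rV[R]_d) (l : windex d) : functional R d :=
  restriction Omega (regular (wavelet phi psi l)).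

(* Weak convergence in S'(R^d), along the finite sets of indices. *)
Definition wavelet_series (R : realType) (d : nat) (phi psi : R -> R[i])
    (a : windex d -> R[i]) (g : functional R d) : Prop :=
  forall f, schwartz f ->
    (fun A : {fset windex d} =>
       normc (g f - \sum_(l <- A) a l * regular (wavelet phi psi l) f))
      @ totally --> (0 : R).

(* The two quasi-norms take the value +oo outside their space. The coefficients
   of g with finite seqnorm are unique when the wavelets are regular enough, so
   that the first infimum is then over a single finite value. *)
Definition Hnorm (R : realType) (d : nat) (phi psi : R -> R[i]) (X : scale)
    (p q : \bar R) (r s : R) (g : functional R d) : \bar R :=
  ereal_inf [set seqnorm X p q r s a |
             a in [set a | tempered g /\ wavelet_series phi psi a g]].

Definition HnormOn (R : realType) (d : nat) (phi psi : R -> R[i])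
    (Omega : set 'rV[R]_d) (X : scale) (p q : \bar R) (r s : R)
    (u : functional R d) : \bar R :=
  ereal_inf [set Hnorm phi psi X p q r s g |
             g in [set g | tempered g /\ restriction Omega g = u]].

Definition bounded_domain (R : realType) (d : nat) (Omega : set 'rV[R]_d) : Prop :=
  [/\ open Omega, connected Omega, Omega !=set0 & bounded_set Omega].

(* The quasi-Banach spaces are {a | NA a < +oo} and {b | NB b < +oo}. *)
Section widths.
Context {R : realType} {A B : lmodType R[i]} {L : choiceType}.
Variables (NA : A -> \bar R) (NB : B -> \bar R) (I : A -> B).
Variables (Lambda : set L) (b : L -> B).

Definition lincomb (S : {fset L}) (c : L -> R[i]) : B :=
  \sum_(l <- S) c l *: b l.

Definition unit_ball : set A := [set a | (NA a <= 1)%E].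

Definition subdict (m : nat) : set {fset L} :=
  [set S : {fset L} | [set` S] `<=` Lambda /\ (#|` S| <= m)%N].

Definition sigma_width (m : nat) : \bar R :=
  ereal_sup [set ereal_inf [set ereal_inf [set NB (I a - lincomb S c)
    | c in [set: L -> R[i]]] | S in subdict m] | a in unit_ball].

Definition d_width (m : nat) : \bar R :=
  ereal_inf [set ereal_sup [set ereal_inf [set NB (I a - lincomb S c)
    | c in [set: L -> R[i]]] | a in unit_ball] | S in subdict m].

Definition zeta_width (m : nat) : \bar R :=
  ereal_inf [set ereal_inf [set ereal_sup [set NB (I a - lincomb S (c^~ a))
    | a in unit_ball] | c in [set: L -> A -> R[i]]] | S in subdict m].

Definition worst_error (alg : A -> B) : \bar R :=
  ereal_sup [set NB (I a - alg a) | a in unit_ball].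

Definition compact_operator : Prop :=
  (forall a, (NA a < +oo)%E -> (NB (I a) < +oo)%E) /\
  forall u : nat -> A, (forall n, unit_ball (u n)) ->
    exists (h : nat -> nat) (v : B),
      [/\ {homo h : m n / (m < n)%N}, (NB v < +oo)%E &
          (fun n => NB (I (u (h n)) - v)) @ \oo --> 0%E].

End widths.

Definition asymp (R : realType) (M0 : nat) (F G : nat -> \bar R) : Prop :=
  exists c1 c2 : R, [/\ 0 < c1, 0 < c2 &
    forall M, (M0 <= M)%N -> (c1%:E * F M <= G M /\ G M <= c2%:E * F M)%E].

Definition term_count (R : realType) (c alpha : R) (M : nat) : nat :=
  absz (Num.ceil (c * 2 `^ (M%:R / alpha))).

(* Main.v *)
From HB Require Import structures.
From mathcomp Require Import all_boot all_order all_algebra finmap complex.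
From mathcomp Require Import all_classical all_reals all_analysis.
From mathcomp Require Import measurable_realfun summability ring lra zify.
Require Import Defs.
Set Implicit Arguments.
Unset Strict Implicit.
Unset Printing Implicit Defensive.
Import Order.TTheory GRing.Theory Num.Theory.
Import numFieldNormedType.Exports.
Import ComplexField.Normc.
Local Open Scope classical_set_scope.
Local Open Scope ring_scope.

(** * Unconditional summation of complex families *)

Section complex_norm.
Context {R : realType}.
Implicit Types z w : R[i].

Lemma normcB z w : normc (z - w) = normc (w - z).
Proof. by rewrite -opprB normcN. Qed.

Lemma normc_ge0 z : 0 <= normc z.
Proof. by case: z => a b /=; rewrite sqrtr_ge0. Qed.

Lemma normc_real (x : R) : normc x%:C%C = `|x|.
Proof. by rewrite /= expr0n addr0 sqrtr_sqr. Qed.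

Lemma normc_distD w z : normc z <= normc w + normc (z - w).
Proof. by rewrite -[X in normc X <= _](subrKC w); exact: le_normcD. Qed.

Lemma normc_sum (I : Type) (s : seq I) (F : I -> R[i]) :
  normc (\sum_(i <- s) F i) <= \sum_(i <- s) normc (F i).
Proof.
elim: s => [|i s IH]; first by rewrite !big_nil normc0.
by rewrite !big_cons (le_trans (le_normcD _ _))// lerD2l.
Qed.

Lemma normc_prod (I : Type) (s : seq I) (P : pred I) (F : I -> R[i]) :
  normc (\prod_(i <- s | P i) F i) = \prod_(i <- s | P i) normc (F i).
Proof.
elim: s => [|i s IH]; first by rewrite !big_nil normc1.
by rewrite !big_cons; case: (P i) => //; rewrite normcM IH.
Qed.

Lemma normc_Re z : `|complex.Re z| <= normc z.
Proof.
case: z => a b /=; rewrite -sqrtr_sqr ler_sqrt ?addr_ge0 ?sqr_ge0//.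
by rewrite lerDl sqr_ge0.
Qed.

Lemma normc_Im z : `|complex.Im z| <= normc z.
Proof.
case: z => a b /=; rewrite -sqrtr_sqr ler_sqrt ?addr_ge0 ?sqr_ge0//.
by rewrite lerDr sqr_ge0.
Qed.

Lemma normc_ReIm z : normc z <= `|complex.Re z| + `|complex.Im z|.
Proof.
case: z => a b /=.
have := le_normcD a%:C%C (0 +i* b)%C; rewrite /= addr0 add0r !expr0n/=.
by rewrite addr0 add0r !sqrtr_sqr.
Qed.

Lemma normc_conj z : normc (conjc z) = normc z.
Proof. by case: z => a b /=; rewrite sqrrN. Qed.

Lemma normc_eq0P z : (forall e : R, 0 < e -> normc z <= e) -> z = 0.
Proof.
move=> h; apply: eq0_normc; apply/eqP; rewrite eq_le normc_ge0 andbT.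
by apply/ler_addgt0Pl => e e0; rewrite addr0 h.
Qed.

Lemma normcX z n : normc (z ^+ n) = normc z ^+ n.
Proof. by elim: n => [|n IH]; rewrite ?normc1// !exprS normcM IH. Qed.

Lemma mulc_conj z : z * conjc z = (normc z ^+ 2)%:C%C.
Proof.
case: z => a b /=; rewrite sqr_sqrtr ?addr_ge0 ?sqr_ge0//.
by simpc; congr (_ +i* _)%C; rewrite ?expr2 //; ring.
Qed.

End complex_norm.

Section unconditional_sums.
Context {R : realType} {I : choiceType}.
Implicit Types (x y : I -> R[i]) (s t : R[i]).

Definition csums x s := forall e : R, 0 < e ->
  exists A0 : {fset I}, forall A : {fset I}, (A0 `<=` A)%fset ->
    normc (s - \sum_(l <- A) x l) <= e.

#[local] Existing Instance totally_filter.

Lemma csumsP x s : csums x s <->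
  (fun A : {fset I} => normc (s - \sum_(l <- A) x l)) @ totally --> (0 : R).
Proof.
split=> h.
  apply/cvgrPdist_le => e e0; have [A0 hA0] := h e e0.
  exists A0 => //= A /hA0; rewrite sub0r normrN ger0_norm// normc_ge0//.
move=> e e0; move/cvgrPdist_le: h => /(_ e e0)[A0 _ hA0]; exists A0 => A /hA0/=.
by rewrite sub0r normrN ger0_norm// normc_ge0.
Qed.

Lemma csums_unique x s t : csums x s -> csums x t -> s = t.
Proof.
move=> hs ht; apply/eqP; rewrite -subr_eq0; apply/eqP/normc_eq0P => e e0.
have [A hA] := hs _ (divr_gt0 e0 (ltr0n R 2)).
have [B hB] := ht _ (divr_gt0 e0 (ltr0n R 2)).
rewrite -(subrKA (\sum_(l <- (A `|` B)%fset) x l)) (le_trans (le_normcD _ _))//.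
rewrite [leRHS](splitr e); apply: lerD; first exact/hA/fsubsetUl.
by rewrite normcB; exact/hB/fsubsetUr.
Qed.

Lemma csumsD x y s t : csums x s -> csums y t -> csums (fun l => x l + y l) (s + t).
Proof.
move=> hs ht e e0; have [A hA] := hs _ (divr_gt0 e0 (ltr0n R 2)).
have [B hB] := ht _ (divr_gt0 e0 (ltr0n R 2)).
exists (A `|` B)%fset => C; rewrite fsubUset => /andP[AC BC].
rewrite big_split/= opprD addrACA (le_trans (le_normcD _ _))//.
by rewrite [leRHS](splitr e) lerD ?hA ?hB.
Qed.

Lemma csumsZ (c : R[i]) x s : csums x s -> csums (fun l => c * x l) (c * s).
Proof.
move=> hs e e0; have c1 : 0 < normc c + 1 by rewrite ltr_wpDl// normc_ge0.
have [A hA] := hs _ (divr_gt0 e0 c1); exists A => B /hA.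
rewrite ler_pdivlMr// => h; rewrite -mulr_sumr -mulrBr normcM.
by rewrite (le_trans _ h)// mulrC ler_wpM2l ?normc_ge0// lerDl.
Qed.

Lemma eq_csums x y s : x =1 y -> csums x s -> csums y s.
Proof. by move=> /funext ->. Qed.

Lemma ler_fsetsum (f : I -> R) (A B : {fset I}) : (A `<=` B)%fset ->
  (forall l, 0 <= f l) -> \sum_(l <- A) f l <= \sum_(l <- B) f l.
Proof.
move=> AB f0; rewrite [leRHS](big_fsetID _ (mem A))/=.
rewrite -[leLHS]addr0 lerD ?sumr_ge0// le_eqVlt; apply/orP; left; apply/eqP.
by apply: eq_fbigl => i; rewrite !inE/= -(@in_fsetI _ B A) (fsetIidPr AB).
Qed.

Lemma csums_fin (A : {fset I}) x : (forall l, l \notin A -> x l = 0) ->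
  csums x (\sum_(l <- A) x l).
Proof.
move=> xA e e0; exists A => B AB.
by rewrite (big_fset_incl _ AB) ?subrr ?normc0 ?ltW// => l _ /xA.
Qed.

Lemma csums_le (C : R) x s : (forall A : {fset I}, normc (\sum_(l <- A) x l) <= C) ->
  csums x s -> normc s <= C.
Proof.
move=> hC hs; apply/ler_addgt0Pr => e e0; have [A /(_ A (fsubset_refl A)) hA] := hs e e0.
by rewrite (le_trans (normc_distD (\sum_(l <- A) x l) _))// lerD.
Qed.

Let csums_ge0 (y : I -> R) (C : R) : (forall l, 0 <= y l) ->
  (forall A : {fset I}, \sum_(l <- A) y l <= C) -> exists s, csums (fun l => (y l)%:C%C) s.
Proof.
move=> y0 yC; pose E := [set \sum_(l <- A) y l | A in [set: {fset I}]].
have hE : has_sup E.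
  split; first by exists (\sum_(l <- fset0) y l), fset0.
  by exists C => _ [A _ <-]; exact: yC.
exists (sup E)%:C%C => e e0; have [_ [A _ <-] hA] := sup_adherent e0 hE.
exists A => B AB; have AB' := ler_fsetsum AB y0.
rewrite -(rmorph_sum (real_complex R)) -(rmorphB (real_complex R)) normc_real ger0_norm.
  by rewrite lerBlDl -lerBlDr (le_trans (ltW hA)).
by rewrite subr_ge0; apply: ub_le_sup; [case: hE|exists B].
Qed.

(** Absolute summability is enough, since it passes to the positive and
    negative parts of the real and imaginary parts. *)
Lemma csums_abs x (C : R) : (forall A : {fset I}, \sum_(l <- A) normc (x l) <= C) ->
  exists s, csums x s.
Proof.
move=> xC.
have h (f : I -> R) : (forall l, `|f l| <= normc (x l)) -> exists s, csums (fun l => (f l)%:C%C) s.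
  move=> fx; have [|A|s hs] := @csums_ge0 (fun l => Num.max (f l) 0) C.
  - by move=> l; rewrite le_max lexx orbT.
  - apply: le_trans (xC A); apply: ler_sum => l _; apply: le_trans (fx l).
    by rewrite ge_max ler_norm normr_ge0.
  have [|A|t ht] := @csums_ge0 (fun l => Num.max (- f l) 0) C.
  - by move=> l; rewrite le_max lexx orbT.
  - apply: le_trans (xC A); apply: ler_sum => l _; apply: le_trans (fx l).
    by rewrite ge_max normr_ge0 -normrN ler_norm.
  exists (s + (-1) * t); apply: eq_csums (csumsD hs (csumsZ (-1) ht)) => l /=.
  rewrite mulN1r -(rmorphB (real_complex R)); congr (_%:C%C).
  have [f0|f0] := leP 0 (f l).
    by rewrite (@max_r _ _ (- f l) 0) ?oppr_le0// subr0.
  by rewrite (@max_l _ _ (- f l) 0) ?oppr_ge0 ?ltW// sub0r opprK.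
have [s hs] := h (fun l => complex.Re (x l)) (fun l => normc_Re _).
have [t ht] := h (fun l => complex.Im (x l)) (fun l => normc_Im _).
exists (s + 'i%C * t); apply: eq_csums (csumsD hs (csumsZ _ ht)) => l /=.
by rewrite [RHS]complexE.
Qed.

Lemma fset_tail (M : I -> R) (C : R) : (forall l, 0 <= M l) ->
  (forall A : {fset I}, \sum_(l <- A) M l <= C) -> forall e, 0 < e ->
  exists A : {fset I}, forall B : {fset I}, [disjoint A & B]%fset -> \sum_(l <- B) M l <= e.
Proof.
move=> M0 MC e e0; pose E := [set \sum_(l <- A) M l | A in [set: {fset I}]].
have hE : has_sup E.
  split; first by exists (\sum_(l <- fset0) M l), fset0.
  by exists C => _ [A _ <-]; exact: MC.
have [_ [A _ <-] hA] := sup_adherent e0 hE; exists A => B AB.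
have : \sum_(l <- (A `|` B)%fset) M l <= sup E by apply: ub_le_sup; [case: hE|exists (A `|` B)%fset].
rewrite (big_fsetID _ (mem A))/= => h.
have eA : \sum_(l <- [fset x | x in (A `|` B)%fset & x \in A]%fset) M l = \sum_(l <- A) M l.
  by apply: eq_fbigl => l; rewrite !inE/=; case: (l \in A); rewrite ?orbT ?andbF.
have eB : \sum_(l <- [fset x | x in (A `|` B)%fset & x \notin A]%fset) M l = \sum_(l <- B) M l.
  apply: eq_fbigl => l; rewrite !inE/=; have [lA|] := boolP (l \in A); rewrite ?andbT//=.
  by move/fdisjointP: AB => /(_ l lA)/negbTE ->.
move: h; rewrite eA eB => h.
by rewrite -(lerD2l (\sum_(l <- A) M l)) (le_trans h)// -lerBlDr ltW.
Qed.

(** Dominated convergence for series: the tail outside a finite set is small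
    uniformly in [n], and finitely many terms pass to the limit. *)
Lemma csums0_dominated (z : nat -> I -> R[i]) (M : I -> R) (C : R) (l0 : I) (w : R[i]) :
  (forall l, 0 <= M l) -> (forall A : {fset I}, \sum_(l <- A) M l <= C) ->
  (forall n l, normc (z n l) <= M l) -> (forall n, csums (z n) 0) ->
  (forall l, l != l0 -> forall e : R, 0 < e -> \forall n \near \oo, normc (z n l) <= e) ->
  (forall e : R, 0 < e -> \forall n \near \oo, normc (w - z n l0) <= e) -> w = 0.
Proof.
move=> M0 MC zM z0 zl zl0; apply: normc_eq0P => e e0.
have e3 : 0 < e / 3 by rewrite divr_gt0.
have [A hA] := fset_tail M0 MC e3.
pose N := (#|` A|.+1)%:R : R; have N0 : 0 < N by rewrite ltr0n.
pose A1 := (A `\ l0)%fset.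
have near_l : \forall n \near \oo, forall l, l \in A1 -> normc (z n l) <= e / 3 / N.
  have : forall s : seq I, {subset s <= A1} ->
      \forall n \near \oo, forall l, l \in s -> normc (z n l) <= e / 3 / N.
    elim=> [_|l s IH sA]; first by apply: nearW.
    have lA1 : l \in A1 by apply: sA; rewrite mem_head.
    have /IH hs : {subset s <= A1} by move=> i si; apply: sA; rewrite in_cons si orbT.
    have hl := zl l _ _ (divr_gt0 e3 N0).
    have : \forall n \near \oo, normc (z n l) <= e / 3 / N.
      by apply: hl; move: lA1; rewrite !inE => /andP[].
    by move: hs; apply: filterS2 => n h2 h1 i; rewrite in_cons => /orP[/eqP->|/h2].
  by apply.
near \oo => n.
have hl : forall l, l \in A1 -> normc (z n l) <= e / 3 / N by near: n.
have h0 : normc (w - z n l0) <= e / 3 by near: n; exact: zl0.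
rewrite (le_trans (normc_distD (z n l0) _))//.
suff : normc (z n l0) <= e / 3 + e / 3.
  move=> h; apply: le_trans (lerD h h0) _; lra.
have [B hB] := z0 n _ e3.
(* The partial sum over all of A, B and l0 is small, and so is its part away
   from l0: this bounds the term at l0. *)
apply/ler_addgt0Pr => t t0.
have [B' hB'] := z0 n _ t0; pose D := (B' `|` (A `|` [fset l0]))%fset.
have := hB' D (fsubsetUl _ _); rewrite sub0r normcN.
have l0D : l0 \in D by rewrite !inE eqxx !orbT.
rewrite (big_fsetD1 l0)//= (big_fsetID _ (mem A1) (D `\ l0)%fset)/=.
set s1 := \sum_(_ <- _) _; set s2 := \sum_(_ <- _) _ => hs.
have h1 : normc s1 <= e / 3.
  rewrite (le_trans (normc_sum _ _))// (le_trans (y := \sum_(l <- A1) e / 3 / N))//.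
    rewrite /s1 (_ : [fset _ | _ in _ & _]%fset = A1).
      by rewrite big_seq [leRHS]big_seq; apply: ler_sum => l; exact: hl.
    by apply/fsetP => l; rewrite !inE/=; case: (l == l0) => //=; case: (l \in A); rewrite ?orbT ?andbF.
  rewrite big_const_seq count_predT iter_addr_0 -(mulr_natr (e / 3 / N)).
  rewrite mulrAC ler_pdivrMr// ler_wpM2l ?(ltW e3)// ler_nat ltnW// ltnS.
  exact/fsubset_leq_card/fsubD1set.
have h2 : normc s2 <= e / 3.
  rewrite (le_trans (normc_sum _ _))//; apply: le_trans (ler_sum _ (fun l _ => zM n l)) _.
  apply: hA; rewrite -fsetI_eq0; apply/eqP/fsetP => l; rewrite !inE/=.
  by case: (l == l0) => //=; case: (l \in A); rewrite ?orbT ?andbF.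
have := normc_distD (z n l0 + (s1 + s2)) (z n l0); rewrite opprD addNKr normcN => h.
by rewrite (le_trans h)// [leRHS]addrC lerD// (le_trans (le_normcD _ _))// lerD.
Unshelve. all: by end_near. Qed.

End unconditional_sums.

(** * Powers of two and geometric sums *)

Section power_of_two.
Context {R : realType}.
Implicit Types x y : R.

Lemma p2_gt0 x : 0 < (2 : R) `^ x. Proof. exact: powR_gt0. Qed.
Lemma p2_ge0 x : 0 <= (2 : R) `^ x. Proof. exact: powR_ge0. Qed.

Lemma p2D x y : (2 : R) `^ (x + y) = 2 `^ x * 2 `^ y.
Proof. by rewrite powRD// pnatr_eq0 implybT. Qed.

Lemma p2_nat n : (2 : R) `^ n%:R = 2 ^+ n. Proof. by rewrite powR_mulrn. Qed.

Lemma p2_le x y : x <= y -> (2 : R) `^ x <= 2 `^ y.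
Proof. by move=> xy; apply: ler_powR => //; rewrite ler1n. Qed.

Lemma p2_sum (I : Type) (s : seq I) (P : pred I) (F : I -> R) :
  (2 : R) `^ (\sum_(i <- s | P i) F i) = \prod_(i <- s | P i) 2 `^ F i.
Proof. by apply: big_morph; [exact: p2D|rewrite powRr0]. Qed.

Lemma p2_lt1 x : 0 < x -> (2 : R) `^ (- x) < 1.
Proof.
move=> x0; rewrite powRN invf_lt1 ?p2_gt0//.
rewrite -[ltLHS](powRr0 2) lt_neqAle p2_le ?ltW// andbT.
apply/eqP => /(congr1 (@ln R)); rewrite !ln_powR mul0r => /esym/eqP.
by rewrite mulf_eq0 gt_eqF//= gt_eqF// ln_gt0// ltr1n.
Qed.

Lemma geometric_le (q : R) n : 0 <= q -> q < 1 -> \sum_(i < n) q ^+ i <= (1 - q)^-1.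
Proof.
move=> q0 q1; have q1' : 0 < 1 - q by rewrite subr_gt0.
rewrite -[leRHS]mul1r ler_pdivlMr// mulrC -opprB mulNr -subrX1 opprB lerBlDr.
by rewrite lerDl exprn_ge0.
Qed.

End power_of_two.

Section sums_over_subsets.
Context {R : realType}.

Lemma ler_sum_subseq (I : eqType) (s s' : seq I) (F : I -> R) : uniq s ->
  {subset s <= s'} -> (forall i, 0 <= F i) -> \sum_(i <- s) F i <= \sum_(i <- s') F i.
Proof.
elim: s s' => [|x s IH] s' /=; first by move=> _ _ F0; rewrite big_nil sumr_ge0.
move=> /andP[xs us] ss' F0; rewrite big_cons.
have xs' : x \in s' by apply: ss'; rewrite mem_head.
rewrite (perm_big _ (perm_to_rem xs'))/= big_cons lerD2l; apply: IH => // i si.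
have : i \in s' by apply: ss'; rewrite in_cons si orbT.
rewrite (perm_mem (perm_to_rem xs')) in_cons => /orP[/eqP ix|//].
by move: xs; rewrite -ix si.
Qed.

Lemma sum_injective_geometric (I : eqType) (s : seq I) (h : I -> nat) (q : R) :
  uniq s -> {in s &, injective h} -> 0 <= q -> q < 1 ->
  \sum_(i <- s) q ^+ h i <= (1 - q)^-1.
Proof.
move=> us hi q0 q1; rewrite -(big_map h xpredT (fun n => q ^+ n)).
apply: le_trans (geometric_le (\max_(i <- s) h i).+1 q0 q1).
rewrite -(big_mkord xpredT (fun n => q ^+ n)) /index_iota subn0.
apply: ler_sum_subseq => [||n]; last exact: exprn_ge0.
  by rewrite map_inj_in_uniq.
by move=> _ /mapP[i si ->]; rewrite mem_iota/= add0n ltnS leq_bigmax_seq.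
Qed.

(** Points that are one apart lie at distances at least 0, 1, 2, ... from [n],
    on either side of [n]. *)
Lemma sum_separated (x : nat -> R) (a n : R) M : 0 < a ->
  (forall m, x m + 1 <= x m.+1) ->
  \sum_(m < M) 2 `^ (- (a * `|x m - n|)) <= 2 * (1 - 2 `^ (- a))^-1.
Proof.
move=> a0 xS; set q : R := 2 `^ (- a).
have q0 : 0 <= q by exact: p2_ge0.
have q1 : q < 1 by exact: p2_lt1.
have xD m k : x m + k%:R <= x (m + k)%N.
  elim: k => [|k IH]; first by rewrite addr0 addn0.
  by rewrite addnS (le_trans _ (xS _))// -natr1 addrA lerD2r.
have xlt m m' : (m < m')%N -> x m + 1 <= x m'.
  by move=> mm'; rewrite -(subnKC mm') addSnnS (le_trans _ (xD _ _))// lerD2l ler1n.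
have tq m : 2 `^ (- (a * `|x m - n|)) <= q ^+ Num.truncn `|x m - n|.
  rewrite /q -powR_mulrn ?p2_ge0// -powRrM mulNr p2_le// lerN2 ler_wpM2l ?(ltW a0)//.
  by have /andP[] := truncn_itv (normr_ge0 (x m - n)).
have tlt m m' (t : R -> R) : `|t (x m)| + 1 <= `|t (x m')| ->
    Num.truncn `|t (x m)| != Num.truncn `|t (x m')|.
  move=> h; apply/eqP => e.
  have /andP[h1 _] := truncn_itv (normr_ge0 (t (x m))).
  have /andP[_] := truncn_itv (normr_ge0 (t (x m'))).
  by rewrite -e -natr1 ltNge (le_trans _ h)// lerD2r.
rewrite -(big_mkord xpredT (fun m => 2 `^ (- (a * `|x m - n|)))).
rewrite (bigID (fun m => n <= x m))/= mulr_natl mulr2n lerD//.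
  rewrite -big_filter; apply: le_trans (ler_sum _ (fun m _ => tq m)) _.
  apply: sum_injective_geometric => //; first by rewrite filter_uniq ?iota_uniq.
  move=> m m'; rewrite !mem_filter => /andP[nm _] /andP[nm' _].
  have [mm'|mm'|//] := ltngtP m m' => /eqP.
    rewrite (negbTE (tlt m m' (fun y => y - n) _))//.
    by rewrite !ger0_norm ?subr_ge0// addrAC lerD2r xlt.
  rewrite eq_sym (negbTE (tlt m' m (fun y => y - n) _))//.
  by rewrite !ger0_norm ?subr_ge0// addrAC lerD2r xlt.
rewrite -big_filter; apply: le_trans (ler_sum _ (fun m _ => tq m)) _.
apply: sum_injective_geometric => //; first by rewrite filter_uniq ?iota_uniq.
move=> m m'; rewrite !mem_filter -!ltNge => /andP[nm _] /andP[nm' _].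
have [mm'|mm'|//] := ltngtP m m' => /eqP.
  rewrite eq_sym (negbTE (tlt m' m (fun y => y - n) _))//.
  by rewrite !ltr0_norm ?subr_lt0//; have := xlt _ _ mm'; lra.
rewrite (negbTE (tlt m m' (fun y => y - n) _))//.
by rewrite !ltr0_norm ?subr_lt0//; have := xlt _ _ mm'; lra.
Qed.

Lemma sum_prod_le (I : finType) (T : eqType) (s : seq {ffun I -> T})
    (e : I -> seq T) (f : I -> T -> R) : uniq s ->
  (forall k i, k \in s -> k i \in e i) -> (forall i t, 0 <= f i t) ->
  \sum_(k <- s) \prod_i f i (k i) <= \prod_i \sum_(t <- e i) f i t.
Proof.
move=> us se f0; case: s us se => [|k0 s] us se.
  by rewrite big_nil prodr_ge0// => i _; rewrite sumr_ge0.
set s' := k0 :: s; pose M := (\max_i size (e i)).+1.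
pose F i (m : 'I_M) := if (m < size (e i))%N then f i (nth (k0 i) (e i) m) else 0.
have -> : \prod_i \sum_(t <- e i) f i t = \prod_i \sum_(m < M) F i m.
  apply: eq_bigr => i _; rewrite (big_nth (k0 i)) big_mkord.
  rewrite -big_mkcond/= (big_ord_widen_cond M xpredT (fun m => f i (nth (k0 i) (e i) m)))//.
  by rewrite ltnW// ltnS (leq_bigmax i).
rewrite bigA_distr_bigA/=.
pose h (g : {ffun I -> 'I_M}) : {ffun I -> T} := [ffun i => nth (k0 i) (e i) (g i)].
pose G (g : {ffun I -> 'I_M}) := [forall i, (g i < size (e i))%N].
apply: (@le_trans _ _ (\sum_(g | G g) \prod_i f i (h g i))); last first.
  rewrite big_mkcond/=; apply: ler_sum => g _; case: ifPn => [/forallP Gg|_].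
    by apply: ler_prod => i _; rewrite f0/= /F Gg ffunE.
  by apply: prodr_ge0 => i _; rewrite /F; case: ifP.
rewrite -[leRHS]big_filter -[leRHS](big_map h xpredT (fun k => \prod_i f i (k i))).
apply: ler_sum_subseq => //; last by move=> k; apply: prodr_ge0.
move=> k ks; apply/mapP.
have kM i : (index (k i) (e i) < M)%N.
  by rewrite /M ltnS (leq_trans (index_size _ _))// (leq_bigmax i).
exists [ffun i => Ordinal (kM i)].
  rewrite mem_filter mem_index_enum andbT; apply/forallP => i.
  by rewrite ffunE index_mem; exact: se.
by apply/ffunP => i; rewrite !ffunE nth_index//; exact: se.
Qed.

End sums_over_subsets.

(** * Anisotropic weights on the dyadic levels *)

Section levels.
Context {R : realType} (d : nat).
Implicit Types j : level d.

(** The part of [|j|_1] that is not carried by the largest coordinate; the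
    hypothesis [s1 - s0 > 0] of the theorem penalises it. *)
Definition excess j : nat := (norm1 j - normoo j)%N.

Definition tilted (eps : R) j : R := (norm1 j)%:R + eps * (excess j)%:R.

Definition bump_weight (eps a b n : R) j : R :=
  2 `^ (- (a * `|tilted eps j - n|) - b * (excess j)%:R).

Definition set_coord j (i : 'I_d) (m : nat) : level d :=
  [ffun i' => if i' == i then m else j i'].

Lemma normoo_le_norm1 j : (normoo j <= norm1 j)%N.
Proof. by apply/bigmax_leqP => i _; rewrite /norm1 (bigD1 i)//= leq_addr. Qed.

Lemma norm1_le_dnormoo j : (norm1 j <= d * normoo j)%N.
Proof.
have := sum_nat_const (mem 'I_d) (normoo j); rewrite card_ord => <-.
by apply: leq_sum => i _; exact: (leq_bigmax i).
Qed.

Lemma excessE j : (excess j)%:R = (norm1 j)%:R - (normoo j)%:R :> R.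
Proof. by rewrite natrB// normoo_le_norm1. Qed.

Lemma norm1_set_coord j i m :
  norm1 (set_coord j i m) = (m + \sum_(i' | i' != i) j i')%N.
Proof.
rewrite /norm1 (bigD1 i)//= ffunE eqxx; congr (_ + _)%N.
by apply: eq_bigr => i' /negbTE ii'; rewrite ffunE ii'.
Qed.

Lemma normoo_set_coord j i m :
  normoo (set_coord j i m) = maxn m (\max_(i' | i' != i) j i').
Proof.
rewrite /normoo (bigD1 i)//= ffunE eqxx; congr maxn.
by apply: eq_bigr => i' /negbTE ii'; rewrite ffunE ii'.
Qed.

Lemma tilted_set_coordS eps j i m : 0 <= eps ->
  tilted eps (set_coord j i m) + 1 <= tilted eps (set_coord j i m.+1).
Proof.
move=> e0; rewrite /tilted !norm1_set_coord addSn -natr1 addrAC lerD2l.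
rewrite ler_wpM2l// ler_nat /excess !norm1_set_coord !normoo_set_coord.
set x := \sum_(_ | _) _; set y := \max_(_ | _) _; rewrite /maxn.
by case: (m < y)%N /idP; case: (m.+1 < y)%N /idP; lia.
Qed.

(** For each choice of a coordinate [i] and of the others, the tilted sizes of
    the levels on that line are one apart, and the sum over the others
    converges because one of the coordinates is the largest. *)
Lemma sum_bump_weight (eps a b : R) : (0 < d)%N -> 0 <= eps -> 0 < a -> 0 < b ->
  exists2 C : R, 0 < C &
    forall n (J : {fset level d}), \sum_(j <- J) bump_weight eps a b n j <= C.
Proof.
move=> d0 e0 a0 b0; pose q : R := 2 `^ (- b); pose G := (1 - q)^-1.
have q0 : 0 <= q by exact: p2_ge0.
have q1 : q < 1 by exact: p2_lt1.
have G0 : 0 < G by rewrite invr_gt0 subr_gt0.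
pose L : R := 2 * (1 - 2 `^ (- a))^-1.
have L0 : 0 < L by rewrite mulr_gt0// invr_gt0 subr_gt0 p2_lt1.
exists (\sum_(i < d) G ^+ d * L).
  by rewrite sumr_const card_ord pmulrn_lgt0// mulr_gt0// exprn_gt0.
move=> n J.
pose rest i j : R := \prod_(i' < d) (if i' == i then 1 else q ^+ j i').
have rest0 i j : 0 <= rest i j.
  by apply: prodr_ge0 => i' _; case: ifP => // _; exact: exprn_ge0.
have wle j : bump_weight eps a b n j <=
    \sum_(i < d) rest i j * 2 `^ (- (a * `|tilted eps j - n|)).
  have [|i hi] := @bigop.eq_bigmax _ (fun i => j i); first by rewrite card_ord.
  rewrite (bigD1 i)//= -[leLHS]addr0 lerD//; last first.
    by apply: sumr_ge0 => i' _; rewrite mulr_ge0 ?p2_ge0.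
  rewrite /bump_weight p2D mulrC ler_wpM2r ?p2_ge0//.
  rewrite /excess /norm1 (bigD1 i)//= /normoo hi addKn -mulNr mulrC natr_sum.
  rewrite mulr_suml p2_sum /rest [leRHS](bigD1 i)//= eqxx mul1r le_eqVlt.
  apply/orP; left; apply/eqP; apply: eq_bigr => i' /negbTE ->.
  by rewrite /q -powR_mulrn ?p2_ge0// -powRrM mulrC.
apply: le_trans (ler_sum _ (fun j _ => wle j)) _.
rewrite exchange_big/=; apply: ler_sum => i _.
pose Q := undup [seq set_coord j i 0 | j <- J].
pose M := (\max_(j <- J) j i).+1.
have JQ : {subset (J : seq _) <= [seq set_coord r i m | r <- Q, m <- iota 0 M]}.
  move=> j jJ; have jM : j i \in iota 0 M by rewrite mem_iota add0n ltnS (@leq_bigmax_seq _ _ xpredT (fun j : level d => j i)).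
  apply/allpairsP; exists (set_coord j i 0, j i) => /=; split.
  - by rewrite mem_undup; apply/mapP; exists j.
  - exact: jM.
  - by apply/ffunP => i'; rewrite !ffunE; case: eqP => // ->.
apply: le_trans (ler_sum_subseq _ JQ _) _; first exact: fset_uniq.
  by move=> j; rewrite mulr_ge0 ?p2_ge0.
rewrite big_allpairs_dep.
apply: (@le_trans _ _ (\sum_(r <- Q) rest i r * L)).
  apply: ler_sum => r _; rewrite -[iota 0 M]/(index_iota 0 M) big_mkord.
  rewrite (eq_bigr (fun m : 'I_M => rest i r * 2 `^ (- (a * `|tilted eps (set_coord r i m) - n|)))).
    rewrite -mulr_sumr ler_wpM2l//.
    apply: (@sum_separated _ (fun m => tilted eps (set_coord r i m))) => // m.
    exact: tilted_set_coordS.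
  by move=> m _; congr (_ * _); apply: eq_bigr => i' _; rewrite ffunE; case: eqP.
rewrite -mulr_suml ler_wpM2r ?(ltW L0)//.
pose M' := (\max_(r <- Q) normoo r).+1.
pose f (i' : 'I_d) m := if i' == i then 1 else q ^+ m.
pose e (i' : 'I_d) := if i' == i then [:: 0%N] else iota 0 M'.
apply: (le_trans (@sum_prod_le R _ _ Q e f _ _ _)); first exact: undup_uniq.
- move=> r i' rQ; rewrite /e; case: eqP => [->|_].
    by move: rQ; rewrite mem_undup => /mapP[j _ ->]; rewrite ffunE eqxx.
  rewrite mem_iota/= add0n ltnS (leq_trans (leq_bigmax i'))//.
  exact: leq_bigmax_seq.
- by move=> i' m; rewrite /f; case: ifP => // _; exact: exprn_ge0.
rewrite -[d in leRHS]card_ord -prodr_const; apply: ler_prod => i' _.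
apply/andP; split.
  by apply: sumr_ge0 => m _; rewrite /f; case: ifP => // _; exact: exprn_ge0.
rewrite /e /f; case: ifP => _; last first.
  by rewrite -[iota 0 M']/(index_iota 0 M') big_mkord; exact: geometric_le.
by rewrite big_seq1 invf_ge1 ?subr_gt0// gerBl.
Qed.

End levels.

(** * Finite boxes of wavelet indices *)

Section boxes.
Context {R : realType} (d : nat).
Implicit Types (j : level d) (k : shift d) (l : windex d) (D B : nat).

(** Up to the choice of [D], the indices of the wavelets that meet a fixed
    bounded set. *)
Definition boxed D l : bool := [forall i, (`|l.2 i|%N <= D * 2 ^ l.1 i)%N].

Definition centered_ints (N : nat) : seq int :=
  [seq m%:Z - N%:Z | m <- iota 0 (2 * N).+1].

Lemma centered_intsP N (z : int) : (`|z|%N <= N)%N -> z \in centered_ints N.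
Proof.
move=> zN; apply/mapP; exists (absz (z + N%:Z)); last by lia.
by rewrite mem_iota add0n leq0n /=; lia.
Qed.

Lemma exists_fset_ffun (T : choiceType) (e : 'I_d -> seq T) :
  exists A : {fset {ffun 'I_d -> T}}, forall k : {ffun 'I_d -> T},
    (forall i, k i \in e i) -> k \in A.
Proof.
pose M := (\max_i size (e i)).+1.
have [eN|] := pselect (forall i, e i != [::]); last first.
  move=> /existsNP[i /negP/negPn/eqP ei]; exists fset0 => k /(_ i).
  by rewrite ei.
have [t ht] : exists t : 'I_d -> T, True.
  have h i : exists t, t \in e i.
    by case: (e i) (eN i) => // t s _; exists t; rewrite mem_head.
  by exists (fun i => xchoose (h i)).
exists [fset f | f in [seq [ffun i => nth (t i) (e i) (g i)] | g : {ffun 'I_d -> 'I_M}]]%fset => k ke.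
rewrite inE/=; apply/mapP.
have kM i : (index (k i) (e i) < M)%N.
  by rewrite /M ltnS (leq_trans (index_size _ _))// (leq_bigmax i).
exists [ffun i => Ordinal (kM i)]; first exact: mem_enum.
by apply/ffunP => i; rewrite !ffunE nth_index//; exact: ke.
Qed.

Lemma box_shifts_key D j : exists A : {fset shift d}, forall k, (k \in A) = boxed D (j, k).
Proof.
have [A hA] := exists_fset_ffun (fun i => centered_ints (D * 2 ^ j i)).
exists [fset k in A | boxed D (j, k)]%fset => k; rewrite !inE/= andbC.
have [kb /=|//] := boolP (boxed D (j, k)); apply: hA => i.
by apply: centered_intsP; move/forallP: kb.
Qed.
Definition box_shifts D j : {fset shift d} := projT1 (cid (box_shifts_key D j)).

Lemma mem_box_shifts D j k : (k \in box_shifts D j) = boxed D (j, k).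
Proof. by rewrite /box_shifts; case: cid. Qed.

Lemma box_levels_key B : exists A : {fset level d}, forall j, (j \in A) = (normoo j <= B)%N.
Proof.
have [A hA] := exists_fset_ffun (fun=> iota 0 B.+1).
exists [fset j in A | (normoo j <= B)%N]%fset => j; rewrite !inE/= andbC.
have [jB /=|//] := boolP (normoo j <= B)%N; apply: hA => i.
by rewrite mem_iota add0n ltnS /= (leq_trans _ jB)// (leq_bigmax i).
Qed.
Definition box_levels B : {fset level d} := projT1 (cid (box_levels_key B)).

Lemma mem_box_levels B j : (j \in box_levels B) = (normoo j <= B)%N.
Proof. by rewrite /box_levels; case: cid. Qed.

Lemma fset_boxed D B (P : pred (windex d)) :
  exists A : {fset windex d}, forall l, (l \in A) = [&& P l, boxed D l & (normoo l.1 <= B)%N].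
Proof.
exists [fset l | l in [seq (j, k) | j <- box_levels B, k <- box_shifts D j] & P l]%fset => l.
rewrite !inE/= andbC; congr (_ && _); apply/allpairsPdep/andP => [[j [k [jB kD ->]]]|[lD lB]].
  by rewrite mem_box_shifts in kD; rewrite mem_box_levels in jB.
exists l.1, l.2; rewrite mem_box_shifts mem_box_levels -surjective_pairing.
by split.
Qed.

Lemma card_box_shifts D j : (#|` box_shifts D j|)%:R <= (2 * D + 1)%:R ^+ d * 2 ^+ norm1 j :> R.
Proof.
rewrite -sum1_size natr_sum.
have := @sum_prod_le R _ _ (box_shifts D j) (fun i => centered_ints (D * 2 ^ j i)) (fun _ _ => 1).
move=> /(_ (fset_uniq _) _ (fun _ _ => ler01)) h.
rewrite (eq_bigr (fun=> \prod_(i < d) 1)); last by move=> k _; rewrite big1.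
apply: le_trans (h _) _ => [k i|].
  by rewrite mem_box_shifts => /forallP/(_ i)/centered_intsP.
apply: (@le_trans _ _ (\prod_(i < d) ((2 * D + 1)%:R * 2 ^+ j i))).
  apply: ler_prod => i _; rewrite sumr_ge0//=.
  rewrite big_const_seq count_predT iter_addr_0 size_map size_iota -natrX -natrM ler_nat.
  have := expn_gt0 2 (j i); lia.
by rewrite big_split/= prodr_const card_ord -expr_sum.
Qed.

Lemma sum_windex_le D (A : {fset windex d}) (F : windex d -> R) : (forall l, 0 <= F l) ->
  (forall l, l \in A -> boxed D l) ->
  \sum_(l <- A) F l <= \sum_(j <- [fset l.1 | l in A]%fset) \sum_(k <- box_shifts D j) F (j, k).
Proof.
move=> F0 AD; set J := [fset _ | _ in _]%fset.
have := big_allpairs_dep (op := +%R) (idx := 0 : R) (h := fun j k => (j, k))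
  (r1 := J) (r2 := fun j => box_shifts D j) (F := F).
move=> <-.
apply: ler_sum_subseq => // l lA; apply/allpairsPdep; exists l.1, l.2.
rewrite mem_box_shifts -surjective_pairing; split => //; last exact: AD.
by apply/imfsetP; exists l.
Qed.

Lemma sum_geometric_levels (J : {fset level d}) : \sum_(j <- J) 2 ^- norm1 j <= 2 ^+ d :> R.
Proof.
pose B := \max_(j <- J) normoo j.
rewrite (eq_bigr (fun j => \prod_(i < d) (2^-1 : R) ^+ (j i))); last first.
  by move=> j _; rewrite /norm1 -exprVn -expr_sum.
apply: (le_trans (@sum_prod_le R _ _ J (fun=> iota 0 B.+1) (fun i m => 2^-1 ^+ m) _ _ _)).
- exact: fset_uniq.
- move=> j i jJ; rewrite mem_iota add0n leq0n ltnS /= (leq_trans (leq_bigmax i))//.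
  exact: (@leq_bigmax_seq _ _ xpredT (fun j : level d => normoo j)).
- by move=> i m; rewrite exprn_ge0// invr_ge0.
rewrite prodr_const card_ord lerXn2r ?nnegrE//.
  by rewrite sumr_ge0// => m _; rewrite exprn_ge0// invr_ge0.
rewrite -[iota 0 B.+1]/(index_iota 0 B.+1) big_mkord.
have e : 1 - 2^-1 = 2^-1 :> R by lra.
apply: le_trans (@geometric_le R 2^-1 B.+1 _ _) _; [lra|lra|by rewrite e invrK].
Qed.

Lemma sum_boxed_geometric D (A : {fset windex d}) :
  \sum_(l <- A) (boxed D l)%:R * 2 ^- (2 * norm1 l.1) <= (2 * D + 1)%:R ^+ d * 2 ^+ d :> R.
Proof.
pose A' := [fset l in A | boxed D l]%fset.
have F0 l : 0 <= 2 ^- (2 * norm1 l.1) :> R by rewrite invr_ge0 exprn_ge0.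
have -> : \sum_(l <- A) (boxed D l)%:R * 2 ^- (2 * norm1 l.1) =
    \sum_(l <- A') 2 ^- (2 * norm1 l.1) :> R.
  rewrite (big_fsetID _ (boxed D) A)/= [X in _ + X]big1_fset ?addr0.
    by apply: eq_big_seq => l; rewrite !inE/= => /andP[_ ->]; rewrite mul1r.
  by move=> l; rewrite !inE/= => /andP[_ /negbTE ->]; rewrite mul0r.
apply: le_trans (@sum_windex_le D A' _ F0 _) _; first by move=> l; rewrite !inE => /andP[].
set J := [fset _ | _ in _]%fset.
apply: (@le_trans _ _ (\sum_(j <- J) (2 * D + 1)%:R ^+ d * 2 ^- norm1 j)).
  apply: ler_sum => j _ /=; rewrite big_const_seq count_predT iter_addr_0.
  rewrite -(mulr_natl (2 ^- (2 * norm1 j)) (size _)).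
  rewrite mulnC exprM expr2 invfM mulrA ler_wpM2r ?invr_ge0 ?exprn_ge0//.
  by rewrite ler_pdivrMr ?exprn_gt0// card_box_shifts.
rewrite -mulr_sumr ler_wpM2l ?exprn_ge0//; exact: sum_geometric_levels.
Qed.

End boxes.

(** * Finite l_p bounds *)

Section finite_lp.
Context {R : realType} {K : choiceType}.
Implicit Types (p : \bar R) (F : {fset K}) (x y : K -> R) (A z : R).

Lemma powR_le_base (r a b : R) : 0 < r -> 0 <= a -> 0 <= b -> (a `^ r <= b `^ r) = (a <= b).
Proof.
move=> r0 a0 b0; apply/idP/idP => [|ab]; last by rewrite ge0_ler_powR ?nnegrE ?(ltW r0).
by apply: contraTT; rewrite -!ltNge => ba; rewrite gt0_ltr_powR ?nnegrE.
Qed.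

Lemma sum_const_fset (F : {fset K}) (c : R) : \sum_(k <- F) c = (#|` F|)%:R * c.
Proof. by rewrite big_const_seq count_predT iter_addr_0 mulr_natl. Qed.

Lemma recip_fin (r : R) : 0 < r -> recip r%:E = r^-1.
Proof. by move=> r0; rewrite /recip inver gt_eqF. Qed.

Lemma recip_pinfty : recip (+oo : \bar R)%E = 0.
Proof. by rewrite /recip invey. Qed.

Lemma recip_ge0 p : (0 < p)%E -> 0 <= recip p.
Proof.
case: p => [r|_|//]; last by rewrite recip_pinfty.
by rewrite lte_fin => r0; rewrite recip_fin// invr_ge0 ltW.
Qed.

(** [lp_le p F x A] bounds the l_p quasi-norm of a nonnegative [x] on [F] by
    [A], without taking the root, so that it makes sense for all [p]. *)
Definition lp_le p F x A : Prop :=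
  if p is r%:E then \sum_(k <- F) x k `^ r <= A `^ r
  else forall k, k \in F -> x k <= A.

Lemma lp_le_point p F x A k : (0 < p)%E -> (forall k, 0 <= x k) -> 0 <= A ->
  lp_le p F x A -> k \in F -> x k <= A.
Proof.
case: p => [r|_|//]; rewrite ?lte_fin; last by move=> _ _ /[apply].
move=> r0 x0 A0 /= h kF; rewrite -(powR_le_base r0)//.
by apply: le_trans h; rewrite (big_fsetD1 k)//= lerDl sumr_ge0// => i _; exact: powR_ge0.
Qed.

Lemma lp_le_fsubset p F F' x A : (F' `<=` F)%fset -> lp_le p F x A -> lp_le p F' x A.
Proof.
case: p => [r| |] /= sF h; last 2 first.
- by move=> k /(fsubsetP sF); exact: h.
- by move=> k /(fsubsetP sF); exact: h.
apply: le_trans h; apply: ler_fsetsum => // k; exact: powR_ge0.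
Qed.

Lemma lp_le_mono p F x y A B : (0 < p)%E ->
  (forall k, k \in F -> 0 <= y k <= x k) -> 0 <= A <= B ->
  lp_le p F x A -> lp_le p F y B.
Proof.
move=> p0 yx /andP[A0 AB]; case: p p0 => [r r0| _|//] /= h.
  apply: le_trans (le_trans h _).
    rewrite big_seq [leRHS]big_seq; apply: ler_sum => k /yx /andP[y0 yxk].
    by rewrite powR_le_base// (le_trans y0).
  by rewrite powR_le_base// (le_trans A0).
by move=> k kF; have /andP[_ yxk] := yx k kF; rewrite (le_trans yxk)// (le_trans (h k kF)).
Qed.

Lemma lp_leZ p F x A c : (0 < p)%E -> (forall k, 0 <= x k) -> 0 <= A -> 0 <= c ->
  lp_le p F x A -> lp_le p F (fun k => c * x k) (c * A).
Proof.
move=> p0 x0 A0 c0; case: p p0 => [r _|_|//] /= h.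
  rewrite powRM// (eq_bigr (fun k => c `^ r * x k `^ r)); last first.
    by move=> k _; rewrite powRM.
  by rewrite -mulr_sumr ler_wpM2l// powR_ge0.
by move=> k kF; rewrite ler_wpM2l// h.
Qed.

Lemma lp_le_add p : (0 < p)%E -> exists2 C : R, 0 < C & forall F x y v A,
  (forall k, 0 <= x k) -> (forall k, 0 <= y k) -> (forall k, 0 <= v k <= x k + y k) ->
  0 <= A -> lp_le p F x A -> lp_le p F y A -> lp_le p F v (C * A).
Proof.
case: p => [r|_|//]; last first.
  exists 2; first by [].
  move=> F x y v A x0 y0 hv A0 hx hy k kF; have /andP[_ h] := hv k.
  by rewrite (le_trans h)// mulr_natl mulr2n lerD ?hx ?hy.
rewrite lte_fin => r0; exists (2 * 2 `^ r^-1); first by rewrite mulr_gt0// powR_gt0.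
move=> F x y v A x0 y0 hv A0 /= hx hy.
rewrite powRM ?mulr_ge0 ?powR_ge0// powRM ?powR_ge0// -powRrM mulVf ?gt_eqF//.
rewrite powRr1// -mulrA.
apply: (@le_trans _ _ (\sum_(k <- F) 2 `^ r * (x k `^ r + y k `^ r))).
  apply: ler_sum => k _; have /andP[v0 vxy] := hv k.
  have vm : v k <= 2 * Num.max (x k) (y k).
    by rewrite (le_trans vxy)// mulr_natl mulr2n lerD// le_max lexx ?orbT.
  apply: (@le_trans _ _ ((2 * Num.max (x k) (y k)) `^ r)).
    by rewrite ge0_ler_powR ?nnegrE// ?(ltW r0)// (le_trans v0).
  rewrite powRM//; last by rewrite le_max x0.
  rewrite ler_wpM2l ?powR_ge0//; have [_|_] := leP (x k) (y k).
    by rewrite lerDr powR_ge0.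
  by rewrite lerDl powR_ge0.
by rewrite -mulr_sumr ler_wpM2l ?powR_ge0// big_split/= mulr_natl mulr2n lerD.
Qed.

(** The Stechkin estimate: entries below the threshold [A * z ^ (-1/p0)] have
    an l_p1 norm that is smaller by a power of [z]. *)
Lemma lp_le_threshold p0 p1 F x A z : (0 < p0)%E -> (p0 <= p1)%E -> 0 < z -> 0 <= A ->
  (forall k, 0 <= x k) -> lp_le p0 F x A ->
  (forall k, k \in F -> x k <= A * z `^ (- recip p0)) ->
  lp_le p1 F x (A * z `^ (recip p1 - recip p0)).
Proof.
move=> p00 p01 z0 A0 x0.
case: p1 p01 => [r1|_|]; last by rewrite leeNy_eq => /eqP p0N; rewrite p0N in p00.
  case: p0 p00 => [r0|//|//]; rewrite lte_fin lee_fin => r00 r01 /= h ht.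
  have r10 : 0 < r1 by exact: lt_le_trans r01.
  rewrite !recip_fin// in ht *; set t := A * _ in ht.
  apply: (@le_trans _ _ (\sum_(k <- F) x k `^ r0 * t `^ (r1 - r0))).
    rewrite big_seq [leRHS]big_seq; apply: ler_sum => k kF.
    rewrite -[in leLHS](subrKC r0 r1) [leLHS]powRD; last first.
      by rewrite subrKC gt_eqF.
    rewrite ler_wpM2l ?powR_ge0// ge0_ler_powR ?nnegrE ?subr_ge0 ?x0 ?ht//.
    by rewrite mulr_ge0// powR_ge0.
  rewrite -mulr_suml; apply: le_trans (ler_wpM2r (powR_ge0 _ _) h) _.
  rewrite /t !powRM ?powR_ge0// mulrA -powRD; last by rewrite subrKC (gt_eqF r10).
  rewrite subrKC.
  apply: ler_wpM2l; first exact: powR_ge0.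
  rewrite -(powRrM z) -(powRrM z) le_eqVlt; apply/orP; left; apply/eqP.
  by congr powR; rewrite mulNr mulrBr mulrBl !mulVf ?gt_eqF// opprB.
move=> h ht k kF; rewrite recip_pinfty sub0r; exact: ht.
Qed.

Lemma lp_le_embed p0 p1 F x A : (0 < p0)%E -> (p0 <= p1)%E -> 0 <= A ->
  (forall k, 0 <= x k) -> lp_le p0 F x A -> lp_le p1 F x A.
Proof.
move=> p00 p01 A0 x0 h; have := @lp_le_threshold p0 p1 F x A 1 p00 p01 ltr01 A0 x0 h.
rewrite !powR1 mulr1; apply=> k kF; exact: (lp_le_point p00 x0 A0 h).
Qed.

(** The converse embedding on a set of at most [z] elements; the pointwise
    bound [x ^ p1 <= t ^ p1 + t ^ (p1 - p0) * x ^ p0] replaces Hoelder. *)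
Lemma lp_le_count p0 p1 F x A z : (0 < p1)%E -> (p1 <= p0)%E -> 0 < z -> 0 <= A ->
  (#|` F|)%:R <= z -> (forall k, 0 <= x k) -> lp_le p0 F x A ->
  lp_le p1 F x (2 `^ recip p1 * A * z `^ (recip p1 - recip p0)).
Proof.
move=> p10 p01 z0 A0 Fz x0.
have sumc (c : R) : 0 <= c -> \sum_(k <- F) c <= z * c.
  by move=> c0; rewrite sum_const_fset ler_wpM2r.
case: p1 p10 p01 => [r1|_|//]; last first.
  rewrite leye_eq => /eqP -> h k kF; rewrite recip_pinfty subr0 !powRr0 mul1r mulr1.
  exact: h.
rewrite lte_fin => r10; case: p0 => [r0|_|//]; last first.
  move=> /= h; rewrite recip_fin// recip_pinfty subr0.
  apply: (@le_trans _ _ (z * A `^ r1)).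
    apply: le_trans (sumc _ (powR_ge0 _ _)); rewrite big_seq [leRHS]big_seq.
    apply: ler_sum => k kF; rewrite ge0_ler_powR ?nnegrE ?(ltW r10)//; exact: h.
  rewrite !powRM ?mulr_ge0 ?powR_ge0// -!powRrM mulVf ?gt_eqF// !powRr1 ?(ltW z0)//.
  by rewrite mulrC -mulrA ler_peMl ?ler1n ?mulr_ge0 ?powR_ge0// ltW.
rewrite lee_fin => r10' /= h; have r00 : 0 < r0 by exact: lt_le_trans r10'.
rewrite !recip_fin//; pose t := A * z `^ (- r0^-1).
have [A00|A00] := eqVneq A 0.
  have xk k : k \in F -> x k = 0.
    move=> kF; apply/eqP; rewrite eq_le x0 andbT -A00.
    by apply: (@lp_le_point r0%:E F x A) => //; rewrite lte_fin.
  rewrite big_seq big1 ?powR_ge0// => k kF.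
  by rewrite xk// powR0// gt_eqF.
have A1 : 0 < A by rewrite lt_neqAle eq_sym A00.
have t0 : 0 < t by rewrite mulr_gt0// powR_gt0.
have xt k : x k `^ r1 <= t `^ r1 + t `^ (r1 - r0) * x k `^ r0.
  have [xt|/ltW xt] := leP (x k) t.
    rewrite -[leLHS]addr0 lerD ?mulr_ge0 ?powR_ge0//.
    by rewrite ge0_ler_powR ?nnegrE ?(ltW r10)// ltW.
  rewrite -[leLHS]add0r lerD ?powR_ge0//.
  have xk0 : 0 < x k by exact: lt_le_trans xt.
  rewrite -[in leLHS](subrK r0 r1) [leLHS]powRD; last by rewrite (gt_eqF xk0) implybT.
  rewrite ler_wpM2r ?powR_ge0// -[r1 - r0]opprB !powRN lef_pV2 ?posrE ?powR_gt0//.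
  by rewrite ge0_ler_powR ?nnegrE ?subr_ge0 ?(ltW t0).
apply: le_trans (ler_sum _ (fun k _ => xt k)) _; rewrite big_split/= -mulr_sumr.
have e1 : z * t `^ r1 = A `^ r1 * z `^ (1 - r1 / r0).
  rewrite /t powRM ?powR_ge0 ?(ltW A1)// -powRrM mulrCA; congr (_ * _).
  rewrite -[X in X * _ = _](powRr1 (ltW z0)) -powRD ?(gt_eqF z0) ?implybT//.
  by congr powR; rewrite mulNr mulrC.
have e2 : t `^ (r1 - r0) * A `^ r0 = A `^ r1 * z `^ (1 - r1 / r0).
  rewrite /t powRM ?powR_ge0 ?(ltW A1)// -powRrM mulrAC -powRD ?subrK ?(gt_eqF A1) ?implybT//.
  by congr (_ * powR _ _); rewrite mulNr mulrBr mulVf ?gt_eqF// opprB mulrC.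
apply: (@le_trans _ _ (A `^ r1 * z `^ (1 - r1 / r0) + A `^ r1 * z `^ (1 - r1 / r0))).
  apply: lerD; first by rewrite -e1; apply: sumc; exact: powR_ge0.
  by rewrite -e2 ler_wpM2l ?powR_ge0.
rewrite -mulr2n -[leLHS]mulr_natl !powRM ?mulr_ge0 ?powR_ge0// -!powRrM mulVf ?gt_eqF// powRr1//.
rewrite -mulrA le_eqVlt; apply/orP; left; apply/eqP; congr (_ * (_ * _)).
by congr powR; rewrite mulrBl mulVf ?gt_eqF// mulrC.
Qed.

Lemma lp_le_large p F S x A z : (0 < p)%E -> (p < +oo)%E -> 0 < z -> 0 < A ->
  (forall k, 0 <= x k) -> lp_le p F x A -> (S `<=` F)%fset ->
  (forall k, k \in S -> A * z `^ (- recip p) <= x k) -> (#|` S|)%:R <= z.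
Proof.
case: p => [r|//|//]; rewrite lte_fin => r0 _ z0 A0 x0 h SF hS.
have {}h := lp_le_fsubset SF h; rewrite /= in h.
rewrite recip_fin// in hS.
have : (#|` S|)%:R * (A * z `^ (- r^-1)) `^ r <= A `^ r.
  apply: le_trans h; rewrite -sum_const_fset.
  rewrite big_seq [leRHS]big_seq; apply: ler_sum => k kS.
  rewrite ge0_ler_powR ?nnegrE ?(ltW r0)//; last exact: hS.
  by rewrite mulr_ge0 ?powR_ge0 ?(ltW A0).
rewrite powRM ?powR_ge0 ?(ltW A0)// -powRrM mulNr mulVf ?gt_eqF// powRN.
rewrite powRr1 ?(ltW z0)//; by rewrite mulrCA ger_pMr ?powR_gt0// ler_pdivrMr// mul1r.
Qed.

Lemma lp_le_const p F x A (c : R) (m : nat) : (0 < p)%E -> 0 <= c -> 0 <= A -> (0 < m)%N ->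
  (m <= #|` F|)%N -> (forall k, k \in F -> c <= x k) -> lp_le p F x A ->
  c * m%:R `^ recip p <= A.
Proof.
move=> p0 c0 A0 m0 mF cx; case: p p0 => [r|_|//]; last first.
  rewrite recip_pinfty powRr0 mulr1 => h.
  have [k kF] : exists k, k \in F.
    by apply/fset0Pn; rewrite -cardfs_gt0 (leq_trans m0).
  by rewrite (le_trans (cx k kF))// h.
rewrite lte_fin => r0 /= h; rewrite recip_fin//.
have r1 := ltW r0.
rewrite -(powR_le_base r0) ?mulr_ge0 ?powR_ge0//.
rewrite powRM ?powR_ge0// -powRrM mulVf ?gt_eqF// powRr1//; apply: le_trans h.
apply: (@le_trans _ _ (c `^ r * (#|` F|)%:R)).
  by rewrite ler_wpM2l ?powR_ge0// ler_nat.
rewrite mulrC -sum_const_fset.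
rewrite big_seq [leRHS]big_seq; apply: ler_sum => k kS.
have cxk := cx k kS; by rewrite powR_le_base// (le_trans c0).
Qed.

Lemma lp_le_const_ub p F x (c z : R) : (0 < p)%E -> 0 <= c -> (#|` F|)%:R <= z ->
  (forall k, 0 <= x k <= c) -> lp_le p F x (c * z `^ recip p).
Proof.
move=> p0 c0 Fz xc; have z0 : 0 <= z by exact: le_trans Fz.
case: p p0 => [r|_|//]; last first.
  by rewrite recip_pinfty powRr0 mulr1 => k _; have /andP[] := xc k.
rewrite lte_fin => r0 /=; rewrite recip_fin//; have r1 := ltW r0.
rewrite powRM ?powR_ge0// -powRrM mulVf ?gt_eqF// powRr1//.
apply: (@le_trans _ _ (\sum_(k <- F) c `^ r)).
  by apply: ler_sum => k _; have /andP[? ?] := xc k; rewrite ge0_ler_powR ?nnegrE.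
by rewrite sum_const_fset mulrC ler_wpM2l ?powR_ge0.
Qed.

End finite_lp.

(** * Integration of bounded complex functions with finite support *)

Section complex_integral.
Context {disp} {T : measurableType disp} {R : realType}.
Implicit Types (f g : T -> R[i]) (A : R) (D : set T).

Definition cmeas f : Prop := measurable_fun setT (fun x => complex.Re (f x)) /\
  measurable_fun setT (fun x => complex.Im (f x)).

Lemma cmeas_cst (c : R[i]) : cmeas (fun _ => c). Proof. by split. Qed.

Lemma cmeasD f g : cmeas f -> cmeas g -> cmeas (fun x => f x + g x).
Proof.
move=> [f1 f2] [g1 g2]; split.
  rewrite (_ : (fun x => _) = (fun x => complex.Re (f x) + complex.Re (g x))).
    exact: measurable_funD.
  by apply/funext => x; case: (f x) (g x) => ? ? [].
rewrite (_ : (fun x => _) = (fun x => complex.Im (f x) + complex.Im (g x))).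
  exact: measurable_funD.
by apply/funext => x; case: (f x) (g x) => ? ? [].
Qed.

Lemma cmeasM f g : cmeas f -> cmeas g -> cmeas (fun x => f x * g x).
Proof.
move=> [f1 f2] [g1 g2]; split.
  rewrite (_ : (fun x => _) = (fun x => complex.Re (f x) * complex.Re (g x)
     - complex.Im (f x) * complex.Im (g x))).
    by apply: measurable_funB; exact: measurable_funM.
  by apply/funext => x; case: (f x) (g x) => ? ? [].
rewrite (_ : (fun x => _) = (fun x => complex.Re (f x) * complex.Im (g x)
    + complex.Im (f x) * complex.Re (g x))).
  by apply: measurable_funD; exact: measurable_funM.
by apply/funext => x; case: (f x) (g x) => ? ? [].
Qed.

Lemma cmeas_sum (I : Type) (s : seq I) (F : I -> T -> R[i]) :
  (forall i, cmeas (F i)) -> cmeas (fun x => \sum_(i <- s) F i x).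
Proof.
move=> hF; elim: s => [|i s IH].
  by under eq_fun do rewrite big_nil; exact: cmeas_cst.
by under eq_fun do rewrite big_cons; exact: cmeasD.
Qed.

Lemma cmeas_prod (I : Type) (s : seq I) (F : I -> T -> R[i]) :
  (forall i, cmeas (F i)) -> cmeas (fun x => \prod_(i <- s) F i x).
Proof.
move=> hF; elim: s => [|i s IH].
  by under eq_fun do rewrite big_nil; exact: cmeas_cst.
by under eq_fun do rewrite big_cons; exact: cmeasM.
Qed.

Lemma cmeas_conj f : cmeas f -> cmeas (fun x => conjc (f x)).
Proof.
move=> [f1 f2]; split.
  by rewrite (_ : (fun x => _) = (fun x => complex.Re (f x)))//; apply/funext => x; case: (f x).
rewrite (_ : (fun x => _) = (fun x => - complex.Im (f x))); first exact: measurableT_comp.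
by apply/funext => x; case: (f x).
Qed.

Lemma cmeas_real (h : T -> R) : measurable_fun setT h -> cmeas (fun x => (h x)%:C%C).
Proof. by move=> mh; split. Qed.

(** Every integrand below has this form, for which integrability, Fubini and
    the elementary estimates come for free. *)
Definition bounded_on (mu : {measure set T -> \bar R}) D A f : Prop :=
  [/\ cmeas f, measurable D, (mu D < +oo)%E, 0 <= A &
      forall x, normc (f x) <= A * \1_D x].

Variable mu : {measure set T -> \bar R}.

Lemma le_indic D D' x : D `<=` D' -> \1_D x <= \1_D' x :> R.
Proof.
move=> DD'; rewrite !indicE ler_nat; have [xD|//] := boolP (x \in D).
by rewrite (mem_set (DD' _ (set_mem xD))).
Qed.

Lemma integrable_indic_finite D : measurable D -> (mu D < +oo)%E ->
  mu.-integrable setT (fun x => (\1_D x)%:E).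
Proof.
move=> mD Doo; apply/integrableP; split; first exact/measurable_EFinP.
rewrite (eq_integral (fun x => (\1_D x)%:E)); last first.
  by move=> t _; rewrite gee0_abs// lee_fin.
by rewrite integral_indic// setIT.
Qed.

Lemma bounded_on_integrable D A (h : T -> R) : measurable D -> (mu D < +oo)%E ->
  measurable_fun setT h -> (forall x, `|h x| <= A * \1_D x) ->
  mu.-integrable setT (EFin \o h).
Proof.
move=> mD Doo mh hA; apply: (@le_integrable _ _ _ mu setT measurableT _
   (fun x => A%:E * (\1_D x)%:E)%E).
- exact/measurable_EFinP.
- move=> x _ /=; rewrite lee_fin (le_trans (hA x))// ler_norm//.
- by apply: integrableZl => //; exact: integrable_indic_finite.
Qed.

Lemma bounded_on_Re D A f : bounded_on mu D A f ->
  mu.-integrable setT (EFin \o (fun x => complex.Re (f x))).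
Proof.
move=> [[mf _] mD Doo A0 h]; apply: (@bounded_on_integrable D A) => // x.
exact: le_trans (normc_Re _) (h x).
Qed.

Lemma bounded_on_Im D A f : bounded_on mu D A f ->
  mu.-integrable setT (EFin \o (fun x => complex.Im (f x))).
Proof.
move=> [[_ mf] mD Doo A0 h]; apply: (@bounded_on_integrable D A) => // x.
exact: le_trans (normc_Im _) (h x).
Qed.

Lemma cintegral_le D A f : bounded_on mu D A f ->
  normc (cintegral mu f) <= 2 * A * fine (mu D).
Proof.
move=> bf; have [_ mD Doo A0 h] := bf.
have step (u : T -> R) : mu.-integrable setT (EFin \o u) ->
    (forall x, `|u x| <= A * \1_D x) -> `|Rintegral mu setT u| <= A * fine (mu D).
  move=> iu uA; apply: le_trans (le_normr_Rintegral _ _) _ => //.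
  have iD : mu.-integrable setT (EFin \o (fun x => A * \1_D x)).
    apply: (@bounded_on_integrable D A) => //; first exact: measurable_funM.
    by move=> x; rewrite ger0_norm ?mulr_ge0.
  apply: le_trans (le_Rintegral _ _ iD _) _ => //.
  - exact: integrable_norm.
  - rewrite RintegralZl//; last exact: integrable_indic_finite.
    by rewrite /Rintegral integral_indic// setIT.
apply: le_trans (normc_ReIm _) _; rewrite -mulrA mulr_natl mulr2n lerD//=.
  by apply: step => [|x]; [exact: bounded_on_Re bf|exact: le_trans (normc_Re _) (h x)].
by apply: step => [|x]; [exact: bounded_on_Im bf|exact: le_trans (normc_Im _) (h x)].
Qed.

Lemma cintegralD D A D' A' f g : bounded_on mu D A f -> bounded_on mu D' A' g ->
  cintegral mu (fun x => f x + g x) = cintegral mu f + cintegral mu g.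
Proof.
move=> bf bg; rewrite /cintegral; simpc; congr (_ +i* _)%C.
  rewrite -RintegralD//; [|exact: bounded_on_Re bf|exact: bounded_on_Re bg].
  by apply: eq_Rintegral => x _; case: (f x) (g x) => ? ? [].
rewrite -RintegralD//; [|exact: bounded_on_Im bf|exact: bounded_on_Im bg].
by apply: eq_Rintegral => x _; case: (f x) (g x) => ? ? [].
Qed.

Lemma cintegralZ (c : R[i]) D A f : bounded_on mu D A f ->
  cintegral mu (fun x => c * f x) = c * cintegral mu f.
Proof.
move=> bf; have iRe := bounded_on_Re bf; have iIm := bounded_on_Im bf.
have iZ (k : R) (h : T -> R) : mu.-integrable setT (EFin \o h) ->
    mu.-integrable setT (EFin \o (fun x => k * h x)).
  by move=> ih; apply: eq_integrable (integrableZl _ k ih) => //.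
case: c => a b; rewrite /cintegral; simpc; congr (_ +i* _)%C.
  rewrite -!RintegralZl// -RintegralB//; try exact: iZ.
  by apply: eq_Rintegral => x _; case: (f x).
rewrite -!RintegralZl// -RintegralD//; try exact: iZ.
by apply: eq_Rintegral => x _; case: (f x) => u v /=; rewrite addrC.
Qed.

Lemma bounded_onZ (c : R[i]) D A f : bounded_on mu D A f ->
  bounded_on mu D (normc c * A) (fun x => c * f x).
Proof.
move=> [mf mD Doo A0 h]; split => //; first exact: cmeasM (cmeas_cst c) mf.
  by rewrite mulr_ge0// normc_ge0.
by move=> x; rewrite normcM -mulrA ler_wpM2l ?normc_ge0.
Qed.

Lemma bounded_onD D A D' A' f g : bounded_on mu D A f -> bounded_on mu D' A' g ->
  bounded_on mu (D `|` D') (A + A') (fun x => f x + g x).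
Proof.
move=> [mf mD Doo A0 h] [mg mD' Doo' A0' h']; split => //.
- exact: cmeasD.
- exact: measurableU.
- rewrite (le_lt_trans (measureU2 _ _ _))//; exact: lte_add_pinfty.
- exact: addr_ge0.
move=> x; apply: le_trans (le_normcD _ _) _; apply: le_trans (lerD (h x) (h' x)) _.
by rewrite mulrDl lerD// ler_wpM2l// le_indic.
Qed.

Lemma bounded_on_sum (I : Type) (s : seq I) (D : I -> set T) (A : I -> R) (F : I -> T -> R[i]) :
  (forall i, bounded_on mu (D i) (A i) (F i)) ->
  exists D' A', bounded_on mu D' A' (fun x => \sum_(i <- s) F i x).
Proof.
move=> hF; elim: s => [|i s [D' [A' IH]]].
  exists set0, 0; under eq_fun do rewrite big_nil.
  split; [exact: cmeas_cst|exact: measurable0|by rewrite measure0|by []|].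
  by move=> x; rewrite normc0 mul0r.
exists (D i `|` D'), (A i + A'); under eq_fun do rewrite big_cons.
exact: bounded_onD.
Qed.

Lemma cintegral_sum (I : Type) (s : seq I) (D : I -> set T) (A : I -> R) (F : I -> T -> R[i]) :
  (forall i, bounded_on mu (D i) (A i) (F i)) ->
  cintegral mu (fun x => \sum_(i <- s) F i x) = \sum_(i <- s) cintegral mu (F i).
Proof.
move=> hF; elim: s => [|i s IH].
  rewrite big_nil; under eq_fun do rewrite big_nil.
  by rewrite /cintegral !Rintegral_cst// !mul0r.
rewrite big_cons; under eq_fun do rewrite big_cons.
have [D' [A' bs]] := bounded_on_sum s hF.
by rewrite (cintegralD (hF i) bs) IH.
Qed.

Lemma bounded_onMl D A A' f g : bounded_on mu D A f -> cmeas g -> 0 <= A' ->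
  (forall x, D x -> normc (g x) <= A') -> bounded_on mu D (A' * A) (fun x => g x * f x).
Proof.
move=> [mf mD Doo A0 h] mg A'0 gA; split => //.
- exact: cmeasM.
- exact: mulr_ge0.
move=> x; rewrite normcM -mulrA; have [xD|xD] := boolP (x \in D).
  by rewrite ler_pM ?normc_ge0 ?gA//; exact: set_mem.
have := h x; rewrite !indicE (negbTE xD) !mulr0 => fx.
have -> : normc (f x) = 0 by apply/eqP; rewrite eq_le fx normc_ge0.
by rewrite mulr0.
Qed.

Lemma bounded_on_mono D A D' A' f : bounded_on mu D A f -> D `<=` D' -> measurable D' ->
  (mu D' < +oo)%E -> A <= A' -> bounded_on mu D' A' f.
Proof.
move=> [mf mD Doo A0 h] DD' mD' Doo' AA'; split => //; first exact: le_trans AA'.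
move=> x; apply: le_trans (h x) _; rewrite !indicE.
have [xD|_] := boolP (x \in D); last by rewrite mulr0 mulr_ge0// (le_trans A0).
by rewrite (mem_set (DD' _ (set_mem xD))) !mulr1.
Qed.

End complex_integral.

Section complex_fubini.
Context {d1 d2} {T1 : measurableType d1} {T2 : measurableType d2} {R : realType}.
Variables (m1 : {sigma_finite_measure set T1 -> \bar R})
          (m2 : {sigma_finite_measure set T2 -> \bar R}).
Local Notation m12 := (m1 \x m2)%E.

Lemma bounded_on_fubini (D1 : set T1) (D2 : set T2) A (f : T1 * T2 -> R[i]) :
  bounded_on m12 (D1 `*` D2) A f -> measurable D1 -> measurable D2 ->
  (m1 D1 < +oo)%E -> (m2 D2 < +oo)%E ->
  [/\ cintegral m12 f = cintegral m1 (fun x => cintegral m2 (fun y => f (x, y))),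
      cintegral m12 f = cintegral m2 (fun y => cintegral m1 (fun x => f (x, y))),
      cmeas (fun x => cintegral m2 (fun y => f (x, y))) &
      cmeas (fun y => cintegral m1 (fun x => f (x, y)))].
Proof.
move=> bf mD1 mD2 D1oo D2oo; have [[mf1 mf2] _ _ A0 h] := bf.
have key (u : T1 * T2 -> R) : measurable_fun setT u -> m12.-integrable setT (EFin \o u) ->
    (forall z, `|u z| <= A * \1_(D1 `*` D2) z) ->
    [/\ Rintegral m12 setT u = Rintegral m1 setT (fun x => Rintegral m2 setT (fun y => u (x, y))),
        Rintegral m12 setT u = Rintegral m2 setT (fun y => Rintegral m1 setT (fun x => u (x, y))),
        measurable_fun setT (fun x => Rintegral m2 setT (fun y => u (x, y))) &
        measurable_fun setT (fun y => Rintegral m1 setT (fun x => u (x, y)))].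
  move=> mu iu uA.
  have mu1 x : measurable_fun setT (fun y => u (x, y)) by exact: (measurable_fun_pair2 x).
  have mu2 y : measurable_fun setT (fun x => u (x, y)) by exact: (measurable_fun_pair1 y).
  have i1 x : m2.-integrable setT (EFin \o (fun y => u (x, y))).
    apply: (@bounded_on_integrable _ _ _ m2 D2 A) => // y.
    apply: le_trans (uA _) _; rewrite ler_wpM2l// !indicE ler_nat.
    have [/set_mem[_ /= yD]|//] := boolP ((x, y) \in D1 `*` D2).
    by rewrite (mem_set yD).
  have i2 y : m1.-integrable setT (EFin \o (fun x => u (x, y))).
    apply: (@bounded_on_integrable _ _ _ m1 D1 A) => // x.
    apply: le_trans (uA _) _; rewrite ler_wpM2l// !indicE ler_nat.
    have [/set_mem[/= xD _]|//] := boolP ((x, y) \in D1 `*` D2).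
    by rewrite (mem_set xD).
  have F1 x : (Rintegral m2 setT (fun y => u (x, y)))%:E = (\int[m2]_y (EFin \o u) (x, y))%E.
    by rewrite /Rintegral fineK//; exact: (integrable_fin_num _ (i1 x)).
  have F2 y : (Rintegral m1 setT (fun x => u (x, y)))%:E = (\int[m1]_x (EFin \o u) (x, y))%E.
    by rewrite /Rintegral fineK//; exact: (integrable_fin_num _ (i2 y)).
  split.
  - rewrite {1}/Rintegral -(integral12_prod_meas1 iu) /Rintegral.
    by congr fine; apply: eq_integral => x _; rewrite F1.
  - rewrite {1}/Rintegral -(integral21_prod_meas1 iu) /Rintegral.
    by congr fine; apply: eq_integral => y _; rewrite F2.
  - apply/measurable_EFinP; rewrite (_ : _ \o _ = fubini_F m2 (EFin \o u)).
      exact: (measurable_fubini_F iu).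
    by apply/funext => x /=; rewrite F1.
  - apply/measurable_EFinP; rewrite (_ : _ \o _ = fubini_G m1 (EFin \o u)).
      exact: (measurable_fubini_G iu).
    by apply/funext => x /=; rewrite F2.
have [a1 a2 a3 a4] := key _ mf1 (bounded_on_Re bf) (fun z => le_trans (normc_Re _) (h z)).
have [b1 b2 b3 b4] := key _ mf2 (bounded_on_Im bf) (fun z => le_trans (normc_Im _) (h z)).
by split => //; rewrite /cintegral ?a1 ?b1// -?a1 -?b1 ?a2 ?b2.
Qed.

End complex_fubini.

(** * Lebesgue integration on R and on R^d *)

Section affine_change.
Context {R : realType}.
Local Notation leb := (@lebesgue_measure R).

Lemma measurable_affine (a b : R) : measurable_fun setT (fun x : measurableTypeR R => a * x + b).
Proof. by apply: measurable_funD => //; apply: measurable_funM. Qed.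

Lemma ge0_integral_affine (a b : R) (g : R -> \bar R) : 0 < a ->
  measurable_fun setT (g : measurableTypeR R -> \bar R) -> (forall x, (0 <= g x)%E) ->
  (\int[leb]_x g x = a%:E * \int[leb]_x g (a * x + b)%R)%E.
Proof.
move=> a0 mg g0; pose phi : measurableTypeR R -> measurableTypeR R := fun x => a * x + b.
have mphi : measurable_fun setT phi := measurable_affine a b.
rewrite (eq_measure_integral (mscale (NngNum (ltW a0)) (pushforward leb phi))).
  by rewrite ge0_integral_mscale//= ge0_integral_pushforward.
move=> A mA _; apply: lebesgue_measure_unique => // {mA}A [[x y] _ <-].
rewrite /mscale/= /pushforward /=.
rewrite [X in (_ = _ * leb X)%E](_ : _ = `](x - b) / a, (y - b) / a]%classic); last first.
  apply/seteqP; split => z /=; rewrite !in_itv/= /phi;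
  by rewrite ltr_pdivrMr// ler_pdivlMr// ltrBlDr lerBrDr [z * a]mulrC.
rewrite !lebesgue_measure_itv/= !lte_fin ltr_pM2r ?invr_gt0// ltrD2r.
case: ifPn => _; last by rewrite mule0.
rewrite -!EFinD -EFinM; congr EFin; field; exact: lt0r_neq0.
Qed.

Lemma Rintegral_affine (a b : R) (u : R -> R) : 0 < a ->
  leb.-integrable setT (EFin \o u) ->
  Rintegral leb setT u = a * Rintegral leb setT (fun x => u (a * x + b)).
Proof.
move=> a0 iu; have mu := measurable_int _ iu.
have mphi := measurable_affine a b.
have mu' : measurable_fun setT (EFin \o (fun x : measurableTypeR R => u (a * x + b))).
  exact: measurableT_comp mu mphi.
have iu' : leb.-integrable setT (EFin \o (fun x => u (a * x + b))).
  apply/integrableP; split => //; have /integrableP[_] := iu.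
  rewrite (@ge0_integral_affine a b)//; last exact: measurableT_comp.
  move=> h; rewrite ltNge leye_eq; apply/negP => /eqP e.
  by move: h; rewrite /= e mulry gtr0_sg// mul1e ltxx.
transitivity (fine (a%:E * \int[leb]_x (u (a * x + b)%R)%:E)%E); last first.
  by rewrite fineM//; exact: (integrable_fin_num _ iu').
congr fine; rewrite integralE [in RHS]integralE muleBr//; last first.
  by apply: integrable_add_def.
rewrite (@ge0_integral_affine a b (fun x => ((EFin \o u)^\+ x)%E))//; last exact: measurable_funepos.
rewrite (@ge0_integral_affine a b (fun x => ((EFin \o u)^\- x)%E))//; last exact: measurable_funeneg.
by congr (_ * _ - _ * _)%E; apply: eq_integral => x _; rewrite ?funeposE ?funenegE.
Qed.

Lemma bounded_on_affine (a b : R) (D : set R) A (f : R -> R[i]) : 0 < a ->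
  bounded_on leb D A f -> bounded_on leb ((fun x => a * x + b) @^-1` D) A (fun x => f (a * x + b)).
Proof.
move=> a0 [[mf1 mf2] mD Doo A0 h].
have mphi := measurable_affine a b.
have mD' : measurable ((fun x : measurableTypeR R => a * x + b) @^-1` D).
  by rewrite -[X in measurable X]setTI; exact: mphi.
split => //; first by split; [exact: measurableT_comp mf1 mphi|exact: measurableT_comp mf2 mphi].
have := @ge0_integral_affine a b (fun x => (\1_D x)%:E) a0.
rewrite integral_indic// setIT => /(_ _ _)/wrap[].
- exact/measurable_EFinP.
- by move=> x; rewrite lee_fin.
move=> e; move: Doo; rewrite e.
have -> : (\int[leb]_x (\1_D (a * x + b)%R)%:E)%E =
    leb ((fun x : measurableTypeR R => a * x + b) @^-1` D).
  by rewrite -[in RHS](setIT (_ @^-1` _)) -integral_indic.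
move=> h'; rewrite ltNge leye_eq; apply/negP => /eqP e'.
by move: h'; rewrite e' mulry gtr0_sg// mul1e ltxx.
Qed.

Lemma cintegral_affine (a b : R) (D : set R) A (f : R -> R[i]) : 0 < a ->
  bounded_on leb D A f ->
  cintegral leb (fun x => f (a * x + b)) = (a^-1)%:C%C * cintegral leb f.
Proof.
move=> a0 bf; rewrite /cintegral (Rintegral_affine b a0 (bounded_on_Re bf)).
rewrite (Rintegral_affine b a0 (bounded_on_Im bf)); simpc.
by rewrite !mulrA !mulVf ?gt_eqF// !mul1r.
Qed.

End affine_change.

Section lebesgue_d.
Context {R : realType}.
Local Notation T := (measurableTypeR R).
Local Notation leb := (@lebesgue_measure R).
Local Notation lebd d := (lebesgue_measure_d R d).

Definition tbox d (D : 'I_d -> set R) : set (d.-tuple T) := [set t | forall i, D i (tnth t i)].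

Lemma tnth_tcons0 d (p : T * d.-tuple T) : tnth (tcons p) ord0 = p.1.
Proof. by []. Qed.

Lemma tnth_tconsS d (p : T * d.-tuple T) i : tnth (tcons p) (lift ord0 i) = tnth p.2 i.
Proof. by rewrite !(tnth_nth p.1). Qed.

Lemma tcons_preimage_tbox d (D : 'I_d.+1 -> set R) :
  @tcons R d @^-1` tbox D = D ord0 `*` tbox (fun i => D (lift ord0 i)).
Proof.
apply/seteqP; split => -[x t] /= h.
  split; first exact: (h ord0).
  by move=> i; have := h (lift ord0 i); rewrite tnth_tconsS.
by case: h => /= h0 hS i; case: (unliftP ord0 i) => [j ->|->]; rewrite ?tnth_tconsS.
Qed.

Lemma measurable_tbox d (D : 'I_d -> set R) : (forall i, measurable (D i : set T)) ->
  measurable (tbox D).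
Proof.
move=> mD; rewrite (_ : tbox D = \bigcap_(i in [set: 'I_d]) ((fun t => tnth t i) @^-1` D i)).
  by apply: fin_bigcap_measurable => // i _; rewrite -[X in measurable X]setTI; exact: measurable_tnth.
by apply/seteqP; split => t /= h i; [move=> _; exact: h|exact: (h i I)].
Qed.

Lemma lebd_tbox d (D : 'I_d -> set R) : (forall i, measurable (D i : set T)) ->
  lebd d (tbox D) = (\prod_(i < d) leb (D i))%E.
Proof.
elim: d D => [D _|d IH D mD].
  rewrite big_ord0 /= diracE mem_set//= => -[]//.
rewrite big_ord_recl /= /leb_succ tcons_preimage_tbox product_measure1E//; last first.
  exact: measurable_tbox.
by rewrite IH.
Qed.

Lemma lebd_tbox_fin d (D : 'I_d -> set R) : (forall i, measurable (D i : set T)) ->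
  (forall i, (leb (D i) < +oo)%E) ->
  (lebd d (tbox D) < +oo)%E /\ fine (lebd d (tbox D)) = \prod_(i < d) fine (leb (D i)).
Proof.
move=> mD Doo; rewrite lebd_tbox//.
have -> : (\prod_(i < d) leb (D i))%E = (\prod_(i < d) fine (leb (D i)))%:E.
  rewrite -prodEFin; apply: eq_bigr => i _; rewrite fineK// ge0_fin_numE//.
by rewrite ltry.
Qed.

Lemma cintegral_succ d (F : d.+1.-tuple T -> R[i]) (D : 'I_d.+1 -> set R) A :
  bounded_on (lebd d.+1) (tbox D) A F -> (forall i, measurable (D i : set T)) ->
  (forall i, (leb (D i) < +oo)%E) ->
  [/\ cintegral (lebd d.+1) F = cintegral leb (fun x => cintegral (lebd d) (fun t => F (tcons (x, t)))),
      cintegral (lebd d.+1) F = cintegral (lebd d) (fun t => cintegral leb (fun x => F (tcons (x, t)))),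
      cmeas (fun x : T => cintegral (lebd d) (fun t => F (tcons (x, t)))) &
      cmeas (fun t => cintegral leb (fun x => F (tcons (x, t))))].
Proof.
move=> bF mD Doo; have [[mF1 mF2] _ _ A0 h] := bF.
have mtc := @measurable_tcons R d.
have bF' : bounded_on (leb \x lebd d)%E (D ord0 `*` tbox (fun i => D (lift ord0 i))) A (F \o @tcons R d).
  split => //.
  - by split; [exact: measurableT_comp mF1 mtc|exact: measurableT_comp mF2 mtc].
  - by apply: measurableX => //; exact: measurable_tbox.
  - rewrite /= product_measure1E//; last exact: measurable_tbox.
    have [h1 _] := lebd_tbox_fin (fun i => mD (lift ord0 i)) (fun i => Doo (lift ord0 i)).
    apply: lte_mul_pinfty; [exact: measure_ge0|rewrite ge0_fin_numE; [exact: Doo|exact: measure_ge0]|exact: h1].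
  - by move=> z; rewrite -tcons_preimage_tbox; exact: h.
have [f1 f2 f3 f4] := bounded_on_fubini bF' (mD ord0) (measurable_tbox (fun i => mD (lift ord0 i)))
  (Doo ord0) (lebd_tbox_fin (fun i => mD (lift ord0 i)) (fun i => Doo (lift ord0 i))).1.
suff e : cintegral (lebd d.+1) F = cintegral (leb \x lebd d)%E (F \o @tcons R d) by rewrite e.
have key (u : d.+1.-tuple T -> R) : measurable_fun setT u ->
    (leb \x lebd d)%E.-integrable setT (EFin \o (u \o @tcons R d)) ->
    Rintegral (lebd d.+1) setT u = Rintegral (leb \x lebd d)%E setT (u \o @tcons R d).
  move=> mu iu; rewrite /Rintegral; congr fine.
  rewrite (eq_measure_integral (pushforward (leb \x lebd d)%E (@tcons R d)))//.
  rewrite integral_pushforward//; exact/measurable_EFinP.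
rewrite /cintegral (key _ mF1); last exact: (bounded_on_Re bF').
by rewrite (key _ mF2)//; exact: (bounded_on_Im bF').
Qed.

End lebesgue_d.

Section tensor_products.
Context {R : realType}.
Local Notation T := (measurableTypeR R).
Local Notation leb := (@lebesgue_measure R).
Local Notation lebd d := (lebesgue_measure_d R d).

Lemma cmeas_tnth d (h : R -> R[i]) (i : 'I_d) : cmeas (h : T -> R[i]) ->
  cmeas (fun t : d.-tuple T => h (tnth t i)).
Proof.
by move=> [h1 h2]; split;
  [exact: (measurableT_comp h1 (measurable_tnth i))|exact: (measurableT_comp h2 (measurable_tnth i))].
Qed.

Lemma bounded_on_tensor d (h : 'I_d -> R -> R[i]) (D : 'I_d -> set R) (A : 'I_d -> R) :
  (forall i, bounded_on leb (D i) (A i) (h i)) ->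
  bounded_on (lebd d) (tbox D) (\prod_i A i) (fun t => \prod_i h i (tnth t i)).
Proof.
move=> bh; have mD i : measurable (D i : set T) by case: (bh i).
have Doo i : (leb (D i) < +oo)%E by case: (bh i).
split.
- by apply: cmeas_prod => i; apply: cmeas_tnth; case: (bh i).
- exact: measurable_tbox.
- by have [] := lebd_tbox_fin mD Doo.
- by apply: prodr_ge0 => i _; case: (bh i).
move=> t; rewrite normc_prod; have [tD|tD] := boolP (t \in tbox D).
  rewrite indicE tD mulr1; apply: ler_prod => i _; rewrite normc_ge0/=.
  case: (bh i) => _ _ _ A0 /(_ (tnth t i)) h1; rewrite (le_trans h1)//.
  by rewrite ler_piMr// indicE lern1 leq_b1.
rewrite indicE (negbTE tD) mulr0.
have : exists i, ~ D i (tnth t i).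
  by apply/existsNP => tD'; move/negP: tD; apply; rewrite inE.
move=> [i Di]; rewrite (bigD1 i)//=.
case: (bh i) => _ _ _ A0 /(_ (tnth t i)); rewrite indicE memNset// mulr0 => h1.
have -> : normc (h i (tnth t i)) = 0 by apply/eqP; rewrite eq_le h1 normc_ge0.
by rewrite mul0r.
Qed.

Lemma tensor_tcons d (h : 'I_d.+1 -> R -> R[i]) x (t : d.-tuple T) :
  \prod_i h i (tnth (tcons (x, t)) i) = h ord0 x * \prod_i h (lift ord0 i) (tnth t i).
Proof.
by rewrite big_ord_recl; congr (_ * _); apply: eq_bigr => i _; rewrite tnth_tconsS.
Qed.

Lemma cintegral_tensor d (h : 'I_d -> R -> R[i]) (D : 'I_d -> set R) (A : 'I_d -> R) :
  (forall i, bounded_on leb (D i) (A i) (h i)) ->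
  cintegral (lebd d) (fun t => \prod_i h i (tnth t i)) = \prod_i cintegral leb (h i).
Proof.
elim: d h D A => [h D A _|d IH h D A bh].
  rewrite big_ord0; under eq_fun do rewrite big_ord0.
  by rewrite /cintegral !Rintegral_cst//= mul1r mul0r indicT.
have mD i : measurable (D i : set T) by case: (bh i).
have Doo i : (leb (D i) < +oo)%E by case: (bh i).
have [-> _ _ _] := cintegral_succ (bounded_on_tensor bh) mD Doo.
under eq_fun do under eq_fun do rewrite tensor_tcons.
have bt := bounded_on_tensor (fun i => bh (lift ord0 i)).
under eq_fun do rewrite (cintegralZ _ bt) (IH _ _ _ (fun i => bh (lift ord0 i))) mulrC.
by rewrite (cintegralZ _ (bh ord0)) mulrC big_ord_recl.
Qed.

(** A bound for integrals against the single factor [W i] extends to integrals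
    against the whole tensor product: by Fubini the integral in the [i]-th
    coordinate can be taken first. *)
Lemma cintegral_tensor_le d (W : 'I_d -> R -> R[i]) (D : 'I_d -> set R) (Bw V A E : R)
    (P : (R -> R[i]) -> Prop) (F : d.-tuple T -> R[i]) (i : 'I_d) :
  0 <= E -> 1 <= V -> (forall i, bounded_on leb (D i) Bw (W i)) ->
  (forall i, Bw * fine (leb (D i)) <= V) ->
  cmeas F -> 0 <= A -> (forall t, normc (F t) <= A) ->
  (forall G, P G -> normc (cintegral leb (fun x => W i x * G x)) <= E) ->
  (forall t, P (fun y => F [tuple if i' == i then y else tnth t i' | i' < d])) ->
  normc (cintegral (lebd d) (fun t => (\prod_i W i (tnth t i)) * F t)) <= E * (2 * V) ^+ d.
Proof.
move=> E0 V1; elim: d W D F i => [W D F []//|d IH] W D F i bW WV mF A0 FA hE PF.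
have mD i' : measurable (D i' : set T) by case: (bW i').
have Doo i' : (leb (D i') < +oo)%E by case: (bW i').
have V0 : 0 <= V by exact: le_trans V1.
have mtc := @measurable_tcons R d.
have bWF := bounded_onMl (bounded_on_tensor bW) mF A0 (fun t _ => FA t).
have mF1 x : cmeas (fun t => F (tcons (x, t))).
  case: mF => m1 m2; split.
    by apply: (measurableT_comp m1); apply: (measurableT_comp mtc); exact: pair1_measurable.
  by apply: (measurableT_comp m2); apply: (measurableT_comp mtc); exact: pair1_measurable.
have mF2 t : cmeas (fun x : T => F (tcons (x, t))).
  case: mF => m1 m2; split.
    by apply: (measurableT_comp m1); apply: (measurableT_comp mtc); exact: pair2_measurable.
  by apply: (measurableT_comp m2); apply: (measurableT_comp mtc); exact: pair2_measurable.
have e1 t : (\prod_i W i (tnth t i)) * F t = F t * (\prod_i W i (tnth t i)) by rewrite mulrC.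
under eq_fun do rewrite e1.
have [c1 c2 m1 m2] := cintegral_succ bWF mD Doo.
have [bD bDf] := lebd_tbox_fin (fun i => mD (lift ord0 i)) (fun i => Doo (lift ord0 i)).
have bt := bounded_on_tensor (fun i => bW (lift ord0 i)).
have Bw0 : 0 <= Bw by case: (bW ord0).
have WVd : Bw ^+ d * fine (lebd d (tbox (fun i => D (lift ord0 i)))) <= V ^+ d.
  rewrite bDf -[d in Bw ^+ d]card_ord -prodr_const -big_split/=.
  rewrite -[d in V ^+ d]card_ord -prodr_const; apply: ler_prod => i' _.
  by rewrite WV andbT mulr_ge0// fine_ge0.
rewrite [\prod_i Bw]prodr_const card_ord in bt.
case: (unliftP ord0 i) => [j ij|i0].
  rewrite c1; have inner x : cintegral (lebd d) (fun t => F (tcons (x, t)) *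
        \prod_i W i (tnth (tcons (x, t)) i)) =
      W ord0 x * cintegral (lebd d) (fun t =>
        (\prod_i W (lift ord0 i) (tnth t i)) * F (tcons (x, t))).
    have b' := bounded_onMl bt (mF1 x) A0 (fun t _ => FA _).
    under [in RHS]eq_fun do rewrite mulrC.
    rewrite -(cintegralZ _ b'); congr cintegral; apply/funext => t.
    by rewrite tensor_tcons mulrCA.
  have bin x : normc (cintegral (lebd d) (fun t =>
      (\prod_i W (lift ord0 i) (tnth t i)) * F (tcons (x, t)))) <= E * (2 * V) ^+ d.
    apply: (IH (fun i => W (lift ord0 i)) (fun i => D (lift ord0 i)) (fun t => F (tcons (x, t))) j) => //.
      by rewrite -ij.
    move=> t; have := PF (tcons (x, t)); rewrite ij.
    congr P; apply/funext => y; congr F; apply/eq_from_tnth => i'.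
    rewrite tnth_mktuple; case: (unliftP ord0 i') => [k ->|->].
      by rewrite !tnth_tconsS tnth_mktuple (inj_eq lift_inj).
    by rewrite -[_ == _]/false tnth_tcons0.
  under eq_fun do rewrite inner.
  have bb : bounded_on leb (D ord0) (Bw * (E * (2 * V) ^+ d)) (fun x => cintegral (lebd d)
      (fun t => F (tcons (x, t)) * \prod_i W i (tnth (tcons (x, t)) i))).
    split => //; [exact: Doo|by rewrite mulr_ge0// mulr_ge0// exprn_ge0// mulr_ge0|].
    move=> x; rewrite inner normcM mulrAC; case: (bW ord0) => _ _ _ _ hW.
    by rewrite ler_pM ?normc_ge0.
  under eq_fun do rewrite -inner.
  apply: le_trans (cintegral_le bb) _; rewrite exprSr [leRHS]mulrA.
  rewrite [leLHS](_ : _ = E * (2 * V) ^+ d * (2 * (Bw * fine (leb (D ord0))))); last by ring.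
  by rewrite ler_wpM2l ?ler_wpM2l// mulr_ge0// exprn_ge0// mulr_ge0.
rewrite c2; have inner t : cintegral leb (fun x => F (tcons (x, t)) *
      \prod_i W i (tnth (tcons (x, t)) i)) =
    (\prod_i W (lift ord0 i) (tnth t i)) * cintegral leb (fun x => W ord0 x * F (tcons (x, t))).
  have b' := bounded_onMl (bW ord0) (mF2 t) A0 (fun x _ => FA _).
  rewrite (_ : (fun x => W ord0 x * _) = (fun x => F (tcons (x, t)) * W ord0 x)).
    rewrite -(cintegralZ _ b'); congr cintegral; apply/funext => x.
    by rewrite tensor_tcons [W ord0 x * _]mulrC mulrCA.
  by apply/funext => x; rewrite mulrC.
have bin t : normc (cintegral leb (fun x => W ord0 x * F (tcons (x, t)))) <= E.
  rewrite i0 in hE; apply: hE; have := PF (tcons (0, t)); rewrite i0.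
  congr P; apply/funext => y; congr F; apply/eq_from_tnth => i'.
  rewrite tnth_mktuple; case: (unliftP ord0 i') => [k ->|->].
    by rewrite -[_ == _]/false !tnth_tconsS.
  by rewrite eqxx tnth_tcons0.
have bb : bounded_on (lebd d) (tbox (fun i => D (lift ord0 i))) (Bw ^+ d * E) (fun t =>
    cintegral leb (fun x => F (tcons (x, t)) * \prod_i W i (tnth (tcons (x, t)) i))).
  split => //; [exact: measurable_tbox|by rewrite mulr_ge0// exprn_ge0|].
  move=> t; rewrite inner normcM mulrAC; case: bt => _ _ _ _ hW.
  by rewrite ler_pM ?normc_ge0.
apply: le_trans (cintegral_le bb) _; rewrite exprSr.
apply: (@le_trans _ _ (2 * E * V ^+ d)).
  rewrite [leLHS](_ : _ = 2 * E * (Bw ^+ d * fine (lebd d (tbox (fun i => D (lift ord0 i)))))); last by ring.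
  by rewrite ler_wpM2l// mulr_ge0.
rewrite [leLHS](_ : _ = E * (V ^+ d * 2)); last by ring.
rewrite ler_wpM2l// ler_pM ?exprn_ge0//.
  by rewrite lerXn2r ?nnegrE ?mulr_ge0// ler_peMl// ler1n.
by rewrite ler_peMr.
Qed.

End tensor_products.

(** * Polynomial approximation of smooth functions *)

Section taylor.
Context {R : realType}.
Local Notation T := (measurableTypeR R).
Local Notation leb := (@lebesgue_measure R).

(** What a function of class C^K gives to a wavelet with [K] vanishing moments:
    near each point it is a polynomial of degree less than [K], up to an error
    of order [K]. *)
Definition taylor_bound (K : nat) (A : R) (F : R -> R[i]) : Prop :=
  forall y0 : R, exists c : nat -> R[i], forall y : R,
    normc (F (y0 + y) - \sum_(b < K) c b * (y ^+ b)%:C%C) <= A * `|y| ^+ K.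

Lemma taylor_real (K : nat) (g : nat -> R -> R) (A : R) :
  (forall n, (n < K)%N -> forall x : R, is_derive x 1 (g n) (g n.+1 x)) ->
  (forall x, `|g K x| <= A) ->
  forall y0, exists2 P : {poly R}, (size P <= K)%N &
    forall y, `|g 0%N (y0 + y) - P.[y]| <= A * `|y| ^+ K.
Proof.
elim: K g => [|K IH] g hg gA y0.
  by exists 0 => [|y]; rewrite ?size_poly0// horner0 subr0 expr0 mulr1.
have [|x|Q sQ hQ] := IH (fun n => g n.+1) _ _ y0; [by move=> n nK; exact: hg|exact: gA|].
pose P := \poly_(i < K.+1) (if i is i'.+1 then Q`_i' / (i'.+1)%:R else g 0%N y0).
have dP : P^`() = Q.
  apply/polyP => i; rewrite coef_deriv coef_poly ltnS.
  have [iK|iK] := ltnP i K; last by rewrite mul0rn nth_default// (leq_trans sQ).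
  by rewrite -[LHS]mulr_natr mulfVK// pnatr_eq0.
exists P; first exact: size_poly.
pose D y := g 0%N (y0 + y) - P.[y].
have D0 : D 0 = 0 by rewrite /D addr0 horner_coef0 coef_poly subrr.
have dD (y : R) : is_derive y 1 D (g 1%N (y0 + y) - Q.[y]).
  rewrite -dP; apply: is_deriveB.
  rewrite -[X in is_derive _ _ _ X]mulr1.
  apply: (@is_derive1_comp _ (g 0%N) (fun z => y0 + z)); first exact: hg.
  by rewrite -[X in is_derive _ _ _ X]add0r; apply: is_deriveD.
have cD : continuous D.
  move=> y; apply/differentiable_continuous/derivable1_diffP.
  by have [] := dD y.
have A0 : 0 <= A by exact: le_trans (gA 0).
move=> y; rewrite -/(D y) -[D y]subr0 -D0.
have bnd xi : `|xi| <= `|y| -> `|(g 1%N (y0 + xi) - Q.[xi]) * y| <= A * `|y| ^+ K.+1.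
  move=> xiy; rewrite normrM exprSr mulrA ler_wpM2r// (le_trans (hQ xi))//.
  by rewrite ler_wpM2l// lerXn2r ?nnegrE.
have [y0'|y0'] := leP 0 y.
  have [xi] := @MVT_segment _ D _ 0 y y0' (fun x _ => dD x) (continuous_subspaceT cD).
  rewrite in_itv/= => /andP[x0 xy] ->; rewrite subr0; apply: bnd.
  by rewrite !ger0_norm.
have [xi] := @MVT_segment _ D _ y 0 (ltW y0') (fun x _ => dD x) (continuous_subspaceT cD).
rewrite in_itv/= => /andP[x0 xy]; rewrite distrC => ->; rewrite sub0r mulrN normrN.
by apply: bnd; rewrite !ler0_norm ?(ltW y0')// lerN2.
Qed.

Lemma taylor_bound_ReIm (K : nat) (A : R) (F : R -> R[i]) (g h : nat -> R -> R) :
  (forall x, F x = (g 0%N x +i* h 0%N x)%C) ->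
  (forall n, (n < K)%N -> forall x : R, is_derive x 1 (g n) (g n.+1 x)) ->
  (forall n, (n < K)%N -> forall x : R, is_derive x 1 (h n) (h n.+1 x)) ->
  (forall x, `|g K x| <= A) -> (forall x, `|h K x| <= A) ->
  taylor_bound K (2 * A) F.
Proof.
move=> FE hg hh gA hA y0.
have [P sP hP] := taylor_real hg gA y0; have [Q sQ hQ] := taylor_real hh hA y0.
exists (fun b => (P`_b +i* Q`_b)%C) => y.
have -> : \sum_(b < K) (P`_b +i* Q`_b)%C * (y ^+ b)%:C%C = (P.[y] +i* Q.[y])%C.
  rewrite (horner_coef_wide _ sP) (horner_coef_wide _ sQ).
  by elim/big_rec3: _ => [//|b u v w _ ->]; simpc.
rewrite FE; apply: le_trans (normc_ReIm _) _; simpc => /=.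
by rewrite -mulrA mulr_natl mulr2n lerD.
Qed.

Lemma taylor_bound_mono K A B F : A <= B -> taylor_bound K A F -> taylor_bound K B F.
Proof.
move=> AB h y0; have [c hc] := h y0; exists c => y.
by rewrite (le_trans (hc y))// ler_wpM2r// exprn_ge0.
Qed.

(** Bounded functions with compact support. *)
Lemma compact_supp_bound (f : R -> R[i]) :
  continuous (fun x => complex.Re (f x)) -> continuous (fun x => complex.Im (f x)) ->
  compact (supp f) -> exists L B : R, [/\ 0 < L, 0 < B &
    forall x, normc (f x) <= B * \1_(`[- L, L]%classic) x].
Proof.
move=> c1 c2 cf; have [M [_ hM]] := compact_bounded cf.
pose L := `|M| + 1; have L0 : 0 < L by rewrite ltr_wpDl.
have fL x : ~ `[- L, L]%classic x -> f x = 0.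
  move=> xL; apply/eqP/negPn/negP => fx0; apply: xL.
  have : `|x| <= L by apply: hM; [rewrite ltr_pwDr// ler_norm|exact: subset_closure].
  by rewrite /= in_itv/= ler_norml.
pose u x := `|complex.Re (f x)| + `|complex.Im (f x)|.
have cu : continuous u.
  by move=> x; apply: cvgD; apply: cvg_norm; [exact: c1|exact: c2].
have LL : - L <= L by rewrite (le_trans _ (ltW L0))// oppr_le0 ltW.
have [xm _ hm] := EVT_max LL (continuous_subspaceT cu).
have u0 : 0 <= u xm by rewrite addr_ge0.
exists L, (u xm + 1); split => //; first by rewrite ltr_wpDl.
move=> x; have [xL|xL] := pselect (`[- L, L]%classic x).
  rewrite indicE mem_set// mulr1 (le_trans (normc_ReIm _))// (le_trans (hm x xL))//.
  by rewrite lerDl.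
by rewrite fL// normc0 indicE memNset// mulr0.
Qed.

Lemma cmeas_continuous (f : R -> R[i]) :
  continuous (fun x => complex.Re (f x)) -> continuous (fun x => complex.Im (f x)) ->
  cmeas (f : T -> R[i]).
Proof. by move=> c1 c2; split; exact: continuous_measurable_fun. Qed.

Lemma CK_continuous K (f : R -> R[i]) : CK K f ->
  continuous (fun x => complex.Re (f x)) /\ continuous (fun x => complex.Im (f x)).
Proof. by move=> [[_ h1] [_ h2]]; split; [exact: (h1 0%N)|exact: (h2 0%N)]. Qed.

Lemma leb_itv_cc (a b : R) : a <= b -> (leb (`[a, b]%classic : set R) = (b - a)%:E)%E.
Proof.
move=> ab; rewrite lebesgue_measure_itv/= lte_fin; case: ltP => // ba.
by rewrite (le_anti (_ : a <= b <= a)) ?subrr// ab ba.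
Qed.

End taylor.

(** * The univariate wavelets *)

Section wavelet1_estimates.
Context {R : realType}.
Local Notation T := (measurableTypeR R).
Local Notation leb := (@lebesgue_measure R).
Local Open Scope complex_scope.
Variables (K : nat) (phi psi : R -> R[i]) (L B : R).
Hypotheses (W : wavelet_system K phi psi) (L0 : 0 < L) (B0 : 0 < B).
Hypothesis phiB : forall x, normc (phi x) <= B * \1_(`[- L, L]%classic) x.
Hypothesis psiB : forall x, normc (psi x) <= B * \1_(`[- L, L]%classic) x.
Local Notation w := (wavelet1 phi psi).
Let L0' : 0 <= L. Proof. exact: ltW. Qed.
Let B0' : 0 <= B. Proof. exact: ltW. Qed.

(** A bounded interval that contains the support of [w j k]. *)
Definition wsupp (j : nat) (k : int) : set R :=
  `[(k%:~R - L) / 2 ^+ j.-1, (k%:~R + L) / 2 ^+ j.-1]%classic.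

Lemma wsuppP j k x : wsupp j k x <-> `[- L, L]%classic (2 ^+ j.-1 * x - k%:~R).
Proof.
have p0 : 0 < (2 : R) ^+ j.-1 by rewrite exprn_gt0.
rewrite /wsupp /= !in_itv/= ler_pdivrMr// ler_pdivlMr// [x * _]mulrC.
by split=> /andP[h1 h2]; apply/andP; split; lra.
Qed.

Lemma leb_wsupp j k : leb (wsupp j k) = (2 * L / 2 ^+ j.-1)%:E.
Proof.
rewrite /wsupp leb_itv_cc; first by congr EFin; ring.
by rewrite ler_pM2r ?invr_gt0 ?exprn_gt0// lerD2l (@le_trans _ _ 0) ?oppr_le0//.
Qed.

Lemma measurable_wsupp j k : measurable (wsupp j k : set T).
Proof. exact: measurable_itv. Qed.

Lemma leb_wsupp_fin j k : (leb (wsupp j k) < +oo)%E /\ 0 <= fine (leb (wsupp j k)) <= 2 * L.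
Proof.
rewrite leb_wsupp ltry; split => //=.
rewrite divr_ge0 ?exprn_ge0// ?mulr_ge0//=.
by rewrite ler_pdivrMr ?exprn_gt0// ler_peMr ?mulr_ge0// exprn_ege1// ler1n.
Qed.

Lemma cmeas_wavelet1 j k : cmeas (w j k : T -> R[i]).
Proof.
have mv : cmeas (phi : T -> R[i]) /\ cmeas (psi : T -> R[i]).
  have [c1 c2] := CK_continuous (scaling_CK W).
  have [c3 c4] := CK_continuous (wavelet_CK W).
  by split; exact: cmeas_continuous.
have comp (f : R -> R[i]) a b : cmeas (f : T -> R[i]) -> cmeas (fun x : T => f (a * x + b)).
  by move=> [h1 h2]; have m := measurable_affine a b;
     split; [exact: (measurableT_comp h1 m)|exact: (measurableT_comp h2 m)].
case: j => [|j] /=.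
  have := comp phi 1 (- k%:~R) mv.1; congr cmeas; apply/funext => x.
  by rewrite mul1r.
exact: cmeasM (cmeas_cst _) (comp psi _ _ mv.2).
Qed.

Lemma wavelet1_norm j k x : normc (w j k x) <= B * \1_(wsupp j k) x.
Proof.
have e : \1_(wsupp j k) x = \1_(`[- L, L]%classic) (2 ^+ j.-1 * x - k%:~R) :> R.
  rewrite !indicE (_ : (x \in wsupp j k) = (2 ^+ j.-1 * x - k%:~R \in `[- L, L]%classic))//.
  by apply/idP/idP; rewrite !inE wsuppP.
rewrite e; case: j e => [|j] _ /=; first by rewrite expr0 mul1r.
rewrite normcM normc_real ger0_norm ?invr_ge0 ?sqrtr_ge0//.
rewrite -[leRHS]mul1r ler_pM ?normc_ge0 ?invr_ge0 ?sqrtr_ge0//.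
by rewrite invf_le1 ?sqrtr_gt0// -[leLHS]sqrtr1 ler_wsqrtr// ler1n.
Qed.

Lemma wavelet1_bounded j k : bounded_on leb (wsupp j k) B (w j k).
Proof.
split; [exact: cmeas_wavelet1|exact: measurable_wsupp|by have [] := leb_wsupp_fin j k
  |exact: ltW|exact: wavelet1_norm].
Qed.

Lemma leb_LL_fin : (leb (`[(- L)%R, L]%classic : set R) < +oo)%E.
Proof. by rewrite leb_itv_cc ?ltry// (@le_trans _ _ 0) ?oppr_le0. Qed.

Lemma psi_bounded : bounded_on leb (`[- L, L]%classic : set R) B psi.
Proof.
split => //.
- by have [c1 c2] := CK_continuous (wavelet_CK W); exact: cmeas_continuous.
- exact: leb_LL_fin.
Qed.

Lemma fine_leb_LL : fine (leb (`[- L, L]%classic : set R)) = 2 * L.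
Proof.
rewrite leb_itv_cc/=; first by ring.
by rewrite (@le_trans _ _ 0) ?oppr_le0.
Qed.

Lemma cmeas_pow (b : nat) : cmeas (fun x : T => (x ^+ b)%:C).
Proof. by apply: cmeas_real; apply: measurable_funX. Qed.

Lemma psi_poly (c : nat -> R[i]) (a : R) :
  cintegral leb (fun y => (\sum_(b < K) c b * ((a * y) ^+ b)%:C) * psi y) = 0 /\
  exists D A, bounded_on leb D A (fun y => (\sum_(b < K) c b * ((a * y) ^+ b)%:C) * psi y).
Proof.
have bb (b : nat) : bounded_on leb (`[- L, L]%classic : set R) (L ^+ b * B)
    (fun y => (y ^+ b)%:C * psi y).
  apply: bounded_onMl psi_bounded (cmeas_pow b) _ _; first by rewrite exprn_ge0//.
  move=> x; rewrite normc_real normrX /= in_itv/= -ler_norml => xL.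
  by rewrite lerXn2r ?nnegrE//.
have E : (fun y => (\sum_(b < K) c b * ((a * y) ^+ b)%:C) * psi y) =
    (fun y => \sum_(b < K) (c b * (a ^+ b)%:C) * ((y ^+ b)%:C * psi y)).
  apply/funext => y; rewrite mulr_suml; apply: eq_bigr => b _.
  by rewrite exprMn (rmorphM (real_complex R)) !mulrA.
rewrite E; split; last exact: (bounded_on_sum _ (fun b : 'I_K => bounded_onZ _ (bb b))).
rewrite (cintegral_sum _ (fun b : 'I_K => bounded_onZ _ (bb b))) big1// => b _.
rewrite (cintegralZ _ (bb b)) (_ : (fun x => _) = (fun x => psi x * (x ^+ b)%:C)).
  by rewrite (wavelet_moments W)// mulr0.
by apply/funext => x; rewrite mulrC.
Qed.

(** The vanishing moments remove the Taylor polynomial of [F]. *)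
Lemma wavelet1_decay (F : R -> R[i]) (A : R) j k : 0 <= A -> cmeas (F : T -> R[i]) ->
  (forall x, normc (F x) <= A) -> taylor_bound K A F ->
  normc (cintegral leb (fun x => w j k x * F x)) <= (4 * B * L * (1 + 2 * L) ^+ K) * A / 2 ^+ (K * j).
Proof.
move=> A0 mF FA tF; have L2 : 1 <= (1 + 2 * L) ^+ K.
  by rewrite exprn_ege1// lerDl mulr_ge0//.
have swap j' k' : (fun x => w j' k' x * F x) = (fun x => F x * w j' k' x).
  by apply/funext => x; rewrite mulrC.
case: j => [|j].
  rewrite muln0 expr0 divr1 swap.
  apply: le_trans (cintegral_le (bounded_onMl (wavelet1_bounded 0 k) mF A0 (fun x _ => FA x))) _.
  apply: (@le_trans _ _ (2 * (A * B) * (2 * L))).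
    by apply: ler_wpM2l; [rewrite !mulr_ge0|have /andP[] := (leb_wsupp_fin 0 k).2].
  rewrite [leLHS](_ : _ = 4 * B * L * A * 1); last by ring.
  rewrite [leRHS](_ : _ = 4 * B * L * A * (1 + 2 * L) ^+ K); last by ring.
  by rewrite ler_wpM2l// !mulr_ge0.
pose a : R := 2 ^- j; have a0 : 0 < a by rewrite invr_gt0 exprn_gt0.
pose y0 : R := a * k%:~R; have [c hc] := tF y0.
pose P y := \sum_(b < K) c b * ((a * y) ^+ b)%:C.
have mFa : cmeas (fun y : T => F (y0 + a * y)).
  have [m1 m2] := mF; have m := measurable_affine a y0; under eq_fun do rewrite addrC.
  by split; [exact: (measurableT_comp m1 m)|exact: (measurableT_comp m2 m)].
pose H y := F (y0 + a * y) - P y.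
have mP : cmeas (P : T -> R[i]).
  apply: cmeas_sum => b; apply: cmeasM; first exact: cmeas_cst.
  by apply: cmeas_real; apply: measurable_funX; exact: measurable_funM.
have mH : cmeas (H : T -> R[i]).
  apply: cmeasD => //; rewrite (_ : (fun x => - P x) = (fun x => -1 * P x)).
    exact: cmeasM (cmeas_cst _) mP.
  by apply/funext => x; rewrite mulN1r.
have hH y : `[- L, L]%classic y -> normc (H y) <= A * (a * L) ^+ K.
  rewrite /= in_itv/= -ler_norml => yL; rewrite (le_trans (hc _))// ler_wpM2l//.
  by rewrite normrM gtr0_norm// lerXn2r ?nnegrE ?mulr_ge0 ?ler_wpM2l ?(ltW a0).
have AK0 : 0 <= A * (a * L) ^+ K by rewrite mulr_ge0// exprn_ge0// mulr_ge0// ltW.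
have bH := bounded_onMl psi_bounded mH AK0 hH.
have [P0 [D' [A' bP]]] := psi_poly c a.
have bG := bounded_onD bH bP; have iG := cintegralD bH bP.
rewrite P0 addr0 in iG.
have GE : (fun y => H y * psi y + P y * psi y) = (fun y => F (y0 + a * y) * psi y).
  by apply/funext => y; rewrite -mulrDl /H subrK.
rewrite GE in bG iG.
have p0 : 0 < (2 : R) ^+ j by rewrite exprn_gt0.
have wE : (fun x => w j.+1 k x * F x) = (fun x => ((Num.sqrt 2)^-1)%:C *
    ((fun y => F (y0 + a * y) * psi y) (2 ^+ j * x + - k%:~R))).
  apply/funext => x /=; rewrite -mulrA [_ * F x]mulrC; congr (_ * (F _ * _)).
  by rewrite mulrBr mulrA mulVf ?mul1r ?gt_eqF// /y0 addrCA subrr addr0.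
rewrite wE (cintegralZ _ (bounded_on_affine (- k%:~R) p0 bG)) (cintegral_affine _ p0 bG) iG.
rewrite !normcM !normc_real ger0_norm ?invr_ge0 ?sqrtr_ge0// ger0_norm ?invr_ge0 ?(ltW p0)//.
have s1 : (Num.sqrt 2)^-1 <= 1 :> R.
  by rewrite invf_le1 ?sqrtr_gt0// -[leLHS]sqrtr1 ler_wsqrtr// ler1n.
have j1 : (2 ^+ j)^-1 <= 1 :> R by rewrite invf_le1// exprn_ege1// ler1n.
rewrite mulrA; apply: (@le_trans _ _ (1 * (A * (a * L) ^+ K * B * 2 * (2 * L)))).
  rewrite ler_pM ?normc_ge0 ?mulr_ge0 ?invr_ge0 ?sqrtr_ge0 ?(ltW p0)//.
    by rewrite -[leRHS]mulr1 ler_pM ?invr_ge0 ?sqrtr_ge0 ?(ltW p0).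
  apply: le_trans (cintegral_le bH) _; rewrite -[X in _ * X <= _]/(fine (leb _)) fine_leb_LL.
  by rewrite le_eqVlt; apply/orP; left; apply/eqP; ring.
rewrite mul1r [leLHS](_ : _ = 4 * B * L * A * (a * L) ^+ K); last by ring.
rewrite [leRHS](_ : _ = 4 * B * L * A * ((1 + 2 * L) ^+ K / 2 ^+ (K * j.+1))); last by ring.
rewrite ler_wpM2l ?mulr_ge0//.
rewrite mulnC exprM -expr_div_n lerXn2r ?nnegrE ?mulr_ge0 ?invr_ge0 ?addr_ge0 ?mulr_ge0 ?exprn_ge0//.
rewrite (_ : (1 + 2 * L) / 2 ^+ j.+1 = a * ((1 + 2 * L) / 2)); last first.
  by rewrite /a exprS invfM; ring.
rewrite ler_wpM2l ?(ltW a0)// ler_pdivlMr//; lra.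
Qed.

End wavelet1_estimates.

Section orthogonality.
Context {R : realType}.
Local Notation T := (measurableTypeR R).
Local Notation leb := (@lebesgue_measure R).
Local Open Scope complex_scope.
Variables (K : nat) (phi psi : R -> R[i]) (L B : R).
Hypotheses (W : wavelet_system K phi psi) (L0 : 0 < L) (B0 : 0 < B).
Hypothesis phiB : forall x, normc (phi x) <= B * \1_(`[- L, L]%classic) x.
Hypothesis psiB : forall x, normc (psi x) <= B * \1_(`[- L, L]%classic) x.
Local Notation w := (wavelet1 phi psi).

#[local] Existing Instance totally_filter.

Lemma conjcM (x y : R[i]) : conjc (x * y) = conjc x * conjc y.
Proof. exact: (rmorphM conjc). Qed.

Lemma measurable_normc (f : T -> R[i]) : cmeas f -> measurable_fun setT (fun x => normc (f x)).
Proof.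
move=> [m1 m2]; rewrite (_ : (fun x => _) =
    (fun x => Num.sqrt (complex.Re (f x) ^+ 2 + complex.Im (f x) ^+ 2))); last first.
  by apply/funext => x; case: (f x).
apply: (@measurableT_comp _ _ _ _ _ _ (@Num.sqrt R)).
  by apply: continuous_measurable_fun; exact: sqrt_continuous.
by apply: measurable_funD; exact: measurable_funX.
Qed.

Lemma cnormL2_sq (f : T -> R[i]) D A : bounded_on leb D A f ->
  (cnormL2 f `^ 2 = (Rintegral leb setT (fun x => normc (f x) ^+ 2))%:E)%E.
Proof.
move=> bf; have [mf mD Doo A0 h] := bf.
rewrite /cnormL2 powR_Lnorm ?pnatr_eq0// /Rintegral fineK.
  apply: eq_integral => x _ /=; rewrite ?poweR_EFin powR_mulrn ?normr_ge0//.
  by rewrite ger0_norm ?normc_ge0.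
apply: integrable_fin_num => //.
apply: (@bounded_on_integrable _ _ _ leb D (A ^+ 2)) => //.
  by apply: measurable_funX; exact: measurable_normc.
move=> x; rewrite ger0_norm ?exprn_ge0 ?normc_ge0//.
apply: (@le_trans _ _ ((A * \1_D x) ^+ 2)); first by rewrite lerXn2r ?nnegrE ?normc_ge0 ?mulr_ge0.
by rewrite exprMn indicE; case: (x \in D); rewrite ?expr1n// expr0n.
Qed.

Lemma cintegral_sq (f : T -> R[i]) :
  cintegral leb (fun x => f x * conjc (f x)) = (Rintegral leb setT (fun x => normc (f x) ^+ 2))%:C.
Proof.
rewrite /cintegral (_ : (fun x => complex.Re _) = (fun x => normc (f x) ^+ 2)).
  rewrite (_ : (fun x => complex.Im _) = (fun=> 0)).
    by rewrite Rintegral_cst// mul0r.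
  by apply/funext => x; rewrite mulc_conj.
by apply/funext => x; rewrite mulc_conj.
Qed.

Lemma cnormL2_1 (f : T -> R[i]) D A : bounded_on leb D A f -> cnormL2 f = 1%E ->
  cintegral leb (fun x => f x * conjc (f x)) = 1.
Proof.
move=> bf f1; rewrite cintegral_sq; congr (_%:C).
by have := cnormL2_sq bf; rewrite f1 poweR1r => -[].
Qed.

Lemma bounded_on_conj (f : T -> R[i]) D A :
  bounded_on leb D A f -> bounded_on leb D A (fun x => conjc (f x)).
Proof.
move=> [mf mD Doo A0 h]; split => //; first exact: cmeas_conj.
by move=> x; rewrite normc_conj.
Qed.

Lemma bounded_on_M (f g : T -> R[i]) D A D' A' :
  bounded_on leb D A f -> bounded_on leb D' A' g -> bounded_on leb D' (A * A') (fun x => f x * g x).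
Proof.
move=> [mf mD Doo A0 h] bg; apply: bounded_onMl => // x _; rewrite (le_trans (h x))//.
by rewrite ler_piMr// indicE lern1 leq_b1.
Qed.

Lemma cintegral_CauchySchwarz (f g : T -> R[i]) D A D' A' :
  bounded_on leb D A f -> bounded_on leb D' A' g ->
  ((normc (cintegral leb (fun x => f x * conjc (g x))))%:E <= 2%:E * (cnormL2 f * cnormL2 g))%E.
Proof.
move=> bf bg; have bfg := bounded_on_M bf (bounded_on_conj bg).
have [mfg mD Doo A0 h] := bfg.
have iN : leb.-integrable setT (EFin \o (fun x => normc (f x * conjc (g x)))).
  apply: (@bounded_on_integrable _ _ _ leb D' (A * A')) => //; first exact: measurable_normc.
  by move=> x; rewrite ger0_norm ?normc_ge0.
apply: (@le_trans _ _ (2%:E * (Rintegral leb setT (fun x => normc (f x * conjc (g x))))%:E)%E).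
  rewrite -EFinM lee_fin; apply: le_trans (normc_ReIm _) _; rewrite mulr_natl mulr2n lerD//=.
    apply: le_trans (le_normr_Rintegral _ (bounded_on_Re bfg)) _ => //.
    apply: le_Rintegral => //; last by move=> x _; exact: normc_Re.
    exact: integrable_norm (bounded_on_Re bfg).
  apply: le_trans (le_normr_Rintegral _ (bounded_on_Im bfg)) _ => //.
  apply: le_Rintegral => //; last by move=> x _; exact: normc_Im.
  exact: integrable_norm (bounded_on_Im bfg).
rewrite lee_pmul2l//= /Rintegral fineK; last exact: (integrable_fin_num _ iN).
have mf : measurable_fun setT (fun x => normc (f x)) by apply: measurable_normc; case: bf.
have mg : measurable_fun setT (fun x => normc (g x)) by apply: measurable_normc; case: bg.
have h2 : 2^-1 + 2^-1 = 1 :> R by rewrite [RHS](splitr 1) mul1r.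
apply: le_trans (hoelder leb mf mg (ltr0n R 2) (ltr0n R 2) h2).
rewrite Lnorm1 le_eqVlt; apply/orP; left; apply/eqP; apply: eq_integral => x _ /=.
by rewrite normcM normc_conj ger0_norm// mulr_ge0 ?normc_ge0.
Qed.

Lemma cintegral_conj (f : T -> R[i]) D A : bounded_on leb D A f ->
  cintegral leb (fun x => conjc (f x)) = conjc (cintegral leb f).
Proof.
move=> bf; rewrite /cintegral /=; congr (_ +i* _).
  by apply: eq_Rintegral => x _; case: (f x).
rewrite -mulN1r -RintegralZl//; last exact: bounded_on_Im bf.
by apply: eq_Rintegral => x _; case: (f x) => u v /=; rewrite mulN1r.
Qed.

Lemma wavelet1_norm2 j k : cintegral leb (fun x => w j k x * conjc (w j k x)) = (2 ^- j)%:C.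
Proof.
have bpsi := psi_bounded W L0 B0 psiB.
have bphi : bounded_on leb (`[- L, L]%classic : set R) B phi.
  split => //; last exact: ltW.
  - by have [c1 c2] := CK_continuous (scaling_CK W); exact: cmeas_continuous.
  - exact: leb_LL_fin.
have p1 := cnormL2_1 bpsi (wavelet_norm W).
have f1 := cnormL2_1 bphi (scaling_norm W).
case: j => [|j] /=.
  rewrite (_ : (fun x => _) = (fun x => (fun y => phi y * conjc (phi y)) (1 * x + - k%:~R))).
    rewrite (cintegral_affine _ ltr01 (bounded_on_M bphi (bounded_on_conj bphi))) f1 mulr1.
    by rewrite invr1.
  by apply/funext => x; rewrite mul1r.
have j0 : 0 < (2 : R) ^+ j by rewrite exprn_gt0.
have bpp := bounded_on_M bpsi (bounded_on_conj bpsi).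
rewrite (_ : (fun x => _) = (fun x => (2^-1)%:C * (fun y => psi y * conjc (psi y)) (2 ^+ j * x + - k%:~R))).
  rewrite (cintegralZ _ (bounded_on_affine _ j0 bpp)) (cintegral_affine _ j0 bpp) p1 mulr1.
  by rewrite -(rmorphM (real_complex R)) -invfM -exprS.
apply/funext => x; set z := psi _.
have cr (a : R) : conjc a%:C = a%:C by rewrite /= oppr0.
rewrite conjcM [conjc _%:C]cr -!mulrA [z * (_ * _)]mulrCA !mulrA.
by rewrite -(rmorphM (real_complex R)) -invfM -expr2 sqr_sqrtr.
Qed.

(** Parseval's identity for a single wavelet already forces all the other
    coefficients to vanish. *)
Lemma wavelet1_gram j k j' k' :
  cintegral leb (fun x => w j k x * conjc (w j' k' x)) =
  if (j == j') && (k == k') then (2 ^- j)%:C else 0.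
Proof.
have [/andP[/eqP -> /eqP ->]|ne] := ifPn; first exact: wavelet1_norm2.
pose f := w j k; have bw l := wavelet1_bounded W L0 B0 phiB psiB l.1 l.2.
have bf : bounded_on leb (wsupp L j k) B f := bw (j, k).
pose ip (l : nat * int) := innerL2 f (w l.1 l.2).
have bfw l := bounded_on_M bf (bounded_on_conj (bw l)).
pose S (A : {fset nat * int}) x := \sum_(l <- A) 2 ^+ l.1 * ip l * w l.1 l.2 x.
have bS A : exists D A', bounded_on leb D A' (S A).
  exact: (bounded_on_sum A (fun l => bounded_onZ _ (bw l))).
have brem A : exists D A', bounded_on leb D A' (fun x => f x - S A x).
  have [D [A' h]] := bS A; exists (wsupp L j k `|` D), (B + normc (-1) * A').
  rewrite (_ : (fun x => _) = (fun x => f x + -1 * S A x)).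
    exact: bounded_onD bf (bounded_onZ _ h).
  by apply/funext => x; rewrite mulN1r.
have f2 : cintegral leb (fun x => f x * conjc (f x)) = (2 ^- j)%:C := wavelet1_norm2 j k.
have ipf l : cintegral leb (fun x => w l.1 l.2 x * conjc (f x)) = conjc (ip l).
  rewrite /ip /innerL2 -(cintegral_conj (bfw l)); congr cintegral; apply/funext => x.
  by rewrite conjcM conjcK mulrC.
have p2c n : ((2 : R) ^+ n)%:C = 2 ^+ n.
  by have -> := rmorphXn (real_complex R) n 2; congr (_ ^+ n); exact: (rmorph_nat (real_complex R)).
have key A : cintegral leb (fun x => (f x - S A x) * conjc (f x)) =
    (2 ^- j - \sum_(l <- A) 2 ^+ l.1 * normc (ip l) ^+ 2)%:C.
  have bwf l := bounded_on_M (bw l) (bounded_on_conj bf).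
  rewrite (_ : (fun x => _) = (fun x => f x * conjc (f x) + -1 *
      \sum_(l <- A) (2 ^+ l.1 * ip l) * (w l.1 l.2 x * conjc (f x)))); last first.
    apply/funext => x; rewrite mulrBl mulN1r /S mulr_suml; congr (_ - _).
    by apply: eq_bigr => l _; rewrite !mulrA.
  have [D [A' bs]] := bounded_on_sum A (fun l => bounded_onZ (2 ^+ l.1 * ip l) (bwf l)).
  rewrite (cintegralD (bounded_on_M bf (bounded_on_conj bf)) (bounded_onZ _ bs)).
  rewrite (cintegralZ _ bs) (cintegral_sum A (fun l => bounded_onZ (2 ^+ l.1 * ip l) (bwf l))).
  rewrite f2 (rmorphB (real_complex R)) mulN1r (rmorph_sum (real_complex R)); congr (_ - _).
  apply: eq_bigr => l _; rewrite (cintegralZ _ (bwf l)) ipf -mulrA mulc_conj.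
  by rewrite -p2c -(rmorphM (real_complex R)).
have foo : (cnormL2 f < +oo)%E.
  rewrite ltey; apply/eqP => e; have := cnormL2_sq bf.
  by rewrite e poweRyr ?pnatr_eq0.
have iL2 : inL2 f by split => //; [case: bf => -[]|case: bf => -[]].
have small (e : R) : 0 < e -> \forall A \near totally, (cnormL2 (fun x => (f x - S A x)%R) < e%:E)%E.
  move=> e0; have h := wavelet_expansion W iL2.
  have : nbhs (0 : \bar R)%E [set x | (x < e%:E)%E].
    by apply: open_nbhs_nbhs; split; [exact: open_ereal_lt_ereal|rewrite /= lte_fin].
  by move=> /h.
have lim (e : R) : 0 < e -> \forall A \near totally,
    `|2 ^- j - \sum_(l <- (A : {fset nat * int})) 2 ^+ l.1 * normc (ip l) ^+ 2| <= e.
  move=> e0; set N := fine (cnormL2 f).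
  have N0 : 0 <= N by rewrite fine_ge0// Lnorm_ge0.
  have Nf : cnormL2 f = N%:E by rewrite fineK// ge0_fin_numE// Lnorm_ge0.
  have e1 : 0 < e / (2 * (N + 1)) by rewrite divr_gt0// mulr_gt0// ltr_wpDl.
  apply: filterS (small _ e1) => A hA; have [D [A' br]] := brem A.
  have := cintegral_CauchySchwarz br bf; rewrite key normc_real => h.
  rewrite -lee_fin (le_trans h)// Nf.
  apply: (@le_trans _ _ (2%:E * ((e / (2 * (N + 1)))%:E * N%:E))%E).
    by rewrite lee_pmul2l//= lee_wpmul2r ?lee_fin// ltW.
  rewrite -!EFinM lee_fin.
  rewrite [leLHS](_ : _ = e * (N / (N + 1))); last by field; rewrite gt_eqF// ltr_wpDl.
  by rewrite ler_piMr ?(ltW e0)// ler_pdivrMr ?mul1r ?lerDl// ltr_wpDl.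
have ipff : normc (ip (j, k)) = 2 ^- j.
  by rewrite /ip /innerL2 f2 normc_real ger0_norm// invr_ge0 exprn_ge0.
suff : 2 ^+ j' * normc (ip (j', k')) ^+ 2 = 0.
  move/eqP; rewrite mulf_eq0 gt_eqF ?exprn_gt0// expf_eq0 => /andP[_ /eqP h].
  exact: (eq0_normc h).
apply/eqP; rewrite eq_le mulr_ge0 ?exprn_ge0 ?normc_ge0// andbT.
apply/ler_addgt0Pl => e e0; rewrite addr0; have [A _ hA] := lim e e0.
pose A1 := ((j, k) |` ((j', k') |` A))%fset.
have /hA : (A `<=` A1)%fset by apply/fsubsetP => l lA; rewrite !inE lA !orbT.
rewrite (big_fsetD1 (j, k)); last by rewrite !inE eqxx.
rewrite (big_fsetD1 (j', k')); last first.
  rewrite !inE eqxx /= ?orbT ?andbT; move: ne; apply: contra => /eqP[-> ->].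
  by rewrite !eqxx.
rewrite ipff; have -> : (2 : R) ^+ j * (2 ^- j) ^+ 2 = 2 ^- j.
  by rewrite expr2 mulrA mulfV ?mul1r// expf_neq0.
set s := \sum_(_ <- _) _; set a := 2 ^+ j' * _; have s0 : 0 <= s.
  by apply: sumr_ge0 => l _; rewrite mulr_ge0 ?exprn_ge0 ?normc_ge0.
have a0 : 0 <= a by rewrite mulr_ge0 ?exprn_ge0 ?normc_ge0.
rewrite ler_norml => /andP[h _]; have {}h : - e <= 2 ^- j - (2 ^- j + (a + s)) := h.
lra.
Qed.

End orthogonality.

(** * Continuous and rapidly decreasing functions on R^d *)

Section continuous_on_Rd.
Context {R : realType} {d : nat}.
Local Notation T := (measurableTypeR R).
Implicit Types (x y : 'rV[R]_d) (t : d.-tuple T).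

Lemma rV_norm_le x (e : R) : 0 <= e -> (`|x| <= e) <-> (forall i, `|x ord0 i| <= e).
Proof.
move=> e0; rewrite -[X in X <= e]/(mx_norm x) mx_normrE; split => [/bigmax_leP[_ h] i|h].
  exact: (h (ord0, i)).
by apply/bigmax_leP; split => // -[i j] _ /=; rewrite (ord1 i).
Qed.

Lemma vecE t i : vec t ord0 i = tnth t i. Proof. by rewrite mxE. Qed.

Lemma bigcup_countType (I : countType) (P : set I) (F : I -> set (d.-tuple T)) :
  (forall i, measurable (F i)) -> measurable (\bigcup_(i in P) F i).
Proof.
move=> mF.
rewrite (_ : \bigcup_(i in P) F i = \bigcup_n (if @choice.unpickle I n is Some i then
   (if pselect (P i) then F i else set0) else set0)).
  apply: bigcupT_measurable => n; case: choice.unpickle => // i.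
  by case: pselect => Pi /=.
apply/seteqP; split => t /=.
  by move=> [i Pi Ft]; exists (choice.pickle i) => //; rewrite choice.pickleK; case: pselect.
by move=> [n _]; case: choice.unpickle => // i; case: pselect => // Pi Fi; exists i.
Qed.

(** A continuous function is the limit of its values at dyadic grid points. *)
Lemma continuous_vec_measurable (f : 'rV[R]_d -> R) : continuous f ->
  measurable_fun setT (fun t : d.-tuple T => f (vec t)).
Proof.
move=> cf.
pose grid n (k : shift d) : 'rV[R]_d := \row_i ((k i)%:~R / 2 ^+ n).
pose k_ n t : shift d := [ffun i => Num.floor (tnth t i * 2 ^+ n)].
apply: (@measurable_fun_cvg _ _ _ setT (fun n t => f (grid n (k_ n t)))).
  move=> n _ Y mY; rewrite setTI.
  rewrite (_ : _ @^-1` Y = \bigcup_(k in [set k | Y (f (grid n k))])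
     tbox (fun i => `[(k i)%:~R / 2 ^+ n, (k i + 1)%:~R / 2 ^+ n[%classic)).
    by apply: bigcup_countType => k; apply: measurable_tbox => i; exact: measurable_itv.
  have n0 : 0 < (2 : R) ^+ n by rewrite exprn_gt0.
  apply/seteqP; split => t /=.
    move=> Yt; exists (k_ n t) => // i /=; rewrite in_itv/= ffunE.
    by rewrite ler_pdivrMr// ltr_pdivlMr// floor_itv.
  move=> [k Yk tk]; suff -> : k_ n t = k by [].
  apply/ffunP => i; have := tk i; rewrite /= in_itv/= ffunE.
  rewrite ler_pdivrMr// ltr_pdivlMr// => h; apply/eqP.
  by rewrite floor_eq.
move=> t _; apply: continuous_cvg; first exact: cf.
apply/cvgrPdist_le => e e0.
near=> n; apply/rV_norm_le; first exact: ltW.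
move=> i; rewrite !mxE ffunE.
have n0 : 0 < (2 : R) ^+ n by rewrite exprn_gt0.
apply: (@le_trans _ _ (1 / 2 ^+ n)); last first.
  by apply: ltW; near: n; exact: (near_infty_natSinv_expn_lt (PosNum e0)).
have /andP[h1 h2] := floor_itv (tnth t i * 2 ^+ n).
rewrite ger0_norm; last by rewrite subr_ge0 ler_pdivrMr.
by rewrite lerBlDr -mulrDl ler_pdivlMr// addrC (le_trans (ltW h2))// intrD.
Unshelve. all: by end_near. Qed.

End continuous_on_Rd.

Section schwartz_functions.
Context {R : realType} {d : nat}.
Local Notation T := (measurableTypeR R).
Implicit Types (f : 'rV[R]_d -> R[i]) (g : 'rV[R]_d -> R).

Lemma is_derive_line g (x v : 'rV[R]_d) (y : R) : derivable g (x + y *: v) v ->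
  is_derive y 1 (fun y => g (x + y *: v)) ('D_v g (x + y *: v)).
Proof.
move=> dg; have e : (fun h : R => h^-1 *: (((fun y => g (x + y *: v)) \o pseudometric_normed_Zmodule.shift y) (h *: 1) - g (x + y *: v))) =
    (fun h : R => h^-1 *: ((g \o pseudometric_normed_Zmodule.shift (x + y *: v)) (h *: v) - g (x + y *: v))).
  apply/funext => h /=; rewrite /pseudometric_normed_Zmodule.shift; congr (_ *: (g _ - _)).
  by rewrite [h *: 1]mulr1 scalerDl addrCA.
by apply: DeriveDef; [rewrite /derivable e|rewrite /derive e].
Qed.

Lemma seminorm_ge0 N f : (0 <= seminorm N f)%E.
Proof.
apply: ereal_sup_ge; exists ((1 + `|0 : 'rV[R]_d|) ^+ N * normc (cpderiv [::] f 0))%:E.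
  by exists [::] => //; exists 0.
by rewrite lee_fin mulr_ge0 ?normc_ge0// exprn_ge0// addr_ge0.
Qed.

Lemma seminorm_fin N f : schwartz f -> seminorm N f = (fine (seminorm N f))%:E.
Proof. by move=> [_ /(_ N) h]; rewrite fineK// ge0_fin_numE// seminorm_ge0. Qed.

Lemma schwartz_weighted N f s x : schwartz f -> (size s <= N)%N ->
  (1 + `|x|) ^+ N * normc (cpderiv s f x) <= fine (seminorm N f).
Proof.
move=> sf sN; rewrite -lee_fin -seminorm_fin//.
by apply: ereal_sup_ubound; exists s => //; exists x.
Qed.

Lemma schwartz_bound N f s x : schwartz f -> (size s <= N)%N ->
  normc (cpderiv s f x) <= fine (seminorm N f).
Proof.
move=> sf sN; apply: le_trans (schwartz_weighted x sf sN).
by rewrite ler_peMl ?normc_ge0// exprn_ege1// lerDl.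
Qed.

Lemma seminorm_fine_ge0 N f : 0 <= fine (seminorm N f).
Proof. by rewrite fine_ge0// seminorm_ge0. Qed.

Lemma schwartz_cmeas f : schwartz f -> cmeas (fun t : d.-tuple T => f (vec t)).
Proof.
move=> [[s1 s2] _]; split.
  exact: (continuous_vec_measurable (s1 [::]).1).
exact: (continuous_vec_measurable (s2 [::]).1).
Qed.

Lemma schwartz_taylor N f (t : d.-tuple T) (i : 'I_d) : schwartz f ->
  taylor_bound N (2 * fine (seminorm N f))
    (fun y => f (vec [tuple if i' == i then y else tnth t i' | i' < d])).
Proof.
move=> sf; have [[s1 s2] _] := sf.
pose x0 : 'rV[R]_d := \row_i' (if i' == i then 0 else tnth t i').
pose e : 'rV[R]_d := delta_mx 0 i.
have lineE y : vec [tuple if i' == i then y else tnth t i' | i' < d] = x0 + y *: e.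
  apply/rowP => i'; rewrite !mxE tnth_mktuple eqxx /=.
  by case: eqP => _; rewrite ?mulr1 ?add0r// mulr0 addr0.
under eq_fun do rewrite lineE.
apply: (@taylor_bound_ReIm R N (fine (seminorm N f)) (fun y => f (x0 + y *: e))
  (fun n y => pderiv (nseq n i) (fun z => complex.Re (f z)) (x0 + y *: e))
  (fun n y => pderiv (nseq n i) (fun z => complex.Im (f z)) (x0 + y *: e))).
- by move=> y /=; case: (f (x0 + y *: e)).
- by move=> n _ y; apply: is_derive_line; exact: (s1 (nseq n i)).2.
- by move=> n _ y; apply: is_derive_line; exact: (s2 (nseq n i)).2.
- move=> y; apply: le_trans (@schwartz_bound N f (nseq N i) (x0 + y *: e) sf _).
    exact: le_trans (normc_Re _).
  by rewrite size_nseq.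
- move=> y; apply: le_trans (@schwartz_bound N f (nseq N i) (x0 + y *: e) sf _).
    exact: le_trans (normc_Im _).
  by rewrite size_nseq.
Qed.

End schwartz_functions.

Section pairing_decay.
Context {R : realType}.
Local Notation T := (measurableTypeR R).
Local Notation leb := (@lebesgue_measure R).
Variables (K : nat) (phi psi : R -> R[i]) (L B : R).
Hypotheses (W : wavelet_system K phi psi) (L0 : 0 < L) (B0 : 0 < B).
Hypothesis phiB : forall x, normc (phi x) <= B * \1_(`[- L, L]%classic) x.
Hypothesis psiB : forall x, normc (psi x) <= B * \1_(`[- L, L]%classic) x.
Let L0' : 0 <= L. Proof. exact: ltW. Qed.
Let B0' : 0 <= B. Proof. exact: ltW. Qed.

Lemma wavelet_vec d (l : windex d) (t : d.-tuple T) :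
  wavelet phi psi l (vec t) = \prod_i wavelet1 phi psi (l.1 i) (l.2 i) (tnth t i).
Proof. by apply: eq_bigr => i _; rewrite vecE. Qed.

Lemma regular_schwartz d (F : 'rV[R]_d -> R[i]) f : schwartz f ->
  regular F f = cintegral (lebesgue_measure_d R d) (fun t => F (vec t) * f (vec t)).
Proof. by move=> sf; rewrite /regular; case: asboolP. Qed.

Lemma pairing_decay d : (0 < d)%N -> exists2 C : R, 0 < C &
  forall (f : 'rV[R]_d -> R[i]) (l : windex d), schwartz f ->
  normc (regular (wavelet phi psi l) f) <= C * fine (seminorm K f) / 2 ^+ (K * normoo l.1).
Proof.
move=> d0; pose V := 1 + B * (2 * L); have V1 : 1 <= V by rewrite lerDl !mulr_ge0.
have V0 : 0 < V by exact: lt_le_trans V1.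
pose C1 := 4 * B * L * (1 + 2 * L) ^+ K.
have C10 : 0 < C1 by rewrite !mulr_gt0// exprn_gt0// addr_gt0 ?mulr_gt0.
exists (C1 * 2 * (2 * V) ^+ d); first by apply: mulr_gt0; [exact: mulr_gt0|rewrite exprn_gt0// mulr_gt0].
move=> f l sf; rewrite regular_schwartz//; set A := fine (seminorm K f).
have A0 : 0 <= A := seminorm_fine_ge0 K f.
have [|i hi] := @bigop.eq_bigmax _ (fun i => l.1 i); first by rewrite card_ord.
under eq_fun do rewrite wavelet_vec.
have fA x : normc (f x) <= A.
  by have := @schwartz_bound _ _ K f [::] x sf isT; rewrite /cpderiv /=; case: (f x).
apply: le_trans (@cintegral_tensor_le _ d (fun i => wavelet1 phi psi (l.1 i) (l.2 i))
    (fun i => wsupp L (l.1 i) (l.2 i)) B V A (C1 * (2 * A) / 2 ^+ (K * l.1 i))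
    (fun G => [/\ cmeas (G : T -> R[i]), forall x, normc (G x) <= 2 * A & taylor_bound K (2 * A) G])
    (fun t => f (vec t)) i _ V1 _ _ _ A0 _ _ _) _.
- by rewrite divr_ge0 ?exprn_ge0//; apply: mulr_ge0; [exact: ltW|exact: mulr_ge0].
- by move=> i'; exact: (wavelet1_bounded W L0 B0 phiB psiB).
- move=> i'; rewrite /V; have [_ /andP[_ h]] := leb_wsupp_fin L0 (l.1 i') (l.2 i').
  by rewrite (le_trans (ler_wpM2l B0' h))// lerDr.
- exact: schwartz_cmeas.
- by move=> t; exact: fA.
- move=> G [mG GA tG]; apply: (wavelet1_decay W L0 B0 phiB psiB) => //.
  by rewrite mulr_ge0.
- move=> t; split; last exact: schwartz_taylor.
    pose tt (y : T) : d.-tuple T := [tuple if i' == i then y else tnth t i' | i' < d].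
    have mtt : measurable_fun setT tt.
      apply/measurable_fun_tnthP => i'.
      rewrite (_ : _ \o _ = (fun y => if i' == i then y else tnth t i')); last first.
        by apply/funext => y; exact: (tnth_mktuple (fun k => if k == i then y else tnth t k) i').
      by case: (i' == i); [exact: measurable_id|exact: measurable_cst].
    have [m1 m2] := schwartz_cmeas sf.
    by split; [exact: (measurableT_comp m1 mtt)|exact: (measurableT_comp m2 mtt)].
  by move=> y; rewrite (le_trans (fA _))// ler_peMl// ler1n.
rewrite /normoo hi le_eqVlt; apply/orP; left; apply/eqP.
by rewrite -/C1; ring.
Qed.

End pairing_decay.

(** * Wavelet series of tempered distributions *)

Section schwartz_space.
Context {R : realType} {d : nat}.
Implicit Types (f h : 'rV[R]_d -> R[i]) (u v : 'rV[R]_d -> R).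

Lemma pderiv_lin s (a b : R) u v : real_smooth u -> real_smooth v ->
  pderiv s (fun x => a * u x + b * v x) = (fun x => a * pderiv s u x + b * pderiv s v x).
Proof.
move=> su sv; elim: s => [//|i s IH] /=; rewrite IH; apply/funext => x.
have du := (su s).2 i x; have dv := (sv s).2 i x.
have h := is_deriveD (is_deriveZ a (derivableP du)) (is_deriveZ b (derivableP dv)).
exact: (@derive_val _ _ _ _ _ _ _ h).
Qed.

Lemma real_smooth_lin (a b : R) u v : real_smooth u -> real_smooth v ->
  real_smooth (fun x => a * u x + b * v x).
Proof.
move=> su sv s; rewrite pderiv_lin//; split.
  have ct (c : R) g : continuous g -> continuous (fun x : 'rV[R]_d => c * g x).
    by move=> cg x; apply: continuous_comp; [exact: cg|exact: mulrl_continuous].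
  have c1 := ct a _ (su s).1; have c2 := ct b _ (sv s).1.
  by move=> x; exact: (cvgD (c1 x) (c2 x)).
move=> i x; rewrite (_ : (fun x => _) = (a \*: pderiv s u) \+ (b \*: pderiv s v))//.
by apply: derivableD; apply: derivableZ; [exact: (su s).2|exact: (sv s).2].
Qed.

Lemma cpderiv_lin s (c : R[i]) f h : smooth f -> smooth h ->
  smooth (fun x => c * f x + h x) /\
  cpderiv s (fun x => c * f x + h x) = (fun x => c * cpderiv s f x + cpderiv s h x).
Proof.
move=> [f1 f2] [h1 h2]; case: c => a b.
have e1 : (fun x => complex.Re ((a +i* b)%C * f x + h x)) =
    (fun x => 1 * (a * complex.Re (f x) + (- b) * complex.Im (f x)) + 1 * complex.Re (h x)).
  by apply/funext => x; case: (f x) (h x) => ? ? [? ?] /=; ring.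
have e2 : (fun x => complex.Im ((a +i* b)%C * f x + h x)) =
    (fun x => 1 * (a * complex.Im (f x) + b * complex.Re (f x)) + 1 * complex.Im (h x)).
  by apply/funext => x; case: (f x) (h x) => ? ? [? ?] /=; ring.
have s1 := real_smooth_lin a (- b) f1 f2; have s2 := real_smooth_lin a b f2 f1.
split.
  by split; [rewrite e1; exact: real_smooth_lin|rewrite e2; exact: real_smooth_lin].
apply/funext => x; rewrite /cpderiv e1 e2 (pderiv_lin s 1 1 s1 h1) (pderiv_lin s 1 1 s2 h2).
rewrite (pderiv_lin s a (- b) f1 f2) (pderiv_lin s a b f2 f1); simpc.
by congr (_ +i* _)%C; ring.
Qed.

Lemma schwartz_lin (c : R[i]) f h : schwartz f -> schwartz h ->
  schwartz (fun x => c * f x + h x).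
Proof.
move=> sf sh; have sf' := sf.1; have sh' := sh.1.
split; first by have [] := cpderiv_lin [::] c sf' sh'.
move=> N; apply: (@le_lt_trans _ _ (normc c * fine (seminorm N f) + fine (seminorm N h))%:E);
  last exact: ltry.
apply: ub_ereal_sup => _ [s sN [x _ <-]].
have [_ ->] := cpderiv_lin s c sf' sh'; rewrite lee_fin.
have w0 : 0 <= (1 + `|x|) ^+ N by rewrite exprn_ge0// addr_ge0.
apply: le_trans (ler_wpM2l w0 (le_normcD _ _)) _; rewrite mulrDr lerD//.
  by rewrite normcM mulrCA ler_wpM2l ?normc_ge0// schwartz_weighted.
exact: schwartz_weighted.
Qed.

Lemma tempered_nonschwartz (g : functional R d) f : tempered g -> ~ schwartz f -> g f = 0.
Proof. by move=> [h _ _]; exact: h. Qed.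

End schwartz_space.

Section wavelet_synthesis.
Context {R : realType} {d : nat}.
Variables (K : nat) (phi psi : R -> R[i]) (C : R).
Hypothesis C0 : 0 < C.
Hypothesis decay : forall (f : 'rV[R]_d -> R[i]) (l : windex d), schwartz f ->
  normc (regular (wavelet phi psi l) f) <= C * fine (seminorm K f) / 2 ^+ (K * normoo l.1).
Hypothesis regular_lin : forall (l : windex d) (c : R[i]) (f h : 'rV[R]_d -> R[i]),
  schwartz f -> schwartz h -> regular (wavelet phi psi l) (fun x => c * f x + h x) =
  c * regular (wavelet phi psi l) f + regular (wavelet phi psi l) h.
Local Notation rw := (fun l f => regular (wavelet phi psi l) f).

(** Coefficients that are carried by the wavelets near a bounded set and grow
    at most exponentially in the level. *)
Definition tame (D rho : nat) (a : windex d -> R[i]) : Prop :=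
  exists2 M : R, 0 <= M & forall l, normc (a l) <= M * (boxed D l)%:R * 2 ^+ (rho * norm1 l.1).

Lemma tame_pairing_sum D rho (M : R) (a : windex d -> R[i]) f : (d * (rho + 2) <= K)%N ->
  0 <= M -> (forall l, normc (a l) <= M * (boxed D l)%:R * 2 ^+ (rho * norm1 l.1)) -> schwartz f ->
  forall A : {fset windex d}, \sum_(l <- A) normc (a l * rw l f) <=
    M * (C * fine (seminorm K f)) * ((2 * D + 1)%:R ^+ d * 2 ^+ d).
Proof.
move=> dK M0 ha sf A; set S := fine _; have S0 : 0 <= S := seminorm_fine_ge0 K f.
apply: (@le_trans _ _ (\sum_(l <- A) M * (C * S) * ((boxed D l)%:R * 2 ^- (2 * norm1 l.1)))).
  apply: ler_sum => l _; rewrite normcM.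
  apply: le_trans (ler_pM (normc_ge0 _) (normc_ge0 _) (ha l) (decay l sf)) _.
  rewrite -/S [leLHS](_ : _ = M * (C * S) * (boxed D l)%:R *
    (2 ^+ (rho * norm1 l.1) / 2 ^+ (K * normoo l.1))); last by ring.
  rewrite [leRHS]mulrA ler_wpM2l ?mulr_ge0 ?(ltW C0)//.
  rewrite ler_pdivrMr ?exprn_gt0// mulrC ler_pdivlMr ?exprn_gt0// -exprD.
  rewrite ler_eXn2l ?ltr1n//; have := norm1_le_dnormoo l.1; nia.
by rewrite -mulr_sumr ler_wpM2l ?sum_boxed_geometric// !mulr_ge0// ltW.
Qed.

(** The sum of the wavelet series with tame coefficients. *)
Definition synthesis (a : windex d -> R[i]) : functional R d := fun f =>
  if pselect (schwartz f /\ exists s, csums (fun l => a l * rw l f) s) is left h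
  then projT1 (cid h.2) else 0.

Lemma synthesisP D rho (a : windex d -> R[i]) f : (d * (rho + 2) <= K)%N ->
  tame D rho a -> schwartz f -> csums (fun l => a l * rw l f) (synthesis a f).
Proof.
move=> dK [M M0 ha] sf; rewrite /synthesis; case: pselect => [h|].
  by case: (cid h.2).
case; split => //; exact: csums_abs (tame_pairing_sum dK M0 ha sf).
Qed.

Lemma synthesis_series D rho (a : windex d -> R[i]) : (d * (rho + 2) <= K)%N ->
  tame D rho a -> wavelet_series phi psi a (synthesis a).
Proof. by move=> dK ta f sf; apply/csumsP; exact: (synthesisP dK ta sf). Qed.

Lemma synthesis_tempered D rho (a : windex d -> R[i]) : (d * (rho + 2) <= K)%N ->
  tame D rho a -> tempered (synthesis a).
Proof.
move=> dK ta; have [M M0 ha] := ta; split.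
- by move=> f nf; rewrite /synthesis; case: pselect => // -[].
- move=> c f h sf sh; have sl := schwartz_lin c sf sh.
  apply: csums_unique (synthesisP dK ta sl) _.
  apply: eq_csums (csumsD (csumsZ c (synthesisP dK ta sf)) (synthesisP dK ta sh)) => l /=.
  by rewrite regular_lin// mulrDr mulrCA.
exists (M * C * ((2 * D + 1)%:R ^+ d * 2 ^+ d)), K => f sf.
rewrite (seminorm_fin K sf) -EFinM lee_fin.
apply: csums_le (synthesisP dK ta sf) => A; apply: le_trans (normc_sum _ _) _.
apply: le_trans (tame_pairing_sum dK M0 ha sf A) _.
by rewrite le_eqVlt; apply/orP; left; apply/eqP; ring.
Qed.

End wavelet_synthesis.

Section restriction_to_domain.
Context {R : realType} {d : nat}.
Local Notation T := (measurableTypeR R).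
Local Notation leb := (@lebesgue_measure R).
Variables (K : nat) (phi psi : R -> R[i]) (L B : R).
Hypotheses (W : wavelet_system K phi psi) (L0 : 0 < L) (B0 : 0 < B).
Hypothesis phiB : forall x, normc (phi x) <= B * \1_(`[- L, L]%classic) x.
Hypothesis psiB : forall x, normc (psi x) <= B * \1_(`[- L, L]%classic) x.
Local Notation rw l f := (regular (wavelet phi psi l) f).
Local Notation syn := (synthesis phi psi).

Lemma wavelet_schwartz_bounded (l : windex d) f : schwartz f ->
  exists A, bounded_on (lebesgue_measure_d R d) (tbox (fun i => wsupp L (l.1 i) (l.2 i))) A
    (fun t => wavelet phi psi l (vec t) * f (vec t)).
Proof.
move=> sf; pose A := fine (seminorm 0 f).
have bt := bounded_on_tensor (fun i => wavelet1_bounded W L0 B0 phiB psiB (l.1 i) (l.2 i)).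
exists (A * \prod_(i < d) B).
rewrite (_ : (fun t => _) = (fun t => f (vec t) * \prod_i wavelet1 phi psi (l.1 i) (l.2 i) (tnth t i))).
  apply: bounded_onMl bt (schwartz_cmeas sf) (seminorm_fine_ge0 0 f) _ => t _.
  by have := @schwartz_bound _ _ 0 f [::] (vec t) sf isT; rewrite /cpderiv /=; case: (f _).
by apply/funext => t; rewrite wavelet_vec mulrC.
Qed.

Lemma regular_linear (l : windex d) (c : R[i]) f h : schwartz f -> schwartz h ->
  rw l (fun x => c * f x + h x) = c * rw l f + rw l h.
Proof.
move=> sf sh; rewrite !regular_schwartz//; last exact: schwartz_lin.
have [A bf] := wavelet_schwartz_bounded l sf; have [A' bh] := wavelet_schwartz_bounded l sh.
rewrite -(cintegralZ c bf) -(cintegralD (bounded_onZ c bf) bh); congr cintegral.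
by apply/funext => t; rewrite mulrDr mulrCA.
Qed.

(** On test functions in [Omega], wavelets outside [nabla] are invisible. *)
Lemma regular_outside_nabla (Omega : set 'rV[R]_d) (l : windex d) f :
  test_function Omega f -> ~ nabla phi psi Omega l -> rw l f = 0.
Proof.
move=> [_ _ fO] nl; rewrite /regular; case: asboolP => // _.
rewrite (_ : (fun t => _) = (fun=> 0)); first by rewrite /cintegral !Rintegral_cst// !mul0r.
apply/funext => t; have [->|w0] := eqVneq (wavelet phi psi l (vec t)) 0; first by rewrite mul0r.
have [->|f0] := eqVneq (f (vec t)) 0; first by rewrite mulr0.
exfalso; apply: nl; exists (vec t); split; first exact: subset_closure.
by apply: fO; exact: subset_closure.
Qed.

(** The relevant coefficients: those of the wavelets that meet [Omega]. *)
Definition on_nabla (Omega : set 'rV[R]_d) (a : windex d -> R[i]) : windex d -> R[i] :=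
  fun l => if `[< nabla phi psi Omega l >] then a l else 0.

Lemma restriction_synthesis D rho (Omega : set 'rV[R]_d) g (a : windex d -> R[i]) C : 
  (forall (f : 'rV[R]_d -> R[i]) (l : windex d), schwartz f ->
    normc (rw l f) <= C * fine (seminorm K f) / 2 ^+ (K * normoo l.1)) -> 0 < C ->
  (d * (rho + 2) <= K)%N -> tame D rho (on_nabla Omega a) -> tempered g ->
  wavelet_series phi psi a g ->
  restriction Omega (syn (on_nabla Omega a)) = restriction Omega g.
Proof.
move=> dec C0 dK ta tg ag; apply/funext => f; rewrite /restriction; case: asboolP => // tf.
have [sf|nsf] := pselect (schwartz f); last first.
  rewrite (tempered_nonschwartz tg nsf) (tempered_nonschwartz _ nsf)//.
  exact: (synthesis_tempered C0 dec regular_linear dK ta).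
have h1 := synthesisP C0 dec dK ta sf.
have h2 : csums (fun l => a l * rw l f) (g f) by apply/csumsP; exact: ag.
apply: csums_unique h1 (eq_csums _ h2) => l; rewrite /on_nabla; case: asboolP => // nl.
by rewrite (regular_outside_nabla tf nl) !mulr0.
Qed.

(** Subtracting a linear combination of dictionary elements amounts to
    subtracting its coefficients. *)
Lemma restriction_sub_lincomb D rho (Omega : set 'rV[R]_d) (a : windex d -> R[i]) C
    (S : {fset windex d}) (c : windex d -> R[i]) :
  (forall (f : 'rV[R]_d -> R[i]) (l : windex d), schwartz f ->
    normc (rw l f) <= C * fine (seminorm K f) / 2 ^+ (K * normoo l.1)) -> 0 < C ->
  (d * (rho + 2) <= K)%N -> tame D rho a ->
  tame D rho (fun l => a l - (if l \in S then c l else 0)) ->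
  restriction Omega (syn (fun l => a l - (if l \in S then c l else 0))) =
  restriction Omega (syn a) - lincomb (dictionary phi psi Omega) S c.
Proof.
move=> dec C0 dK ta ta'; apply/funext => f.
have lE : lincomb (dictionary phi psi Omega) S c f =
    \sum_(l <- S) c l * dictionary phi psi Omega l f.
  rewrite /lincomb; elim: (S : seq _) => [|l s IH]; first by rewrite !big_nil.
  by rewrite !big_cons -IH.
rewrite [RHS]/(_ - _) /= -[RHS]/(restriction Omega (syn a) f - lincomb (dictionary phi psi Omega) S c f).
rewrite lE /restriction /dictionary.
have [tf|tf] := pselect (test_function Omega f); last first.
  rewrite asboolF// sub0r big1 ?oppr0// => l _; by rewrite /restriction asboolF// mulr0.
rewrite asboolT//.
have [sf|nsf] := pselect (schwartz f); last first.
  rewrite (tempered_nonschwartz _ nsf); last exact: (synthesis_tempered C0 dec regular_linear dK ta').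
  rewrite (tempered_nonschwartz _ nsf); last exact: (synthesis_tempered C0 dec regular_linear dK ta).
  rewrite sub0r big1 ?oppr0// => l _.
  by rewrite /restriction asboolT// /regular asboolF// mulr0.
have h1 := synthesisP C0 dec dK ta sf; have h2 := synthesisP C0 dec dK ta' sf.
have h3 : csums (fun l => (if l \in S then c l else 0) * rw l f) (\sum_(l <- S) c l * rw l f).
  rewrite [X in csums _ X](_ : _ = \sum_(l <- S) (if l \in S then c l else 0) * rw l f).
    by apply: csums_fin => l /negbTE ->; rewrite mul0r.
  by apply: eq_big_seq => l ->.
have -> : \sum_(l <- S) c l * restriction Omega (regular (wavelet phi psi l)) f = \sum_(l <- S) c l * rw l f.
  by apply: eq_bigr => l _; rewrite /restriction asboolT.
rewrite -mulN1r; apply: csums_unique h2 (eq_csums _ (csumsD h1 (csumsZ (-1) h3))) => l /=.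
by rewrite mulrBl mulN1r.
Qed.

(** The wavelets that meet a bounded set have their indices in a box. *)
Lemma nabla_boxed (Omega : set 'rV[R]_d) : bounded_set Omega ->
  exists D : nat, forall l, nabla phi psi Omega l -> boxed D l.
Proof.
move=> [M0 [_ hM]]; pose M := `|M0| + 1; have M1 : 0 <= M by rewrite addr_ge0.
have OM x : Omega x -> `|x| <= M by apply: hM; rewrite ltr_pwDr// ler_norm.
pose D := (Num.truncn (L + M)).+1; have LD : L + M <= D%:R by rewrite ltW// truncnS_gt.
exists D => l [x [xs xO]]; apply/forallP => i.
pose Z : set 'rV[R]_d := [set y | wsupp L (l.1 i) (l.2 i) (y ord0 i)].
have Zx : Z x.
  have : closed Z.
    apply: (@closed_comp _ _ (fun y : 'rV[R]_d => y ord0 i) (wsupp L (l.1 i) (l.2 i))).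
      by move=> y _; exact: coord_continuous.
    exact: interval_closed.
  apply; apply: closure_subset xs => y /= wy.
  have : wavelet1 phi psi (l.1 i) (l.2 i) (y ord0 i) != 0.
    by apply: contra wy => /eqP e; rewrite /wavelet (bigD1 i)//= e mul0r.
  apply: contraNP => nZ; have := wavelet1_norm phiB psiB (l.1 i) (l.2 i) (y ord0 i).
  rewrite indicE memNset// mulr0 => h; apply/eqP/eq0_normc/eqP.
  by rewrite eq_le h normc_ge0.
move/wsuppP: Zx; rewrite /= in_itv/= -ler_norml => Zx.
have xi : `|x ord0 i| <= M by move/(rV_norm_le _ M1): (OM x xO).
have kle : `|(l.2 i)%:~R| <= L + 2 ^+ (l.1 i) * M :> R.
  rewrite -(subrK (2 ^+ (l.1 i).-1 * x ord0 i) (l.2 i)%:~R) (le_trans (ler_normD _ _))//.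
  rewrite lerD//; first by rewrite distrC.
  rewrite normrM ger0_norm ?exprn_ge0// ler_pM ?exprn_ge0//.
  by rewrite ler_eXn2l ?ltr1n// leq_pred.
rewrite -(ler_nat R) natrM natrX natr_absz intr_norm.
apply: le_trans kle _; apply: (@le_trans _ _ ((L + M) * 2 ^+ l.1 i)); last first.
  by rewrite ler_wpM2r// exprn_ge0.
by rewrite mulrDl [M * _]mulrC lerD2r ler_peMr ?(ltW L0)// exprn_ege1// ler1n.
Qed.

End restriction_to_domain.

(** * The sequence quasi-norms, one level at a time *)

Section ell_bounds.
Context {R : realType} {I : choiceType}.
Implicit Types (x : I -> R) (M : R) (F : {fset I}) (q : \bar R).

Lemma poweR_le (x y : \bar R) (r : R) : 0 <= r -> (0 <= x)%E -> (x <= y)%E -> (x `^ r <= y `^ r)%E.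
Proof.
move=> r0 x0 xy; apply: gt0_ler_poweR => //; rewrite in_itv/= leey andbT//.
exact: le_trans xy.
Qed.

Lemma esum_ge_fset (f : I -> \bar R) F : (\sum_(i <- F) f i <= \esum_(i in setT) f i)%E.
Proof.
apply: esum_ge; exists [set` F]; first by split => //; exact: finite_fset.
by rewrite fsbig_finite//= set_fsetK.
Qed.

Lemma esum_le_fset (f : I -> \bar R) (M : \bar R) :
  (forall F, (\sum_(i <- F) f i <= M)%E) -> (\esum_(i in setT) f i <= M)%E.
Proof.
move=> h; apply: ub_ereal_sup => _ [A [fA _] <-].
by rewrite fsbig_finite//=; exact: h.
Qed.

Lemma ell_ge q (f : I -> \bar R) i : (0 < q)%E -> (forall i, (0 <= f i)%E) -> (f i <= ell q f)%E.
Proof.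
case: q => [r|_ f0|//] /=; last by apply: ereal_sup_ubound; exists i.
rewrite lte_fin => r0 f0.
have -> : f i = ((f i `^ r) `^ r^-1)%E by rewrite -poweRrM mulfV ?gt_eqF// poweRe1.
apply: poweR_le; [by rewrite invr_ge0 ltW|exact: poweR_ge0|].
by have := esum_ge_fset (fun i => (f i `^ r)%E) [fset i]%fset; rewrite big_seq_fset1.
Qed.

Lemma ell_ge0 q (f : I -> \bar R) (i : I) : (0 < q)%E -> (forall i, (0 <= f i)%E) -> (0 <= ell q f)%E.
Proof. by move=> q0 f0; exact: le_trans (ell_ge i q0 f0). Qed.

Lemma lp_le_of_ell q x M F : (0 < q)%E -> (forall i, 0 <= x i) -> 0 <= M ->
  (ell q (fun i => (x i)%:E) <= M%:E)%E -> lp_le q F x M.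
Proof.
move=> q0 x0 M0 h; case: q q0 h => [r|_ h|//]; last first.
  by move=> k _; rewrite -lee_fin (le_trans _ h)//; apply: (@ell_ge +oo%E (fun i => (x i)%:E)).
rewrite lte_fin => r0; rewrite /ell => h; set S := (\esum_(i in _) _)%E in h.
have S0 : (0 <= S)%E by apply: esum_ge0 => i _; exact: poweR_ge0.
have hS : (S <= (M `^ r)%:E)%E.
  rewrite -[S]poweRe1// -(mulVf (lt0r_neq0 r0)) poweRrM -poweR_EFin.
  by apply: poweR_le; [exact: ltW|exact: poweR_ge0|].
rewrite /lp_le -lee_fin; apply: le_trans hS; rewrite -sumEFin.
apply: le_trans (esum_ge_fset _ F); rewrite le_eqVlt; apply/orP; left; apply/eqP.
by apply: eq_bigr => i _; rewrite poweR_EFin.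
Qed.

Lemma ell_le_of_lp q (f : I -> \bar R) x M : (0 < q)%E -> 0 <= M -> (forall i, 0 <= x i) ->
  (forall i, (0 <= f i <= (x i)%:E)%E) -> (forall F, lp_le q F x M) -> (ell q f <= M%:E)%E.
Proof.
move=> q0 M0 x0 fx h; case: q q0 h => [r|_ h|//]; last first.
  apply: ub_ereal_sup => _ [i _ <-]; have /andP[_ h1] := fx i; apply: le_trans h1 _.
  by rewrite lee_fin; apply: (h [fset i]%fset); rewrite inE.
rewrite lte_fin => r0 /= h.
have -> : M%:E = ((M `^ r)%:E `^ r^-1)%E.
  by rewrite poweR_EFin -powRrM mulfV ?gt_eqF// powRr1.
apply: poweR_le; [by rewrite invr_ge0 ltW|by apply: esum_ge0 => i _; exact: poweR_ge0|].
apply: esum_le_fset => F; apply: le_trans (_ : (\sum_(i <- F) (x i `^ r)%:E <= _)%E); last first.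
  by rewrite sumEFin lee_fin; exact: h.
apply: lee_sum => i _; rewrite -poweR_EFin; have /andP[f0 h1] := fx i.
by apply: poweR_le => //; exact: ltW.
Qed.

Lemma sum_le_size_pow (s : seq I) x (p : R) : uniq s -> 0 < p -> (forall i, 0 <= x i) ->
  (\sum_(i <- s) x i) `^ p <= (size s)%:R `^ p * \sum_(i <- s) x i `^ p.
Proof.
move=> us p0 x0; set S := \sum_(i <- s) x i `^ p.
have S0 : 0 <= S by apply: sumr_ge0 => i _; exact: powR_ge0.
have xS i : i \in s -> x i <= S `^ p^-1.
  move=> si; rewrite -(powR_le_base p0) ?powR_ge0// -powRrM mulVf ?gt_eqF// powRr1//.
  by rewrite /S (bigD1_seq i)//= lerDl sumr_ge0// => j _; exact: powR_ge0.
have : \sum_(i <- s) x i <= (size s)%:R * S `^ p^-1.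
  rewrite -sum1_size natr_sum mulr_suml big_seq [leRHS]big_seq.
  by apply: ler_sum => i si; rewrite mul1r; exact: xS.
rewrite -(powR_le_base p0) ?mulr_ge0 ?powR_ge0 ?sumr_ge0// => h; apply: le_trans h _.
by rewrite powRM ?powR_ge0// -powRrM mulVf ?gt_eqF// powRr1.
Qed.

End ell_bounds.

Section cubes.
Context {R : realType} {d : nat}.
Local Notation T := (measurableTypeR R).
Local Notation leb := (@lebesgue_measure R).
Local Notation lebd := (lebesgue_measure_d R d).
Implicit Types (j : level d) (k : Defs.shift d) (t : d.-tuple T).

Lemma ge0_le_integral_any disp (U : measurableType disp) (mu : {measure set U -> \bar R})
    (f g : U -> \bar R) : (forall x, (0 <= f x)%E) -> (forall x, (f x <= g x)%E) ->
  (\int[mu]_x f x <= \int[mu]_x g x)%E.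
Proof.
move=> f0 fg; have g0 x : (0 <= g x)%E by exact: le_trans (fg x).
rewrite !ge0_integralTE//; apply: ereal_sup_le => _ [h hf <-]; exists h => // x.
exact: le_trans (hf x) (fg x).
Qed.

Definition side (b : bool) j k (i : 'I_d) : set R :=
  [set` Interval (BSide b (2 ^- j i * (k i)%:~R)) (BSide (~~ b) (2 ^- j i * (k i + 1)%:~R))].

Lemma leb_side b j k i : leb (side b j k i) = (2 ^- j i)%:E.
Proof.
rewrite /side lebesgue_measure_itv/= lte_fin ltr_pM2l ?invr_gt0 ?exprn_gt0// ltr_int ltzD1 lexx.
by rewrite -EFinD -mulrBr -intrB addrAC subrr add0r mulr1.
Qed.

Lemma measurable_side b j k i : measurable (side b j k i : set T).
Proof. exact: measurable_itv. Qed.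

Lemma lebd_cube b j k : lebd (tbox (side b j k)) = (2 ^- norm1 j)%:E.
Proof.
rewrite lebd_tbox; last by move=> i; exact: measurable_side.
under eq_bigr do rewrite leb_side; rewrite prodEFin; congr EFin.
by rewrite /norm1 expr_sum prodfV.
Qed.

Lemma vec_cube j k t : cube (j, k) (vec t) <-> tbox (side true j k) t.
Proof.
by split=> h i; have := h i; rewrite /side/= in_itv/= mxE.
Qed.

Lemma floor_in_cube j k t (i : 'I_d) : tbox (side true j k) t ->
  k i \in [:: Num.floor (2 ^+ j i * tnth t i); Num.floor (2 ^+ j i * tnth t i) - 1].
Proof.
move=> /(_ i); rewrite /side/= in_itv/= => /andP[h1 h2]; set x := _ * _.
have p0 : 0 < (2 : R) ^+ j i by rewrite exprn_gt0.
have k1 : (k i)%:~R <= x by rewrite /x -ler_pdivrMl.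
have k2 : x <= (k i + 1)%:~R by rewrite /x -ler_pdivlMl.
have /andP[f1 f2] := floor_itv x.
have a1 : k i <= Num.floor x by rewrite floor_ge_int.
have a2 : Num.floor x <= k i + 1 by rewrite -(ler_int R) (le_trans f1).
rewrite !inE; apply/orP; have [->|ne] := eqVneq (k i) (Num.floor x); [by left|right].
by apply/eqP; lia.
Qed.

Lemma open_cube_unique j k k' t : tbox (side false j k) t -> tbox (side true j k') t -> k' = k.
Proof.
move=> h h'; apply/ffunP => i; have := h i; have := h' i; rewrite /side/= !in_itv/=.
move=> /andP[h1 h2] /andP[h3 h4].
have p0 : 0 < (2 : R) ^- j i by rewrite invr_gt0 exprn_gt0.
have a1 : k' i < k i + 1 by rewrite -(ltr_int R) -(ltr_pM2l p0) (le_lt_trans h1).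
have a2 : k i < k' i + 1 by rewrite -(ltr_int R) -(ltr_pM2l p0) (lt_le_trans h3).
lia.
Qed.

Lemma cubes_at j t : exists2 A : {fset Defs.shift d}, (size A)%:R <= 2 ^+ d :> R &
  forall k, tbox (side true j k) t -> k \in A.
Proof.
pose e (i : 'I_d) := [:: Num.floor (2 ^+ j i * tnth t i); Num.floor (2 ^+ j i * tnth t i) - 1].
have [A hA] := exists_fset_ffun e.
exists [fset k in A | [forall i, k i \in e i]]%fset; last first.
  move=> k kt; rewrite !inE/=; apply/andP; split.
    by apply: hA => i; exact: floor_in_cube.
  by apply/forallP => i; exact: floor_in_cube.
set A' := [fset _ in _ | _]%fset.
rewrite -sum1_size natr_sum.
have := @sum_prod_le R _ _ A' e (fun _ _ => 1) (fset_uniq _) _ (fun _ _ => ler01).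
move=> h; rewrite (eq_bigr (fun=> \prod_(i < d) 1)); last by move=> k _; rewrite big1.
apply: le_trans (h _) _ => [k i|].
  by rewrite !inE/= => /andP[_ /forallP/(_ i)]; rewrite /e ?inE.
rewrite (eq_bigr (fun=> 2)); first by rewrite prodr_const card_ord.
by move=> i _; rewrite !big_cons big_nil addr0.
Qed.

(** The value of the level [j] part of the F-quasi-norm at the point [t]. *)
Definition level_value (a : windex d -> R[i]) j t : R :=
  normc (\sum_(k \in [set: Defs.shift d]) a (j, k) * (\1_(cube (j, k)) (vec t))%:C%C).

Lemma cube_term0 (a : windex d -> R[i]) j k t : ~ tbox (side true j k) t ->
  a (j, k) * (\1_(cube (j, k)) (vec t))%:C%C = 0.
Proof.
by move=> h; rewrite indicE memNset ?mulr0// => /vec_cube.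
Qed.

Lemma cube_term1 (a : windex d -> R[i]) j k t : tbox (side true j k) t ->
  a (j, k) * (\1_(cube (j, k)) (vec t))%:C%C = a (j, k).
Proof.
by move=> h; rewrite indicE mem_set ?mulr1//; exact/vec_cube.
Qed.

Lemma level_value_open_cube (a : windex d -> R[i]) j k t : tbox (side false j k) t ->
  level_value a j t = normc (a (j, k)).
Proof.
move=> h; rewrite /level_value (fsbigTE [fset k]%fset).
  rewrite big_seq_fset1 cube_term1// => i; have := h i; rewrite /side/= !in_itv/=.
  by move=> /andP[h1 h2]; rewrite !ltW.
move=> k'; rewrite inE => /eqP kk'; apply: cube_term0 => h'; apply: kk'.
exact: open_cube_unique h'.
Qed.

Lemma level_value_le (a : windex d -> R[i]) j t (p : R) (F : {fset Defs.shift d}) : 0 < p ->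
  (forall k, k \notin F -> a (j, k) = 0) ->
  level_value a j t `^ p <=
    (2 ^+ d) `^ p * \sum_(k <- F) normc (a (j, k)) `^ p * \1_(tbox (side true j k)) t.
Proof.
move=> p0 aF; have [A cA hA] := cubes_at j t.
pose x k := normc (a (j, k) * (\1_(cube (j, k)) (vec t))%:C%C).
have x0 k : 0 <= x k by exact: normc_ge0.
have step : level_value a j t <= \sum_(k <- A) x k.
  rewrite /level_value (fsbigTE A); first exact: normc_sum.
  by move=> k kA; apply: cube_term0 => /hA; apply/negP.
apply: (@le_trans _ _ ((\sum_(k <- A) x k) `^ p)).
  by rewrite powR_le_base// ?normc_ge0// sumr_ge0.
apply: le_trans (sum_le_size_pow (fset_uniq A) p0 x0) _.
apply: ler_pM; rewrite ?powR_ge0 ?sumr_ge0//; first by move=> k _; exact: powR_ge0.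
  by rewrite powR_le_base ?exprn_ge0.
have xE k : x k `^ p = normc (a (j, k)) `^ p * \1_(tbox (side true j k)) t.
  rewrite /x; have [h|h] := pselect (tbox (side true j k) t).
    by rewrite cube_term1// [\1_(tbox _) _]indicE mem_set ?mulr1.
  by rewrite cube_term0// normc0 powR0 ?gt_eqF// [\1_(tbox _) _]indicE memNset ?mulr0.
rewrite (eq_bigr _ (fun k _ => xE k)).
have F0 k : 0 <= normc (a (j, k)) `^ p * \1_(tbox (side true j k)) t by rewrite mulr_ge0// powR_ge0.
apply: (@le_trans _ _ (\sum_(k <- (A `|` F)%fset) normc (a (j, k)) `^ p * \1_(tbox (side true j k)) t)).
  by apply: ler_fsetsum => //; exact: fsubsetUl.
rewrite -(big_fset_incl _ (fsubsetUr A F))// => k _ kF.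
by rewrite aF// normc0 powR0 ?mul0r// gt_eqF.
Qed.

End cubes.

Section level_by_level.
Context {R : realType} {d : nat}.
Local Notation T := (measurableTypeR R).
Local Notation lebd := (lebesgue_measure_d R d).
Implicit Types (j : level d) (a : windex d -> R[i]) (X : scale) (p q : \bar R) (r s : R).

Definition level_weight p r s j : R :=
  (r - recip p) * (norm1 j)%:R + s * (normoo j)%:R.

Lemma level_le_seqnorm X p q r s a (N : R) j F : (0 < p)%E -> (0 < q)%E ->
  (X = scaleF -> (p < +oo)%E) -> 0 <= N -> (seqnorm X p q r s a <= N%:E)%E ->
  lp_le p F (fun k => normc (a (j, k))) (N * 2 `^ (- level_weight p r s j)).
Proof.
move=> p0 q0 pF N0 h; case: X pF h => [_|/(_ erefl) poo] h.
  have h1 : ((2 `^ level_weight p r s j)%:E *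
      ell p (fun k : Defs.shift d => (normc (a (j, k)))%:E) <= N%:E)%E.
    apply: le_trans h; rewrite /seqnorm; pose f j := ((2 `^ level_weight p r s j)%:E *
      ell p (fun k : Defs.shift d => (normc (a (j, k)))%:E))%E.
    apply: (@ell_ge _ _ q f j q0) => i; rewrite /f mule_ge0 ?lee_fin ?p2_ge0//.
    by apply: (ell_ge0 [ffun=> 0]) => // k; rewrite lee_fin normc_ge0.
  have M0 : 0 <= N * 2 `^ (- level_weight p r s j) by rewrite mulr_ge0// p2_ge0.
  apply: (@lp_le_of_ell R _ p (fun k => normc (a (j, k))) _ F p0 (fun k => normc_ge0 _) M0).
  by move: h1; rewrite -lee_pdivlMl ?p2_gt0// => h1; rewrite powRN mulrC EFinM.
case: p p0 poo h => [p|//|//]; rewrite lte_fin => p0 _ /= h.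
pose w : R := r * (norm1 j)%:R + s * (normoo j)%:R.
have hI : (\int[lebd]_t ((2 `^ w * level_value a j t)%:E `^ p) <= (N `^ p)%:E)%E.
  rewrite -poweR_EFin.
  apply: (@le_trans _ _ ((Lnorm lebd p%:E (fun t => ell q (fun j : level d =>
      (2 `^ (r * (norm1 j)%:R + s * (normoo j)%:R) * level_value a j t)%:E))) `^ p)%E); last first.
    by apply: poweR_le; [exact: ltW|exact: Lnorm_ge0|].
  rewrite powR_Lnorm ?gt_eqF//; apply: ge0_le_integral_any => t; first exact: poweR_ge0.
  apply: poweR_le; first exact: ltW.
    by rewrite lee_fin mulr_ge0 ?p2_ge0 ?normc_ge0.
  apply: le_trans (lee_abs _).
  apply: (@ell_ge _ _ q (fun j : level d => (2 `^ (r * (norm1 j)%:R + s * (normoo j)%:R) *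
     level_value a j t)%:E) j q0) => i.
  by rewrite lee_fin mulr_ge0 ?p2_ge0 ?normc_ge0.
have hS : (\int[lebd]_t (\sum_(k <- F) (2 `^ w * normc (a (j, k))) `^ p * \1_(tbox (side false j k)) t)%:E
    <= (N `^ p)%:E)%E.
  apply: le_trans hI; apply: ge0_le_integral_any => t.
    by rewrite lee_fin sumr_ge0// => k _; rewrite mulr_ge0 ?powR_ge0.
  rewrite poweR_EFin lee_fin.
  have [[k0 [k0F tk0]]|nk] := pselect (exists k, k \in F /\ tbox (side false j k) t).
    rewrite (big_fsetD1 k0)//= (level_value_open_cube a tk0).
    rewrite indicE mem_set// mulr1 big1_fset ?addr0// => k; rewrite !inE => /andP[kk0 kF] _.
    rewrite indicE memNset ?mulr0// => tk; move/eqP: kk0; apply.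
    apply: (open_cube_unique tk0) => i; have := tk i; rewrite /side/= !in_itv/=.
    by move=> /andP[h1 h2]; rewrite !ltW.
  rewrite big_seq big1 ?powR_ge0// => k kF; rewrite indicE memNset ?mulr0// => tk.
  by apply: nk; exists k.
rewrite (eq_integral (fun t => \sum_(k <- F) ((2 `^ w * normc (a (j, k))) `^ p * \1_(tbox (side false j k)) t)%:E)%E) in hS;
  last by move=> t _; rewrite sumEFin.
have mc k : measurable (tbox (side false j k) : set (d.-tuple T)).
  by apply: measurable_tbox => i; exact: measurable_side.
rewrite ge0_integral_sum// in hS; last 2 first.
- by move=> k; apply/measurable_EFinP; apply: measurable_funM.
- by move=> k t _; rewrite lee_fin mulr_ge0 ?powR_ge0.
have e k : (\int[lebd]_t ((2 `^ w * normc (a (j, k))) `^ p * \1_(tbox (side false j k)) t)%:E =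
    ((2 `^ w) `^ p * 2 ^- norm1 j * normc (a (j, k)) `^ p)%:E)%E.
  under eq_integral do rewrite EFinM.
  rewrite ge0_integralZl ?lee_fin ?powR_ge0//; last exact/measurable_EFinP.
  rewrite integral_indic// setIT [X in (_ * X)%E](_ : _ = (2 ^- norm1 j)%:E); last exact: lebd_cube.
  by rewrite -EFinM powRM ?p2_ge0 ?normc_ge0// mulrAC.
rewrite (eq_bigr _ (fun k _ => e k)) sumEFin lee_fin -mulr_sumr in hS.
rewrite /level_weight recip_fin//.
have -> : (N * 2 `^ (- ((r - p^-1) * (norm1 j)%:R + s * (normoo j)%:R))) `^ p =
    N `^ p * ((2 `^ w) `^ p * 2 ^- norm1 j)^-1.
  rewrite powRM ?p2_ge0//; congr (_ * _).
  rewrite -p2_nat -powRN -!powRrM -p2D -powRN; congr (_ `^ _).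
  by rewrite /w; field; rewrite gt_eqF.
by rewrite ler_pdivlMr ?mulr_gt0 ?powR_gt0 ?invr_gt0 ?exprn_gt0// mulrC.
Qed.

(** Weights on the levels that are summable to every positive power, uniformly
    in the family. *)
Definition uniformly_summable (Om : set (level d -> R)) : Prop :=
  (forall w, Om w -> forall j, 0 <= w j) /\
  forall kappa : R, 0 < kappa -> exists2 C : R, 0 < C &
    forall w, Om w -> forall J : {fset level d}, \sum_(j <- J) w j `^ kappa <= C.

Lemma uniformly_summable_ell Om q : uniformly_summable Om -> (0 < q)%E ->
  exists2 C : R, 0 < C & forall w, Om w -> forall J, lp_le q J w C.
Proof.
move=> [w0 hO]; case: q => [q|_|//]; last first.
  have [C C0 hC] := hO 1 ltr01; exists C => // w Ow J j _.
  by have := hC w Ow [fset j]%fset; rewrite big_seq_fset1 powRr1// w0.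
rewrite lte_fin => q0; have [C C0 hC] := hO q q0.
exists (C `^ q^-1); first exact: powR_gt0.
move=> w Ow J /=; rewrite -powRrM mulVf ?gt_eqF// powRr1 ?(ltW C0)//; exact: hC.
Qed.

(** For the F-scale the l_q sum is split as a product of [w ^ (1/2)], which is
    l_q-summable, and a supremum, which is bounded by the sum of p-th powers;
    in this way no triangle inequality in L_p is needed. *)
Lemma seqnorm_le_levels Om X p q r s : uniformly_summable Om -> (0 < p)%E -> (0 < q)%E ->
  (X = scaleF -> (p < +oo)%E) -> exists2 C : R, 0 < C &
  forall w, Om w -> forall (N : R) a (F : level d -> {fset Defs.shift d}), 0 <= N ->
    (forall j k, k \notin F j -> a (j, k) = 0) ->
    (forall j, lp_le p (F j) (fun k => normc (a (j, k))) (N * w j * 2 `^ (- level_weight p r s j))) ->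
    (seqnorm X p q r s a <= (C * N)%:E)%E.
Proof.
move=> hO p0 q0 pF; have w0 := hO.1.
have aF0 (a : windex d -> R[i]) (F : level d -> {fset Defs.shift d}) j (F' : {fset Defs.shift d}) M :
    (forall j k, k \notin F j -> a (j, k) = 0) -> 0 <= M ->
    lp_le p (F j) (fun k => normc (a (j, k))) M -> lp_le p F' (fun k => normc (a (j, k))) M.
  move=> aF M0; case: (p) p0 => [p'|_|//]; last first.
    move=> h k _; have [kF|kF] := boolP (k \in F j); first exact: h.
    by rewrite aF// normc0.
  rewrite lte_fin => p'0 /= h; apply: le_trans h.
  apply: le_trans (ler_fsetsum (fsubsetUl F' (F j)) (fun k => powR_ge0 _ _)) _.
  rewrite -(big_fset_incl _ (fsubsetUr F' (F j)))// => k _ kF.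
  by rewrite aF// normc0 powR0// gt_eqF.
case: X pF => [_|/(_ erefl) poo].
  have [C C0 hC] := uniformly_summable_ell hO q0; exists C => // w Ow N a F N0 aF h.
  apply: (@ell_le_of_lp _ _ q _ (fun j => N * w j)) => //.
  - by rewrite mulr_ge0// ltW.
  - by move=> j; rewrite mulr_ge0// (w0 w Ow).
  - move=> j; rewrite -/(level_weight p r s j).
    have M0 : 0 <= N * w j * 2 `^ (- level_weight p r s j).
      by rewrite mulr_ge0 ?p2_ge0// mulr_ge0// (w0 w Ow).
    have h1 : (ell p (fun k : Defs.shift d => (normc (a (j, k)))%:E) <=
        (N * w j * 2 `^ (- level_weight p r s j))%:E)%E.
      apply: (@ell_le_of_lp _ _ p _ (fun k => normc (a (j, k))) _ p0 M0) => [k|k|F']; first exact: normc_ge0.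
        by rewrite lexx andbT lee_fin normc_ge0.
      exact: aF0 aF M0 (h j).
    apply/andP; split.
      rewrite mule_ge0 ?lee_fin ?p2_ge0//.
      by apply: (ell_ge0 [ffun=> 0]) => // k; rewrite lee_fin normc_ge0.
    apply: le_trans (lee_wpmul2l _ h1) _; first by rewrite lee_fin p2_ge0.
    by rewrite -EFinM lee_fin powRN mulrCA mulfV ?mulr1// gt_eqF ?p2_gt0.
  - move=> J; have := @lp_leZ _ _ q J w C N q0 (w0 w Ow) (ltW C0) N0 (hC w Ow J).
    by rewrite [C * N]mulrC.
case: p p0 poo aF0 => [p|//|//]; rewrite lte_fin => p0 _ aF0.
have hO2 : uniformly_summable [set (fun j => w j `^ 2^-1) | w in Om].
  split; first by move=> _ [w Ow <-] j; exact: powR_ge0.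
  move=> kappa k0; have [|C C0 hC] := hO.2 (2^-1 * kappa); first by rewrite mulr_gt0// invr_gt0.
  exists C => // _ [w Ow <-] J; under eq_bigr do rewrite -powRrM; exact: hC.
have [C1 C10 hC1] := uniformly_summable_ell hO2 q0.
have [|C2 C20 hC2] := hO.2 (p / 2); first by rewrite divr_gt0.
exists (C1 * (2 ^+ d) * C2 `^ p^-1); first by rewrite !mulr_gt0 ?exprn_gt0 ?powR_gt0.
move=> w Ow N a F N0 aF h; have wj := w0 w Ow.
pose wr j : R := r * (norm1 j)%:R + s * (normoo j)%:R.
pose H j (t : d.-tuple T) : R := w j `^ (- (p / 2)) * (2 `^ wr j) `^ p * (2 ^+ d) `^ p *
  \sum_(k <- F j) normc (a (j, k)) `^ p * \1_(tbox (side true j k)) t.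
have sum0 j (t : d.-tuple T) : 0 <= \sum_(k <- F j) normc (a (j, k)) `^ p * \1_(tbox (side true j k)) t.
  by apply: sumr_ge0 => k _; rewrite mulr_ge0 ?powR_ge0.
have H0 j (t : d.-tuple T) : 0 <= H j t by rewrite !mulr_ge0 ?powR_ge0.
have gH j (t : d.-tuple T) : (2 `^ wr j * level_value a j t) `^ p <= w j `^ (p / 2) * H j t.
  have lv0 : 0 <= level_value a j t by exact: normc_ge0.
  rewrite powRM ?p2_ge0//; have hl := level_value_le t p0 (aF j).
  have [wj0|wj0] := eqVneq (w j) 0.
    have aj k : a (j, k) = 0.
      have [kF|/aF//] := boolP (k \in F j); apply/eq0_normc/eqP.
      rewrite eq_le normc_ge0 andbT; have := h j; rewrite wj0 mulr0 mul0r => hj.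
      exact: (@lp_le_point _ _ p%:E (F j) (fun k => normc (a (j, k))) 0 k p0 (fun k => normc_ge0 _) (lexx 0) hj kF).
    have -> : level_value a j t = 0.
      by rewrite /level_value fsbig1 ?normc0// => k _; rewrite aj mul0r.
    by rewrite powR0 ?gt_eqF// mulr0 mulr_ge0 ?powR_ge0.
  rewrite /H !mulrA -powRD ?wj0 ?implybT// subrr powRr0 mul1r -!mulrA.
  by rewrite ler_wpM2l ?powR_ge0.
have mH j : measurable_fun setT (H j).
  apply: measurable_funM => //; apply: measurable_sum => k; apply: measurable_funM => //.
  by apply: measurable_indic; apply: measurable_tbox => i; exact: measurable_side.
have iH j : (\int[lebd]_t (H j t)%:E <= ((2 ^+ d) `^ p * N `^ p * w j `^ (p / 2))%:E)%E.
  have mc k : measurable (tbox (side true j k) : set (d.-tuple T)).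
    by apply: measurable_tbox => i; exact: measurable_side.
  rewrite /H; under eq_integral do rewrite EFinM -sumEFin.
  rewrite ge0_integralZl//; last 3 first.
  - apply: emeasurable_sum => k; apply/measurable_EFinP; exact: measurable_funM.
  - by move=> t _; apply: sume_ge0 => k _; rewrite lee_fin mulr_ge0 ?powR_ge0.
  - by rewrite lee_fin !mulr_ge0 ?powR_ge0.
  rewrite ge0_integral_sum//; last 2 first.
  - by move=> k; apply/measurable_EFinP; apply: measurable_funM.
  - by move=> k t _; rewrite lee_fin mulr_ge0 ?powR_ge0.
  have e k : (\int[lebd]_t (normc (a (j, k)) `^ p * \1_(tbox (side true j k)) t)%:E =
      (normc (a (j, k)) `^ p * 2 ^- norm1 j)%:E)%E.
    under eq_integral do rewrite EFinM.
    rewrite ge0_integralZl ?lee_fin ?powR_ge0//; last exact/measurable_EFinP.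
    by rewrite integral_indic// setIT [X in (_ * X)%E](_ : _ = (2 ^- norm1 j)%:E)//; exact: lebd_cube.
  rewrite (eq_bigr _ (fun k _ => e k)) sumEFin -EFinM lee_fin -mulr_suml.
  have hj : \sum_(k <- F j) normc (a (j, k)) `^ p <= (N * w j * 2 `^ (- level_weight p%:E r s j)) `^ p := h j.
  have wp0 : 0 <= w j `^ (- (p / 2)) * (2 `^ wr j) `^ p * (2 ^+ d) `^ p by rewrite !mulr_ge0 ?powR_ge0.
  apply: le_trans (ler_wpM2l wp0 (ler_wpM2r _ hj)) _; first by rewrite invr_ge0 exprn_ge0.
  rewrite !powRM ?mulr_ge0 ?p2_ge0 ?wj//.
  have e2 : (2 `^ wr j) `^ p * ((2 `^ (- level_weight p%:E r s j)) `^ p * 2 ^- norm1 j) = 1 :> R.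
    rewrite -p2_nat -powRN -!powRrM -!p2D -[RHS](powRr0 2); congr (_ `^ _).
    by rewrite /wr /level_weight recip_fin//; field; rewrite gt_eqF.
  have [wj0|wj0] := eqVneq (w j) 0.
    by rewrite wj0 !powR0 ?oppr_eq0 ?gt_eqF ?divr_gt0// !mul0r mulr0.
  have e3 : w j `^ (- (p / 2)) * w j `^ p = w j `^ (p / 2).
    rewrite -powRD ?wj0 ?implybT//; congr (_ `^ _); by rewrite addrC {1}(splitr p) addrK.
  rewrite -e3 [leLHS](_ : _ = (2 ^+ d) `^ p * N `^ p * (w j `^ (- (p / 2)) * w j `^ p) *
     ((2 `^ wr j) `^ p * ((2 `^ (- level_weight p%:E r s j)) `^ p * 2 ^- norm1 j))); last by ring.
  by rewrite e2 mulr1.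
pose unp n := @choice.pickle_inv (level d) n.
pose Hn n (t : d.-tuple T) : \bar R := (if unp n is Some j then (C1 `^ p) * H j t else 0)%:E.
have Hn0 n (t : d.-tuple T) : (0 <= Hn n t)%E.
  by rewrite /Hn; case: (unp n) => // j; rewrite lee_fin mulr_ge0 ?powR_ge0.
have mHn n : measurable_fun setT (Hn n).
  rewrite /Hn; apply/measurable_EFinP; case: (unp n) => [j|]//.
  exact: measurable_funM.
pose S (t : d.-tuple T) := (\sum_(n <oo) Hn n t)%E.
have S0 (t : d.-tuple T) : (0 <= S t)%E by exact: nneseries_ge0.
have HS j (t : d.-tuple T) : ((C1 `^ p * H j t)%:E <= S t)%E.
  apply: le_trans (nneseries_lim_ge (choice.pickle j).+1 (fun n _ _ => Hn0 n t)).
  rewrite big_mkord big_ord_recr/= {2}/Hn /unp choice.pickleK_inv leeDr//.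
  by apply: sume_ge0 => i _; exact: Hn0.
have iS : (\int[lebd]_t S t <= (C1 `^ p * ((2 ^+ d) `^ p * N `^ p * C2))%:E)%E.
  rewrite integral_nneseries//; apply: lime_le.
    by apply: is_cvg_nneseries => n _ _; apply: integral_ge0.
  near=> n; rewrite big_mkord.
  pose J := [fset j | j in pmap unp (iota 0 n)]%fset.
  pose G j := C1 `^ p * ((2 ^+ d) `^ p * N `^ p * w j `^ (p / 2)).
  apply: (@le_trans _ _ (\sum_(j <- pmap unp (iota 0 n)) (G j)%:E)%E).
    rewrite -(big_mkord xpredT (fun i => \int[lebd]_t Hn i t)%E) /index_iota subn0.
    elim: (iota 0 n) => [|i l IH] /=; first by rewrite !big_nil.
    rewrite big_cons; case E : (unp i) => [j|] /=.
      rewrite big_cons; apply: leeD => //; rewrite /Hn E.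
      under eq_integral do rewrite EFinM.
      rewrite ge0_integralZl ?lee_fin ?powR_ge0//; [|by apply/measurable_EFinP; exact: mH|by move=> t _; rewrite lee_fin; exact: H0].
      rewrite /G EFinM; apply: lee_wpmul2l; first by rewrite lee_fin powR_ge0.
      exact: iH.
    rewrite (eq_integral (cst 0%E)); last by move=> t _; rewrite /Hn E.
    by rewrite integral0 add0e.
  rewrite sumEFin lee_fin /G -!mulr_sumr.
  apply: ler_wpM2l; first exact: powR_ge0.
  apply: ler_wpM2l; first by rewrite mulr_ge0 ?powR_ge0.
  apply: le_trans (hC2 w Ow J); apply: ler_sum_subseq => [|j jl|j]; last exact: powR_ge0.
    apply: (@pmap_uniq _ _ unp choice.pickle); last exact: iota_uniq.
    exact: choice.pickle_invK.
  by rewrite inE.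
rewrite /seqnorm.
set Q := Lnorm _ _ _.
have Q0 : (0 <= Q)%E by exact: Lnorm_ge0.
have hQ : (Q `^ p <= (C1 `^ p * ((2 ^+ d) `^ p * N `^ p * C2))%:E)%E.
  rewrite /Q powR_Lnorm ?gt_eqF//; apply: le_trans iS.
  apply: ge0_le_integral_any => t; first exact: poweR_ge0.
  have E0 : (0 <= ell q (fun j : level d => (2 `^ (r * (norm1 j)%:R + s * (normoo j)%:R) *
     level_value a j t)%:E))%E.
    apply: (ell_ge0 [ffun=> 0%N]) => // j.
    by rewrite lee_fin mulr_ge0 ?p2_ge0 ?normc_ge0.
  rewrite gee0_abs//.
  have [Soo|] := eqVneq (S t) +oo%E; first by rewrite Soo leey.
  move=> Soo; have Sf : S t \is a fin_num by rewrite ge0_fin_numE// ltey.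
  set sg := fine (S t); have sg0 : 0 <= sg by exact: fine_ge0.
  have HS' j : C1 `^ p * H j t <= sg by rewrite -lee_fin fineK.
  have b j : 2 `^ wr j * level_value a j t <= (sg `^ p^-1 / C1) * (w j `^ 2^-1).
    rewrite -(powR_le_base p0); last 2 first.
    - by rewrite mulr_ge0 ?p2_ge0 ?normc_ge0.
    - by rewrite !mulr_ge0 ?powR_ge0// invr_ge0 ltW.
    apply: le_trans (gH j t) _.
    rewrite powRM ?powR_ge0//; last by rewrite mulr_ge0 ?powR_ge0// invr_ge0 ltW.
    rewrite -(powRrM (w j)) [2^-1 * p]mulrC [leRHS]mulrC ler_wpM2l ?powR_ge0//.
    rewrite powRM ?powR_ge0// ?invr_ge0 ?(ltW C10)//.
    rewrite -powRrM mulVf ?gt_eqF// powRr1// -powR_inv1 ?(ltW C10)// -powRrM mulN1r powRN.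
    by rewrite ler_pdivlMr ?powR_gt0// mulrC.
  have -> : S t = ((sg `^ p^-1)%:E `^ p)%E.
    by rewrite poweR_EFin -powRrM mulVf ?gt_eqF// powRr1// fineK.
  apply: poweR_le => //; first exact: ltW.
  have c0 : 0 <= sg `^ p^-1 / C1 by rewrite mulr_ge0 ?powR_ge0// invr_ge0 ltW.
  apply: (@ell_le_of_lp _ _ q _ (fun j => (sg `^ p^-1 / C1) * (w j `^ 2^-1))) => //.
  - exact: powR_ge0.
  - by move=> j; rewrite mulr_ge0 ?powR_ge0.
  - move=> j; rewrite !lee_fin; apply/andP; split; last exact: b.
    by rewrite mulr_ge0 ?p2_ge0 ?normc_ge0.
  - move=> J; have Ow2 : [set (fun j => w j `^ 2^-1) | w in Om] (fun j => w j `^ 2^-1) by exists w.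
    have := @lp_leZ _ _ q J (fun j => w j `^ 2^-1) C1 (sg `^ p^-1 / C1) q0
      (fun j => powR_ge0 _ _) (ltW C10) c0 (hC1 _ Ow2 J).
    by rewrite divfK// gt_eqF.
have -> : Q = ((Q `^ p) `^ p^-1)%E by rewrite -poweRrM mulfV ?gt_eqF// poweRe1.
apply: (@le_trans _ _ ((C1 `^ p * ((2 ^+ d) `^ p * N `^ p * C2))%:E `^ p^-1)%E).
  by apply: poweR_le => //; [rewrite invr_ge0 ltW|exact: poweR_ge0].
rewrite poweR_EFin lee_fin !powRM ?mulr_ge0 ?powR_ge0 ?(ltW C20)//.
rewrite -!powRrM mulfV ?gt_eqF// !powRr1 ?exprn_ge0 ?(ltW C10)//.
by rewrite le_eqVlt; apply/orP; left; apply/eqP; ring.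
Unshelve. all: by end_near. Qed.

End level_by_level.

(** * Smooth functions with compact support on the line *)

Section flat_functions.
Context {R : realType}.
Local Notation T := (measurableTypeR R).
Local Notation leb := (@lebesgue_measure R).
Implicit Types (p : {poly R}) (f g h : R -> R) (x y e : R).

(** The functions [p(1/x) exp(-1/x)] on the right half-line, extended by zero:
    the family is closed under differentiation. *)
Definition flat p x : R := if 0 < x then p.[x^-1] * expR (- x^-1) else 0.

Lemma flat_le_sqr p : exists2 C : R, 0 <= C & forall x, x <= 1 -> `|flat p x| <= C * x ^+ 2.
Proof.
pose n := size p; pose S := \sum_(i < n) `|p`_i|.
have S0 : 0 <= S by apply: sumr_ge0.
exists (S * (n.+2)`!%:R); first by rewrite mulr_ge0.
move=> x x1; rewrite /flat; case: ltP => x0; last first.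
  by rewrite normr0 mulr_ge0 ?sqr_ge0// mulr_ge0.
pose t := x^-1; have t1 : 1 <= t by rewrite invf_ge1.
have t0 : 0 < t by rewrite invr_gt0.
have pt : `|p.[t]| <= S * t ^+ n.
  rewrite horner_coef; apply: le_trans (ler_norm_sum _ _ _) _.
  rewrite mulr_suml; apply: ler_sum => i _; rewrite normrM ler_wpM2l//.
  rewrite ger0_norm ?exprn_ge0 ?(ltW t0)//.
  by apply: ler_weXn2l => //; exact: ltnW (ltn_ord i).
have ft : expR (- t) <= (n.+2)`!%:R / t ^+ n.+2.
  rewrite expRN -[leRHS]invrK lef_pV2 ?posrE ?expR_gt0 ?invr_gt0 ?divr_gt0 ?exprn_gt0 ?ltr0n ?fact_gt0//.
  by rewrite invf_div; apply: le_trans (expR_ge1Dxn n.+1 (ltW t0)); rewrite lerDr.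
rewrite normrM (ger0_norm (expR_ge0 _)).
apply: le_trans (ler_pM (normr_ge0 _) (expR_ge0 _) pt ft) _.
rewrite le_eqVlt; apply/orP; left; apply/eqP.
have -> : x = t^-1 by rewrite invrK.
by rewrite !exprS; field; rewrite ?gt_eqF ?exprn_gt0.
Qed.

Lemma is_derive_flat p x : is_derive x 1 (flat p) (flat ('X^2 * (p - p^`())) x).
Proof.
have [x0|x0|x0] := ltgtP x 0.
- rewrite [flat _ x]/flat ltNge (ltW x0)/=.
  apply: (near_eq_is_derive (f := fun=> 0)).
  near=> y; rewrite /flat ltNge (_ : y <= 0)//; near: y; exact: lt_le_nbhsl.
- rewrite [flat _ x]/flat x0.
  apply: (near_eq_is_derive (f := fun y => p.[y^-1] * expR (- y^-1))).
    near=> y; rewrite /flat (_ : 0 < y)//; near: y; exact: lt_nbhsr.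
  have xn : x != 0 by rewrite gt_eqF.
  have dV : is_derive x 1 (fun y : R => y^-1) (- x ^- 2).
    have := @is_deriveV _ id x 1 1 xn (is_derive_id x 1).
    by rewrite [_ *: _]mulr1.
  have dp : is_derive x 1 (fun y : R => p.[y^-1]) (p^`().[x^-1] * - x ^- 2).
    exact: (@is_derive1_comp _ (horner p) (fun y : R => y^-1) x _ _ (is_derive_poly p x^-1) dV).
  have de : is_derive x 1 (fun y : R => expR (- y^-1)) (expR (- x^-1) * x ^- 2).
    rewrite -[x ^- 2]opprK.
    exact: (@is_derive1_comp _ (@expR R) (fun y : R => - y^-1) x _ _ (is_derive_expR _) (is_deriveN dV)).
  have := is_deriveM dp de; congr is_derive.
  rewrite /GRing.scale/= hornerM hornerXn hornerD hornerN exprVn; ring.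
- rewrite x0 [flat _ 0]/flat ltxx; have [C C0 hC] := flat_le_sqr p.
  have f0 : flat p 0 = 0 by rewrite /flat ltxx.
  have : h^-1 *: ((flat p \o pseudometric_normed_Zmodule.shift 0) (h *: 1) - flat p 0) @[h --> (0 : R)^'] --> (0 : R).
    apply/cvgr0Pnorm_le => e e0; near=> h.
    rewrite f0 /= /pseudometric_normed_Zmodule.shift addr0 subr0 [h *: 1]mulr1 normrZ normfV.
    have hn : h != 0 by near: h; exact: nbhs_dnbhs_neq.
    rewrite ler_pdivrMl ?normr_gt0//.
    have h1 : h <= 1.
      apply: le_trans (ler_norm _) _; apply: ltW; near: h; exact: dnbhs0_lt.
    have h2 : `|h| <= e / (C + 1).
      by apply: ltW; near: h; apply: dnbhs0_lt; rewrite divr_gt0// ltr_wpDl.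
    apply: le_trans (hC h h1) _; rewrite -real_normK ?num_real// expr2 mulrCA ler_wpM2l//.
    rewrite ler_pdivlMr ?ltr_wpDl// in h2.
    by apply: le_trans h2; rewrite mulrC ler_wpM2l// lerDl.
  by move=> lim0; apply: DeriveDef; [exact: (cvgP _ lim0)|exact: cvg_lim].
Unshelve. all: by end_near. Qed.

Lemma continuous_bounded f (L : R) : continuous f ->
  exists2 M : R, 0 <= M & forall x, `|x| <= L -> `|f x| <= M.
Proof.
move=> cf; have [L0|L0] := ltP L 0.
  by exists 0 => // x xL; have := le_lt_trans xL L0; rewrite normr_lt0.
have LL : - L <= L by rewrite (le_trans _ L0)// oppr_le0.
have cn : continuous (fun x => `|f x|) by move=> x; apply: cvg_norm; exact: cf.
have [c _ hc] := EVT_max LL (continuous_subspaceT cn).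
by exists `|f c| => // x; rewrite ler_norml => xL; apply: hc; rewrite in_itv.
Qed.

Lemma is_derive_continuous f f' : (forall x, is_derive x 1 f (f' x)) -> continuous f.
Proof.
move=> h x; apply/differentiable_continuous/derivable1_diffP.
by have [] := h x.
Qed.

Lemma integrable_segment f (L : R) : continuous f ->
  leb.-integrable `[- L, L] (EFin \o f).
Proof.
move=> cf; apply: continuous_compact_integrable; first exact: segment_compact.
exact: continuous_subspaceT.
Qed.

Definition conv (L : R) h g (s x : R) : R :=
  Rintegral leb `[- L, L] (fun y => h y * g (x + s * y)).

Lemma continuous_conv_arg h g (s x : R) : continuous h -> continuous g ->
  continuous (fun y => h y * g (x + s * y)).
Proof.
move=> ch cg y; apply: cvgM; first exact: ch.
apply: (@continuous_comp _ _ _ (fun y => x + s * y) g); last exact: cg.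
by apply: cvgD; [exact: cvg_cst|exact: mulrl_continuous].
Qed.

Lemma is_derive_conv (L : R) h g g' (s : R) : continuous h -> continuous g' ->
  (forall x, is_derive x 1 g (g' x)) ->
  forall x, is_derive x 1 (conv L h g s) (conv L h g' s x).
Proof.
move=> ch cg' dg a; have cg : continuous g := is_derive_continuous dg.
pose f x y := h y * g (x + s * y).
have df x y : is_derive x 1 (f ^~ y) (h y * g' (x + s * y)).
  have d1 : is_derive x 1 (fun x : R => x + s * y) 1.
    by rewrite -[X in is_derive _ _ _ X]addr0; apply: is_deriveD.
  have d2 : is_derive x 1 (fun x => g (x + s * y)) (g' (x + s * y) * 1).
    exact: (@is_derive1_comp _ g (fun x => x + s * y) x _ _ (dg _) d1).
  by rewrite mulr1 in d2; exact: (is_deriveZ (h y) d2).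
have [Mh Mh0 hMh] := continuous_bounded L ch.
have [Mg Mg0 hMg] := continuous_bounded (`|a| + 1 + `|s| * L) cg'.
have Ia : `](a - 1), (a + 1)[%classic a by rewrite /= in_itv/= ltrBlDr ltrDl ltr01.
have mB : measurable (`[- L, L]%classic : set T) by exact: measurable_itv.
have intf (x : R) : `](a - 1), (a + 1)[%classic x -> leb.-integrable `[- L, L] (EFin \o f x).
  by move=> _; apply: integrable_segment; exact: continuous_conv_arg.
have derf (x y : R) : `](a - 1), (a + 1)[%classic x -> `[- L, L]%classic y -> derivable (f ^~ y) x 1.
  by move=> _ _; have [] := df x y.
have d1 x y : partial1of2 f x y = h y * g' (x + s * y).
  by rewrite partial1of2E; have [_] := df x y.
have G_ub (x y : R) : `](a - 1), (a + 1)[%classic x -> `[- L, L]%classic y ->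
    `|partial1of2 f x y| <= cst (Mh * Mg) y.
  rewrite /= !in_itv/= => /andP[x1 x2] yL; rewrite d1 normrM; rewrite -ler_norml in yL.
  apply: ler_pM => //; first exact: hMh.
  apply: hMg; apply: le_trans (ler_normD _ _) _; apply: lerD; last by rewrite normrM ler_wpM2l.
  rewrite -[x](subrKC a); apply: le_trans (ler_normD _ _) _; rewrite lerD2l.
  by rewrite ler_norml; apply/andP; split; lra.
have intG : leb.-integrable `[- L, L] (EFin \o cst (Mh * Mg)).
  by apply: integrable_segment => x; exact: cvg_cst.
have G0 (y : R) : 0 <= cst (Mh * Mg) y by rewrite mulr_ge0.
apply: DeriveDef; first exact: (derivable_under_integral mB Ia intf derf G0 intG G_ub).
rewrite -derive1E (differentiation_under_integral mB Ia intf derf G0 intG G_ub).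
by apply: eq_Rintegral => y _; rewrite d1.
Qed.

(** A class of smooth functions that is visibly closed under differentiation;
    it contains the mollifiers and the mollified functions. *)
Inductive smooth_line : (R -> R) -> Prop :=
| smooth_flat p (a b : R) : smooth_line (fun x => flat p (a * x + b))
| smooth_cst (c : R) : smooth_line (fun=> c)
| smooth_add f g : smooth_line f -> smooth_line g -> smooth_line (fun x => f x + g x)
| smooth_mul f g : smooth_line f -> smooth_line g -> smooth_line (fun x => f x * g x)
| smooth_conv (L : R) h g (s : R) : continuous h -> smooth_line g -> smooth_line (conv L h g s).

Lemma continuous_conv (L : R) h g (s : R) : continuous h -> continuous g ->
  continuous (conv L h g s).
Proof.
move=> ch cg a; pose f x y := h y * g (x + s * y).
have [Mh Mh0 hMh] := continuous_bounded L ch.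
have [Mg Mg0 hMg] := continuous_bounded (`|a| + 1 + `|s| * L) cg.
have mB : measurable (`[- L, L]%classic : set T) by exact: measurable_itv.
have intf (x : R) : `](a - 1), (a + 1)[%classic x -> leb.-integrable `[- L, L] (EFin \o f x).
  by move=> _; apply: integrable_segment; exact: continuous_conv_arg.
have cf : {ae leb, forall y, `[- L, L]%classic y -> {in `](a - 1), (a + 1)[%classic, continuous (f ^~ y)}}.
  apply: aeW => y _ x _; apply: cvgM; first exact: cvg_cst.
  apply: (@continuous_comp _ _ _ (fun x => x + s * y) g); last exact: cg.
  by apply: cvgD; [exact: cvg_id|exact: cvg_cst].
have intG : leb.-integrable `[- L, L] (EFin \o cst (Mh * Mg)).
  by apply: integrable_segment => x; exact: cvg_cst.
have G_ub (x : R) : `](a - 1), (a + 1)[%classic x ->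
    {ae leb, forall y, `[- L, L]%classic y -> `|f x y| <= cst (Mh * Mg) y}.
  move=> hx; apply: aeW => y; move: hx.
  rewrite /= !in_itv/= => /andP[x1 x2] yL; rewrite /f normrM; rewrite -ler_norml in yL.
  apply: ler_pM => //; first exact: hMh.
  apply: hMg; apply: le_trans (ler_normD _ _) _; apply: lerD; last by rewrite normrM ler_wpM2l.
  rewrite -[x](subrKC a); apply: le_trans (ler_normD _ _) _; rewrite lerD2l.
  by rewrite ler_norml; apply/andP; split; lra.
have := @continuity_under_integral R _ _ leb f _ mB (a - 1) (a + 1) intf cf _ intG G_ub a.
by apply; rewrite inE /= in_itv/= ltrBlDr ltrDl ltr01.
Qed.

Lemma smooth_line_continuous f : smooth_line f -> continuous f.
Proof.
elim=> [p a b|c|u v _ cu _ cv|u v _ cu _ cv|L h u s ch _ cu].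
- apply: (is_derive_continuous (f' := fun x => flat ('X^2 * (p - p^`())) (a * x + b) * a)) => x.
  apply: (@is_derive1_comp _ (flat p) (fun x => a * x + b) x _ _ (is_derive_flat _ _)).
  rewrite -[X in is_derive _ _ _ X]addr0; apply: is_deriveD.
  by rewrite -[X in is_derive _ _ _ X]mulr1; apply: (@is_deriveZ _ _ _ id).
- by move=> x; exact: cvg_cst.
- by move=> x; apply: cvgD; [exact: cu|exact: cv].
- by move=> x; apply: cvgM; [exact: cu|exact: cv].
- exact: continuous_conv.
Qed.

Lemma smooth_line_derive f : smooth_line f ->
  exists2 g, smooth_line g & forall x, is_derive x 1 f (g x).
Proof.
elim=> [p a b|c|u v _ [u' su du] _ [v' sv dv]|u v su0 [u' su du] sv0 [v' sv dv]|L h u s ch _ [u' su du]].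
- exists (fun x => flat ('X^2 * (p - p^`())) (a * x + b) * a).
    by apply: smooth_mul; [exact: smooth_flat|exact: smooth_cst].
  move=> x; apply: (@is_derive1_comp _ (flat p) (fun x => a * x + b) x _ _ (is_derive_flat _ _)).
  rewrite -[X in is_derive _ _ _ X]addr0; apply: is_deriveD.
  by rewrite -[X in is_derive _ _ _ X]mulr1; apply: (@is_deriveZ _ _ _ id).
- by exists (fun=> 0); [exact: smooth_cst|move=> x; exact: is_derive_cst].
- by exists (fun x => u' x + v' x); [exact: smooth_add|move=> x; exact: is_deriveD].
- exists (fun x => u x * v' x + v x * u' x); first by apply: smooth_add; exact: smooth_mul.
  by move=> x; exact: is_deriveM.
- exists (conv L h u' s); first exact: smooth_conv.
  by apply: is_derive_conv => //; exact: smooth_line_continuous.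
Qed.

(** An even mollifier supported in [-e, e]. *)
Lemma mollifier e : 0 < e -> exists2 rho : R -> R, smooth_line rho &
  [/\ forall x, 0 <= rho x, forall x, e < `|x| -> rho x = 0, forall x, rho (- x) = rho x &
      Rintegral leb `[- e, e] rho = 1].
Proof.
move=> e0; pose u x := flat 1 ((-1) * x + e) * flat 1 (1 * x + e).
have flat0 x : 0 <= flat 1 x by rewrite /flat; case: ifP => // _; rewrite hornerC mul1r expR_ge0.
have u0 x : 0 <= u x by rewrite mulr_ge0.
have su : smooth_line u by apply: smooth_mul; exact: smooth_flat.
have cu := smooth_line_continuous su.
have uN x : u (- x) = u x by rewrite /u mulrNN !mul1r mulN1r mulrC.
have ue x : e < `|x| -> u x = 0.
  rewrite ltr_normr => /orP[h|h]; rewrite /u /flat !mul1r mulN1r.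
    by rewrite ltNge (_ : - x + e <= 0) ?mul0r//; lra.
  by rewrite mulrC ltNge (_ : x + e <= 0) ?mul0r//; lra.
pose c := expR (- (e / 2)^-1) ^+ 2; have c0 : 0 < c by rewrite exprn_gt0// expR_gt0.
have e2 : 0 < e / 2 by rewrite divr_gt0.
have uc x : `[- (e / 2), e / 2]%classic x -> c <= u x.
  rewrite /= in_itv/= => /andP[h1 h2].
  have fl y : e / 2 <= y -> expR (- (e / 2)^-1) <= flat 1 y.
    move=> hy; have y0 : 0 < y by exact: lt_le_trans hy.
    by rewrite /flat y0 hornerC mul1r ler_expR lerN2 lef_pV2 ?posrE.
  by rewrite /c /u expr2 ler_pM ?expR_ge0// ?fl//; lra.
have iu : 0 < Rintegral leb `[- e, e] u.
  have : Rintegral leb `[- (e / 2), e / 2] (cst c) <= Rintegral leb `[- e, e] u.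
    rewrite [leLHS]Rintegral_mkcond [leRHS]Rintegral_mkcond.
    apply: le_Rintegral => //.
    - rewrite -restrict_EFin; apply: (integrable_mkcond _ _).1 => //.
      by apply: integrable_segment => x; exact: cvg_cst.
    - rewrite -restrict_EFin; apply: (integrable_mkcond _ _).1 => //; exact: integrable_segment.
    move=> x _; rewrite /patch; case: ifPn => [|_]; last by case: ifP => // _; exact: u0.
    rewrite inE /= in_itv/= => /andP[h1 h2]; rewrite ifT; last by rewrite inE/= in_itv/=; apply/andP; split; lra.
    by apply: uc; rewrite /= in_itv/= h1.
  apply: lt_le_trans; rewrite Rintegral_cst//.
  rewrite [X in c * fine X](_ : _ = (e / 2 - - (e / 2))%:E); last by apply: leb_itv_cc; lra.
  by rewrite mulr_gt0//=; lra.
pose I := Rintegral leb `[- e, e] u.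
exists (fun x => I^-1 * u x); first by apply: smooth_mul => //; exact: smooth_cst.
split.
- by move=> x; rewrite mulr_ge0// invr_ge0 ltW.
- by move=> x ex; rewrite ue// mulr0.
- by move=> x; rewrite uN.
- rewrite RintegralZl//; first by rewrite mulVf// gt_eqF.
  exact: integrable_segment.
Qed.

Lemma conv_swap (L e : R) h (rho : R -> R) x : continuous h -> continuous rho ->
  (forall x, L < `|x| -> h x = 0) -> (forall x, e < `|x| -> rho x = 0) ->
  (forall x, rho (- x) = rho x) -> conv L h rho (-1) x = conv e rho h 1 x.
Proof.
move=> ch cr hL re rN; pose u y := h y * rho (x + -1 * y).
have cu : continuous u by exact: continuous_conv_arg.
have uL : (u : R -> R) \_ `[- L, L] = u.
  apply/funext => y; rewrite /patch; case: ifPn => // /negP yL; rewrite /u hL ?mul0r//.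
  by rewrite ltNge; apply/negP => h1; apply: yL; rewrite inE/= in_itv/= -ler_norml.
have iu : leb.-integrable setT (EFin \o u).
  rewrite -uL -restrict_EFin; apply: (integrable_mkcond _ _).1 => //; exact: integrable_segment.
rewrite /conv Rintegral_mkcond -/u uL (@Rintegral_affine _ 1 x _ ltr01 iu) mul1r [RHS]Rintegral_mkcond.
apply: eq_Rintegral => z _; rewrite /patch /u.
have -> : x + -1 * (1 * z + x) = - z by ring.
rewrite rN mul1r [z + x]addrC mulrC; case: ifPn => // /negP ze; rewrite re ?mul0r//.
by rewrite ltNge; apply/negP => h1; apply: ze; rewrite inE/= in_itv/= -ler_norml.
Qed.

Lemma average_le e (rho u : R -> R) (M : R) : continuous rho -> continuous u -> (forall x, 0 <= rho x) ->
  Rintegral leb `[- e, e] rho = 1 -> (forall z, `|z| <= e -> `|u z| <= M) ->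
  `|Rintegral leb `[- e, e] (fun z => rho z * u z)| <= M.
Proof.
move=> cr cu r0 r1 uM.
have cru : continuous (fun z => rho z * u z) by move=> z; apply: cvgM; [exact: cr|exact: cu].
apply: le_trans (le_normr_Rintegral _ _) _ => //; first exact: integrable_segment.
rewrite -[leRHS]mul1r -r1 -RintegralZr//; last exact: integrable_segment.
apply: le_Rintegral => //.
- apply: (@integrable_segment (fun z => `|rho z * u z|)) => z; apply: cvg_norm; exact: cru.
- apply: (@integrable_segment (fun z => rho z * M)) => z; apply: cvgM; [exact: cr|exact: cvg_cst].
- by move=> z /=; rewrite in_itv/= -ler_norml => ze; rewrite normrM ger0_norm// ler_wpM2l// uM.
Qed.

(** Smoothing keeps the bounds of all derivatives, because it averages the
    translates of the function. *)
Lemma mollification K (h : nat -> R -> R) (A a b e : R) : (0 < K)%N -> 0 < e ->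
  (forall n, (n < K)%N -> forall x, is_derive x 1 (h n) (h n.+1 x)) ->
  (forall n, (n <= K)%N -> continuous (h n)) ->
  (forall n, (n <= K)%N -> forall x, `|h n x| <= A) ->
  (forall x, ~~ (a <= x <= b) -> h 0%N x = 0) ->
  exists G : nat -> R -> R, [/\ smooth_line (G 0%N),
    forall n, (n < K)%N -> forall x, is_derive x 1 (G n) (G n.+1 x),
    forall n, (n <= K)%N -> forall x, `|G n x| <= A,
    forall x, ~~ (a - e <= x <= b + e) -> G 0%N x = 0 &
    forall x, `|G 0%N x - h 0%N x| <= A * e].
Proof.
move=> K0 e0 dh ch hA hab; have [rho srho [r0 re rN r1]] := mollifier e0.
have cr := smooth_line_continuous srho.
pose L := `|a| + `|b|.
have hL x : L < `|x| -> h 0%N x = 0.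
  move=> xL; apply: hab; apply/negP => /andP[ax xb]; move: xL; rewrite ltNge => /negP; apply.
  rewrite ler_norml /L; have := ler_norm b; have := ler_norm (- a); rewrite normrN.
  by have := normr_ge0 a; have := normr_ge0 b; move=> *; apply/andP; split; lra.
have G0 x : conv e rho (h 0%N) 1 x = conv L (h 0%N) rho (-1) x.
  by rewrite (conv_swap _ (ch _ _) cr hL re rN).
have cx n x : (n <= K)%N -> continuous (fun z : R => h n (x + 1 * z)).
  move=> nK z; apply: (@continuous_comp _ _ _ (fun z : R => x + 1 * z) (h n)); last exact: ch.
  by apply: cvgD; [exact: cvg_cst|exact: mulrl_continuous].
exists (fun n => conv e rho (h n) 1); split.
- rewrite (_ : conv _ _ _ _ = conv L (h 0%N) rho (-1)); last by apply/funext.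
  by apply: smooth_conv => //; exact: ch.
- by move=> n nK; apply: is_derive_conv => //; [exact: ch|exact: dh].
- by move=> n nK x; apply: average_le => // [|z _]; [exact: cx|exact: hA].
- move=> x xab; rewrite /conv /Rintegral integral0_eq// => z /=; rewrite in_itv/= => /andP[z1 z2].
  rewrite hab ?mulr0//; apply: contra xab => /andP[h1 h2]; apply/andP; split; lra.
- move=> x; have -> : h 0%N x = Rintegral leb `[- e, e] (fun z => rho z * h 0%N x).
    by rewrite RintegralZr ?r1 ?mul1r//; exact: integrable_segment.
  rewrite -RintegralB//; last 2 first.
  + by apply: (@integrable_segment (fun z => rho z * h 0%N (x + 1 * z))); apply: continuous_conv_arg => //; exact: ch.
  + apply: (@integrable_segment (fun z => rho z * h 0%N x)) => z.
    by apply: cvgM; [exact: cr|exact: cvg_cst].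
  under eq_Rintegral do rewrite -mulrBr.
  apply: average_le => //.
    by move=> z; apply: cvgB; [exact: cx|exact: cvg_cst].
  move=> z ze; have [P sP hP] := @taylor_real R 1 h A (fun n n1 => dh n (leq_trans n1 K0)) (hA 1%N K0) x.
  have hx : h 0%N x = P.[z].
    have := hP 0; rewrite addr0 normr0 expr1 mulr0 normr_le0 subr_eq0 => /eqP ->.
    by rewrite (size1_polyC sP) !hornerC.
  rewrite mul1r hx; apply: le_trans (hP z) _; rewrite expr1 ler_wpM2l//.
  by apply: le_trans (hA 0%N _ 0).
Qed.

End flat_functions.

(** * Test functions of tensor product form *)

Section smooth_tensors.
Context {R : realType} {d : nat}.
Implicit Types (u v : 'rV[R]_d -> R) (f : 'rV[R]_d -> R[i]).

Inductive smooth_tensor : ('rV[R]_d -> R) -> Prop :=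
| tensor_line i (h : R -> R) : smooth_line h -> smooth_tensor (fun x => h (x ord0 i))
| tensor_cst (c : R) : smooth_tensor (fun=> c)
| tensor_add u v : smooth_tensor u -> smooth_tensor v -> smooth_tensor (fun x => u x + v x)
| tensor_mul u v : smooth_tensor u -> smooth_tensor v -> smooth_tensor (fun x => u x * v x).

Lemma smooth_tensor_continuous u : smooth_tensor u -> continuous u.
Proof.
elim=> [i h sh|c|u1 v1 _ c1 _ c2|u1 v1 _ c1 _ c2] x.
- apply: (@continuous_comp _ _ _ (fun x : 'rV[R]_d => x ord0 i) h); first exact: coord_continuous.
  exact: smooth_line_continuous.
- exact: cst_continuous.
- exact: (cvgD (c1 x) (c2 x)).
- exact: (cvgM (c1 x) (c2 x)).
Qed.

Lemma is_derive_coord (h h' : R -> R) (i i' : 'I_d) (x : 'rV[R]_d) :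
  (forall y : R, is_derive y 1 h (h' y)) ->
  is_derive x (delta_mx 0 i) (fun x : 'rV[R]_d => h (x ord0 i')) (h' (x ord0 i') * (i' == i)%:R).
Proof.
move=> dh; have [<-|ne] := eqVneq i' i.
  rewrite mulr1; have [dy <-] := dh (x ord0 i').
  have e : (fun k : R => k^-1 *: (((fun x : 'rV[R]_d => h (x ord0 i')) \o pseudometric_normed_Zmodule.shift x) (k *: delta_mx 0 i') - h (x ord0 i'))) =
    (fun k : R => k^-1 *: ((h \o pseudometric_normed_Zmodule.shift (x ord0 i')) (k *: 1) - h (x ord0 i'))).
    apply/funext => k /=; rewrite /pseudometric_normed_Zmodule.shift; congr (_ *: (h _ - _)).
    by rewrite [k *: 1]mulr1 !mxE !eqxx mulr1.
  by apply: DeriveDef; [rewrite /derivable e|rewrite /derive e].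
rewrite mulr0; have e : (fun k : R => k^-1 *: (((fun x : 'rV[R]_d => h (x ord0 i')) \o pseudometric_normed_Zmodule.shift x) (k *: delta_mx 0 i) - h (x ord0 i'))) = (fun=> 0).
  apply/funext => k /=; rewrite /pseudometric_normed_Zmodule.shift.
  by rewrite !mxE eqxx (negbTE ne) mulr0 add0r subrr scaler0.
have lim0 : (fun=> (0 : R)) @ (0 : R)^' --> (0 : R) by exact: cvg_cst.
apply: DeriveDef; first by rewrite /derivable e; exact: (cvgP _ lim0).
by rewrite /derive e; exact: cvg_lim.
Qed.

Lemma smooth_tensor_derive u i : smooth_tensor u ->
  exists2 v, smooth_tensor v & forall x, is_derive x (delta_mx 0 i) u (v x).
Proof.
elim=> [i' h sh|c|u1 v1 _ [u' su du] _ [v' sv dv]|u1 v1 su1 [u' su du] sv1 [v' sv dv]].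
- have [h' sh' dh] := smooth_line_derive sh.
  exists (fun x => h' (x ord0 i') * (i' == i)%:R); last by move=> x; exact: is_derive_coord.
  by apply: tensor_mul; [exact: tensor_line|exact: tensor_cst].
- by exists (fun=> 0); [exact: tensor_cst|move=> x; exact: is_derive_cst].
- by exists (fun x => u' x + v' x); [exact: tensor_add|move=> x; exact: is_deriveD].
- exists (fun x => u1 x * v' x + v1 x * u' x); first by apply: tensor_add; exact: tensor_mul.
  by move=> x; exact: is_deriveM.
Qed.

Lemma smooth_tensor_smooth u : smooth_tensor u -> real_smooth u.
Proof.
move=> su s; have {su} : smooth_tensor (pderiv s u).
  elim: s => [//|i s IH] /=; have [v sv dv] := smooth_tensor_derive i IH.
  rewrite (_ : (fun x => _) = v)//; apply/funext => x.
  by have [_] := dv x.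
move=> h; split; first exact: smooth_tensor_continuous.
by move=> i x; have [v sv dv] := smooth_tensor_derive i h; have [] := dv x.
Qed.

Lemma smooth_prod (h : 'I_d -> R -> R[i]) :
  (forall i, smooth_line (fun x => complex.Re (h i x))) ->
  (forall i, smooth_line (fun x => complex.Im (h i x))) ->
  smooth (fun x : 'rV[R]_d => \prod_i h i (x ord0 i)).
Proof.
move=> hR hI; suff [s1 s2] : smooth_tensor (fun x : 'rV[R]_d => complex.Re (\prod_i h i (x ord0 i))) /\
    smooth_tensor (fun x : 'rV[R]_d => complex.Im (\prod_i h i (x ord0 i))).
  by split; exact: smooth_tensor_smooth.
elim: (index_enum _) => [|i s [IH1 IH2]].
  by split; under eq_fun do rewrite big_nil; exact: tensor_cst.
have t1 := tensor_line i (hR i); have t2 := tensor_line i (hI i).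
split.
  rewrite (_ : (fun x => _) = (fun x : 'rV[R]_d =>
     complex.Re (h i (x ord0 i)) * complex.Re (\prod_(i <- s) h i (x ord0 i)) +
     (-1) * (complex.Im (h i (x ord0 i)) * complex.Im (\prod_(i <- s) h i (x ord0 i))))).
    apply: tensor_add; first exact: tensor_mul.
    by apply: tensor_mul; [exact: tensor_cst|exact: tensor_mul].
  apply/funext => x; rewrite big_cons; case: (h _ _) => a b; case: (\prod_(_ <- _) _) => a' b' /=.
  by rewrite mulN1r.
rewrite (_ : (fun x => _) = (fun x : 'rV[R]_d =>
     complex.Re (h i (x ord0 i)) * complex.Im (\prod_(i <- s) h i (x ord0 i)) +
     complex.Im (h i (x ord0 i)) * complex.Re (\prod_(i <- s) h i (x ord0 i)))).
  by apply: tensor_add; exact: tensor_mul.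
by apply/funext => x; rewrite big_cons; case: (h _ _) => a b; case: (\prod_(_ <- _) _) => a' b' /=.
Qed.

Lemma pderiv_off (C : set 'rV[R]_d) u s : closed C -> (forall x, ~ C x -> u x = 0) ->
  forall x, ~ C x -> pderiv s u x = 0.
Proof.
move=> cC u0; elim: s => [//|i s IH] x Cx /=.
have nx : \near x, (fun=> 0) x = pderiv s u x.
  have : \forall y \near x, ~ C y by exact: (open_nbhs_nbhs (conj (closed_openC cC) Cx)).
  by apply: filterS => y /IH.
by rewrite -(near_eq_derive _ nx) derive_cst.
Qed.

Lemma compact_bound (C : set 'rV[R]_d) u : compact C -> continuous u ->
  exists2 M : R, 0 <= M & forall x, C x -> `|u x| <= M.
Proof.
move=> cC cu; have cuC : compact (u @` C).
  by apply: continuous_compact => //; exact: continuous_subspaceT.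
have [M [_ hM]] := compact_bounded cuC.
exists (`|M| + 1) => [|x Cx]; first by rewrite addr_ge0.
by apply: hM; [rewrite ltr_pwDr// ler_norm|exists x].
Qed.

Lemma smooth_compact_schwartz f : smooth f -> compact (supp f) -> schwartz f.
Proof.
move=> sf cf; split => // N; have [s1 s2] := sf; set C := supp f.
have clC : closed C by exact: closed_closure.
have f0 x : ~ C x -> f x = 0.
  by move=> Cx; apply/eqP/negPn/negP => fx; apply: Cx; exact: subset_closure.
have [Mx [_ hMx]] := compact_bounded cf; pose Lx := `|Mx| + 1.
have xL x : C x -> `|x| <= Lx by apply: hMx; rewrite ltr_pwDr// ler_norm.
have bnd s : exists M : R, 0 <= M /\ forall x, (1 + `|x|) ^+ N * normc (cpderiv s f x) <= M.
  have [M1 M10 h1] := compact_bound cf (s1 s).1; have [M2 M20 h2] := compact_bound cf (s2 s).1.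
  have Lx0 : 0 <= 1 + Lx by rewrite addr_ge0// addr_ge0.
  exists ((1 + Lx) ^+ N * (M1 + M2)); split; first by rewrite mulr_ge0 ?exprn_ge0// addr_ge0.
  move=> x; have [Cx|Cx] := pselect (C x).
    apply: ler_pM; rewrite ?normc_ge0 ?exprn_ge0 ?addr_ge0//.
      by rewrite lerXn2r ?nnegrE ?addr_ge0// lerD2l xL.
    by apply: le_trans (normc_ReIm _) _; apply: lerD; [exact: h1|exact: h2].
  rewrite /cpderiv (pderiv_off s clC _ Cx); last by move=> y /f0 ->.
  rewrite (pderiv_off s clC _ Cx); last by move=> y /f0 ->.
  by rewrite normc0 mulr0 mulr_ge0 ?exprn_ge0// addr_ge0.
have [B hB] := choice bnd.
apply: (@le_lt_trans _ _ (\sum_(n < N.+1) \sum_(t : n.-tuple 'I_d) B (val t))%:E); last exact: ltry.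
have B0 s : 0 <= B s by have [] := hB s.
apply: ub_ereal_sup => _ [s sN [x _ <-]]; rewrite lee_fin.
have hs : (size s < N.+1)%N by [].
rewrite (bigD1 (Ordinal hs))//= (bigD1 (in_tuple s))//=.
have [_ hx] := hB s; apply: le_trans (hx x) _.
rewrite -addrA lerDl addr_ge0//; first by apply: sumr_ge0 => t _; exact: B0.
by apply: sumr_ge0 => n _; apply: sumr_ge0 => t _; exact: B0.
Qed.

Definition box (a b : 'I_d -> R) : set 'rV[R]_d := [set x | forall i, a i <= x ord0 i <= b i].

Lemma compact_box a b : compact (box a b).
Proof.
apply: bounded_closed_compact.
  exists (\sum_i (`|a i| + `|b i|)); split; first exact: num_real.
  move=> M hM x xab /=; apply: le_trans (ltW hM).
  have S0 : 0 <= \sum_i (`|a i| + `|b i|) by apply: sumr_ge0 => i _; rewrite addr_ge0.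
  apply/(rV_norm_le x S0) => i.
  have /andP[h1 h2] := xab i; apply: (@le_trans _ _ (`|a i| + `|b i|)); last first.
    by rewrite (bigD1 i)//= lerDl sumr_ge0// => j _; rewrite addr_ge0.
  rewrite ler_norml; have := ler_norm (b i); have := ler_norm (- a i); rewrite normrN.
  by have := normr_ge0 (a i); have := normr_ge0 (b i); move=> *; apply/andP; split; lra.
rewrite (_ : box a b = \bigcap_i ((fun x : 'rV[R]_d => x ord0 i) @^-1` `[a i, b i])).
  apply: closed_bigI => i _; apply: closed_comp; last exact: interval_closed.
  by move=> x _; exact: coord_continuous.
apply/seteqP; split => x h i; first by move=> _; rewrite /= in_itv/=; exact: h.
by have := h i I; rewrite /= in_itv.
Qed.

Lemma tensor_test_function (Omega : set 'rV[R]_d) (h : 'I_d -> R -> R[i]) a b :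
  (forall i, smooth_line (fun x => complex.Re (h i x))) ->
  (forall i, smooth_line (fun x => complex.Im (h i x))) ->
  (forall i x, ~~ (a i <= x <= b i) -> h i x = 0) -> box a b `<=` Omega ->
  test_function Omega (fun x : 'rV[R]_d => \prod_i h i (x ord0 i)).
Proof.
move=> hR hI h0 abO; set f := fun x => _.
have fab : supp f `<=` box a b.
  have cb : closed (box a b) by apply: compact_closed; [exact: norm_hausdorff|exact: compact_box].
  rewrite [X in _ `<=` X]((closure_id _).1 cb); apply: closure_subset => x /= fx i.
  apply/negPn/negP => xi; move/negP: fx; apply; apply/eqP.
  by rewrite /f (bigD1 i)//= h0// mul0r.
split; [exact: smooth_prod| |exact: subset_trans abO].
by apply: subclosed_compact fab; [exact: closed_closure|exact: compact_box].
Qed.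

End smooth_tensors.

(** * Uniqueness of the coefficients inside the domain *)

Section wavelet_mollification.
Context {R : realType}.
Local Notation T := (measurableTypeR R).
Local Notation leb := (@lebesgue_measure R).
Local Open Scope complex_scope.

Definition derivative_chain K (h : nat -> R -> R) : Prop :=
  (forall n, (n < K)%N -> forall x : R, is_derive x 1 (h n) (h n.+1 x)) /\
  (forall n, (n <= K)%N -> continuous (h n)).

Lemma realCK_chain K (f : R -> R) : realCK K f -> derivative_chain K (fun n => derive1n n f).
Proof.
move=> [h1 h2]; split => // n nK x; have d := h1 n nK x.
by apply: DeriveDef => //; rewrite -derive1E.
Qed.

Lemma chain_affine K (h : nat -> R -> R) (c a b : R) : derivative_chain K h ->
  derivative_chain K (fun n x => c * a ^+ n * h n (a * x + b)).
Proof.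
move=> [h1 h2]; split=> [n nK x|n nK x].
  have d1 : is_derive x 1 (fun x : R => a * x + b) a.
    rewrite -[X in is_derive _ _ _ X]addr0; apply: is_deriveD.
    by rewrite -[X in is_derive _ _ _ X]mulr1; apply: (@is_deriveZ _ _ _ id).
  have d2 := @is_derive1_comp _ (h n) (fun x => a * x + b) x _ _ (h1 n nK _) d1.
  have := is_deriveZ (c * a ^+ n) d2; congr is_derive.
  by rewrite /GRing.scale/= exprS; ring.
apply: cvgM; first exact: cvg_cst.
apply: (@continuous_comp _ _ _ (fun x : R => a * x + b) (h n)); last exact: h2.
by apply: cvgD; [exact: mulrl_continuous|exact: cvg_cst].
Qed.

Lemma chain_bounded K (h : nat -> R -> R) (a b : R) : derivative_chain K h ->
  (forall x, ~~ (a <= x <= b) -> h 0%N x = 0) ->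
  exists2 A : R, 0 <= A & forall n, (n <= K)%N -> forall x, `|h n x| <= A.
Proof.
move=> [h1 h2] h0.
have hn n : (n <= K)%N -> forall x, ~~ (a <= x <= b) -> h n x = 0.
  elim: n => [|n IH] nK x xab; first exact: h0.
  have nx : \near x, (fun=> 0) x = h n x.
    have : \forall y \near x, ~ `[a, b]%classic y.
      apply: (open_nbhs_nbhs (conj (closed_openC _) _)); first exact: interval_closed.
      by rewrite /= in_itv/=; exact/negP.
    by apply: filterS => y yab; rewrite IH ?(ltnW nK)//; apply/negP => yab'; apply: yab; rewrite /= in_itv.
  have [_ <-] := h1 n nK x.
  by rewrite -(near_eq_derive _ nx) derive_cst.
pose L := `|a| + `|b|.
have xL x : a <= x <= b -> `|x| <= L.
  move=> /andP[ax xb]; rewrite ler_norml /L; have := ler_norm b; have := ler_norm (- a); rewrite normrN.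
  by have := normr_ge0 a; have := normr_ge0 b; move=> *; apply/andP; split; lra.
have : forall n, exists M : R, 0 <= M /\ ((n <= K)%N -> forall x, `|h n x| <= M).
  move=> n; have [nK|_] := leqP n K; last by exists 0.
  have [M M0 hM] := continuous_bounded L (h2 n nK); exists M; split => // _ x.
  have [xab|xab] := boolP (a <= x <= b); first exact/hM/xL.
  by rewrite hn// normr0.
move=> /choice[M hM].
have M0 n : 0 <= M n by have [] := hM n.
exists (\sum_(n < K.+1) M n); first by apply: sumr_ge0.
move=> n nK x; have [_ /(_ nK x) hx] := hM n; apply: le_trans hx _.
by rewrite (bigD1 (Ordinal (nK : n < K.+1)%N))//= lerDl sumr_ge0.
Qed.

Variables (K : nat) (phi psi : R -> R[i]) (L B : R).
Hypotheses (W : wavelet_system K phi psi) (L0 : 0 < L) (B0 : 0 < B).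
Hypothesis phiB : forall x, normc (phi x) <= B * \1_(`[- L, L]%classic) x.
Hypothesis psiB : forall x, normc (psi x) <= B * \1_(`[- L, L]%classic) x.
Local Notation w := (wavelet1 phi psi).

Lemma wavelet1_conj_chain j k : exists g h : nat -> R -> R,
  [/\ forall x, conjc (w j k x) = g 0%N x +i* h 0%N x, derivative_chain K g & derivative_chain K h].
Proof.
have [c [a [b [f [cf wE]]]]] : exists (c a b : R) f, CK K f /\ forall x, w j k x = c%:C * f (a * x + b).
  case: j => [|j].
    exists 1, 1, (- k%:~R), phi; split; first exact: scaling_CK W.
    by move=> x; rewrite /= !mul1r.
  exists (Num.sqrt 2)^-1, (2 ^+ j), (- k%:~R), psi; split; first exact: wavelet_CK W.
  by [].
have [cR cI] := cf.
exists (fun n x => c * a ^+ n * derive1n n (fun x => complex.Re (f x)) (a * x + b)).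
exists (fun n x => (- c) * a ^+ n * derive1n n (fun x => complex.Im (f x)) (a * x + b)).
split; last 2 first.
- exact: (chain_affine c a b (realCK_chain cR)).
- exact: (chain_affine (- c) a b (realCK_chain cI)).
- move=> x; rewrite wE /= !expr0 !mulr1; case: (f _) => u v; apply/eqP; rewrite eq_complex /=.
  by apply/andP; split; apply/eqP; ring.
Qed.

(** Smooth approximations of the conjugate wavelets, with the bounds that make
    the wavelet coefficients decay uniformly in [e]. *)
Lemma wavelet1_mollified j k : (0 < K)%N -> exists2 A : R, 0 <= A & forall e : R, 0 < e ->
  exists F : R -> R[i], [/\ smooth_line (fun x => complex.Re (F x)) /\ smooth_line (fun x => complex.Im (F x)),
    forall x, normc (F x) <= A, taylor_bound K A F,
    forall x, ~~ ((k%:~R - L) / 2 ^+ j.-1 - e <= x <= (k%:~R + L) / 2 ^+ j.-1 + e) -> F x = 0 &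
    forall x, normc (F x - conjc (w j k x)) <= A * e].
Proof.
move=> K0; have [g [h [wE cg ch]]] := wavelet1_conj_chain j k.
set a := (k%:~R - L) / 2 ^+ j.-1; set b := (k%:~R + L) / 2 ^+ j.-1.
have w0 x : ~~ (a <= x <= b) -> g 0%N x = 0 /\ h 0%N x = 0.
  move=> xab; have : w j k x = 0.
    apply/eq0_normc/eqP; rewrite eq_le normc_ge0 andbT.
    apply: le_trans (wavelet1_norm phiB psiB j k x) _.
    by rewrite indicE memNset ?mulr0// /wsupp/= in_itv/=; exact/negP.
  by move=> wx; have := wE x; rewrite wx => -[<- <-]; rewrite oppr0.
have [A1 A10 hA1] := chain_bounded cg (fun x xab => (w0 x xab).1).
have [A2 A20 hA2] := chain_bounded ch (fun x xab => (w0 x xab).2).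
pose A := A1 + A2; have A0 : 0 <= A by rewrite addr_ge0.
have hg n : (n <= K)%N -> forall x, `|g n x| <= A by move=> nK x; rewrite (le_trans (hA1 n nK x))// lerDl.
have hh n : (n <= K)%N -> forall x, `|h n x| <= A by move=> nK x; rewrite (le_trans (hA2 n nK x))// lerDr.
exists (2 * A); first by rewrite mulr_ge0.
move=> e e0.
have [G [sG dG bG zG aG]] := mollification K0 e0 cg.1 cg.2 hg (fun x xab => (w0 x xab).1).
have [H [sH dH bH zH aH]] := mollification K0 e0 ch.1 ch.2 hh (fun x xab => (w0 x xab).2).
exists (fun x => G 0%N x +i* H 0%N x); split => //.
- move=> x; apply: le_trans (normc_ReIm _) _ => /=.
  by rewrite mulr_natl mulr2n lerD ?bG ?bH.
- apply: (@taylor_bound_ReIm _ K A _ G H) => // x; [exact: bG|exact: bH].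
- by move=> x xab; rewrite zG// zH.
- move=> x; rewrite wE; apply: le_trans (normc_ReIm _) _; simpc => /=.
  by rewrite -mulrA mulr_natl mulr2n lerD.
Qed.

End wavelet_mollification.


Section coefficient_uniqueness.
Context {R : realType} {d : nat}.
Local Notation T := (measurableTypeR R).
Local Notation leb := (@lebesgue_measure R).
Local Open Scope complex_scope.
Variables (K : nat) (phi psi : R -> R[i]) (L B : R).
Hypotheses (W : wavelet_system K phi psi) (L0 : 0 < L) (B0 : 0 < B).
Hypothesis phiB : forall x, normc (phi x) <= B * \1_(`[- L, L]%classic) x.
Hypothesis psiB : forall x, normc (psi x) <= B * \1_(`[- L, L]%classic) x.
Local Notation w := (wavelet1 phi psi).
Local Notation rw l f := (regular (wavelet phi psi l) f).
Let L0' : 0 <= L. Proof. exact: ltW. Qed.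
Let B0' : 0 <= B. Proof. exact: ltW. Qed.

Lemma near_prod (I : Type) (s : seq I) (a : nat -> I -> R[i]) (b : I -> R[i]) :
  (forall i (e : R), 0 < e -> \forall n \near \oo, normc (a n i - b i) <= e) ->
  forall e : R, 0 < e -> \forall n \near \oo, normc (\prod_(i <- s) a n i - \prod_(i <- s) b i) <= e.
Proof.
move=> h; elim: s => [|i s IH] e e0.
  by apply: nearW => n; rewrite !big_nil subrr normc0 ltW.
set Q := \prod_(i <- s) b i in IH.
pose e1 := e / 2 / (normc Q + 1); pose e2 := e / 2 / (normc (b i) + 1).
have q0 : 0 < normc Q + 1 by rewrite ltr_wpDl// normc_ge0.
have b0 : 0 < normc (b i) + 1 by rewrite ltr_wpDl// normc_ge0.
have e10 : 0 < e1 by rewrite !divr_gt0.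
have e20 : 0 < e2 by rewrite !divr_gt0.
near=> n.
have h1 : normc (\prod_(i <- s) a n i - Q) <= 1 by near: n; exact: IH.
have h2 : normc (\prod_(i <- s) a n i - Q) <= e2 by near: n; exact: IH.
have h3 : normc (a n i - b i) <= e1 by near: n; exact: h.
rewrite !big_cons -/Q; set P := \prod_(i <- s) a n i in h1 h2 *.
have -> : a n i * P - b i * Q = (a n i - b i) * P + b i * (P - Q) by ring.
have hP : normc P <= normc Q + 1 by rewrite (le_trans (normc_distD Q P))// lerD2l.
apply: le_trans (le_normcD _ _) _; rewrite !normcM [e]splitr; apply: lerD.
  apply: le_trans (ler_pM (normc_ge0 _) (normc_ge0 _) h3 hP) _.
  by rewrite /e1 divfK// gt_eqF.
apply: le_trans (ler_wpM2l (normc_ge0 _) h2) _.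
rewrite /e2 mulrCA ler_piMr ?divr_ge0 ?(ltW e0)// ler_pdivrMr// mul1r lerDl//.
Unshelve. all: by end_near. Qed.

(** The functionals that vanish on Omega only determine the coefficients of the
    wavelets supported well inside Omega: these are found by pairing with smooth
    approximations of the conjugate wavelet, all other terms being orthogonal in
    the limit. *)
Lemma interior_coefficient_zero (rho : nat) (M eps : R) (Omega : set 'rV[R]_d) (c : windex d -> R[i])
    (l0 : windex d) : (rho + 2 <= K)%N -> 0 <= M -> 0 < eps -> bounded_set Omega ->
  (forall l, normc (c l) <= M * 2 ^+ (rho * norm1 l.1)) ->
  (forall f, test_function Omega f -> csums (fun l => c l * rw l f) 0) ->
  box (fun i => ((l0.2 i)%:~R - L) / 2 ^+ (l0.1 i).-1 - eps)
      (fun i => ((l0.2 i)%:~R + L) / 2 ^+ (l0.1 i).-1 + eps) `<=` Omega ->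
  c l0 = 0.
Proof.
move=> rK M0 eps0 bO hc hz l0O; have K0 : (0 < K)%N by apply: leq_trans rK; rewrite addn2.
have [D hD] := nabla_boxed L0 phiB psiB bO.
have : forall i : 'I_d, exists A : R, 0 <= A /\ forall n : nat, exists F : R -> R[i],
   [/\ smooth_line (fun x => complex.Re (F x)) /\ smooth_line (fun x => complex.Im (F x)),
    forall x, normc (F x) <= A, taylor_bound K A F,
    forall x, ~~ (((l0.2 i)%:~R - L) / 2 ^+ (l0.1 i).-1 - eps / n.+1%:R <= x <=
       ((l0.2 i)%:~R + L) / 2 ^+ (l0.1 i).-1 + eps / n.+1%:R) -> F x = 0 &
    forall x, normc (F x - conjc (w (l0.1 i) (l0.2 i) x)) <= A * (eps / n.+1%:R)].
  move=> i; have [A A0 hA] := wavelet1_mollified W phiB psiB (l0.1 i) (l0.2 i) K0.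
  by exists A; split => // n; apply: hA; rewrite divr_gt0.
move=> /choice[A hA]; have A0 i : 0 <= A i by have [] := hA i.
have /choice[F hF] : forall i : 'I_d, exists F : nat -> R -> R[i], forall n,
   [/\ smooth_line (fun x => complex.Re (F n x)) /\ smooth_line (fun x => complex.Im (F n x)),
    forall x, normc (F n x) <= A i, taylor_bound K (A i) (F n),
    forall x, ~~ (((l0.2 i)%:~R - L) / 2 ^+ (l0.1 i).-1 - eps / n.+1%:R <= x <=
       ((l0.2 i)%:~R + L) / 2 ^+ (l0.1 i).-1 + eps / n.+1%:R) -> F n x = 0 &
    forall x, normc (F n x - conjc (w (l0.1 i) (l0.2 i) x)) <= A i * (eps / n.+1%:R)].
  move=> i; have [_ hi] := hA i; have [G hG] := choice hi; exists G => n; exact: hG.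
have mF i n : cmeas (F i n : T -> R[i]).
  by have [[s1 s2] _ _ _ _] := hF i n; apply: cmeas_continuous; exact: smooth_line_continuous.
pose eta n : 'rV[R]_d -> R[i] := fun x => \prod_i F i n (x ord0 i).
have teta n : test_function Omega (eta n).
  apply: (@tensor_test_function _ _ Omega (fun i => F i n) _ _ _ _ _ l0O) => [i|i|i x xi].
  - by have [[s1 s2] _ _ _ _] := hF i n.
  - by have [[s1 s2] _ _ _ _] := hF i n.
  - have [_ _ _ F0 _] := hF i n; apply: F0; apply: contra xi => /andP[h1 h2].
    have en : eps / n.+1%:R <= eps by rewrite ler_pdivrMr// ler_peMr ?(ltW eps0)// ler1n.
    by move: h1 h2 en; set u := eps / _ => h1 h2 en; apply/andP; split=> /=; lra.
have seta n : schwartz (eta n) by have [s1 s2 _] := teta n; exact: smooth_compact_schwartz.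
pose I j k i n := cintegral leb (fun x => w j k x * F i n x).
have pair n l : rw l (eta n) = \prod_i I (l.1 i) (l.2 i) i n.
  rewrite regular_schwartz//.
  have bb i := bounded_onMl (wavelet1_bounded W L0 B0 phiB psiB (l.1 i) (l.2 i))
     (mF i n) (A0 i) (fun x _ => let: And5 _ h _ _ _ := hF i n in h x).
  have ct : cintegral (lebesgue_measure_d R d)
      (fun t => \prod_i (F i n (tnth t i) * w (l.1 i) (l.2 i) (tnth t i))) =
    \prod_i cintegral leb (fun x => F i n x * w (l.1 i) (l.2 i) x) := cintegral_tensor bb.
  transitivity (\prod_i cintegral leb (fun x => F i n x * w (l.1 i) (l.2 i) x)).
    rewrite -ct; congr cintegral; apply/funext => t; rewrite wavelet_vec /eta -big_split.
    by apply: eq_bigr => i _; rewrite vecE mulrC.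
  apply: eq_bigr => i _; rewrite /I; congr cintegral; apply/funext => x; exact: mulrC.
pose C1 : R := 4 * B * L * (1 + 2 * L) ^+ K.
have C10 : 0 <= C1 by rewrite !mulr_ge0// exprn_ge0// addr_ge0// mulr_ge0.
pose P := \prod_(i < d) (C1 * A i); have P0 : 0 <= P by apply: prodr_ge0 => i _; rewrite mulr_ge0.
have pair_le n l : normc (rw l (eta n)) <= P / 2 ^+ (K * norm1 l.1).
  rewrite pair normc_prod.
  apply: (@le_trans _ _ (\prod_i (C1 * A i / 2 ^+ (K * l.1 i)))).
    apply: ler_prod => i _; rewrite normc_ge0/=; have [_ h1 h2 _ _] := hF i n.
    exact: (wavelet1_decay W L0 B0 phiB psiB _ _ (A0 i) (mF i n) h1 h2).
  by rewrite big_split/= prodfV -expr_sum big_distrr.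
have box_lim (l : windex d) i (e : R) : 0 < e -> \forall n \near \oo,
    normc (I (l.1 i) (l.2 i) i n -
       cintegral leb (fun x => w (l.1 i) (l.2 i) x * conjc (w (l0.1 i) (l0.2 i) x))) <= e.
  move=> e0; pose Q := 2 * (A i * eps * B) * (2 * L) + 1.
  have Q0 : 0 < Q by rewrite ltr_wpDl// !mulr_ge0// ltW.
  near=> n; have [_ h1 _ _ h2] := hF i n.
  have bw := wavelet1_bounded W L0 B0 phiB psiB.
  pose G x := F i n x - conjc (w (l0.1 i) (l0.2 i) x).
  have mw : cmeas (fun x : T => conjc (w (l0.1 i) (l0.2 i) x)).
    by apply: cmeas_conj; exact: (cmeas_wavelet1 W).
  have mG : cmeas (G : T -> R[i]).
    have -> : G = (fun x => F i n x + (-1) * conjc (w (l0.1 i) (l0.2 i) x)).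
      by apply/funext => x; rewrite mulN1r.
    by apply: cmeasD => //; apply: cmeasM => //; exact: cmeas_cst.
  have An0 : 0 <= A i * (eps / n.+1%:R) by rewrite mulr_ge0// divr_ge0// ltW.
  have bG := bounded_onMl (bw (l.1 i) (l.2 i)) mG An0 (fun x _ => h2 x).
  have bW := bounded_on_M (bw (l.1 i) (l.2 i)) (bounded_on_conj (bw (l0.1 i) (l0.2 i))).
  have -> : I (l.1 i) (l.2 i) i n =
     cintegral leb (fun x => w (l.1 i) (l.2 i) x * conjc (w (l0.1 i) (l0.2 i) x)) +
     cintegral leb (fun x => G x * w (l.1 i) (l.2 i) x).
    rewrite -(cintegralD bW bG); congr cintegral; apply/funext => x.
    by rewrite [G x * _]mulrC -mulrDr /G addrC subrK.
  rewrite addrAC subrr add0r; apply: le_trans (cintegral_le bG) _.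
  have [_ /andP[f0 f1]] := leb_wsupp_fin L0 (l.1 i) (l.2 i).
  apply: (@le_trans _ _ (2 * (A i * (eps / n.+1%:R) * B) * (2 * L))).
    by rewrite ler_wpM2l// !mulr_ge0// ?invr_ge0// ltW.
  have -> : 2 * (A i * (eps / n.+1%:R) * B) * (2 * L) = (2 * (A i * eps * B) * (2 * L)) / n.+1%:R.
    by set v := (_^-1); ring.
  apply: (@le_trans _ _ (Q / n.+1%:R)); first by rewrite ler_wpM2r ?invr_ge0// lerDl.
  rewrite ler_pdivrMr// -ler_pdivrMl// mulrC.
  apply: (@le_trans _ _ n%:R); last by rewrite ler_nat.
  by near: n; exact: nbhs_infty_ger.
pose lim (l : windex d) := \prod_i cintegral leb (fun x => w (l.1 i) (l.2 i) x * conjc (w (l0.1 i) (l0.2 i) x)).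
have pair_lim l (e : R) : 0 < e -> \forall n \near \oo, normc (rw l (eta n) - lim l) <= e.
  move=> e0; have := near_prod (index_enum 'I_d) (box_lim l) e0.
  by apply: filterS => n; rewrite pair.
pose Mz (l : windex d) : R := (M * P) * ((boxed D l)%:R * 2 ^- (2 * norm1 l.1)).
have near_c l e : 0 < e -> \forall n \near \oo, normc (c l * lim l - c l * rw l (eta n)) <= e.
  move=> e0; have c1 : 0 < normc (c l) + 1 by rewrite ltr_wpDl ?normc_ge0.
  have := pair_lim l (e / (normc (c l) + 1)) (divr_gt0 e0 c1); apply: filterS => n h.
  rewrite -mulrBr normcM normcB; apply: le_trans (ler_wpM2l (normc_ge0 _) h) _.
  by rewrite mulrCA ler_piMr ?(ltW e0)// ler_pdivrMr// mul1r lerDl.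
have : c l0 * lim l0 = 0.
  apply: (@csums0_dominated _ _ (fun n l => c l * rw l (eta n)) Mz
    (M * P * ((2 * D + 1)%:R ^+ d * 2 ^+ d)) l0).
  - by move=> l; rewrite !mulr_ge0// invr_ge0 exprn_ge0.
  - by move=> S; rewrite -mulr_sumr ler_wpM2l ?mulr_ge0// sum_boxed_geometric.
  - move=> n l; have [/hD bl|nl] := pselect (nabla phi psi Omega l); last first.
      by rewrite (regular_outside_nabla (teta n) nl) mulr0 normc0 !mulr_ge0// invr_ge0 exprn_ge0.
    rewrite normcM /Mz bl mul1r.
    apply: le_trans (ler_pM (normc_ge0 _) (normc_ge0 _) (hc l) (pair_le n l)) _.
    rewrite mulrACA ler_wpM2l ?mulr_ge0// ler_pdivrMr ?exprn_gt0// mulrC.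
    rewrite ler_pdivlMr ?exprn_gt0// -exprD ler_weXn2l ?ler1n//.
    by rewrite -mulnDl leq_mul2r rK orbT.
  - by move=> n; exact/hz.
  - move=> l ll0 e e0; have lim0 : lim l = 0.
      have [i hi] : exists i, ~~ ((l.1 i == l0.1 i) && (l.2 i == l0.2 i)).
        apply/existsP; rewrite -negb_forall; apply: contra ll0 => /forallP h.
        apply/eqP; case: (l) (l0) h => [j k] [j' k'] /= h.
        by congr (_, _); apply/ffunP => i; have /andP[/eqP ? /eqP ?] := h i.
      by rewrite /lim (bigD1 i)//= (wavelet1_gram W L0 B0 phiB psiB) (negbTE hi) mul0r.
    have := near_c l e e0; apply: filterS => n; by rewrite lim0 mulr0 normcB subr0.
  - by move=> e; exact: near_c.
move=> /eqP; rewrite mulf_eq0 => /orP[/eqP//|/eqP h]; exfalso; move/eqP: h; apply/negP.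
rewrite prodf_seq_neq0; apply/allP => i _ /=.
rewrite (wavelet1_gram W L0 B0 phiB psiB) !eqxx /=.
by rewrite (inj_eq (@complexI R) _ 0) invr_eq0 expf_neq0 ?pnatr_eq0.
Unshelve. all: by end_near. Qed.

End coefficient_uniqueness.

(** * Selection of the coefficients that are kept *)

Section recip_order.
Context {R : realType}.
Implicit Types p q : \bar R.

Lemma recip_le p q : (0 < p)%E -> (p <= q)%E -> recip q <= recip p.
Proof.
case: p => [p|_|//]; last by rewrite leye_eq => /eqP ->.
rewrite lte_fin => p0; case: q => [q|_|//]; last by rewrite recip_pinfty recip_ge0.
rewrite lee_fin => pq; rewrite !recip_fin//; last exact: lt_le_trans pq.
by rewrite lef_pV2 ?posrE// (lt_le_trans p0).
Qed.

Lemma recip_lt p q : (0 < p)%E -> (p < q)%E -> recip q < recip p.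
Proof.
case: p => [p|_|//]; last by rewrite ltNge leey.
rewrite lte_fin => p0; case: q => [q|_|//]; last by rewrite recip_pinfty recip_fin// invr_gt0.
rewrite lte_fin => pq; rewrite !recip_fin//; last exact: lt_trans pq.
by rewrite ltf_pV2 ?posrE// (lt_trans p0).
Qed.

End recip_order.

Lemma lp_le_zero {R : realType} {I : choiceType} (p : \bar R) (F : {fset I}) (x : I -> R) (A : R) :
  (0 < p)%E -> 0 <= A -> (forall k, k \in F -> x k = 0) -> lp_le p F x A.
Proof.
case: p => [r|_|//]; last by move=> A0 x0 k /x0 ->.
rewrite lte_fin => r0 A0 x0 /=; rewrite big_seq big1 ?powR_ge0// => k /x0 ->.
by rewrite powR0// gt_eqF.
Qed.

Section selection.
Context {R : realType} {d : nat}.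
Variables (D : nat) (p0 p1 : \bar R) (r0 r1 s0 s1 : R).
Implicit Types (a : windex d -> R[i]) (j : level d) (n N : R).
Hypotheses (d0 : (0 < d)%N) (p00 : (0 < p0)%E) (p10 : (0 < p1)%E).
Local Notation gamma := (Num.max (recip p0 - recip p1) 0).
Local Notation delta := (s1 - s0).
Local Notation beta := ((r0 - r1) - (s1 - s0)).
Local Notation alpha := ((r0 - r1) - (s1 - s0) - gamma).
Hypotheses (delta0 : 0 < delta) (alpha0 : 0 < alpha).
Let eps := delta / (2 * alpha).
Local Notation lw0 := (level_weight p0 r0 s0).
Local Notation lw1 := (level_weight p1 r1 s1).
Local Notation nrm a j := (fun k => normc (a (j, k))).
Local Notation E j := (alpha * tilted eps j + delta / 2 * (excess j)%:R).

Lemma eps_gt0 : 0 < eps. Proof. by rewrite divr_gt0// mulr_gt0. Qed.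

Lemma tilted_ge0 j : 0 <= tilted eps j.
Proof. by rewrite addr_ge0// mulr_ge0// ltW// eps_gt0. Qed.

Lemma tilt_rate j : E j = alpha * (norm1 j)%:R + delta * (excess j)%:R.
Proof. by rewrite /tilted /eps; field; rewrite gt_eqF. Qed.

(** The loss between the two scales, at the level [j]. *)
Lemma level_weight_diff j : lw0 j - lw1 j =
  (beta - (recip p0 - recip p1)) * (norm1 j)%:R + delta * (excess j)%:R.
Proof. by rewrite /level_weight excessE; ring. Qed.

Lemma level_embedding : exists2 C : R, 0 < C & forall N j a, 0 <= N ->
  lp_le p0 (box_shifts D j) (nrm a j) (N * 2 `^ (- lw0 j)) ->
  lp_le p1 (box_shifts D j) (nrm a j) (C * (N * 2 `^ (- E j)) * 2 `^ (- lw1 j)).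
Proof.
have nn a j k : 0 <= nrm a j k by exact: normc_ge0.
have [p01|/ltW p01] := leP p0 p1.
  exists 1 => // N j a N0 h; rewrite mul1r.
  have -> : N * 2 `^ (- E j) * 2 `^ (- lw1 j) = N * 2 `^ (- lw0 j).
    rewrite -mulrA -p2D; congr (_ * 2 `^ _); rewrite tilt_rate.
    have g : gamma = recip p0 - recip p1 by apply/max_idPl; rewrite subr_ge0 recip_le.
    rewrite g (_ : lw0 j = lw1 j + (lw0 j - lw1 j)); last by ring.
    by rewrite level_weight_diff; ring.
  by apply: lp_le_embed h => //; rewrite mulr_ge0// p2_ge0.
have g : gamma = 0 by apply/max_idPr; rewrite subr_le0 recip_le.
pose c : R := (2 * D + 1)%:R ^+ d; have c0 : 0 < c by rewrite exprn_gt0// ltr0n addn1.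
exists (2 `^ recip p1 * c `^ (recip p1 - recip p0)); first by rewrite mulr_gt0// ?p2_gt0// powR_gt0.
move=> N j a N0 h; pose z : R := c * 2 ^+ norm1 j.
have z0 : 0 < z by rewrite mulr_gt0// exprn_gt0.
have := lp_le_count p10 p01 z0 _ (card_box_shifts D j) (nn a j) h.
rewrite mulr_ge0 ?p2_ge0// => /(_ isT); congr lp_le.
rewrite /z powRM ?exprn_ge0 ?(ltW c0)// -p2_nat -powRrM tilt_rate g subr0.
have -> : - lw0 j = - lw1 j - ((beta - (recip p0 - recip p1)) * (norm1 j)%:R + delta * (excess j)%:R).
  by rewrite -level_weight_diff; ring.
rewrite [in LHS]p2D; have -> : - ((beta - (recip p0 - recip p1)) * (norm1 j)%:R + delta * (excess j)%:R) =
   - (beta * (norm1 j)%:R + delta * (excess j)%:R) - (norm1 j)%:R * (recip p1 - recip p0).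
  by ring.
rewrite [in LHS]p2D (powRN 2 ((norm1 j)%:R * _)).
have h0 := p2_gt0 ((norm1 j)%:R * (recip p1 - recip p0)).
by field; rewrite gt_eqF.
Qed.

Lemma card_by_levels (S : {fset windex d}) (v : level d -> R) (C : R) :
  (forall l, l \in S -> boxed D l) ->
  (forall j, \sum_(k <- box_shifts D j) ((j, k) \in S)%:R <= v j) ->
  (forall J : {fset level d}, \sum_(j <- J) v j <= C) -> (#|` S|)%:R <= C.
Proof.
move=> SD Sv vC; apply: le_trans (vC [fset l.1 | l in S]%fset).
apply: le_trans (ler_sum _ (fun j _ => Sv j)).
apply: (le_trans _ (@sum_windex_le R d D S (fun l => (l \in S)%:R) _ SD)); last by move=> l.
rewrite -sum1_size natr_sum big_seq [leRHS]big_seq.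
by apply: ler_sum => l ->.
Qed.

Lemma low_levels_sum n j : tilted eps j <= n ->
  2 ^+ norm1 j <= 2 `^ n * bump_weight eps 1 eps n j :> R.
Proof.
move=> jn; rewrite -p2_nat -p2D p2_le// /bump_weight ler0_norm ?subr_le0// /tilted.
lra.
Qed.

(** Linear selection: all coefficients on the levels with small tilt. *)
Lemma linear_selection : exists2 C : R, 0 < C & forall n, exists S : {fset windex d},
  [/\ forall l, l \in S -> boxed D l, (#|` S|)%:R <= C * 2 `^ n &
  forall N a, 0 <= N -> (forall j, lp_le p0 (box_shifts D j) (nrm a j) (N * 2 `^ (- lw0 j))) ->
  forall j, lp_le p1 (box_shifts D j) (fun k => if (j, k) \in S then 0 else normc (a (j, k)))
     (C * N * 2 `^ (- (alpha * n)) * bump_weight eps alpha (delta / 2) n j * 2 `^ (- lw1 j))].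
Proof.
have [C1 C10 hC1] := sum_bump_weight d0 (ltW eps_gt0) ltr01 eps_gt0.
have [C2 C20 hC2] := level_embedding.
pose c : R := (2 * D + 1)%:R ^+ d; have c0 : 0 < c by rewrite exprn_gt0// ltr0n addn1.
exists (c * C1 + C2); first by rewrite addr_gt0// mulr_gt0.
move=> n; pose B := (Num.truncn `|n|).+1.
have [S hS] := fset_boxed D B (fun l : windex d => tilted eps l.1 <= n).
have SE l : l \in S = (tilted eps l.1 <= n) && boxed D l.
  rewrite hS; case: (boolP (_ <= n)) => //= ln; case: (boxed D l) => //=.
  rewrite -(ler_nat R); apply: (@le_trans _ _ (tilted eps l.1)).
    apply: (@le_trans _ _ (norm1 l.1)%:R); first by rewrite ler_nat normoo_le_norm1.
    by rewrite lerDl mulr_ge0// ltW// eps_gt0.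
  apply: le_trans ln _; apply: le_trans (ler_norm _) _; rewrite ltW//.
  exact: truncnS_gt.
exists S; split.
- by move=> l; rewrite SE => /andP[].
- apply: (@le_trans _ _ (c * C1 * 2 `^ n)); last by rewrite ler_wpM2r ?p2_ge0// lerDl ltW.
  apply: (@card_by_levels S (fun j => c * 2 `^ n * bump_weight eps 1 eps n j)).
  + by move=> l; rewrite SE => /andP[].
  + move=> j; have [jn|jn] := boolP (tilted eps j <= n); last first.
      rewrite big1 => [|k _]; last by rewrite SE (negbTE jn).
      by rewrite !mulr_ge0 ?p2_ge0// ltW.
    apply: (@le_trans _ _ (\sum_(k <- box_shifts D j) 1)).
      by apply: ler_sum => k _; rewrite lern1 leq_b1.
    rewrite sum_const_fset mulr1; apply: le_trans (card_box_shifts D j) _.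
    by rewrite -mulrA ler_wpM2l ?(ltW c0)//; exact: low_levels_sum.
  + by move=> J; rewrite -mulr_sumr [leRHS]mulrAC ler_wpM2l ?mulr_ge0 ?p2_ge0// ?(ltW c0).
move=> N a N0 h j; have F0 : 0 <= N * 2 `^ (- (alpha * n)) * bump_weight eps alpha (delta / 2) n j * 2 `^ (- lw1 j).
  by rewrite !mulr_ge0 ?p2_ge0.
have [jn|jn] := leP (tilted eps j) n.
  have z k : k \in box_shifts D j -> (if (j, k) \in S then 0 else normc (a (j, k))) = 0.
    by rewrite mem_box_shifts SE /= jn => ->.
  apply: lp_le_zero => //; rewrite !mulr_ge0 ?p2_ge0// addr_ge0 ?mulr_ge0//;
  by rewrite ?(ltW c0) ?(ltW C10) ?(ltW C20).
apply: (lp_le_mono p10 _ _ (hC2 N j a N0 (h j))).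
  by move=> k _; case: ifP => _; rewrite ?lexx normc_ge0.
have -> : 2 `^ (- E j) = 2 `^ (- (alpha * n)) * bump_weight eps alpha (delta / 2) n j.
  rewrite /bump_weight -p2D gtr0_norm ?subr_gt0//; congr (_ `^ _); ring.
rewrite [X in 0 <= X <= _](_ : _ = C2 * (N * 2 `^ (- (alpha * n)) * bump_weight eps alpha (delta / 2) n j * 2 `^ (- lw1 j))).
  rewrite [X in _ <= _ <= X](_ : _ = (c * C1 + C2) * (N * 2 `^ (- (alpha * n)) * bump_weight eps alpha (delta / 2) n j * 2 `^ (- lw1 j))).
    by rewrite mulr_ge0 ?(ltW C20)//= ler_wpM2r// lerDr mulr_ge0// ltW.
  by ring.
by ring.
Qed.

(** Adaptive selection, when [p0 < p1]: on the levels with large tilt, the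
    coefficients above a threshold; the remaining ones gain the factor
    [z ^ (- gamma)] of the Stechkin estimate. *)
Lemma threshold_selection : (p0 < p1)%E -> exists2 C : R, 0 < C & forall n N a, 0 < N ->
  (forall j, lp_le p0 (box_shifts D j) (nrm a j) (N * 2 `^ (- lw0 j))) -> exists S : {fset windex d},
  [/\ forall l, l \in S -> boxed D l, (#|` S|)%:R <= C * 2 `^ n &
  forall j, lp_le p1 (box_shifts D j) (fun k => if (j, k) \in S then 0 else normc (a (j, k)))
     (C * N * 2 `^ (- (beta * n)) * bump_weight eps (alpha / 2) (delta / 4) n j * 2 `^ (- lw1 j))].
Proof.
move=> p01; have g0 : 0 < recip p0 - recip p1 by rewrite subr_gt0; exact: recip_lt.
have g : gamma = recip p0 - recip p1 by apply/max_idPl; exact: ltW.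
set ga := recip p0 - recip p1 in g0 g.
pose k1 := alpha / (2 * ga); pose k2 := delta / (4 * ga).
have k10 : 0 < k1 by rewrite divr_gt0// mulr_gt0.
have k20 : 0 < k2 by rewrite divr_gt0// mulr_gt0.
have [C1 C10 hC1] := sum_bump_weight d0 (ltW eps_gt0) ltr01 eps_gt0.
have [C2 C20 hC2] := sum_bump_weight d0 (ltW eps_gt0) k10 k20.
pose c : R := (2 * D + 1)%:R ^+ d; have c0 : 0 < c by rewrite exprn_gt0// ltr0n addn1.
exists (c * C1 + C2 + 1); first by rewrite addr_gt0// addr_gt0// mulr_gt0.
move=> n N a N0 h; pose z j := 2 `^ n * bump_weight eps k1 k2 n j.
have z0 j : 0 < z j by rewrite mulr_gt0 ?p2_gt0.
pose A j := N * 2 `^ (- lw0 j); have A0 j : 0 < A j by rewrite mulr_gt0 ?p2_gt0.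
pose tau j := A j * z j `^ (- recip p0).
pose big (l : windex d) := tau l.1 <= normc (a l).
pose B := (Num.truncn (`|n| + `|n| / k1)).+1.
have [S hS] := fset_boxed D B (fun l : windex d => (tilted eps l.1 <= n) || big l).
have nn j k : 0 <= nrm a j k by exact: normc_ge0.
have p0oo : (p0 < +oo)%E by apply: lt_le_trans p01 _; rewrite leey.
have cardbig j : \sum_(k <- box_shifts D j) (big (j, k))%:R <= z j.
  pose S2 := [fset k in box_shifts D j | big (j, k)]%fset.
  have s2 : (S2 `<=` box_shifts D j)%fset by apply/fsubsetP => k; rewrite !inE => /andP[].
  have hh : (#|` S2|)%:R <= z j.
    apply: (lp_le_large p00 p0oo (z0 j) (A0 j) (nn j) (h j) s2) => k.
    by rewrite !inE => /andP[_].
  apply: le_trans hh; rewrite -(big_fset_incl _ s2)//=; last first.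
    by move=> k kb; rewrite !inE kb /= => /negbTE ->.
  rewrite -[leRHS]mulr1 -sum_const_fset; apply: ler_sum => k _.
  by rewrite lern1 leq_b1.
have leB (m : nat) (x : R) : m%:R <= x -> x <= `|n| + `|n| / k1 -> (m <= B)%N.
  move=> mx xn; rewrite -(ler_nat R); apply: le_trans mx _; apply: le_trans xn _.
  by rewrite ltW//; exact: truncnS_gt.
have nT j : (normoo j)%:R <= tilted eps j.
  apply: (@le_trans _ _ (norm1 j)%:R); first by rewrite ler_nat normoo_le_norm1.
  by rewrite lerDl mulr_ge0// ltW// eps_gt0.
have nk : n <= `|n| + `|n| / k1.
  by rewrite (le_trans (ler_norm n))// lerDl divr_ge0// ltW.
have small l : boxed D l -> n < tilted eps l.1 -> l \notin S -> normc (a l) <= tau l.1.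
  move=> bl nl; apply: contraR; rewrite -ltNge => /ltW hb.
  rewrite hS bl /= {1}/big hb orbT /=; apply: (leB _ _ (nT l.1)).
  have z1 : 1 <= z l.1.
    apply: le_trans (cardbig l.1); rewrite (big_fsetD1 l.2)/=; last first.
      by rewrite mem_box_shifts; case: (l) bl.
    have -> : big (l.1, l.2) by rewrite /big /=; move: hb; case: (l).
    by rewrite lerDl sumr_ge0.
  have : 0 <= n - k1 * (tilted eps l.1 - n) - k2 * (excess l.1)%:R.
    rewrite leNgt; apply/negP => e0; move: z1; rewrite leNgt => /negP; apply.
    rewrite /z /bump_weight -p2D gtr0_norm ?subr_gt0//.
    have -> : n + (- (k1 * (tilted eps l.1 - n)) - k2 * (excess l.1)%:R) =
      - (- (n - k1 * (tilted eps l.1 - n) - k2 * (excess l.1)%:R)) by ring.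
    by rewrite p2_lt1// oppr_gt0.
  have ex0 : 0 <= k2 * (excess l.1)%:R by rewrite mulr_ge0// ltW.
  have nn' := ler_norm n; move=> e1.
  have : k1 * (tilted eps l.1 - n) <= `|n| by lra.
  by rewrite -ler_pdivlMl// mulrC => e2; lra.
exists S; split.
- by move=> l; rewrite hS => /and3P[].
- apply: (@le_trans _ _ ((c * C1 + C2) * 2 `^ n)); last by rewrite ler_wpM2r ?p2_ge0// lerDl.
  apply: (@card_by_levels S (fun j => c * 2 `^ n * bump_weight eps 1 eps n j + z j)).
  + by move=> l; rewrite hS => /and3P[].
  + move=> j; apply: (@le_trans _ _ (c * 2 `^ n * bump_weight eps 1 eps n j + \sum_(k <- box_shifts D j) (big (j, k))%:R));
      last by rewrite lerD2l; exact: cardbig.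
    have st k : ((j, k) \in S)%:R <= (tilted eps j <= n)%R%:R + (big (j, k))%:R :> R.
      rewrite hS /=; case: (tilted eps j <= n) => /=.
        by apply: ler_wpDr => //; rewrite lern1 leq_b1.
      by rewrite add0r ler_nat; case: (big _) => //=; rewrite leq_b1.
    apply: le_trans (ler_sum _ (fun k _ => st k)) _.
    rewrite big_split/= lerD2r sum_const_fset.
    have [jn|jn] := boolP (tilted eps j <= n); last by rewrite mulr0 !mulr_ge0 ?p2_ge0// ltW.
    rewrite mulr1; apply: le_trans (card_box_shifts D j) _.
    by rewrite -mulrA ler_wpM2l ?(ltW c0)//; exact: low_levels_sum.
  + move=> J; rewrite big_split/= -mulr_sumr /z -mulr_sumr mulrDl lerD//.
      by rewrite [leRHS]mulrAC ler_wpM2l ?mulr_ge0 ?p2_ge0// ?(ltW c0).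
    by rewrite mulrC ler_wpM2r ?p2_ge0.
move=> j; have F0 : 0 <= N * 2 `^ (- (beta * n)) * bump_weight eps (alpha / 2) (delta / 4) n j * 2 `^ (- lw1 j).
  by rewrite !mulr_ge0 ?p2_ge0// ltW.
have C0 : 0 <= c * C1 + C2 by rewrite addr_ge0 ?mulr_ge0 ?(ltW c0) ?(ltW C10) ?(ltW C20).
rewrite [X in lp_le _ _ _ X](_ : _ = (c * C1 + C2 + 1) *
  (N * 2 `^ (- (beta * n)) * bump_weight eps (alpha / 2) (delta / 4) n j * 2 `^ (- lw1 j))); last by ring.
have [jn|jn] := leP (tilted eps j) n.
  apply: lp_le_zero => //; first by rewrite mulr_ge0// addr_ge0.
  move=> k; rewrite mem_box_shifts hS /= jn => -> /=.
  by rewrite (leB _ _ (nT j) (le_trans jn nk)).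
pose x k := if (j, k) \in S then 0 else normc (a (j, k)).
have x0 k : 0 <= x k by rewrite /x; case: ifP => // _; exact: normc_ge0.
have hx : lp_le p0 (box_shifts D j) x (A j).
  apply: (lp_le_mono p00 _ _ (h j)) => [k _|]; last by rewrite lexx ltW// A0.
  by rewrite /x; case: ifP => _; rewrite ?lexx normc_ge0.
have := @lp_le_threshold _ _ p0 p1 (box_shifts D j) x (A j) (z j) p00 (ltW p01) (z0 j) (ltW (A0 j)) x0 hx.
have xt k : k \in box_shifts D j -> x k <= A j * z j `^ (- recip p0).
  rewrite mem_box_shifts /x => bk; case: ifPn => [_|kS]; first by rewrite mulr_ge0 ?powR_ge0// ltW// A0.
  exact: (small (j, k)).
move=> /(_ xt); apply: lp_le_mono => //; first by move=> k _; rewrite lexx andbT; exact: x0.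
apply/andP; split; first by rewrite mulr_ge0 ?powR_ge0// ltW// A0.
have -> : A j * z j `^ (recip p1 - recip p0) =
    N * 2 `^ (- (beta * n)) * bump_weight eps (alpha / 2) (delta / 4) n j * 2 `^ (- lw1 j).
  have e1 : lw0 j = lw1 j + E j.
    rewrite tilt_rate g; have := level_weight_diff j; rewrite -/ga => e; lra.
  have e2 : (n + (- (k1 * (tilted eps j - n)) - k2 * (excess j)%:R)) * (recip p1 - recip p0) =
      - (ga * n) + (alpha / 2 * (tilted eps j - n)) + delta / 4 * (excess j)%:R.
    have er : recip p1 - recip p0 = - ga by rewrite opprB.
    have n1 : ga * k1 = alpha / 2 by rewrite /k1; field; rewrite gt_eqF.
    have n2 : ga * k2 = delta / 4 by rewrite /k2; field; rewrite gt_eqF.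
    by rewrite er -n1 -n2; ring.
  rewrite /A /z /bump_weight -!p2D -powRrM gtr0_norm ?subr_gt0// e2 e1.
  rewrite -!mulrA -!p2D; congr (_ * 2 `^ _); rewrite !g; by field.
by rewrite ler_peMl// lerDr.
Qed.

End selection.

(** * From the function spaces to coefficient sequences and back *)

Section coefficients_and_functions.
Context {R : realType} {d : nat}.
Local Open Scope complex_scope.
Variables (K : nat) (phi psi : R -> R[i]) (L B : R).
Hypotheses (d0 : (0 < d)%N) (W : wavelet_system K phi psi) (L0 : 0 < L) (B0 : 0 < B).
Hypothesis phiB : forall x, normc (phi x) <= B * \1_(`[- L, L]%classic) x.
Hypothesis psiB : forall x, normc (psi x) <= B * \1_(`[- L, L]%classic) x.
Variables (Omega : set 'rV[R]_d) (D rho : nat).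
Hypothesis bO : bounded_set Omega.
Hypothesis nablaD : forall l, nabla phi psi Omega l -> boxed D l.
Hypothesis dK : (d * (rho + 2) <= K)%N.
Local Notation rw l f := (regular (wavelet phi psi l) f).
Local Notation syn := (synthesis phi psi).
Local Notation Psi := (dictionary phi psi Omega).
Local Notation HO := (HnormOn phi psi Omega).
Implicit Types (a b c : windex d -> R[i]) (X : scale) (p q : \bar R) (r s N : R) (w : level d -> R).

Definition supported a : Prop := forall l, ~ nabla phi psi Omega l -> a l = 0.

Definition level_bounds p r s w a : Prop := forall j,
  lp_le p (box_shifts D j) (fun k => normc (a (j, k))) (w j * 2 `^ (- level_weight p r s j)).

Definition growth_le p r s : Prop := `|r| + recip p + `|s| <= rho%:R.

Let decay := pairing_decay W L0 B0 phiB psiB d0.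
Let lin := @regular_linear R d K phi psi L B W L0 B0 phiB psiB.

Lemma level_weight_growth p r s (j : level d) : (0 < p)%E -> growth_le p r s ->
  2 `^ (- level_weight p r s j) <= 2 ^+ (rho * norm1 j) :> R.
Proof.
move=> p0 h; rewrite -p2_nat p2_le// natrM /level_weight.
have n1 : (normoo j)%:R <= (norm1 j)%:R :> R by rewrite ler_nat normoo_le_norm1.
have n0 : 0 <= (normoo j)%:R :> R by [].
have m0 : 0 <= (norm1 j)%:R :> R by [].
apply: (@le_trans _ _ ((`|r| + recip p + `|s|) * (norm1 j)%:R)); last by rewrite ler_wpM2r.
have h1 : - r * (norm1 j)%:R <= `|r| * (norm1 j)%:R by rewrite ler_wpM2r// -normrN ler_norm.
have h2 : - s * (normoo j)%:R <= `|s| * (norm1 j)%:R.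
  apply: (@le_trans _ _ (`|s| * (normoo j)%:R)); last by rewrite ler_wpM2l.
  by rewrite ler_wpM2r// -normrN ler_norm.
have -> : - ((r - recip p) * (norm1 j)%:R + s * (normoo j)%:R) =
  - r * (norm1 j)%:R + recip p * (norm1 j)%:R + - s * (normoo j)%:R by ring.
by rewrite !mulrDl lerD// lerD.
Qed.

Lemma level_bounds_tame p r s w M a : (0 < p)%E -> growth_le p r s -> (forall j, 0 <= w j <= M) ->
  supported a -> level_bounds p r s w a -> tame D rho a.
Proof.
move=> p0 gp wM sa ha; have M0 : 0 <= M by have /andP[h1 h2] := wM [ffun=> 0%N]; exact: le_trans h2.
exists M => // -[j k]; have [nl|nl] := pselect (nabla phi psi Omega (j, k)); last first.
  by rewrite sa// normc0 !mulr_ge0// exprn_ge0.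
have bl := nablaD nl; rewrite bl mulr1; have /andP[w0 wj] := wM j.
have kb : k \in box_shifts D j by rewrite mem_box_shifts.
have A0 : 0 <= w j * 2 `^ (- level_weight p r s j) by rewrite mulr_ge0 ?p2_ge0.
apply: le_trans (lp_le_point p0 (fun k => normc_ge0 (a (j, k))) A0 (ha j) kb) _.
by rewrite ler_pM ?p2_ge0//; exact: level_weight_growth.
Qed.

Lemma seqnorm_growth X p q r s a N : (0 < p)%E -> (0 < q)%E -> (X = scaleF -> (p < +oo)%E) ->
  growth_le p r s -> 0 <= N -> (seqnorm X p q r s a <= N%:E)%E ->
  forall l, normc (a l) <= N * 2 ^+ (rho * norm1 l.1).
Proof.
move=> p0 q0 pF gp N0 h [j k].
have A0 : 0 <= N * 2 `^ (- level_weight p r s j) by rewrite mulr_ge0 ?p2_ge0.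
have kk : k \in [fset k]%fset by rewrite inE.
apply: le_trans (lp_le_point p0 (fun k => normc_ge0 (a (j, k))) A0 (level_le_seqnorm j [fset k]%fset p0 q0 pF N0 h) kk) _.
by rewrite ler_wpM2l//; exact: level_weight_growth.
Qed.

(** Passing to the coefficients on the wavelets that meet Omega; only the bounds
    on the levels are kept, since the F-quasi-norm need not decrease when
    coefficients are dropped. *)
Lemma restricted_representation X p q r s f N : (0 < p)%E -> (0 < q)%E ->
  (X = scaleF -> (p < +oo)%E) -> growth_le p r s -> 0 <= N -> (HO X p q r s f < N%:E)%E ->
  exists a, [/\ supported a, level_bounds p r s (fun=> N) a & f = restriction Omega (syn a)].
Proof.
move=> p0 q0 pF gp N0 /ereal_inf_lt[_ [g [tg <-] <-]] /ereal_inf_lt[_ [a [_ ag] <-]] /ltW aN.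
exists (on_nabla phi psi Omega a).
have sa : supported (on_nabla phi psi Omega a).
  by move=> l nl; rewrite /on_nabla asboolF.
have la : level_bounds p r s (fun=> N) (on_nabla phi psi Omega a).
  move=> j; have A0 : 0 <= N * 2 `^ (- level_weight p r s j) by rewrite mulr_ge0 ?p2_ge0.
  apply: (lp_le_mono p0 _ _ (level_le_seqnorm j (box_shifts D j) p0 q0 pF N0 aN)) => [k _|].
    apply/andP; split; first exact: normc_ge0.
    by rewrite /on_nabla; case: asboolP => _; rewrite ?lexx ?normc0 ?normc_ge0.
  by rewrite A0 lexx.
split => //; apply/esym; have [C C0 hC] := decay.
apply: (restriction_synthesis W L0 B0 phiB psiB hC C0 dK) => //.
apply: (level_bounds_tame p0 gp _ sa la (M := N)) => j; by rewrite N0 lexx.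
Qed.

Lemma synthesis_norm_le X p q r s Om : (0 < p)%E -> (0 < q)%E ->
  (X = scaleF -> (p < +oo)%E) -> growth_le p r s -> uniformly_summable Om ->
  exists2 C : R, 0 < C & forall w, Om w -> forall N a, 0 <= N -> supported a ->
    level_bounds p r s (fun j => N * w j) a ->
    tame D rho a /\ (HO X p q r s (restriction Omega (syn a)) <= (C * N)%:E)%E.
Proof.
move=> p0 q0 pF gp hO; have [C C0 hC] := seqnorm_le_levels r s hO p0 q0 pF.
exists C => // w Ow N a N0 sa la; have [C1 C10 hC1] := hO.2 1 ltr01.
have ta : tame D rho a.
  apply: (level_bounds_tame p0 gp _ sa la (M := N * C1)) => j.
  have wj := hO.1 w Ow j; rewrite mulr_ge0//= ler_wpM2l//.
  by have := hC1 w Ow [fset j]%fset; rewrite big_seq_fset1 powRr1.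
split => //; have [C2 C20 hC2] := decay.
apply: (@le_trans _ _ (Hnorm phi psi X p q r s (syn a))).
  apply: ereal_inf_lbound; exists (syn a) => //; split => //.
  exact: (synthesis_tempered C20 hC2 lin dK ta).
apply: (@le_trans _ _ (seqnorm X p q r s a)).
  apply: ereal_inf_lbound; exists a => //; split.
    exact: (synthesis_tempered C20 hC2 lin dK ta).
  exact: (synthesis_series C20 hC2 dK ta).
apply: (hC w Ow N a (box_shifts D)) => // j k; rewrite mem_box_shifts => bl.
by apply: sa => /nablaD; apply/negP.
Qed.

Definition interior_index (e : R) : set (windex d) := [set l : windex d |
  box (fun i => ((l.2 i)%:~R - L) / 2 ^+ (l.1 i).-1 - e)
      (fun i => ((l.2 i)%:~R + L) / 2 ^+ (l.1 i).-1 + e) `<=` Omega].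

Lemma interior_level_le X p q r s b N (e : R) j (F : {fset Defs.shift d}) : (0 < p)%E -> (0 < q)%E ->
  (X = scaleF -> (p < +oo)%E) -> growth_le p r s -> 0 <= N -> 0 < e -> tame D rho b ->
  (HO X p q r s (restriction Omega (syn b)) < N%:E)%E ->
  (forall k, k \in F -> interior_index e (j, k)) ->
  lp_le p F (fun k => normc (b (j, k))) (N * 2 `^ (- level_weight p r s j)).
Proof.
move=> p0 q0 pF gp N0 e0 tb /ereal_inf_lt[_ [g [tg gb] <-]] /ereal_inf_lt[_ [a [_ ag] <-]] /ltW aN iF.
have [C C0 hC] := decay; have [M M0 hM] := tb.
have ab k : k \in F -> a (j, k) = b (j, k).
  move=> kF; apply/eqP; rewrite -subr_eq0; apply/eqP.
  apply: (interior_coefficient_zero W L0 B0 phiB psiB (rho := rho) (M := N + M) (eps := e)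
    (Omega := Omega) (c := fun l => a l - b l) (l0 := (j, k))) => //.
  - by apply: leq_trans dK; rewrite leq_pmull.
  - by rewrite addr_ge0.
  - move=> l; rewrite mulrDl; apply: le_trans (le_normcD _ _) _; rewrite normcN lerD//.
      exact: (seqnorm_growth p0 q0 pF gp N0 aN).
    apply: le_trans (hM l) _; rewrite ler_wpM2r ?exprn_ge0// ler_piMr//.
    by rewrite lern1 leq_b1.
  - move=> f tf; have sf : schwartz f by have [s1 s2 _] := tf; exact: smooth_compact_schwartz.
    have h1 : csums (fun l => a l * rw l f) (g f) by apply/csumsP; exact: ag.
    have h2 := synthesisP C0 hC dK tb sf.
    have e1 : g f = syn b f.
      by have := congr1 (fun u => u f) gb; rewrite /restriction asboolT.
    rewrite -(subrr (g f)) {2}e1 -[- syn b f]mulN1r.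
    apply: eq_csums (csumsD h1 (csumsZ (-1) h2)) => l /=.
    by rewrite mulrBl mulN1r.
  - exact: iF.
apply: (lp_le_mono p0 _ _ (level_le_seqnorm j F p0 q0 pF N0 aN)) => [k kF|].
  by rewrite -ab// normc_ge0 lexx.
by rewrite lexx mulr_ge0 ?p2_ge0.
Qed.

Lemma sub_lincomb_tame a (S : {fset windex d}) c : [set` S] `<=` nabla phi psi Omega ->
  tame D rho a -> tame D rho (fun l => a l - (if l \in S then c l else 0)) /\
  restriction Omega (syn (fun l => a l - (if l \in S then c l else 0))) =
    restriction Omega (syn a) - lincomb Psi S c.
Proof.
move=> SO ta; have [C C0 hC] := decay; have [M M0 hM] := ta.
have ta' : tame D rho (fun l => a l - (if l \in S then c l else 0)).
  pose M1 := \sum_(l <- S) normc (c l).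
  have M10 : 0 <= M1 by apply: sumr_ge0 => l _; exact: normc_ge0.
  exists (M + M1) => [|l]; first by rewrite addr_ge0.
  apply: le_trans (le_normcD _ _) _; rewrite normcN !mulrDl lerD//.
  case: ifPn => lS; last by rewrite normc0 !mulr_ge0// exprn_ge0.
  rewrite nablaD ?mulr1; last exact: SO.
  apply: (@le_trans _ _ M1).
    by rewrite /M1 (big_fsetD1 l)//= lerDl sumr_ge0// => ? _; exact: normc_ge0.
  by rewrite ler_peMr// exprn_ege1// ler1n.
split => //; exact: (restriction_sub_lincomb W L0 B0 phiB psiB Omega hC C0 dK ta ta').
Qed.

End coefficients_and_functions.

(** * Upper bounds *)

Section upper_bounds.
Context {R : realType} {d : nat}.
Local Open Scope complex_scope.
Variables (K : nat) (phi psi : R -> R[i]) (L B : R).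
Hypotheses (d0 : (0 < d)%N) (W : wavelet_system K phi psi) (L0 : 0 < L) (B0 : 0 < B).
Hypothesis phiB : forall x, normc (phi x) <= B * \1_(`[- L, L]%classic) x.
Hypothesis psiB : forall x, normc (psi x) <= B * \1_(`[- L, L]%classic) x.
Variables (Omega : set 'rV[R]_d) (D rho : nat).
Hypothesis bO : bounded_set Omega.
Hypothesis nablaD : forall l, nabla phi psi Omega l -> boxed D l.
Hypothesis dK : (d * (rho + 2) <= K)%N.
Variables (X Y : scale) (p0 p1 q0 q1 : \bar R) (r0 r1 s0 s1 : R).
Hypotheses (p00 : (0 < p0)%E) (p10 : (0 < p1)%E) (q00 : (0 < q0)%E) (q10 : (0 < q1)%E).
Hypotheses (XF : X = scaleF -> (p0 < +oo)%E) (YF : Y = scaleF -> (p1 < +oo)%E).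
Hypotheses (gr0 : growth_le rho p0 r0 s0) (gr1 : growth_le rho p1 r1 s1).
Local Notation gamma := (Num.max (recip p0 - recip p1) 0).
Local Notation delta := (s1 - s0).
Local Notation beta := ((r0 - r1) - (s1 - s0)).
Local Notation alpha := ((r0 - r1) - (s1 - s0) - gamma).
Hypotheses (delta0 : 0 < delta) (alpha0 : 0 < alpha).
Local Notation eps := (delta / (2 * alpha)).
Local Notation lw0 := (level_weight p0 r0 s0).
Local Notation lw1 := (level_weight p1 r1 s1).
Local Notation syn := (synthesis phi psi).
Local Notation Psi := (dictionary phi psi Omega).
Local Notation Lambda := (nabla phi psi Omega).
Local Notation N0 := (HnormOn phi psi Omega X p0 q0 r0 s0).
Local Notation N1 := (HnormOn phi psi Omega Y p1 q1 r1 s1).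
Local Notation supported := (supported phi psi Omega).
Local Notation level_bounds := (level_bounds D).
Implicit Types (a b c : windex d -> R[i]) (f : functional R d) (S : {fset windex d}) (m : nat).

Definition bump_family (e a b : R) : set (level d -> R) :=
  [set w | exists n, w = bump_weight e a b n].

Lemma bump_family_summable (e a b : R) : 0 <= e -> 0 < a -> 0 < b ->
  uniformly_summable (bump_family e a b).
Proof.
move=> e0 a0 b0; split=> [_ [n ->] j|kappa k0]; first exact: p2_ge0.
have [C C0 hC] := sum_bump_weight d0 e0 (mulr_gt0 a0 k0) (mulr_gt0 b0 k0).
exists C => // _ [n ->] J; apply: le_trans (hC n J); rewrite le_eqVlt; apply/orP; left; apply/eqP.
apply: eq_bigr => j _; rewrite /bump_weight -powRrM; congr (_ `^ _); ring.
Qed.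

Lemma exists_log2 (x : R) : 0 < x -> exists n : R, 2 `^ n = x.
Proof.
move=> x0; have l2 : ln 2 != 0 :> R by rewrite gt_eqF// ln_gt0// ltr1n.
by exists (ln x / ln 2); rewrite /powR pnatr_eq0 /= divfK// lnK.
Qed.

Lemma unit_ball_coefficients f : (N0 f <= 1)%E ->
  exists a, [/\ supported a, tame D rho a, f = restriction Omega (syn a) &
    forall j, lp_le p0 (box_shifts D j) (fun k => normc (a (j, k))) (2 * 2 `^ (- lw0 j))].
Proof.
move=> f1; have f2 : (N0 f < 2%:E)%E by apply: le_lt_trans f1 _; rewrite lte_fin ltr1n.
have [a [sa la fa]] := restricted_representation d0 W L0 B0 phiB psiB nablaD dK p00 q00 XF gr0 (ler0n _ 2) f2.
exists a; split => //.
by apply: (level_bounds_tame nablaD p00 gr0 _ sa la (M := 2)) => j; rewrite lexx ler0n.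
Qed.

Lemma remainder_norm_le Om : uniformly_summable Om -> exists2 C : R, 0 < C &
  forall w, Om w -> forall (N : R) (S0 S : {fset windex d}) a, 0 <= N -> supported a -> tame D rho a ->
  (forall l, l \in S = (l \in S0) && `[< Lambda l >]) ->
  (forall j, lp_le p1 (box_shifts D j) (fun k => if (j, k) \in S0 then 0 else normc (a (j, k)))
     (N * w j * 2 `^ (- lw1 j))) ->
  (N1 (restriction Omega (syn a) - lincomb Psi S a)%R <= (C * N)%:E)%E.
Proof.
move=> hO; have [C C0 hC] := synthesis_norm_le d0 W L0 B0 phiB psiB nablaD dK p10 q10 YF gr1 hO.
exists C => // w Ow N S0 S a Nge0 sa ta SE ha.
have SL : [set` S] `<=` Lambda by move=> l /=; rewrite SE => /andP[_ /asboolP].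
have [tb <-] := sub_lincomb_tame d0 W L0 B0 phiB psiB nablaD dK a SL ta.
have bE l : normc (a l - (if l \in S then a l else 0)) = if l \in S0 then 0 else normc (a l).
  rewrite SE; case: (l \in S0) => /=; last by rewrite subr0.
  case: asboolP => nl; first by rewrite subrr normc0.
  by rewrite (sa l nl) subr0 normc0.
have [//|//|_ ->//] := hC w Ow N (fun l => a l - (if l \in S then a l else 0)) Nge0.
  by move=> l nl; rewrite (sa l nl) sub0r; case: ifP; rewrite oppr0.
move=> j; apply: (lp_le_mono p10 _ _ (ha j)) => [k _|].
  by rewrite bE lexx andbT; case: ifP => // _; exact: normc_ge0.
by rewrite lexx mulr_ge0 ?p2_ge0// mulr_ge0//; exact: hO.1.
Qed.

Lemma restrict_to_nabla (S0 : {fset windex d}) m : (#|` S0|)%:R <= m%:R :> R ->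
  exists2 S, subdict Lambda m S & forall l, l \in S = (l \in S0) && `[< Lambda l >].
Proof.
move=> S0m; exists [fset l in S0 | `[< Lambda l >]]%fset; last by move=> l; rewrite !inE.
split; first by move=> l /=; rewrite !inE => /andP[_ /asboolP].
rewrite ler_nat in S0m; apply: leq_trans S0m; apply: fsubset_leq_card.
by apply/fsubsetP => l; rewrite !inE => /andP[].
Qed.

Lemma log2_rate (C : R) m : 0 < C -> (0 < m)%N -> exists n : R, C * 2 `^ n = m%:R /\
  forall t : R, 2 `^ (- (t * n)) = C `^ t * m%:R `^ (- t).
Proof.
move=> C0 m0; have m0' : 0 < m%:R :> R by rewrite ltr0n.
have [n hn] := exists_log2 (divr_gt0 m0' C0).
exists n; rewrite hn; split; first by rewrite mulrC divfK// gt_eqF.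
move=> t; rewrite -mulNr mulrC powRrM hn powRM ?invr_ge0 ?ltW// mulrC; congr (_ * _).
by rewrite -powR_inv1 ?ltW// -powRrM mulrNN mul1r.
Qed.

Let eps0 : 0 < eps. Proof. by rewrite divr_gt0// mulr_gt0. Qed.

Theorem linear_upper_bound : exists2 C : R, 0 < C & forall m, (0 < m)%N ->
  exists2 S, subdict Lambda m S & forall f, (N0 f <= 1)%E ->
  exists c, (N1 (f - lincomb Psi S c)%R <= (C * m%:R `^ (- alpha))%:E)%E.
Proof.
have [C1 C10 hC1] := linear_selection D d0 p00 p10 delta0 alpha0.
have d20 : 0 < delta / 2 by rewrite divr_gt0.
have [C2 C20 hC2] := remainder_norm_le (bump_family_summable (ltW eps0) alpha0 d20).
exists (C2 * (C1 * 2 * C1 `^ alpha)); first by rewrite !mulr_gt0// powR_gt0.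
move=> m m0; have [n [nm nt]] := log2_rate C10 m0.
have [S0 [S0D cS0 hS0]] := hC1 n; rewrite nm in cS0.
have [S dS SE] := restrict_to_nabla cS0; exists S => // f f1.
have [a [sa ta -> la]] := unit_ball_coefficients f1; exists a.
have -> : C2 * (C1 * 2 * C1 `^ alpha) * m%:R `^ (- alpha) = C2 * (C1 * 2 * 2 `^ (- (alpha * n))).
  by rewrite nt; ring.
apply: (hC2 (bump_weight eps alpha (delta / 2) n) _ _ S0 S a) => //; first by exists n.
  by rewrite !mulr_ge0 ?p2_ge0// ltW.
by move=> j; exact: hS0.
Qed.

Theorem adaptive_upper_bound : exists2 C : R, 0 < C & forall m, (0 < m)%N ->
  forall f, (N0 f <= 1)%E -> exists2 S, subdict Lambda m S &
  exists c, (N1 (f - lincomb Psi S c)%R <= (C * m%:R `^ (- beta))%:E)%E.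
Proof.
have [p10'|p01] := leP p1 p0.
  have [C C0 hC] := linear_upper_bound; exists C => // m m0 f f1.
  have [S dS hS] := hC m m0; exists S => //; have [c hc] := hS f f1; exists c.
  have g : gamma = 0 by apply/max_idPr; rewrite subr_le0 recip_le.
  by rewrite g subr0 in hc.
have [C1 C10 hC1] := threshold_selection D d0 p00 p10 delta0 alpha0 p01.
have a20 : 0 < alpha / 2 by rewrite divr_gt0.
have d40 : 0 < delta / 4 by rewrite divr_gt0.
have [C2 C20 hC2] := remainder_norm_le (bump_family_summable (ltW eps0) a20 d40).
exists (C2 * (C1 * 2 * C1 `^ beta)); first by rewrite !mulr_gt0// powR_gt0.
move=> m m0 f f1; have [n [nm nt]] := log2_rate C10 m0.
have [a [sa ta -> la]] := unit_ball_coefficients f1.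
have [S0 [S0D cS0 hS0]] := hC1 n 2 a (ltr0n _ 2) la; rewrite nm in cS0.
have [S dS SE] := restrict_to_nabla cS0; exists S => //; exists a.
have -> : C2 * (C1 * 2 * C1 `^ beta) * m%:R `^ (- beta) = C2 * (C1 * 2 * 2 `^ (- (beta * n))).
  by rewrite nt; ring.
apply: (hC2 (bump_weight eps (alpha / 2) (delta / 4) n) _ _ S0 S a) => //; first by exists n.
by rewrite !mulr_ge0 ?p2_ge0// ltW.
Qed.

End upper_bounds.

(** * Lower bounds *)

Section lower_bounds.
Context {R : realType} {d : nat}.
Local Open Scope complex_scope.
Variables (K : nat) (phi psi : R -> R[i]) (L B : R).
Hypotheses (d0 : (0 < d)%N) (W : wavelet_system K phi psi) (L0 : 0 < L) (B0 : 0 < B).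
Hypothesis phiB : forall x, normc (phi x) <= B * \1_(`[- L, L]%classic) x.
Hypothesis psiB : forall x, normc (psi x) <= B * \1_(`[- L, L]%classic) x.
Variables (Omega : set 'rV[R]_d) (D rho : nat).
Hypothesis bO : bounded_set Omega.
Hypothesis nablaD : forall l, nabla phi psi Omega l -> boxed D l.
Hypothesis dK : (d * (rho + 2) <= K)%N.
Variables (X Y : scale) (p0 p1 q0 q1 : \bar R) (r0 r1 s0 s1 : R).
Hypotheses (p00 : (0 < p0)%E) (p10 : (0 < p1)%E) (q00 : (0 < q0)%E) (q10 : (0 < q1)%E).
Hypotheses (XF : X = scaleF -> (p0 < +oo)%E) (YF : Y = scaleF -> (p1 < +oo)%E).
Hypotheses (gr0 : growth_le rho p0 r0 s0) (gr1 : growth_le rho p1 r1 s1).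
Local Notation gamma := (Num.max (recip p0 - recip p1) 0).
Local Notation delta := (s1 - s0).
Local Notation beta := ((r0 - r1) - (s1 - s0)).
Local Notation alpha := ((r0 - r1) - (s1 - s0) - gamma).
Hypotheses (delta0 : 0 < delta) (alpha0 : 0 < alpha).
Local Notation eps := (delta / (2 * alpha)).
Local Notation lw0 := (level_weight p0 r0 s0).
Local Notation lw1 := (level_weight p1 r1 s1).
Local Notation syn := (synthesis phi psi).
Local Notation Psi := (dictionary phi psi Omega).
Local Notation Lambda := (nabla phi psi Omega).
Local Notation N0 := (HnormOn phi psi Omega X p0 q0 r0 s0).
Local Notation N1 := (HnormOn phi psi Omega Y p1 q1 r1 s1).
Local Notation supported := (supported phi psi Omega).
Local Notation level_bounds := (level_bounds D).
Implicit Types (a b c : windex d -> R[i]) (f : functional R d) (S : {fset windex d}) (m : nat).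

Hypothesis oO : open Omega.
Hypothesis Omega0 : Omega !=set0.
Local Notation interior_index := (interior_index L Omega).

Lemma lp_le_extend (p : \bar R) (F F' : {fset Defs.shift d}) (x : Defs.shift d -> R) A :
  (0 < p)%E -> 0 <= A -> (F' `<=` F)%fset -> (forall k, k \notin F' -> x k = 0) ->
  lp_le p F' x A -> lp_le p F x A.
Proof.
case: p => [p|_|//]; last first.
  move=> A0 sF x0 h k _; have [kF|kF] := boolP (k \in F'); first exact: h.
  by rewrite x0.
rewrite lte_fin => p_0 A0 sF x0 /= h; apply: le_trans h.
rewrite le_eqVlt; apply/orP; left; apply/eqP/esym.
by apply: (big_fset_incl _ sF) => k _ kF; rewrite x0// powR0// gt_eqF.
Qed.

Lemma interior_nabla (e : R) l : 0 < e -> interior_index e l -> Lambda l.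
Proof.
move=> e0 il.
have /choice[x hx] : forall i, exists x, wavelet1 phi psi (l.1 i) (l.2 i) x != 0.
  move=> i; apply: contrapT => h.
  have w0 x : wavelet1 phi psi (l.1 i) (l.2 i) x = 0.
    by apply/eqP/negPn/negP => wx; apply: h; exists x.
  have := wavelet1_norm2 W L0 B0 phiB psiB (l.1 i) (l.2 i).
  rewrite (_ : (fun x => _) = (fun=> 0)); last by apply/funext => x; rewrite w0 mul0r.
  rewrite /cintegral !Rintegral_cst// !mul0r => /(congr1 (@complex.Re R)) /= /esym/eqP.
  by rewrite invr_eq0 expf_eq0 pnatr_eq0 andbF.
exists (\row_i x i); split.
  apply: subset_closure; rewrite /= /wavelet prodf_seq_neq0; apply/allP => i _ /=.
  by rewrite mxE.
apply: il => i; rewrite mxE; have xi : wsupp L (l.1 i) (l.2 i) (x i).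
  apply: contrapT => nx; move/negP: (hx i); apply; apply/eqP/eq0_normc/eqP.
  rewrite eq_le normc_ge0 andbT; apply: le_trans (wavelet1_norm phiB psiB _ _ _) _.
  by rewrite indicE memNset// mulr0.
move: xi; rewrite /wsupp /= in_itv/= => /andP[h1 h2].
by apply/andP; split; lra.
Qed.

(** The levels that grow in one direction only, and their wavelets inside Omega. *)
Lemma interior_wavelets : exists (e : R) (n0 A : nat), [/\ 0 < e &
  forall n, (n0 <= n)%N -> exists j (F : {fset Defs.shift d}),
  [/\ norm1 j = (n + A)%N, normoo j = n, #|` F| = (2 ^ (n - n0))%N &
      forall k, k \in F -> interior_index e (j, k)]].
Proof.
have [x0 Ox0] := Omega0.
have [r r_0 hr] : exists2 r : R, 0 < r & forall x : 'rV[R]_d, (forall i, `|x0 ord0 i - x ord0 i| < r) -> Omega x.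
  have /nbhs_ballP[r r_0 hr] : nbhs x0 Omega by apply: open_nbhs_nbhs.
  exists r => // x hx; apply: hr; split => // i i'; rewrite (ord1 i); exact: hx.
have [J hJ] : exists J : nat, (L + 1) / 2 ^+ J <= r / 5.
  have r5 : 0 < r / 5 / (L + 1) by rewrite !divr_gt0// addr_gt0.
  have [N _ hN] := near_infty_natSinv_expn_lt (PosNum r5).
  exists N; rewrite mulrC -ler_pdivlMr ?addr_gt0// -div1r ltW//; exact: (hN N (leqnn N)).
pose i0 : 'I_d := Ordinal d0.
pose jJ : level d := [ffun=> J.+1].
exists (r / 5), (J.+3), (\sum_(i | i != i0) jJ i)%N; split; first by rewrite divr_gt0.
move=> n n0; pose j := set_coord jJ i0 n.
pose base i : int := Num.floor (2 ^+ (j i).-1 * x0 ord0 i).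
pose shift_t (t : nat) : Defs.shift d := [ffun i => base i + (if i == i0 then t%:Z else 0)].
have inj : injective shift_t.
  move=> t t' /ffunP/(_ i0); rewrite !ffunE eqxx => /addrI; by case.
exists j, [fset shift_t t | t in iota 0 (2 ^ (n - J.+3))]%fset; split.
- by rewrite /j norm1_set_coord.
- rewrite /j normoo_set_coord; apply/maxn_idPl; apply/bigmax_leqP => i _.
  by rewrite ffunE (leq_trans _ n0)// -[J.+3]addn2 leq_addr.
- by rewrite card_imfset//= undup_id ?size_iota// iota_uniq.
move=> k /imfsetP[t /=]; rewrite mem_iota add0n /= => tn -> x xb; apply: hr => i.
have {xb} := xb i; rewrite /= ffunE; set q := (j i).-1.
have Jq : (J <= q)%N.
  rewrite /q /j ffunE; case: ifP => _; last by rewrite ffunE.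
  by clear -n0; lia.
have p0' : 0 < (2 : R) ^+ q by rewrite exprn_gt0.
have hq : (L + 1) / 2 ^+ q <= r / 5.
  apply: le_trans hJ; rewrite ler_pM2l ?addr_gt0// lef_pV2 ?posrE ?exprn_gt0//.
  by rewrite ler_weXn2l// ler1n.
have /andP[f1 f2] := floor_itv (2 ^+ q * x0 ord0 i); rewrite -/(base i) intrD in f1 f2.
have t0 : 0 <= (if i == i0 then t%:Z else 0)%:~R / (2 : R) ^+ q <= r / 5.
  case: eqP => [ii|_]; last first.
    by apply/andP; split; rewrite mulr0z mul0r// divr_ge0// ltW.
  rewrite divr_ge0 ?exprn_ge0//=.
  have qn : q = n.-1 by rewrite /q /j ffunE ii eqxx.
  apply: le_trans (_ : 2 ^- J / 1 <= _); last first.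
    rewrite divr1; apply: le_trans hJ; rewrite mulrC ler_peMr// ?invr_ge0 ?exprn_ge0//.
    by rewrite lerDr ltW.
  rewrite divr1 ler_pdivrMr// mulrC -ler_pdivrMr ?invr_gt0 ?exprn_gt0// invrK.
  rewrite -natrX -natrM -natrX ler_nat.
  apply: (@leq_trans (2 ^ (n - J.+3) * 2 ^ J)); first by rewrite leq_mul2r ltnW ?orbT.
  by rewrite -expnD leq_exp2l// qn; clear -n0; lia.
rewrite intrD; set b := (base i)%:~R in f1 f2 *; set u := (_%:~R) in t0 *.
have fl : b / 2 ^+ q <= x0 ord0 i < (b + 1) / 2 ^+ q.
  by rewrite ler_pdivrMr// ltr_pdivlMr// ![x0 _ _ * _]mulrC f1.
move: fl t0 hq; rewrite !mulrDl ?mulNr ?mul1r.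
set b' := b / _; set u' := u / _; set L' := L / _; set v := _^-1.
have L'0 : 0 <= L' by rewrite divr_ge0 ?ltW.
have v0 : 0 < v by rewrite invr_gt0.
move=> /andP[h1 h2] /andP[h3 h4] h5 /andP[h6 h7].
by rewrite ltr_norml; apply/andP; split; lra.
Qed.

Lemma level_indicator_summable : uniformly_summable
  [set w : level d -> R | exists j, w = fun j' => (j' == j)%:R].
Proof.
split=> [_ [j ->] j'|kappa k0]; first exact: ler0n.
exists 1 => // _ [j ->] J; have e j' : (j' == j)%:R `^ kappa = (j' == j)%:R :> R.
  by case: (j' == j); rewrite ?powR1// powR0// gt_eqF.
under eq_bigr do rewrite e.
have [jJ|jJ] := boolP (j \in J).
  rewrite (big_fsetD1 j)//= eqxx big1_fset ?addr0// => j' ; rewrite !inE => /andP[/negbTE ->].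
  by [].
by rewrite big_seq big1// => j' j'J; case: eqP => // jj; rewrite -jj j'J in jJ.
Qed.

(** The test functions: equal coefficients on a set of wavelets of one level. *)
Lemma test_function_lower_bound : exists2 C : R, 0 < C & forall (e : R) j (F : {fset Defs.shift d}),
  0 < e -> (0 < #|` F|)%N -> (forall k, k \in F -> interior_index e (j, k)) ->
  exists2 f, (N0 f <= 1)%E & forall S c m, [set` S] `<=` Lambda -> (0 < m)%N ->
    (m <= #|` [fset k in F | (j, k) \notin S]%fset|)%N ->
    ((C * (#|` F|)%:R `^ (- recip p0) * m%:R `^ recip p1 * 2 `^ (lw1 j - lw0 j))%:E
      <= N1 (f - lincomb Psi S c)%R)%E.
Proof.
have [C C0 hC] := synthesis_norm_le d0 W L0 B0 phiB psiB nablaD dK p00 q00 XF gr0 level_indicator_summable.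
exists (C^-1 / 2); first by rewrite divr_gt0// invr_gt0.
move=> e j F e0 F0 iF; set kap : R := (#|` F|)%:R; have kap0 : 0 < kap by rewrite ltr0n.
pose t := C^-1 * kap `^ (- recip p0) * 2 `^ (- lw0 j).
have t0 : 0 < t by rewrite !mulr_gt0 ?p2_gt0 ?powR_gt0// invr_gt0.
pose a : windex d -> R[i] := fun l => if (l.1 == j) && (l.2 \in F) then t%:C else 0.
have sa : supported a.
  move=> [j' k] nl; rewrite /a /=; case: ifP => // /andP[/eqP jj kF].
  by exfalso; apply: nl; rewrite jj; exact: interior_nabla e0 (iF k kF).
have aE k : a (j, k) = if k \in F then t%:C else 0 by rewrite /a eqxx.
have at0 : normc t%:C = t by rewrite normc_real gtr0_norm.
pose w : level d -> R := fun j' => (j' == j)%:R.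
have Ow : [set w : level d -> R | exists j, w = fun j' => (j' == j)%:R] w by exists j.
have C1 : 0 <= C^-1 by rewrite invr_ge0 ltW.
have [//|ta hN] := hC w Ow C^-1 a C1 sa.
  move=> j'; rewrite /w; have [->|jj] := eqVneq j' j; last first.
    apply: lp_le_zero => //; first by rewrite mulr0 mul0r.
    by move=> k _; rewrite /a /= (negbTE jj) normc0.
  rewrite mulr1; apply: (lp_le_extend (F' := F)) => //.
  - by rewrite mulr_ge0 ?p2_ge0.
  - by apply/fsubsetP => k kF; rewrite mem_box_shifts; apply: nablaD; exact: interior_nabla e0 (iF k kF).
  - by move=> k /negbTE kF; rewrite aE kF normc0.
  have -> : C^-1 * 2 `^ (- lw0 j) = t * kap `^ recip p0.
    rewrite /t (powRN kap); have x0 : kap `^ recip p0 != 0 by rewrite gt_eqF ?powR_gt0.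
    by field; rewrite ?(gt_eqF C0) ?x0.
  apply: lp_le_const_ub => //; first exact: ltW.
  by move=> k; rewrite normc_ge0 aE; case: ifP => _; rewrite ?at0 ?normc0 ?lexx ?(ltW t0).
exists (restriction Omega (syn a)); first by rewrite (le_trans hN)// mulfV ?gt_eqF.
move=> S c m SL m0 mF; set V : R := _ * _ in |- *.
have V0 : 0 < V by rewrite !mulr_gt0 ?p2_gt0 ?powR_gt0 ?invr_gt0// ltr0n.
rewrite leNgt; apply/negP.
have [tb <-] := sub_lincomb_tame d0 W L0 B0 phiB psiB nablaD dK c SL ta => hlt.
pose F' := [fset k in F | (j, k) \notin S]%fset.
have iF' k : k \in F' -> interior_index e (j, k) by rewrite !inE => /andP[/iF].
have := interior_level_le d0 W L0 B0 phiB psiB bO dK p10 q10 YF gr1 (ltW V0) e0 tb hlt iF'.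
move=> hl; have {hl} := lp_le_const p10 (ltW t0) _ m0 mF _ hl.
rewrite mulr_ge0 ?(ltW V0) ?p2_ge0// => /(_ isT) hl.
have {hl} : t * m%:R `^ recip p1 <= V * 2 `^ (- lw1 j).
  apply: hl => k; rewrite !inE => /andP[kF /negbTE kS].
  by rewrite kS subr0 aE kF at0.
have -> : V * 2 `^ (- lw1 j) = (t * m%:R `^ recip p1) / 2.
  rewrite /V /t p2D (powRN 2 (lw1 j)); field; rewrite ?gt_eqF ?p2_gt0//.
rewrite ler_pdivlMr// -subr_ge0 => h.
have tm : 0 < t * m%:R `^ recip p1 by rewrite mulr_gt0// powR_gt0// ltr0n.
lra.
Qed.

End lower_bounds.

(** * Rates of the lower bounds *)

Section lower_rates.
Context {R : realType} {d : nat}.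
Local Open Scope complex_scope.
Variables (K : nat) (phi psi : R -> R[i]) (L B : R).
Hypotheses (d0 : (0 < d)%N) (W : wavelet_system K phi psi) (L0 : 0 < L) (B0 : 0 < B).
Hypothesis phiB : forall x, normc (phi x) <= B * \1_(`[- L, L]%classic) x.
Hypothesis psiB : forall x, normc (psi x) <= B * \1_(`[- L, L]%classic) x.
Variables (Omega : set 'rV[R]_d) (D rho : nat).
Hypothesis bO : bounded_set Omega.
Hypothesis nablaD : forall l, nabla phi psi Omega l -> boxed D l.
Hypothesis dK : (d * (rho + 2) <= K)%N.
Variables (X Y : scale) (p0 p1 q0 q1 : \bar R) (r0 r1 s0 s1 : R).
Hypotheses (p00 : (0 < p0)%E) (p10 : (0 < p1)%E) (q00 : (0 < q0)%E) (q10 : (0 < q1)%E).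
Hypotheses (XF : X = scaleF -> (p0 < +oo)%E) (YF : Y = scaleF -> (p1 < +oo)%E).
Hypotheses (gr0 : growth_le rho p0 r0 s0) (gr1 : growth_le rho p1 r1 s1).
Local Notation gamma := (Num.max (recip p0 - recip p1) 0).
Local Notation delta := (s1 - s0).
Local Notation beta := ((r0 - r1) - (s1 - s0)).
Local Notation alpha := ((r0 - r1) - (s1 - s0) - gamma).
Hypotheses (delta0 : 0 < delta) (alpha0 : 0 < alpha).
Local Notation eps := (delta / (2 * alpha)).
Local Notation lw0 := (level_weight p0 r0 s0).
Local Notation lw1 := (level_weight p1 r1 s1).
Local Notation syn := (synthesis phi psi).
Local Notation Psi := (dictionary phi psi Omega).
Local Notation Lambda := (nabla phi psi Omega).
Local Notation N0 := (HnormOn phi psi Omega X p0 q0 r0 s0).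
Local Notation N1 := (HnormOn phi psi Omega Y p1 q1 r1 s1).
Local Notation supported := (supported phi psi Omega).
Local Notation level_bounds := (level_bounds D).
Implicit Types (a b c : windex d -> R[i]) (f : functional R d) (S : {fset windex d}) (m : nat).

Hypothesis oO : open Omega.
Hypothesis Omega0 : Omega !=set0.
Local Notation interior_index := (interior_index L Omega).
Local Notation kappa := (beta - (recip p0 - recip p1)).

Lemma kappa_gt0 : 0 < kappa.
Proof.
apply: lt_le_trans alpha0 _; rewrite lerD2l lerN2.
by rewrite le_max lexx.
Qed.

Lemma fset_of_card (T : choiceType) (F : {fset T}) m : (m <= #|` F|)%N ->
  exists2 F' : {fset T}, (F' `<=` F)%fset & #|` F'| = m.
Proof.
move=> mF; exists [fset k in take m F]%fset.
  by apply/fsubsetP => k; rewrite !inE /=; exact: mem_take.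
by rewrite card_fseq undup_id ?take_uniq// size_takel.
Qed.

Lemma card_outside j (F : {fset Defs.shift d}) S m : #|` F| = (2 * m)%N -> (#|` S| <= m)%N ->
  (m <= #|` [fset k in F | (j, k) \notin S]%fset|)%N.
Proof.
move=> F2 Sm; set F' := [fset _ in _ | _]%fset.
have sub : (F `<=` F' `|` [fset l.2 | l in S])%fset.
  apply/fsubsetP => k kF; rewrite in_fsetU; apply/orP.
  have [kS|kS] := boolP ((j, k) \in S); last by left; rewrite !inE kF.
  by right; apply/imfsetP; exists (j, k).
have h1 := fsubset_leq_card sub; have h2 := leq_card_fsetU F' [fset l.2 | l in S]%fset.
have h3 : (#|` [fset l.2 | l in S]%fset| <= m)%N.
  by apply: leq_trans Sm; exact: leq_imfset_card.
have := leq_trans h1 (leq_trans h2.1 (leq_add (leqnn _) h3)); rewrite F2; clear; lia.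
Qed.

Lemma test_level : exists (e C : R), [/\ 0 < e, 0 < C & forall m, (0 < m)%N ->
  exists j (F : {fset Defs.shift d}), [/\ #|` F| = (2 * m)%N,
    forall k, k \in F -> interior_index e (j, k) &
    C * m%:R `^ (- kappa) <= 2 `^ (lw1 j - lw0 j)]].
Proof.
have [e [n0 [A [e0 hA]]]] := interior_wavelets d0 L0 oO Omega0.
pose G : R := 2 ^+ n0.+2; have G0 : 0 < G by rewrite exprn_gt0.
have k0 := kappa_gt0.
exists e, (2 `^ (- (kappa * A%:R + delta * A%:R)) * G `^ (- kappa)); split => //.
  by rewrite mulr_gt0 ?p2_gt0 ?powR_gt0.
move=> m m0; pose t := trunc_log 2 m; pose n := (n0 + t.+2)%N.
have m1 : (m < 2 ^ t.+1)%N by exact: trunc_log_ltn.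
have m2 : (2 ^ t <= m)%N by exact: trunc_logP.
have [j [F [j1 joo cF iF]]] := hA n (leq_addr _ _).
rewrite /n addKn in cF.
have [|F' sF cF'] := @fset_of_card _ F (2 * m)%N; first by rewrite cF expnS leq_pmul2l// ltnW.
exists j, F'; split => //; first by move=> k /(fsubsetP sF); exact: iF.
have exA : excess j = A by rewrite /excess j1 joo addKn.
have -> : lw1 j - lw0 j = - (kappa * A%:R + delta * A%:R) - kappa * n%:R.
  by rewrite -opprB level_weight_diff exA j1 natrD; ring.
rewrite p2D -mulrA ler_wpM2l ?p2_ge0//.
have m0' : 0 < m%:R :> R by rewrite ltr0n.
have -> : - (kappa * n%:R) = n%:R * - kappa by ring.
have e1 : G `^ (- kappa) * m%:R `^ (- kappa) = (G * m%:R) `^ (- kappa).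
  by rewrite powRM//; exact: ltW.
rewrite e1 powRrM p2_nat !powRN.
have P1 : 0 < (G * m%:R) `^ kappa by apply: powR_gt0; exact: mulr_gt0.
have P2 : 0 < ((2 : R) ^+ n) `^ kappa by apply: powR_gt0; exact: exprn_gt0.
rewrite (lef_pV2 P1 P2).
have Gm : 0 <= G * m%:R by rewrite mulr_ge0// ltW.
have n2 : 0 <= (2 : R) ^+ n by rewrite exprn_ge0.
rewrite (powR_le_base k0 n2 Gm).
rewrite /G /n -natrX -natrX -natrM ler_nat expnD -[n0.+2]addn2 expnD -mulnA.
by rewrite leq_pmul2l ?expn_gt0// -[t.+2]addn2 expnD mulnC leq_pmul2l.
Qed.

Theorem adaptive_lower_bound : exists2 C : R, 0 < C & forall m, (0 < m)%N ->
  exists2 f, (N0 f <= 1)%E & forall S c, subdict Lambda m S ->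
    ((C * m%:R `^ (- beta))%:E <= N1 (f - lincomb Psi S c)%R)%E.
Proof.
have [e [C1 [e0 C10 h1]]] := test_level.
have [C2 C20 h2] := test_function_lower_bound d0 W L0 B0 phiB psiB bO nablaD dK
  p00 p10 q00 q10 XF YF gr0 gr1.
exists (C2 * 2 `^ (- recip p0) * C1); first by rewrite !mulr_gt0 ?p2_gt0.
move=> m m0; have [j [F [cF iF hl]]] := h1 m m0.
have [|f f1 hf] := h2 e j F e0 _ iF; first by rewrite cF muln_gt0.
exists f => // S c [SL Sm]; apply: le_trans (hf S c m SL m0 (card_outside j cF Sm)).
have m0' : 0 < m%:R :> R by rewrite ltr0n.
have mb : m%:R `^ (- beta) = m%:R `^ (- recip p0) * m%:R `^ recip p1 * m%:R `^ (- kappa).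
  have -> : - beta = - recip p0 + recip p1 + - kappa by ring.
  by rewrite !powRD ?(gt_eqF m0') ?implybT.
rewrite lee_fin cF natrM powRM ?ler0n// mb.
apply: (@le_trans _ _ (C2 * 2 `^ (- recip p0) * ((m%:R : R) `^ (- recip p0) * (m%:R : R) `^ recip p1) * (C1 * (m%:R : R) `^ (- kappa)))).
  by rewrite le_eqVlt; apply/orP; left; apply/eqP; ring.
apply: le_trans (ler_wpM2l _ hl) _; first by rewrite !mulr_ge0 ?powR_ge0// ltW.
by rewrite le_eqVlt; apply/orP; left; apply/eqP; ring.
Qed.

Theorem linear_lower_bound : exists2 C : R, 0 < C & forall m, (0 < m)%N ->
  forall S, subdict Lambda m S -> exists2 f, (N0 f <= 1)%E & forall c,
    ((C * m%:R `^ (- alpha))%:E <= N1 (f - lincomb Psi S c)%R)%E.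
Proof.
have [p10'|p01] := leP p1 p0.
  have [C C0 hC] := adaptive_lower_bound; exists C => // m m0 S dS.
  have [f f1 hf] := hC m m0; exists f => // c.
  have g : gamma = 0 by apply/max_idPr; rewrite subr_le0 recip_le.
  by rewrite g subr0; exact: hf.
have g : gamma = recip p0 - recip p1 by apply/max_idPl; rewrite subr_ge0 recip_le// ltW.
have [e [C1 [e0 C10 h1]]] := test_level.
have [C2 C20 h2] := test_function_lower_bound d0 W L0 B0 phiB psiB bO nablaD dK
  p00 p10 q00 q10 XF YF gr0 gr1.
exists (C2 * C1); first by rewrite mulr_gt0.
move=> m m0 S [SL Sm]; have [j [F [cF iF hl]]] := h1 m m0.
have /fset0Pn[k] : [fset k in F | (j, k) \notin S]%fset != fset0.
  by rewrite -cardfs_gt0 (leq_trans m0)//; exact: card_outside.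
rewrite !inE => /andP[kF kS].
have ik k' : k' \in [fset k]%fset -> interior_index e (j, k').
  by rewrite inE => /eqP ->; exact: iF.
have [|f f1 hf] := h2 e j [fset k]%fset e0 _ ik; first by rewrite cardfs1.
exists f => // c; apply: le_trans (hf S c 1%N SL isT _).
  rewrite cardfs1 !powR1 !mulr1 lee_fin g -mulrA ler_wpM2l ?(ltW C20)//.
rewrite cardfs_gt0; apply/fset0Pn; exists k.
by rewrite !inE eqxx.
Qed.

End lower_rates.

(** * Compactness *)

Section ultrafilter_limits.
Context {R : realType}.

Lemma ultra_limit (U : set_system nat) (x : nat -> R) (M : R) : UltraFilter U ->
  (forall n, `|x n| <= M) -> exists z : R, forall e : R, 0 < e -> U [set n | `|x n - z| <= e].
Proof.
move=> UU xM; have PU : ProperFilter U by exact: ultra_proper.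
have PF : ProperFilter (x @ U) by exact: fmap_proper_filter.
have [] := @segment_compact R (- M) M (x @ U) PF.
  have : U (x @^-1` `[- M, M]%classic); last by [].
  by apply: (@filterS _ U _ setT) filterT => n _; rewrite /= in_itv/= -ler_norml; exact: xM.
move=> z [_ cz]; exists z => e e0.
have [//|nU] := in_ultra_setVsetC [set n | `|x n - z| <= e] UU.
have [y [[n nn <-] yb]] : exists y, [set y | exists2 n, ~ `|x n - z| <= e & x n = y] y /\ ball z e y.
  have [|y [h1 h2]] := cz [set y | exists2 n, ~ `|x n - z| <= e & x n = y] (ball z e) _ (nbhsx_ballx z e e0).
    have h0 : U (x @^-1` [set y | exists2 n, ~ `|x n - z| <= e & x n = y]).
      by apply: filterS nU => n h /=; exists n.
    exact: h0.
  by exists y.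
by exfalso; apply: nn; rewrite distrC ltW.
Qed.

Lemma ultra_complex_limit (U : set_system nat) (x : nat -> R[i]) (M : R) : UltraFilter U ->
  (forall n, normc (x n) <= M) ->
  exists z : R[i], forall e : R, 0 < e -> U [set n | normc (x n - z) <= e].
Proof.
move=> UU xM; have PU : ProperFilter U by exact: ultra_proper.
have [u hu] := ultra_limit UU (fun n => le_trans (normc_Re (x n)) (xM n)).
have [v hv] := ultra_limit UU (fun n => le_trans (normc_Im (x n)) (xM n)).
exists (u +i* v)%C => e e0; have e2 : 0 < e / 2 by rewrite divr_gt0.
apply: filterS2 (hu _ e2) (hv _ e2) => n h1 h2 /=.
apply: le_trans (normc_ReIm _) _; rewrite [e]splitr lerD//.
  have -> : complex.Re (x n - (u +i* v)%C) = complex.Re (x n) - u by case: (x n).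
  exact: h1.
have -> : complex.Im (x n - (u +i* v)%C) = complex.Im (x n) - v by case: (x n).
exact: h2.
Qed.

Lemma filter_forall_seq (T : eqType) (U : set_system nat) (P : T -> set nat) (s : seq T) : Filter U ->
  (forall x, x \in s -> U (P x)) -> U [set n | forall x, x \in s -> P x n].
Proof.
move=> FU; elim: s => [|x s IH] h; first by apply: filterS filterT.
have h1 := h x (mem_head _ _); have h2 := IH (fun y ys => h y (mem_behead (s := x :: s) ys)).
apply: filterS2 h1 h2 => n p1 p2 y; rewrite inE => /orP[/eqP -> //|]; exact: p2.
Qed.

Lemma increasing_choice (P : nat -> nat -> Prop) : (forall n m, exists k, (m < k)%N /\ P n k) ->
  exists h : nat -> nat, {homo h : m n / (m < n)%N} /\ forall n, P n (h n).
Proof.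
move=> hP; have /choice[g hg] : forall nm : nat * nat, exists k, (nm.2 < k)%N /\ P nm.1 k.
  by move=> [n m]; exact: hP.
pose fix h n := if n is n'.+1 then g (n, h n') else g (0%N, 0%N).
exists h; split; last first.
  by case=> [|n]; [exact: (hg (0%N, 0%N)).2|exact: (hg (n.+1, h n)).2].
apply: homo_ltn => [y x z|n]; first exact: ltn_trans.
by have [] := hg (n.+1, h n).
Qed.

End ultrafilter_limits.

Section compactness.
Context {R : realType} {d : nat}.
Local Open Scope complex_scope.
Variables (K : nat) (phi psi : R -> R[i]) (L B : R).
Hypotheses (d0 : (0 < d)%N) (W : wavelet_system K phi psi) (L0 : 0 < L) (B0 : 0 < B).
Hypothesis phiB : forall x, normc (phi x) <= B * \1_(`[- L, L]%classic) x.
Hypothesis psiB : forall x, normc (psi x) <= B * \1_(`[- L, L]%classic) x.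
Variables (Omega : set 'rV[R]_d) (D rho : nat).
Hypothesis bO : bounded_set Omega.
Hypothesis nablaD : forall l, nabla phi psi Omega l -> boxed D l.
Hypothesis dK : (d * (rho + 2) <= K)%N.
Variables (X Y : scale) (p0 p1 q0 q1 : \bar R) (r0 r1 s0 s1 : R).
Hypotheses (p00 : (0 < p0)%E) (p10 : (0 < p1)%E) (q00 : (0 < q0)%E) (q10 : (0 < q1)%E).
Hypotheses (XF : X = scaleF -> (p0 < +oo)%E) (YF : Y = scaleF -> (p1 < +oo)%E).
Hypotheses (gr0 : growth_le rho p0 r0 s0) (gr1 : growth_le rho p1 r1 s1).
Local Notation gamma := (Num.max (recip p0 - recip p1) 0).
Local Notation delta := (s1 - s0).
Local Notation beta := ((r0 - r1) - (s1 - s0)).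
Local Notation alpha := ((r0 - r1) - (s1 - s0) - gamma).
Hypotheses (delta0 : 0 < delta) (alpha0 : 0 < alpha).
Local Notation eps := (delta / (2 * alpha)).
Local Notation lw0 := (level_weight p0 r0 s0).
Local Notation lw1 := (level_weight p1 r1 s1).
Local Notation syn := (synthesis phi psi).
Local Notation Psi := (dictionary phi psi Omega).
Local Notation Lambda := (nabla phi psi Omega).
Local Notation N0 := (HnormOn phi psi Omega X p0 q0 r0 s0).
Local Notation N1 := (HnormOn phi psi Omega Y p1 q1 r1 s1).
Local Notation supported := (supported phi psi Omega).
Local Notation level_bounds := (level_bounds D).
Implicit Types (a b c : windex d -> R[i]) (f : functional R d) (S : {fset windex d}) (m : nat).

Let decay := pairing_decay W L0 B0 phiB psiB d0.

Lemma ell_pos (T : choiceType) (q : \bar R) (f : T -> \bar R) : (0 < q)%E ->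
  (forall i, (0 <= f i)%E) -> T -> (0 <= ell q f)%E.
Proof. by move=> q_0 f0 i; exact: ell_ge0. Qed.

Lemma HnormOn_ge0 Z p q r s f : (0 < p)%E -> (0 < q)%E ->
  (0 <= HnormOn phi psi Omega Z p q r s f)%E.
Proof.
move=> p_0 q_0; apply: le_ereal_inf_tmp => _ [g _ <-]; apply: le_ereal_inf_tmp => _ [a _ <-].
case: Z => /=; last exact: Lnorm_ge0.
apply: (ell_pos q_0) => [j|]; last exact: [ffun=> 0%N].
rewrite mule_ge0 ?lee_fin ?p2_ge0//; apply: (ell_pos p_0) => [k|]; last exact: [ffun=> 0].
by rewrite lee_fin normc_ge0.
Qed.

Lemma restriction_synthesis_sub a b : tame D rho a -> tame D rho b ->
  tame D rho (fun l => a l - b l) /\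
  restriction Omega (syn (fun l => a l - b l)) = restriction Omega (syn a) - restriction Omega (syn b).
Proof.
move=> ta tb; have [C C0 hC] := decay.
have tab : tame D rho (fun l => a l - b l).
  have [M M0 hM] := ta; have [M' M'0 hM'] := tb.
  exists (M + M') => [|l]; first by rewrite addr_ge0.
  by apply: le_trans (le_normcD _ _) _; rewrite normcN !mulrDl lerD.
split => //; apply/funext => f.
rewrite -[RHS]/(restriction Omega (syn a) f - restriction Omega (syn b) f) /restriction.
case: asboolP => tf; last by rewrite subrr.
have sf : schwartz f by have [s1' s2 _] := tf; exact: smooth_compact_schwartz.
apply: csums_unique (synthesisP C0 hC dK tab sf) _.
rewrite -[- syn b f]mulN1r.
apply: eq_csums (csumsD (synthesisP C0 hC dK ta sf) (csumsZ (-1) (synthesisP C0 hC dK tb sf))) => l /=.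
by rewrite mulrBl mulN1r.
Qed.

Let d20 : 0 < delta / 2. Proof. by rewrite divr_gt0. Qed.
Let eps0 : 0 < eps. Proof. by rewrite divr_gt0// mulr_gt0. Qed.

Lemma bump_at0 (j : level d) : 2 `^ (- (alpha * tilted eps j + delta / 2 * (excess j)%:R)) =
  bump_weight eps alpha (delta / 2) 0 j.
Proof.
have t0 : 0 <= tilted eps j by rewrite /tilted addr_ge0// mulr_ge0//; exact: ltW.
by rewrite /bump_weight subr0 (ger0_norm t0); congr (_ `^ _); ring.
Qed.

Lemma embedding_bounded f : (N0 f < +oo)%E -> (N1 f < +oo)%E.
Proof.
move=> foo; have [N [Nge0 fN]] : exists N : R, 0 <= N /\ (N0 f < N%:E)%E.
  have := HnormOn_ge0 X r0 s0 f p00 q00; move: foo; case: (N0 f) => [x| |]//.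
  by move=> _ x0; exists (x + 1); rewrite lte_fin ltrDl ltr01 addr_ge0.
have [a [sa la ->]] := restricted_representation d0 W L0 B0 phiB psiB nablaD dK p00 q00 XF gr0 Nge0 fN.
have [C1 C10 hC1] := level_embedding (d := d) D p00 p10 alpha0.
have [C C0 hC] := synthesis_norm_le d0 W L0 B0 phiB psiB nablaD dK p10 q10 YF gr1
  (bump_family_summable d0 (ltW eps0) alpha0 d20).
have [||//||_ h] := hC (bump_weight eps alpha (delta / 2) 0) _ (C1 * N) a; first by exists 0.
- by rewrite mulr_ge0// ltW.
- move=> j; have := hC1 N j a Nge0 (la j); rewrite bump_at0; congr lp_le; ring.
by apply: le_lt_trans h _; exact: ltry.
Qed.

Lemma lp_le_limit (p : \bar R) : (0 < p)%E -> exists2 C : R, 0 < C &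
  forall (U : set_system nat) (a : nat -> windex d -> R[i]) z j (A : R), UltraFilter U -> 0 < A ->
  (forall l (e : R), 0 < e -> U [set n | normc (a n l - z l) <= e]) ->
  (forall n, lp_le p (box_shifts D j) (fun k => normc (a n (j, k))) A) ->
  lp_le p (box_shifts D j) (fun k => normc (z (j, k))) (C * A) /\
  forall n, lp_le p (box_shifts D j) (fun k => normc (a n (j, k) - z (j, k))) (C * A).
Proof.
move=> p_0; have [C1 C10 hC1] := lp_le_add p_0 (R := R) (K := Defs.shift d).
pose C := C1 * (C1 + 1); have C1' : 0 <= C1 by exact: ltW.
exists (C + C1); first by rewrite addr_gt0// mulr_gt0// addr_gt0.
move=> U a z j A UU A0 az aA; have PU : ProperFilter U by exact: ultra_proper.
pose V : R := (#|` box_shifts D j|)%:R `^ recip p + 1.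
have V0 : 0 < V by rewrite ltr_wpDl// powR_ge0.
have [n hn] : exists n, forall k, k \in box_shifts D j -> normc (a n (j, k) - z (j, k)) <= A / V.
  apply: (@filter_ex _ U); apply: filter_forall_seq => k _; exact: (az (j, k) _ (divr_gt0 A0 V0)).
pose e k := if k \in box_shifts D j then normc (z (j, k) - a n (j, k)) else 0.
have eV k : 0 <= e k <= A / V.
  rewrite /e; case: ifP => [kb|_]; first by rewrite normc_ge0 normcB hn.
  by rewrite lexx divr_ge0// ltW.
have he : lp_le p (box_shifts D j) e A.
  have := lp_le_const_ub p_0 _ (lexx _) eV (F := box_shifts D j).
  rewrite divr_ge0 ?(ltW A0) ?(ltW V0)// => /(_ isT).
  apply: lp_le_mono => //; first by move=> k _; rewrite lexx andbT; have /andP[] := eV k.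
  rewrite mulr_ge0 ?powR_ge0 ?divr_ge0 ?(ltW A0) ?(ltW V0)//= mulrAC ler_pdivrMr//.
  by rewrite ler_wpM2l ?(ltW A0)// lerDl.
pose z' k := if k \in box_shifts D j then normc (z (j, k)) else 0.
have hz' : lp_le p (box_shifts D j) z' (C1 * A).
  apply: (hC1 _ (fun k => normc (a n (j, k))) e) => //.
  - by move=> k; exact: normc_ge0.
  - by move=> k; have /andP[] := eV k.
  - move=> k; rewrite /z' /e; case: ifP => _; last by rewrite lexx addr0 normc_ge0.
    by rewrite normc_ge0 normc_distD.
  - exact: ltW.
have hz : lp_le p (box_shifts D j) (fun k => normc (z (j, k))) (C1 * A).
  apply: (lp_le_mono p_0 _ _ hz') => [k kb|]; last by rewrite lexx mulr_ge0// ltW.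
  by rewrite /z' kb lexx normc_ge0.
have CA : 0 <= C1 * A by rewrite mulr_ge0// ltW.
have CCA : 0 <= C * A by rewrite !mulr_ge0 ?addr_ge0// ltW.
split.
  apply: (lp_le_mono p_0 _ _ hz) => [k _|]; first by rewrite lexx normc_ge0.
  by rewrite CA mulrDl lerDr.
move=> n'; have : lp_le p (box_shifts D j) (fun k => normc (a n' (j, k) - z (j, k))) (C1 * ((C1 + 1) * A)).
  have AC : A <= (C1 + 1) * A by rewrite mulrDl mul1r lerDr.
  have C1A : C1 * A <= (C1 + 1) * A by rewrite mulrDl mul1r lerDl ltW.
  apply: (hC1 _ (fun k => normc (a n' (j, k))) (fun k => normc (z (j, k)))).
  - by move=> k; exact: normc_ge0.
  - by move=> k; exact: normc_ge0.
  - by move=> k; rewrite normc_ge0 (le_trans (le_normcD _ _))// normcN.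
  - by rewrite (le_trans CA).
  - apply: (lp_le_mono p_0 _ _ (aA n')) => [k _|]; first by rewrite lexx normc_ge0.
    by rewrite (ltW A0).
  - apply: (lp_le_mono p_0 _ _ hz) => [k _|]; first by rewrite lexx normc_ge0.
    by rewrite CA.
rewrite mulrA -/C; apply: lp_le_mono => [//|k _|]; first by rewrite lexx normc_ge0.
by rewrite CCA mulrDl lerDl.
Qed.

Lemma lp_le_small (p : \bar R) (F : {fset Defs.shift d}) (A : R) : (0 < p)%E -> 0 < A ->
  exists2 eta : R, 0 < eta & forall x : Defs.shift d -> R, (forall k, k \in F -> 0 <= x k <= eta) ->
  lp_le p F x A.
Proof.
move=> p_0 A0; pose V : R := (#|` F|)%:R `^ recip p + 1.
have V0 : 0 < V by rewrite ltr_wpDl// powR_ge0.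
have AV : 0 <= A / V by rewrite divr_ge0// ltW.
exists (A / V) => [|x hx]; first exact: divr_gt0.
pose y k := if k \in F then x k else 0.
have hy k : 0 <= y k <= A / V by rewrite /y; case: ifP => [/hx//|_]; rewrite lexx.
apply: (lp_le_mono p_0 _ _ (lp_le_const_ub p_0 AV (lexx _) hy)) => [k kF|].
  by rewrite /y kF lexx andbT; have /andP[] := hx k kF.
rewrite mulr_ge0 ?powR_ge0//= mulrAC ler_pdivrMr//.
by apply: ler_wpM2l; [exact: ltW|rewrite lerDl].
Qed.

(** The coefficients of a sequence in the unit ball converge along an
    ultrafilter. The embedding makes the levels with large tilt uniformly small,
    so that the convergence is in norm. *)
Lemma unit_ball_ultra_limit (u : nat -> functional R d) : (forall n, (N0 (u n) <= 1)%E) ->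
  exists v, (N1 v < +oo)%E /\
  forall e : R, 0 < e -> forall m0, exists m, (m0 < m)%N /\ (N1 (u m - v)%R <= e%:E)%E.
Proof.
move=> hu.
have /choice[a ha] : forall n, exists a, [/\ supported a, tame D rho a, u n = restriction Omega (syn a) &
    forall j, lp_le p0 (box_shifts D j) (fun k => normc (a (j, k))) (2 * 2 `^ (- lw0 j))].
  by move=> n; exact: (unit_ball_coefficients d0 W L0 B0 phiB psiB nablaD dK p00 q00 XF gr0 (hu n)).
have sa n : supported (a n) by have [] := ha n.
have la n j : lp_le p0 (box_shifts D j) (fun k => normc (a n (j, k))) (2 * 2 `^ (- lw0 j)).
  by have [_ _ _] := ha n; exact.
have A0 (j : level d) : 0 < 2 * 2 `^ (- lw0 j) by rewrite mulr_gt0 ?p2_gt0.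
have [U [UU Usub]] := ultraFilterLemma eventually_filter.
have PU : ProperFilter U by exact: ultra_proper.
have /choice[z hz] : forall l, exists z : R[i], forall e : R, 0 < e -> U [set n | normc (a n l - z) <= e].
  move=> [j k]; apply: (ultra_complex_limit (M := 2 * 2 `^ (- lw0 j)) UU) => n.
  have [nl|nl] := pselect (Lambda (j, k)); last by rewrite sa// normc0 ltW.
  have kb : k \in box_shifts D j by rewrite mem_box_shifts; exact: nablaD.
  exact: (lp_le_point p00 (fun k => normc_ge0 (a n (j, k))) (ltW (A0 j)) (la n j) kb).
have sz : supported z.
  move=> l nl; apply: normc_eq0P => e e0; have [n /=] := filter_ex (hz l e e0).
  by rewrite sa// normcB subr0.
have [C1 C10 hC1] := lp_le_limit p00.
have N30 : 0 < C1 * 2 by rewrite mulr_gt0.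
set N3 := C1 * 2 in N30.
have lz : level_bounds p0 r0 s0 (fun=> N3) z.
  by move=> j; have [h _] := hC1 U a z j _ UU (A0 j) hz (la^~ j); rewrite /N3 -mulrA.
pose diff n l := a n l - z l.
have ldiff n j : lp_le p0 (box_shifts D j) (fun k => normc (diff n (j, k))) (N3 * 2 `^ (- lw0 j)).
  by have [_ h] := hC1 U a z j _ UU (A0 j) hz (la^~ j); rewrite /N3 -mulrA; exact: h.
have sdiff n : supported (diff n) by move=> l nl; rewrite /diff sa// sz// subrr.
have tz : tame D rho z.
  by apply: (level_bounds_tame nablaD p00 gr0 _ sz lz (M := N3)) => j; rewrite lexx ltW.
have [C2 C20 hC2] := level_embedding (d := d) D p00 p10 alpha0.
have [C3 C30 hC3] := synthesis_norm_le d0 W L0 B0 phiB psiB nablaD dK p10 q10 YF gr1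
  (bump_family_summable d0 (ltW eps0) alpha0 d20).
exists (restriction Omega (syn z)); split.
  have [||//||_ h] := hC3 (bump_weight eps alpha (delta / 2) 0) _ (C2 * N3) z; first by exists 0.
  - by rewrite mulr_ge0// ltW.
  - move=> j; have := hC2 N3 j z (ltW N30) (lz j); rewrite bump_at0; congr lp_le; ring.
  by apply: le_lt_trans h _; exact: ltry.
move=> e e0 m0; pose x := e / (C3 * (C2 * N3)).
have c0 : 0 < C3 * (C2 * N3) by rewrite mulr_gt0// mulr_gt0.
have [y hy] := exists_log2 (divr_gt0 e0 c0).
pose n := - (y / alpha); have nx : 2 `^ (- (alpha * n)) = x.
  rewrite /x -hy /n mulrN opprK mulrCA mulfV ?mulr1//; exact: lt0r_neq0.
pose w : level d -> R := bump_weight eps alpha (delta / 2) n.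
have x0 : 0 < x by rewrite divr_gt0.
have w0 j : 0 < w j by exact: p2_gt0.
have Q0 (j : level d) : 0 < C2 * N3 * x * w j * 2 `^ (- lw1 j).
  exact: mulr_gt0 (mulr_gt0 (mulr_gt0 (mulr_gt0 C20 N30) x0) (w0 j)) (p2_gt0 _).
have small (j : level d) : U [set m | lp_le p1 (box_shifts D j) (fun k => normc (diff m (j, k)))
    (C2 * N3 * x * w j * 2 `^ (- lw1 j))].
  have [eta eta0 heta] := lp_le_small (box_shifts D j) p10 (Q0 j).
  have h : U [set m | forall k, k \in (box_shifts D j : seq _) -> normc (diff m (j, k)) <= eta].
    by apply: filter_forall_seq => k _; exact: hz.
  by apply: filterS h => m h /=; apply: heta => k kb; rewrite normc_ge0 h.
pose Bn := (Num.truncn `|n|).+1.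
have fin : U [set m | forall j, j \in (box_levels d Bn : seq (level d)) ->
    lp_le p1 (box_shifts D j) (fun k => normc (diff m (j, k))) (C2 * N3 * x * w j * 2 `^ (- lw1 j))].
  by apply: filter_forall_seq => j _; exact: small.
have late : U [set m | (m0 < m)%N] by apply: Usub; exact: nbhs_infty_gt.
have [m [/= h1 h2]] := filter_ex (filterI fin late).
exists m; split => //; have [_ ta -> _] := ha m.
have [td <-] := restriction_synthesis_sub ta tz.
have Cx : 0 <= C2 * N3 * x := ltW (mulr_gt0 (mulr_gt0 C20 N30) x0).
have [|//|j|_] := hC3 w _ (C2 * N3 * x) (diff m) Cx; first by exists n.
  have [jn|jn] := leP (tilted eps j) n.
    apply: h1; rewrite mem_box_levels -(ler_nat R).
    apply: (@le_trans _ _ (norm1 j)%:R); first by rewrite ler_nat normoo_le_norm1.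
    apply: (@le_trans _ _ (tilted eps j)); first by rewrite /tilted lerDl mulr_ge0//; exact: ltW.
    apply: le_trans jn _; apply: le_trans (ler_norm n) _; rewrite ltW//; exact: truncnS_gt.
  have := hC2 N3 j (diff m) (ltW N30) (ldiff m j); congr lp_le.
  have -> : 2 `^ (- (alpha * tilted eps j + delta / 2 * (excess j)%:R)) = x * w j.
    rewrite -nx /w /bump_weight -p2D gtr0_norm ?subr_gt0//; congr (_ `^ _); ring.
  ring.
move=> h; apply: le_trans h _; rewrite lee_fin /x le_eqVlt; apply/orP; left; apply/eqP.
by rewrite [LHS]mulrA mulrC divfK// gt_eqF.
Qed.

Theorem compact_embedding : compact_operator N0 N1 id.
Proof.
split; first exact: embedding_bounded.
move=> u hu; have [v [voo hv]] := unit_ball_ultra_limit hu.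
have pick n m0 : exists m, (m0 < m)%N /\ (N1 (u m - v)%R <= ((n.+1%:R)^-1)%:E)%E.
  by apply: hv; rewrite invr_gt0.
have [h [hm hh]] := increasing_choice pick.
exists h, v; split => //.
apply: (@squeeze_cvge _ _ _ _ (fun=> 0%E) _ (fun n => (n.+1%:R^-1 : R)%:E)).
- by apply: nearW => n; rewrite HnormOn_ge0//=; exact: hh.
- exact: cvg_cst.
- exact: cvge_harmonic.
Qed.

End compactness.

(** * Widths and algorithms *)

Section width_inequalities.
Context {R : realType} {A B : lmodType R[i]} {L : choiceType}.
Variables (NA : A -> \bar R) (NB : B -> \bar R) (I : A -> B).
Variables (Lambda : set L) (b : L -> B).
Implicit Types (S : {fset L}) (m : nat).
Local Notation lc := (lincomb b).

Lemma d_width_le_zeta m : (d_width NA NB I Lambda b m <= zeta_width NA NB I Lambda b m)%E.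
Proof.
apply: le_ereal_inf_tmp => _ [S dS <-]; apply: le_ereal_inf_tmp => _ [c _ <-].
apply: (@le_trans _ _ (ereal_sup [set ereal_inf [set NB (I a - lc S c)
    | c in [set: L -> R[i]]] | a in unit_ball NA])).
  by apply: ereal_inf_lbound; exists S.
apply: ub_ereal_sup => _ [a aB <-].
apply: (@le_trans _ _ (NB (I a - lc S (c^~ a)))).
  by apply: ereal_inf_lbound; exists (c^~ a).
by apply: ereal_sup_ubound; exists a.
Qed.

Lemma zeta_width_le m S (alg : A -> B) (c : A -> L -> R[i]) : subdict Lambda m S ->
  (forall a, alg a = lc S (c a)) -> (zeta_width NA NB I Lambda b m <= worst_error NA NB I alg)%E.
Proof.
move=> dS hc; apply: (@le_trans _ _ (ereal_inf [set ereal_sup [set NB (I a - lc S (c^~ a))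
    | a in unit_ball NA] | c in [set: L -> A -> R[i]]])).
  by apply: ereal_inf_lbound; exists S.
apply: ereal_inf_lbound; exists (fun l a => c a l) => //.
rewrite /worst_error; congr ereal_sup; apply: eq_imagel => a _.
by rewrite hc.
Qed.

Lemma sigma_width_le m (alg : A -> B) : (forall a, unit_ball NA a ->
    exists2 S, subdict Lambda m S & exists c, alg a = lc S c) ->
  (sigma_width NA NB I Lambda b m <= worst_error NA NB I alg)%E.
Proof.
move=> h; apply: ub_ereal_sup => _ [a aB <-]; have [S dS [c ac]] := h a aB.
apply: (@le_trans _ _ (NB (I a - alg a))); last by apply: ereal_sup_ubound; exists a.
apply: le_trans (_ : (ereal_inf [set NB (I a - lc S c) | c in [set: L -> R[i]]] <= _)%E).
  by apply: ereal_inf_lbound; exists S.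
by apply: ereal_inf_lbound; exists c => //; rewrite ac.
Qed.

Lemma worst_error_le (alg : A -> B) (x : \bar R) : (forall a, unit_ball NA a -> (NB (I a - alg a) <= x)%E) ->
  (worst_error NA NB I alg <= x)%E.
Proof. by move=> h; apply: ub_ereal_sup => _ [a /h ? <-]. Qed.

Lemma sigma_width_ge m a (x : \bar R) : unit_ball NA a ->
  (forall S c, subdict Lambda m S -> (x <= NB (I a - lc S c))%E) ->
  (x <= sigma_width NA NB I Lambda b m)%E.
Proof.
move=> aB h; apply: (@le_trans _ _ (ereal_inf [set ereal_inf [set NB (I a - lc S c)
    | c in [set: L -> R[i]]] | S in subdict Lambda m])); last by apply: ereal_sup_ubound; exists a.
apply: le_ereal_inf_tmp => _ [S dS <-]; apply: le_ereal_inf_tmp => _ [c _ <-]; exact: h.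
Qed.

Lemma d_width_ge m (x : \bar R) : (forall S, subdict Lambda m S ->
    exists2 a, unit_ball NA a & forall c, (x <= NB (I a - lc S c))%E) ->
  (x <= d_width NA NB I Lambda b m)%E.
Proof.
move=> h; apply: le_ereal_inf_tmp => _ [S dS <-]; have [a aB ha] := h S dS.
apply: (@le_trans _ _ (ereal_inf [set NB (I a - lc S c) | c in [set: L -> R[i]]])).
  by apply: le_ereal_inf_tmp => _ [c _ <-]; exact: ha.
by apply: ereal_sup_ubound; exists a.
Qed.

End width_inequalities.

Section asymptotics.
Context {R : realType}.
Implicit Types (F G : nat -> \bar R) (z : nat -> R).

Lemma asymp_between M0 F G z (c C : R) : 0 < c -> 0 < C ->
  (forall M, (M0 <= M)%N -> [/\ (F M <= G M)%E, (G M <= (C * z M)%:E)%E & ((c * z M)%:E <= F M)%E]) ->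
  asymp M0 F G.
Proof.
move=> c0 C0 h; exists 1, (C / c); split => //; first exact: divr_gt0.
move=> M MM; have [h1 h2 h3] := h M MM; split; first by rewrite mul1e.
apply: le_trans h2 _; apply: le_trans (_ : ((C / c)%:E * (c * z M)%:E <= _)%E).
  by rewrite -EFinM lee_fin mulrA divfK// gt_eqF.
by apply: lee_wpmul2l => //; rewrite lee_fin divr_ge0 ?ltW.
Qed.

Lemma asymp_rate M0 G z (c C : R) : 0 < c -> 0 < C ->
  (forall M, (M0 <= M)%N -> (G M <= (C * z M)%:E)%E /\ ((c * z M)%:E <= G M)%E) ->
  asymp M0 G (fun M => (z M)%:E).
Proof.
move=> c0 C0 h; exists C^-1, c^-1; split; rewrite ?invr_gt0//.
move=> M MM; have [h2 h3] := h M MM; split.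
  apply: le_trans (lee_wpmul2l _ h2) _; first by rewrite lee_fin invr_ge0 ltW.
  by rewrite -EFinM lee_fin mulKf// gt_eqF.
apply: le_trans (_ : (_ <= (c^-1)%:E * (c * z M)%:E)%E) _.
  by rewrite -EFinM lee_fin mulKf// gt_eqF.
by apply: lee_wpmul2l => //; rewrite lee_fin invr_ge0 ltW.
Qed.

Lemma term_count_gt0 (alpha : R) M : (0 < term_count 1 alpha M)%N.
Proof.
by rewrite /term_count absz_gt0 gt_eqF// mul1r ceil_gt0 powR_gt0.
Qed.

End asymptotics.

(** A common bounded support for the scaling function and the wavelet. *)
Lemma wavelet_system_bound (R : realType) K (phi psi : R -> R[i]) : wavelet_system K phi psi ->
  exists L B : R, [/\ 0 < L, 0 < B, forall x, normc (phi x) <= B * \1_(`[- L, L]%classic) x &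
    forall x, normc (psi x) <= B * \1_(`[- L, L]%classic) x].
Proof.
move=> W; have [c1 c2] := CK_continuous (scaling_CK W); have [c3 c4] := CK_continuous (wavelet_CK W).
have [L1 [B1 [L10 B10 h1]]] := compact_supp_bound c1 c2 (scaling_supp W).
have [L2 [B2 [L20 B20 h2]]] := compact_supp_bound c3 c4 (wavelet_supp W).
have sub (l l' : R) : l <= l' -> `[- l, l]%classic `<=` `[- l', l']%classic.
  by move=> ll x; rewrite /= !in_itv/= => /andP[a b]; apply/andP; split; lra.
exists (L1 + L2), (B1 + B2); split; rewrite ?addr_gt0// => x.
  apply: le_trans (h1 x) _; apply: ler_pM; [exact: ltW|exact: ler0n|by rewrite lerDl ltW|].
  by apply: le_indic; apply: sub; rewrite lerDl ltW.
apply: le_trans (h2 x) _; apply: ler_pM; [exact: ltW|exact: ler0n|by rewrite lerDr ltW|].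
by apply: le_indic; apply: sub; rewrite lerDr ltW.
Qed.

Theorem theorem4p1 (R : realType) (d : nat) (X Y : scale)
    (p0 p1 q0 q1 : \bar R) (r0 r1 s0 s1 : R) :
  (0 < d)%N ->
  (0 < p0)%E -> (0 < p1)%E -> (0 < q0)%E -> (0 < q1)%E ->
  (X = scaleF -> (p0 < +oo)%E) -> (Y = scaleF -> (p1 < +oo)%E) ->
  r0 - r1 - Num.max (recip p0 - recip p1) 0 > s1 - s0 -> s1 - s0 > 0 ->
  exists K : nat, forall phi psi : R -> R[i], wavelet_system K phi psi ->
  forall Omega : set 'rV[R]_d, bounded_domain Omega ->
  let N0 := HnormOn phi psi Omega X p0 q0 r0 s0 in
  let N1 := HnormOn phi psi Omega Y p1 q1 r1 s1 in
  let Lambda := nabla phi psi Omega in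
  let Psi := dictionary phi psi Omega in
  let beta := (r0 - r1) - (s1 - s0) in
  let alpha := (r0 - r1) - (s1 - s0) - Num.max (recip p0 - recip p1) 0 in
  compact_operator N0 N1 id /\
  exists (M0 : nat) (c c' : R) (algB algA : nat -> functional R d -> functional R d),
  [/\ (0 < M0)%N, 0 < c, 0 < c',
      forall M f, (0 < M)%N -> (N0 f < +oo)%E ->
        (exists S a, [set` S] `<=` Lambda /\ algB M f = lincomb Psi S a) /\
        (exists S a, [set` S] `<=` Lambda /\ algA M f = lincomb Psi S a) &
    [/\ asymp M0 (fun M => sigma_width N0 N1 id Lambda Psi (term_count c alpha M))
                 (fun M => worst_error N0 N1 id (algB M)),
        asymp M0 (fun M => worst_error N0 N1 id (algB M))
                 (fun M => ((term_count c alpha M)%:R `^ (- beta))%:E) &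
        forall M, (M0 <= M)%N -> forall f, (N0 f < +oo)%E ->
          exists2 S, subdict Lambda (term_count c alpha M) S &
          exists a, algB M f = lincomb Psi S a] /\
    [/\ asymp M0 (fun M => zeta_width N0 N1 id Lambda Psi (term_count c' alpha M))
                 (fun M => d_width N0 N1 id Lambda Psi (term_count c' alpha M)),
        asymp M0 (fun M => d_width N0 N1 id Lambda Psi (term_count c' alpha M))
                 (fun M => worst_error N0 N1 id (algA M)),
        asymp M0 (fun M => worst_error N0 N1 id (algA M))
                 (fun M => ((term_count c' alpha M)%:R `^ (- alpha))%:E) &
        forall M, (M0 <= M)%N ->
          exists2 S, subdict Lambda (term_count c' alpha M) S &
          forall f, (N0 f < +oo)%E -> exists a, algA M f = lincomb Psi S a]].
Proof.
move=> d0 p00 p10 q00 q10 XF YF rs delta0.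
have alpha0 : 0 < (r0 - r1) - (s1 - s0) - Num.max (recip p0 - recip p1) 0 by lra.
pose g0 := `|r0| + recip p0 + `|s0|; pose g1 := `|r1| + recip p1 + `|s1|.
have g00 : 0 <= g0 by rewrite !addr_ge0 ?recip_ge0.
have g10 : 0 <= g1 by rewrite !addr_ge0 ?recip_ge0.
pose rho := (Num.truncn (g0 + g1)).+1.
have hrho : g0 + g1 <= rho%:R by rewrite ltW//; exact: truncnS_gt.
have gr0 : growth_le rho p0 r0 s0 by apply: le_trans hrho; rewrite lerDl.
have gr1 : growth_le rho p1 r1 s1 by apply: le_trans hrho; rewrite lerDr.
pose K := (d * (rho + 2))%N; exists K => phi psi W Omega [oO _ Omega0 bO] N0 N1 Lambda Psi beta alpha.
have [L [B [L0 B0 phiB psiB]]] := wavelet_system_bound W.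
have [D nablaD] := nabla_boxed L0 phiB psiB bO.
have dK : (d * (rho + 2) <= K)%N by [].
split.
  exact: (compact_embedding d0 W L0 B0 phiB psiB nablaD dK p00 p10 q00 q10 XF YF gr0 gr1 delta0 alpha0).
have [CA CA0 upA] := linear_upper_bound d0 W L0 B0 phiB psiB nablaD dK p00 p10 q00 q10 XF YF gr0 gr1 delta0 alpha0.
have [CB CB0 upB] := adaptive_upper_bound d0 W L0 B0 phiB psiB nablaD dK p00 p10 q00 q10 XF YF gr0 gr1 delta0 alpha0.
have [cA cA0 loA] := linear_lower_bound d0 W L0 B0 phiB psiB bO nablaD dK p00 p10 q00 q10 XF YF gr0 gr1 alpha0 oO Omega0.
have [cB cB0 loB] := adaptive_lower_bound d0 W L0 B0 phiB psiB bO nablaD dK p00 p10 q00 q10 XF YF gr0 gr1 alpha0 oO Omega0.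
pose m M := term_count 1 alpha M; have m0 M : (0 < m M)%N by exact: term_count_gt0.
have /choice[S_ hS] : forall M, exists S, subdict Lambda (m M) S /\ forall f, exists c, (N0 f <= 1)%E ->
    (N1 (f - lincomb Psi S c)%R <= (CA * (m M)%:R `^ (- alpha))%:E)%E.
  move=> M; have [S dS hS] := upA (m M) (m0 M); exists S; split => // f.
  have [f1|nf] := pselect (N0 f <= 1)%E; last by exists (fun=> 0).
  by have [c hc] := hS f f1; exists c.
have /choice[c_ hc] : forall M, exists c : functional R d -> windex d -> R[i], forall f, (N0 f <= 1)%E ->
    (N1 (f - lincomb Psi (S_ M) (c f))%R <= (CA * (m M)%:R `^ (- alpha))%:E)%E.
  by move=> M; have [_ /choice[c hc]] := hS M; exists c.
have /choice[T_ hT] : forall Mf : nat * functional R d, exists Sc : {fset windex d} * (windex d -> R[i]),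
    subdict Lambda (m Mf.1) Sc.1 /\ ((N0 Mf.2 <= 1)%E ->
    (N1 (Mf.2 - lincomb Psi Sc.1 Sc.2)%R <= (CB * (m Mf.1)%:R `^ (- beta))%:E)%E).
  move=> [M f]; have [f1|nf] := pselect (N0 f <= 1)%E.
    by have [S dS [c hc']] := upB (m M) (m0 M) f f1; exists (S, c).
  exists (fset0, fun=> 0); split; last by move=> f1; case: nf.
  by split; [move=> l /=; rewrite inE|rewrite cardfs0].
pose algA M f := lincomb Psi (S_ M) (c_ M f).
pose algB M f := lincomb Psi (T_ (M, f)).1 (T_ (M, f)).2.
have WA M : (worst_error N0 N1 id (algA M) <= (CA * (m M)%:R `^ (- alpha))%:E)%E.
  by apply: worst_error_le => f; exact: hc.
have WB M : (worst_error N0 N1 id (algB M) <= (CB * (m M)%:R `^ (- beta))%:E)%E.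
  by apply: worst_error_le => f; have [_] := hT (M, f); exact.
have dz M := d_width_le_zeta N0 N1 id Lambda Psi (m M).
have zW M : (zeta_width N0 N1 id Lambda Psi (m M) <= worst_error N0 N1 id (algA M))%E.
  by apply: (@zeta_width_le _ _ _ _ N0 N1 id Lambda Psi (m M) (S_ M) (algA M) (c_ M)) => //; have [] := hS M.
have sW M : (sigma_width N0 N1 id Lambda Psi (m M) <= worst_error N0 N1 id (algB M))%E.
  apply: sigma_width_le => f _; exists (T_ (M, f)).1; first by have [] := hT (M, f).
  by exists (T_ (M, f)).2.
have dl M : ((cA * (m M)%:R `^ (- alpha))%:E <= d_width N0 N1 id Lambda Psi (m M))%E.
  by apply: d_width_ge => S dS; exact: (loA (m M) (m0 M) S dS).
have sl M : ((cB * (m M)%:R `^ (- beta))%:E <= sigma_width N0 N1 id Lambda Psi (m M))%E.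
  have [f f1 hf] := loB (m M) (m0 M).
  by apply: (sigma_width_ge f1) => S c dS; exact: hf.
exists 1%N, 1, 1, algB, algA; split => //.
  move=> M f _ _; split.
    by exists (T_ (M, f)).1, (T_ (M, f)).2; split => //; have [[]] := hT (M, f).
  by exists (S_ M), (c_ M f); split => //; have [[]] := hS M.
split.
  split.
  - by apply: (asymp_between (z := fun M => (m M)%:R `^ (- beta)) cB0 CB0).
  - by apply: (asymp_rate cB0 CB0) => M _; split => //; exact: le_trans (sl M) (sW M).
  - move=> M _ f _; exists (T_ (M, f)).1; first by have [] := hT (M, f).
    by exists (T_ (M, f)).2.
split.
- exists (cA / CA), 1; split; rewrite ?divr_gt0// => M _; split; last by rewrite mul1e.
  apply: le_trans (dl M); apply: le_trans (lee_wpmul2l _ (le_trans (zW M) (WA M))) _.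
    by rewrite lee_fin divr_ge0 ?ltW.
  by rewrite -EFinM lee_fin mulrA divfK// gt_eqF.
- apply: (asymp_between (z := fun M => (m M)%:R `^ (- alpha)) cA0 CA0) => M _; split => //.
  exact: le_trans (dz M) (zW M).
- apply: (asymp_rate cA0 CA0) => M _; split => //.
  by apply: le_trans (dl M) _; apply: le_trans (dz M) (zW M).
- move=> M _; exists (S_ M); first by have [] := hS M.
  by move=> f _; exists (c_ M f).
Qed.
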